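(* Let $r=\sqrt[4]{12}$ (the positive real root) and $$z=-8\left(74977+40284r+21644r^2+11629r^3\right),$$ $$a=\frac1{18}\left(1038+558r+300r^2+161r^3\right),\qquad b=\frac13\left(387+208r+112r^2+60r^3\right).$$ Then $$\frac{48}{\pi^2}S(1,0,36;2)=\frac{140}{27}L_{-4}(2)+\frac{13}{\sqrt3}L_{-3}(2)-\sum_{n=1}^{\infty}\frac{(1)_n^3}{\left(\frac12\right)_n^3}\frac{(a-bn)}{n^3}z^{-n}.$$
   Context: $S(A,B,C;t)=\sum_{(n,m)\in\mathbb Z^2\setminus\{(0,0)\}}(An^2+Bnm+Cm^2)^{-t}$ is the Epstein zeta function. $(x)_n=\Gamma(x+n)/\Gamma(x)$. $L_k(t)=\sum_{n=1}^\infty\chi_k(n)n^{-t}$ with $\chi_k(n)=\left(\frac kn\right)$ the Jacobi (Kronecker) symbol. *)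

(* Defs.v *)
(* Stdlib real numbers with Coquelicot; the prime factorization of a natural
   number is MathComp's [prime_decomp]. *)
From Stdlib Require Import Reals ZArith.
From Coquelicot Require Import Coquelicot.
From Stdlib Require Import List.
From mathcomp Require prime.
Open Scope R_scope.

(* The directed set of finite subsets of D, ordered by inclusion; a finite
   subset is a duplicate-free list.  Convergence along this filter is
   unordered (equivalently, absolute) summability over D. *)
Definition finite_subsets {T : Type} (D : T -> Prop) (P : list T -> Prop) : Prop :=
  exists F0 : list T, Forall D F0 /\
    forall F : list T, NoDup F -> Forall D F -> incl F0 F -> P F.

Definition list_sum {T : Type} (f : T -> R) (F : list T) : R :=
  fold_right Rplus 0 (map f F).

Definition sum_over {T : Type} (D : T -> Prop) (f : T -> R) : R :=
  iota (fun s : R => filterlim (list_sum f) (finite_subsets D) (locally s)).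

(* Intended for positive definite forms and real t > 1, where the base of the
   power is positive and the sum converges. *)
Definition epstein (A B C t : R) : R :=
  sum_over (fun p : Z * Z => p <> (0, 0)%Z)
    (fun p => let n := IZR (fst p) in let m := IZR (snd p) in
      Rpower (A * n ^ 2 + B * n * m + C * m ^ 2) (- t)).

(* Euler's integral, which represents the Gamma function for x > 0. *)
Definition Gamma (x : R) : R :=
  RInt_gen (fun u => Rpower u (x - 1) * exp (- u)) (at_right 0) (Rbar_locally p_infty).

Definition pochhammer (x : R) (n : nat) : R := Gamma (x + INR n) / Gamma x.

(* (k / p) for a prime p: the Legendre symbol when p is odd (the last test
   searches for a square root of k modulo p), and Kronecker's value at p = 2. *)
Definition kronecker_prime (k : Z) (p : nat) : Z :=
  let q := Z.of_nat p in
  if (k mod q =? 0)%Z then 0%Z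
  else if (q =? 2)%Z then
    (if ((k mod 8 =? 1)%Z || (k mod 8 =? 7)%Z)%bool then 1%Z else (-1)%Z)
  else if existsb (fun x => ((Z.of_nat x ^ 2 - k) mod q =? 0)%Z) (List.seq 0 p)
  then 1%Z else (-1)%Z.

(* (k / n) for n >= 1, completely multiplicative in n; [prime_decomp n] is the
   list of the pairs (p, e) with p prime and p ^ e exactly dividing n. *)
Definition kronecker (k : Z) (n : nat) : Z :=
  fold_right (fun pe acc => (kronecker_prime k (fst pe) ^ Z.of_nat (snd pe) * acc)%Z)
    1%Z (prime.prime_decomp n).

(* [Series] starts at index 0, so the n-th term of the sum has index n - 1. *)
Definition Lseries (k : Z) (t : R) : R :=
  Series (fun j => let n := S j in IZR (kronecker k n) * Rpower (INR n) (- t)).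

(* Main.v *)
Require Import Defs.
From Stdlib Require Import Reals ZArith.
From Coquelicot Require Import Coquelicot.
From mathcomp Require all_boot all_algebra finfield.
From Stdlib Require Import Ranalysis5 List Lra Lia Classical ClassicalEpsilon Permutation FunctionalExtensionality.
From Corelib Require Import ssreflect.
(* again, so that [list_sum] is the real-valued sum *)
Require Import Defs.
Open Scope R_scope.
Open Scope general_if_scope.
Unset SsrOldRewriteGoalsOrder.

(** The form [n^2 + 36 m^2] is [u^2 + v^2] restricted to [6 | v], so the Epstein
    value is a lattice sum over the Gaussian integers with a congruence
    condition, called [even_part] below ([epstein_even_part]).  Its companion
    [odd_part] is the sum of [(-1)^u / (u^2 + v^2)^2] over [3 | v] with [v] odd.
    Dilations by 2 and 3, the reflection [v -> - v] and the rotation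
    [(u, v) -> (u + v, u - v)] express [even_part + odd_part] through the sums
    weighted by [1] and by [chi3 (u^2 + v^2)].  By Jacobi's two-square theorem
    ([two_squares]) these two are [4 zeta(2) L_{-4}(2)] and
    [4 L_12(2) L_{-3}(2)], where [zeta(2)] and [L_12(2)] are elementary
    multiples of [PI^2].  This yields the two L-values of the theorem
    ([even_plus_odd]); what remains is to identify [48 / PI^2 * odd_part] with
    the hypergeometric series.

    Summing over [u] first, the partial fraction expansion of
    [1 / sinh] turns [odd_part] into values at [a = 3 PI] of
    [H (a) = sum over odd k > 0 of 1 / (k^3 sinh (k a))] and of its derivative
    ([odd_part_value]).  The third derivative of [H] is, up to sign, the
    Eisenstein series [sum of n^3 / sinh (n a)] over odd [n].

    On the other side let [f (th) = sum of cos (n th) / cosh (n a)] over all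
    integers [n], a multiple of Jacobi's function dn.  Products of such Fourier
    series are computed by telescoping sums of [tanh], which gives the
    differential equations of [f] in [th] and in [a] and its addition formula.
    Put [C = f (0)^2], [B = f (PI)^2], [A = C - B] and
    [kap = sum of 1 / cosh (n a)^2].  As functions of [a],
    [C' = C (B - kap)], [B' = B (C - kap)], [kap' = (B C - kap^2) / 2].
    The generating series [W] of [(1)_n^3 / ((1/2)_n^3 n^3)] satisfies a third
    order inhomogeneous hypergeometric equation; after the substitution
    [t = - A^2 / (4 B C)] it says that the third derivative of [W (t) / A] is
    [C^2 - B^2], which is 16 times the Eisenstein series above.  As both sides
    vanish at infinity, [W (t) / A = - 16 H] ([V_eq_Hh]).

    The numbers [z, a, b] of the theorem are the values at [3 PI] of functions
    of [a, A, B, C, kap]: the symmetry under [a -> PI^2 / a] expresses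
    [A], [C] and [kap] at the fixed point [PI] through [B]
    ([self_dual_values]), and the cubic transformation carries them to [3 PI],
    where the parameter of the transformation is a root of a quartic equation
    that is solved by [12^(1/4)] ([triple_dual_values]). *)


(** * Unordered sums of real families *)

Definition is_sum {T : Type} (f : T -> R) (s : R) : Prop :=
  filterlim (list_sum f) (finite_subsets (fun _ : T => True)) (locally s).

Definition tsum {T : Type} (f : T -> R) : R := sum_over (fun _ : T => True) f.

Definition summable {T : Type} (f : T -> R) : Prop :=
  exists M, forall F, NoDup F -> list_sum (fun t => Rabs (f t)) F <= M.

Lemma eq_dec_classic {T : Type} (x y : T) : {x = y} + {x <> y}.
Proof. exact: excluded_middle_informative. Qed.

Section ListSum.
Context {T : Type}.
Implicit Types (f g : T -> R) (F G : list T).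

Lemma list_sum_cons f x F : list_sum f (x :: F) = f x + list_sum f F.
Proof. by []. Qed.

Lemma list_sum_app f F G : list_sum f (F ++ G) = list_sum f F + list_sum f G.
Proof.
  elim: F => [|x F IH] /=; first by rewrite /list_sum /=; lra.
  rewrite !list_sum_cons IH; lra.
Qed.

Lemma list_sum_perm f F G : Permutation F G -> list_sum f F = list_sum f G.
Proof.
  elim=> [|x l l' _ IH|x y l|l l' l'' _ IH1 _ IH2] //.
  - by rewrite !list_sum_cons IH.
  - rewrite !list_sum_cons; lra.
  - by rewrite IH1.
Qed.

Lemma list_sum_ext f g F :
  (forall x, In x F -> f x = g x) -> list_sum f F = list_sum g F.
Proof.
  elim: F => [|x F IH] H //; rewrite !list_sum_cons IH ?H //=; auto.
  by move=> y Hy; apply: H; right.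
Qed.

Lemma list_sum_plus f g F :
  list_sum (fun x => f x + g x) F = list_sum f F + list_sum g F.
Proof.
  elim: F => [|x F IH]; first by rewrite /list_sum /=; lra.
  rewrite !list_sum_cons IH; lra.
Qed.

Lemma list_sum_scal k f F : list_sum (fun x => k * f x) F = k * list_sum f F.
Proof.
  elim: F => [|x F IH]; first by rewrite /list_sum /=; lra.
  rewrite !list_sum_cons IH; lra.
Qed.

Lemma list_sum_le f g F :
  (forall x, In x F -> f x <= g x) -> list_sum f F <= list_sum g F.
Proof.
  elim: F => [|x F IH] H; first by rewrite /list_sum /=; lra.
  rewrite !list_sum_cons; apply: Rplus_le_compat; first by apply: H; left.
  by apply: IH => y Hy; apply: H; right.
Qed.

Lemma list_sum_0 f F : (forall x, In x F -> f x = 0) -> list_sum f F = 0.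
Proof.
  elim: F => [|x F IH] H //; rewrite list_sum_cons H; first by left.
  rewrite IH; [by move=> y Hy; apply: H; right|lra].
Qed.

Lemma list_sum_nonneg f F : (forall x, 0 <= f x) -> 0 <= list_sum f F.
Proof.
  move=> H; elim: F => [|x F IH]; first by rewrite /list_sum /=; lra.
  rewrite list_sum_cons; move: (H x); lra.
Qed.


Lemma incl_split F G : NoDup F -> incl F G -> exists G', Permutation G (F ++ G').
Proof.
  elim: F G => [|x F IH] G; first by move=> _ _; exists G.
  move=> /NoDup_cons_iff [Hx HF] HI.
  have [l1 [l2 HG]] := in_split x G (HI x (or_introl eq_refl)).
  have [|G' HG'] := IH (l1 ++ l2) HF.
    move=> y Hy; have := HI y (or_intror Hy); rewrite HG.
    move=> Hy'; have [H|[H|H]] := in_app_or _ _ _ Hy'; apply: in_or_app; auto.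
    by subst y; case: Hx.
  exists G'; rewrite HG; apply: Permutation_sym; apply: Permutation_cons_app.
  exact: Permutation_sym.
Qed.

Lemma list_sum_incl f F G :
  (forall x, 0 <= f x) -> NoDup F -> incl F G -> list_sum f F <= list_sum f G.
Proof.
  move=> H HF HI; have [G' HG'] := incl_split F G HF HI.
  rewrite (list_sum_perm f G _ HG') list_sum_app.
  move: (list_sum_nonneg f G' H); lra.
Qed.

Lemma list_sum_map {S : Type} (e : S -> T) f (G : list S) :
  list_sum f (map e G) = list_sum (fun s => f (e s)) G.
Proof. by rewrite /list_sum map_map. Qed.

Lemma exists_nodup F : exists G, NoDup G /\ incl F G /\ incl G F.
Proof.
  exists (nodup eq_dec_classic F); split; first exact: NoDup_nodup.
  by split=> x; rewrite nodup_In.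
Qed.

End ListSum.

Section Sums.
Context {T : Type}.
Implicit Types (f g : T -> R) (F G : list T) (s k : R).

Lemma is_sum_eps f s : is_sum f s <-> forall eps, 0 < eps ->
  exists F0, forall F, NoDup F -> incl F0 F -> Rabs (list_sum f F - s) < eps.
Proof.
  have HT : forall F : list T, List.Forall (fun _ => True) F by move=> F; apply/Forall_forall.
  split=> H.
  - move=> eps He.
    have [F0 [_ HF0]] := H (ball s eps) (locally_ball s (mkposreal eps He)).
    by exists F0 => F HF HI; apply: HF0.
  - move=> P [eps HP]; have [F0 HF0] := H eps (cond_pos eps).
    by exists F0; split=> // F HF _ HI; apply: HP; apply: HF0.
Qed.

Lemma is_sum_uniq f s s' : is_sum f s -> is_sum f s' -> s = s'.
Proof.
  move=> /is_sum_eps H /is_sum_eps H'; apply: NNPP => Hne.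
  have He : 0 < Rabs (s - s') / 2 by have := Rabs_pos_lt (s - s'); lra.
  have [F1 H1] := H _ He; have [F2 H2] := H' _ He.
  have [F [HF [HI _]]] := exists_nodup (F1 ++ F2).
  have A1 := H1 F HF (fun x Hx => HI x (in_or_app _ _ x (or_introl Hx))).
  have A2 := H2 F HF (fun x Hx => HI x (in_or_app _ _ x (or_intror Hx))).
  move: A1 A2; rewrite /Rabs; repeat case: Rcase_abs; lra.
Qed.

Lemma tsum_eq f s : is_sum f s -> tsum f = s.
Proof.
  move=> H; apply: (is_sum_uniq f) => //.
  apply: (iota_correct (fun s => is_sum f s)).
  by exists s; split=> // s' H'; apply: (is_sum_uniq f).
Qed.

Lemma is_sum_ext f g s : (forall x, f x = g x) -> is_sum f s -> is_sum g s.
Proof.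
  by move=> E; rewrite (functional_extensionality f g E).
Qed.

Lemma tsum_ext f g : (forall x, f x = g x) -> tsum f = tsum g.
Proof.
  move=> E; rewrite /tsum /sum_over; congr iota.
  by rewrite (functional_extensionality f g E).
Qed.

Lemma is_sum_plus f g s s' :
  is_sum f s -> is_sum g s' -> is_sum (fun x => f x + g x) (s + s').
Proof.
  move=> /is_sum_eps H /is_sum_eps H'; apply/is_sum_eps => eps He.
  have He2 : 0 < eps / 2 by lra.
  have [F1 H1] := H _ He2; have [F2 H2] := H' _ He2.
  exists (F1 ++ F2) => F HF HI.
  have A1 := H1 F HF (fun x Hx => HI x (in_or_app _ _ x (or_introl Hx))).
  have A2 := H2 F HF (fun x Hx => HI x (in_or_app _ _ x (or_intror Hx))).
  rewrite list_sum_plus.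
  move: A1 A2; rewrite /Rabs; repeat case: Rcase_abs; lra.
Qed.

Lemma is_sum_scal k f s : is_sum f s -> is_sum (fun x => k * f x) (k * s).
Proof.
  move=> /is_sum_eps H; apply/is_sum_eps => eps He.
  have Hk := Rabs_pos k.
  have He2 : 0 < eps / (Rabs k + 1) by apply: Rdiv_lt_0_compat; lra.
  have [F1 H1] := H _ He2; exists F1 => F HF HI.
  rewrite list_sum_scal -Rmult_minus_distr_l Rabs_mult.
  have A := H1 F HF HI.
  apply: (Rle_lt_trans _ (Rabs k * (eps / (Rabs k + 1)))).
    apply: Rmult_le_compat_l; lra.
  rewrite /Rdiv -Rmult_assoc (Rmult_comm (Rabs k)) Rmult_assoc.
  rewrite -[X in _ < X]Rmult_1_r; apply: Rmult_lt_compat_l => //.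
  apply: (Rmult_lt_reg_r (Rabs k + 1)); first lra.
  field_simplify; lra.
Qed.

Lemma is_sum_opp f s : is_sum f s -> is_sum (fun x => - f x) (- s).
Proof.
  move=> H; have := is_sum_scal (-1) f s H.
  rewrite (_ : -1 * s = - s); first ring.
  by apply: is_sum_ext => x; ring.
Qed.

Lemma is_sum_minus f g s s' :
  is_sum f s -> is_sum g s' -> is_sum (fun x => f x - g x) (s - s').
Proof. by move=> H H'; apply: is_sum_plus => //; apply: is_sum_opp. Qed.

Lemma is_sum_0 : is_sum (fun _ : T => 0) 0.
Proof.
  apply/is_sum_eps => eps He; exists nil => F _ _.
  rewrite list_sum_0 // Rminus_0_r Rabs_R0 //.
Qed.

Lemma summable_ext f g : (forall x, f x = g x) -> summable f -> summable g.
Proof.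
  move=> E [M H]; exists M => F HF; rewrite -(list_sum_ext (fun t => Rabs (f t))); auto.
  by move=> x _; rewrite E.
Qed.

Lemma summable_le f g : (forall x, Rabs (f x) <= g x) -> summable g -> summable f.
Proof.
  move=> E [M H]; exists M => F HF; apply: Rle_trans (H F HF).
  apply: list_sum_le => x _; move: (E x) (Rle_abs (g x)); lra.
Qed.

Lemma summable_abs f : summable f -> summable (fun x => Rabs (f x)).
Proof.
  move=> [M H]; exists M => F HF; rewrite -(list_sum_ext (fun t => Rabs (f t))); auto.
  by move=> x _; rewrite Rabs_Rabsolu.
Qed.

Lemma summable_plus f g : summable f -> summable g -> summable (fun x => f x + g x).
Proof.
  move=> [M H] [M' H']; exists (M + M') => F HF.
  apply: (Rle_trans _ (list_sum (fun x => Rabs (f x) + Rabs (g x)) F)).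
    by apply: list_sum_le => x _; apply: Rabs_triang.
  rewrite list_sum_plus; move: (H F HF) (H' F HF); lra.
Qed.

Lemma summable_scal k f : summable f -> summable (fun x => k * f x).
Proof.
  move=> [M H]; exists (Rabs k * M) => F HF.
  rewrite (list_sum_ext _ (fun x => Rabs k * Rabs (f x))).
    by move=> x _; rewrite Rabs_mult.
  rewrite list_sum_scal; apply: Rmult_le_compat_l; [exact: Rabs_pos|exact: H].
Qed.

Lemma summable_opp f : summable f -> summable (fun x => - f x).
Proof. by move=> /(summable_scal (-1)); apply: summable_ext => x; ring. Qed.

Lemma summable_minus f g : summable f -> summable g -> summable (fun x => f x - g x).
Proof. by move=> H H'; apply: summable_plus => //; apply: summable_opp. Qed.

Lemma summable_ex_nonneg f : (forall x, 0 <= f x) -> summable f -> exists s, is_sum f s.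
Proof.
  move=> Hp [M H].
  have E F : list_sum (fun t => Rabs (f t)) F = list_sum f F.
    by apply: list_sum_ext => x _; rewrite Rabs_pos_eq.
  have [||s [Hub Hlub]] := completeness (fun r => exists F, NoDup F /\ r = list_sum f F).
  - by exists M => r [F [HF ->]]; rewrite -E; apply: H.
  - by exists 0; exists nil; split; [apply: NoDup_nil|].
  exists s; apply/is_sum_eps => eps He.
  have [F0 [HF0 HF1]] : exists F0, NoDup F0 /\ s - eps < list_sum f F0.
    apply: NNPP => Hn; have : s <= s - eps; last lra.
    apply: Hlub => r [F [HF ->]]; apply: Rnot_lt_le => Hlt; apply: Hn.
    by exists F.
  exists F0 => F HF HI.
  have := list_sum_incl f F0 F Hp HF0 HI.
  have : list_sum f F <= s by apply: Hub; exists F.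
  rewrite /Rabs; case: Rcase_abs; lra.
Qed.

Lemma summable_ex f : summable f -> exists s, is_sum f s.
Proof.
  move=> H.
  have [x||s1 H1] := summable_ex_nonneg (fun x => (Rabs (f x) + f x) / 2).
  - move: (Rle_abs (- f x)); rewrite Rabs_Ropp; lra.
  - apply: (summable_le _ (fun x => Rabs (f x))); last exact: summable_abs.
    move=> x; rewrite /Rabs; repeat case: Rcase_abs; lra.
  have [x||s2 H2] := summable_ex_nonneg (fun x => (Rabs (f x) - f x) / 2).
  - move: (Rle_abs (f x)); lra.
  - apply: (summable_le _ (fun x => Rabs (f x))); last exact: summable_abs.
    move=> x; rewrite /Rabs; repeat case: Rcase_abs; lra.
  exists (s1 - s2); apply: is_sum_ext (is_sum_minus _ _ _ _ H1 H2) => x; lra.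
Qed.

Lemma tsum_is_sum f : summable f -> is_sum f (tsum f).
Proof. by move=> /summable_ex [s Hs]; rewrite (tsum_eq f s Hs). Qed.

Lemma is_sum_summable f s : is_sum f s -> summable f.
Proof.
  move=> /is_sum_eps /(_ 1 Rlt_0_1) [F1 H1].
  have [F0 [HF0 [HI _]]] := exists_nodup F1.
  have Hd F : NoDup F -> (forall x, In x F -> ~ In x F0) -> Rabs (list_sum f F) <= 2.
    move=> HF Hdis.
    have A1 := H1 F0 HF0 HI.
    have A2 : Rabs (list_sum f (F0 ++ F) - s) < 1.
      apply: H1; last by move=> x Hx; apply: in_or_app; left; apply: HI.
      apply: NoDup_app => // x Hx Hx'; exact: (Hdis x Hx' Hx).
    rewrite list_sum_app in A2; move: A1 A2.
    rewrite /Rabs; repeat case: Rcase_abs; lra.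
  exists (list_sum (fun x => Rabs (f x)) F0 + 4) => F HF.
  set P := fun x => if Rle_dec 0 (f x) then true else false.
  set Q := fun x => if excluded_middle_informative (In x F0) then true else false.
  have Hs (p : T -> bool) (h : T -> R) G : list_sum h G =
      list_sum h (filter p G) + list_sum h (filter (fun x => negb (p x)) G).
    elim: G => [|x G IH] /=; first by rewrite /list_sum /=; lra.
    case: (p x) => /=; rewrite !list_sum_cons IH; lra.
  rewrite (Hs Q) (Hs P _ (filter (fun x => negb (Q x)) F)).
  have B0 : list_sum (fun x => Rabs (f x)) (filter Q F) <= list_sum (fun x => Rabs (f x)) F0.
    apply: list_sum_incl; [by move=> x; apply: Rabs_pos|exact: NoDup_filter|].
    move=> x /filter_In [_]; rewrite /Q; by case: excluded_middle_informative.
  have Hdd p : forall x, In x (filter p (filter (fun x => negb (Q x)) F)) -> ~ In x F0.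
    move=> x /filter_In [/filter_In [_]]; rewrite /Q; by case: excluded_middle_informative.
  have B1 := Hd _ (NoDup_filter _ (NoDup_filter _ HF)) (Hdd P).
  have B2 := Hd _ (NoDup_filter _ (NoDup_filter _ HF)) (Hdd (fun x => negb (P x))).
  have E1 : list_sum (fun x => Rabs (f x)) (filter P (filter (fun x => negb (Q x)) F)) =
     list_sum f (filter P (filter (fun x => negb (Q x)) F)).
    apply: list_sum_ext => x /filter_In [_]; rewrite /P; case: Rle_dec => // Hx _.
    exact: Rabs_pos_eq.
  have E2 : list_sum (fun x => Rabs (f x)) (filter (fun x => negb (P x)) (filter (fun x => negb (Q x)) F)) =
     - list_sum f (filter (fun x => negb (P x)) (filter (fun x => negb (Q x)) F)).
    rewrite [in RHS](_ : forall r, - r = -1 * r); first by move=> r; ring.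
    rewrite -list_sum_scal.
    apply: list_sum_ext => x /filter_In [_]; rewrite /P; case: Rle_dec => // Hx _.
    rewrite Rabs_left; [lra|ring].
  rewrite E1 E2.
  have [K1 K1'] := proj1 (Rabs_le_between _ _) B1.
  have [K2 K2'] := proj1 (Rabs_le_between _ _) B2; lra.
Qed.

Lemma is_sum_le f g s s' :
  (forall x, f x <= g x) -> is_sum f s -> is_sum g s' -> s <= s'.
Proof.
  move=> E /is_sum_eps H /is_sum_eps H'; apply: Rnot_lt_le => Hlt.
  have He : 0 < (s - s') / 2 by lra.
  have [F1 H1] := H _ He; have [F2 H2] := H' _ He.
  have [F [HF [HI _]]] := exists_nodup (F1 ++ F2).
  have A1 := H1 F HF (fun x Hx => HI x (in_or_app _ _ x (or_introl Hx))).
  have A2 := H2 F HF (fun x Hx => HI x (in_or_app _ _ x (or_intror Hx))).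
  have := list_sum_le f g F (fun x _ => E x).
  move: A1 A2; rewrite /Rabs; repeat case: Rcase_abs; lra.
Qed.


Lemma tsum_nonneg f : (forall x, 0 <= f x) -> summable f -> 0 <= tsum f.
Proof. by move=> E Hf; apply: is_sum_le E is_sum_0 _; apply: tsum_is_sum. Qed.

Lemma tsum_Rabs_le f g : (forall x, Rabs (f x) <= g x) -> summable g -> Rabs (tsum f) <= tsum g.
Proof.
  move=> E Hg; have Hf := summable_le f g E Hg.
  apply: Rabs_le; split.
  - have Hm := is_sum_opp _ _ (tsum_is_sum g Hg).
    apply: is_sum_le Hm (tsum_is_sum f Hf) => x.
    move: (E x); rewrite /Rabs; case: Rcase_abs; lra.
  - apply: is_sum_le (tsum_is_sum f Hf) (tsum_is_sum g Hg) => x.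
    move: (E x); rewrite /Rabs; case: Rcase_abs; lra.
Qed.

Lemma tsum_plus f g : summable f -> summable g ->
  tsum (fun x => f x + g x) = tsum f + tsum g.
Proof. by move=> Hf Hg; apply: tsum_eq; apply: is_sum_plus; apply: tsum_is_sum. Qed.

Lemma tsum_minus f g : summable f -> summable g ->
  tsum (fun x => f x - g x) = tsum f - tsum g.
Proof. by move=> Hf Hg; apply: tsum_eq; apply: is_sum_minus; apply: tsum_is_sum. Qed.

Lemma tsum_scal k f : summable f -> tsum (fun x => k * f x) = k * tsum f.
Proof. by move=> Hf; apply: tsum_eq; apply: is_sum_scal; apply: tsum_is_sum. Qed.

Lemma tsum_opp f : summable f -> tsum (fun x => - f x) = - tsum f.
Proof. by move=> Hf; apply: tsum_eq; apply: is_sum_opp; apply: tsum_is_sum. Qed.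

Lemma tsum_0 f : (forall x, f x = 0) -> tsum f = 0.
Proof.
  move=> H; apply: tsum_eq; apply: is_sum_ext is_sum_0 => x; by rewrite H.
Qed.

Lemma list_sum_le_tsum f F :
  (forall x, 0 <= f x) -> summable f -> NoDup F -> list_sum f F <= tsum f.
Proof.
  move=> Hp Hs HF; apply: Rnot_lt_le => Hlt.
  have /is_sum_eps H := tsum_is_sum _ Hs.
  have [F0 H0] := H _ (Rlt_Rminus _ _ Hlt).
  have [G [HG [HI _]]] := exists_nodup (F0 ++ F).
  have A1 := H0 G HG (fun x Hx => HI x (in_or_app _ _ x (or_introl Hx))).
  have A2 := list_sum_incl f F G Hp HF (fun x Hx => HI x (in_or_app _ _ x (or_intror Hx))).
  move: A1 A2; rewrite /Rabs; case: Rcase_abs; lra.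
Qed.

Lemma is_sum_single (x0 : T) f : (forall x, x <> x0 -> f x = 0) -> is_sum f (f x0).
Proof.
  move=> H; apply/is_sum_eps => eps He; exists (x0 :: nil) => F HF HI.
  have Hx : In x0 F by apply: HI; left.
  have [l1 [l2 E]] := in_split x0 F Hx; rewrite E in HF *.
  have Hn := NoDup_remove_2 _ _ _ HF.
  have Z l : (forall x, In x l -> In x (l1 ++ l2)) -> list_sum f l = 0.
    move=> Hl; apply: list_sum_0 => x /Hl Hx1; apply: H => Ex; by subst.
  rewrite list_sum_app list_sum_cons !Z.
  - by move=> x Hx1; apply: in_or_app; left.
  - by move=> x Hx1; apply: in_or_app; right.
  by rewrite (_ : _ - _ = 0) ?Rabs_R0 //; ring.
Qed.

End Sums.

Section Reindex.
Context {A B : Type}.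

Lemma list_sum_preimage (e : A -> B) (f : B -> R) :
  (forall x y, e x = e y -> x = y) -> (forall b, (forall a, e a <> b) -> f b = 0) ->
  forall F, NoDup F -> exists G, NoDup G /\ (forall a, In a G <-> In (e a) F) /\
    list_sum f F = list_sum (fun a => f (e a)) G.
Proof.
  move=> Hinj H0; elim=> [|b F IH].
    by move=> _; exists nil; split; [apply: NoDup_nil|split].
  move=> /NoDup_cons_iff [Hb HF]; have [G [HG [HGF EG]]] := IH HF.
  have [[a Ha]|Hna] := classic (exists a, e a = b).
  - exists (a :: G); split; [|split].
    + apply/NoDup_cons_iff; split=> //; by rewrite HGF Ha.
    + move=> a' /=; rewrite HGF -Ha; split; move=> [E|E].
      * by left; rewrite E.
      * by right.
      * by left; apply: Hinj.
      * by right.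
    + by rewrite !list_sum_cons EG Ha.
  - exists G; split; [|split] => //.
    + move=> a; rewrite HGF /=; split; auto; move=> [E|] //.
      by case: Hna; exists a.
    + rewrite list_sum_cons EG H0; [|lra].
      by move=> a Ea; apply: Hna; exists a.
Qed.

Lemma is_sum_embed (e : A -> B) (f : B -> R) s :
  (forall x y, e x = e y -> x = y) -> (forall b, (forall a, e a <> b) -> f b = 0) ->
  is_sum (fun a => f (e a)) s -> is_sum f s.
Proof.
  move=> Hinj H0 /is_sum_eps H; apply/is_sum_eps => eps He.
  have [F0 HF0] := H eps He; exists (map e F0) => F HF HI.
  have [G [HG [HGF ->]]] := list_sum_preimage e f Hinj H0 F HF.
  apply: HF0 => // a Ha; rewrite HGF; apply: HI; exact: in_map.
Qed.

Lemma summable_comp_inj (e : A -> B) (f : B -> R) :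
  (forall x y, e x = e y -> x = y) -> summable f -> summable (fun a => f (e a)).
Proof.
  move=> Hinj [M H]; exists M => F HF.
  rewrite -(list_sum_map e (fun b => Rabs (f b))); apply: H.
  apply: NoDup_map_NoDup_ForallPairs => // x y _ _; exact: Hinj.
Qed.

Lemma tsum_embed (e : A -> B) (f : B -> R) :
  (forall x y, e x = e y -> x = y) -> (forall b, (forall a, e a <> b) -> f b = 0) ->
  summable f -> tsum f = tsum (fun a => f (e a)).
Proof.
  move=> Hinj H0 Hs; apply: tsum_eq; apply: (is_sum_embed e) => //.
  apply: tsum_is_sum; exact: summable_comp_inj.
Qed.

Lemma tsum_bij (e : A -> B) (e' : B -> A) (f : B -> R) :
  (forall x, e' (e x) = x) -> (forall y, e (e' y) = y) ->
  summable f -> tsum f = tsum (fun a => f (e a)).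
Proof.
  move=> H1 H2; apply: tsum_embed.
  - by move=> x y E; rewrite -(H1 x) E H1.
  - by move=> b /(_ (e' b)); rewrite H2.
Qed.

Lemma summable_embed (e : A -> B) (f : B -> R) :
  (forall x y, e x = e y -> x = y) -> (forall b, (forall a, e a <> b) -> f b = 0) ->
  summable (fun a => f (e a)) -> summable f.
Proof.
  move=> Hinj H0 /tsum_is_sum H; apply: is_sum_summable.
  by apply: is_sum_embed H.
Qed.

End Reindex.

Section Products.
Context {A B : Type}.

Lemma list_sum_flat (f : A * B -> R) (L : list A) (sec : A -> list B) :
  list_sum f (flat_map (fun a => map (pair a) (sec a)) L) =
  list_sum (fun a => list_sum (fun b => f (a, b)) (sec a)) L.
Proof.
  elim: L => [|a L IH] //=; by rewrite list_sum_app list_sum_cons IH list_sum_map.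
Qed.

Lemma NoDup_flat (L : list A) (sec : A -> list B) :
  NoDup L -> (forall a, NoDup (sec a)) ->
  NoDup (flat_map (fun a => map (pair a) (sec a)) L).
Proof.
  move=> HL HS; elim: L HL => [|a L IH] /=; first by move=> _; apply: NoDup_nil.
  move=> /NoDup_cons_iff [Ha HL]; apply: NoDup_app.
  - apply: NoDup_map_NoDup_ForallPairs; last exact: HS.
    by move=> x y _ _ [].
  - exact: IH.
  - move=> [x y] /in_map_iff [b [[Ex Ey] _]] /in_flat_map [a' [Ha' /in_map_iff [b' [[Ex' Ey'] _]]]].
    by subst.
Qed.

Lemma summable_slice (f : A * B -> R) a : summable f -> summable (fun b => f (a, b)).
Proof. by apply: summable_comp_inj => x y []. Qed.

(** The partial sums over a large finite set of first components are
    approximated by partial sums over finite subsets of the product. *)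
Lemma is_sum_fubini (f : A * B -> R) s :
  is_sum f s -> is_sum (fun a => tsum (fun b => f (a, b))) s.
Proof.
  move=> Hf; have Hs := is_sum_summable _ _ Hf.
  move/is_sum_eps: Hf => Hf; apply/is_sum_eps => eps He.
  have [F0 HF0] := Hf (eps / 2) (ltac:(lra)).
  exists (map fst F0) => L HL HI.
  set n := INR (length L) + 1.
  have Hn : 0 < n by rewrite /n; move: (pos_INR (length L)); lra.
  have Hd : 0 < eps / (2 * n) by apply: Rdiv_lt_0_compat; lra.
  have Hsec a : exists S, NoDup S /\ (forall b, In (a, b) F0 -> In b S) /\
      Rabs (list_sum (fun b => f (a, b)) S - tsum (fun b => f (a, b))) < eps / (2 * n).
    have /is_sum_eps /(_ _ Hd) [S0 HS0] := tsum_is_sum _ (summable_slice f a Hs).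
    have [S [HS [HI1 _]]] := exists_nodup (S0 ++ map snd F0).
    exists S; split=> //; split.
    - move=> b Hb; apply: HI1; apply: in_or_app; right.
      exact: (in_map snd F0 (a, b)).
    - by apply: HS0 => // x Hx; apply: HI1; apply: in_or_app; left.
  pose sec a := proj1_sig (constructive_indefinite_description _ (Hsec a)).
  have Psec a := proj2_sig (constructive_indefinite_description _ (Hsec a)).
  rewrite -/(sec _) in Psec.
  have HF := HF0 (flat_map (fun a => map (pair a) (sec a)) L)
     (NoDup_flat L sec HL (fun a => proj1 (Psec a))).
  have {}HF : Rabs (list_sum f (flat_map (fun a => map (pair a) (sec a)) L) - s) < eps / 2.
    apply: HF => -[a b] Hab; apply/in_flat_map; exists a; split.
    - apply: HI; exact: (in_map fst F0 (a, b)).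
    - apply: in_map; exact: (proj1 (proj2 (Psec a))).
  rewrite list_sum_flat in HF.
  have Hdiff : Rabs (list_sum (fun a => list_sum (fun b => f (a, b)) (sec a)) L -
      list_sum (fun a => tsum (fun b => f (a, b))) L) <= INR (length L) * (eps / (2 * n)).
    clear HL HI HF; clearbody n; elim: L => [|a L IH].
      rewrite /list_sum /= Rminus_0_r Rabs_R0; lra.
    rewrite !list_sum_cons (S_INR (length L) : INR (length (a :: L)) = _).
    have H1 := proj2 (proj2 (Psec a)).
    set X := list_sum (fun b => f (a, b)) (sec a) in H1 *.
    set Y := tsum (fun b => f (a, b)) in H1 *.
    set U := list_sum _ L in IH *; set V := list_sum _ L in IH *.
    rewrite (_ : X + U - (Y + V) = (X - Y) + (U - V)); first ring.
    apply: Rle_trans (Rabs_triang _ _) _; lra.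
  have Hle : INR (length L) * (eps / (2 * n)) < eps / 2.
    rewrite (_ : eps / 2 = n * (eps / (2 * n))); first by field; lra.
    apply: Rmult_lt_compat_r => //; rewrite /n; lra.
  move: HF Hdiff Hle; rewrite /Rabs; repeat case: Rcase_abs; lra.
Qed.

Lemma tsum_fubini (f : A * B -> R) :
  summable f -> tsum f = tsum (fun a => tsum (fun b => f (a, b))).
Proof. by move=> Hf; symmetry; apply: tsum_eq; apply: is_sum_fubini; apply: tsum_is_sum. Qed.

Lemma summable_fubini (f : A * B -> R) :
  summable f -> summable (fun a => tsum (fun b => f (a, b))).
Proof. by move=> /tsum_is_sum /is_sum_fubini /is_sum_summable. Qed.

Lemma summable_prod (f : A * B -> R) (g : A -> R) :
  (forall a, summable (fun b => f (a, b))) ->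
  (forall a, tsum (fun b => Rabs (f (a, b))) <= g a) -> summable g -> summable f.
Proof.
  move=> Hf Hg [M HM]; exists M => F HF.
  set L := nodup eq_dec_classic (map fst F).
  set S := nodup eq_dec_classic (map snd F).
  apply: (Rle_trans _ (list_sum (fun p => Rabs (f p))
    (flat_map (fun a => map (pair a) S) L))).
    apply: list_sum_incl => //; first by move=> p; apply: Rabs_pos.
    move=> [a b] Hab; apply/in_flat_map; exists a; split.
    - by rewrite nodup_In; exact: (in_map fst F (a, b)).
    - apply: in_map; rewrite nodup_In; exact: (in_map snd F (a, b)).
  rewrite list_sum_flat; apply: Rle_trans (HM L (NoDup_nodup _ _)).
  apply: list_sum_le => a _; apply: Rle_trans (Rle_abs _).
  apply: Rle_trans (Hg a).
  apply: (list_sum_le_tsum (fun b => Rabs (f (a, b)))) (summable_abs _ (Hf a)) (NoDup_nodup _ _).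
  move=> b; exact: Rabs_pos.
Qed.

Lemma summable_mult (x : A -> R) (y : B -> R) :
  summable x -> summable y -> summable (fun p => x (fst p) * y (snd p)).
Proof.
  move=> Hx Hy.
  apply: (summable_prod _ (fun a => tsum (fun b => Rabs (y b)) * Rabs (x a))).
  - by move=> a /=; apply: summable_scal.
  - move=> a /=; rewrite (tsum_ext _ (fun b => Rabs (x a) * Rabs (y b))).
      by move=> b; rewrite Rabs_mult.
    rewrite tsum_scal; [exact: summable_abs|lra].
  - apply: summable_scal; exact: summable_abs.
Qed.

Lemma tsum_mult (x : A -> R) (y : B -> R) :
  summable x -> summable y ->
  tsum (fun p => x (fst p) * y (snd p)) = tsum x * tsum y.
Proof.
  move=> Hx Hy; rewrite tsum_fubini; first exact: summable_mult.
  rewrite (tsum_ext _ (fun a => tsum y * x a)); last by rewrite tsum_scal //; ring.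
  by move=> a /=; rewrite tsum_scal //; ring.
Qed.

End Products.

Lemma tsum_swap {A B : Type} (f : A * B -> R) :
  summable f -> tsum f = tsum (fun b => tsum (fun a => f (a, b))).
Proof.
  move=> Hf.
  rewrite (tsum_bij (fun p : B * A => (snd p, fst p)) (fun p : A * B => (snd p, fst p))) //.
  - by case.
  - by case.
  rewrite tsum_fubini //.
  by apply: summable_comp_inj Hf => -[x1 x2] [y1 y2] /= [-> ->].
Qed.

Lemma is_sum_series (f : nat -> R) s : is_sum f s -> is_series f s.
Proof.
  move=> /is_sum_eps H; suff L : is_lim_seq (sum_n f) s by [].
  apply/is_lim_seq_spec => eps.
  have [F0 HF0] := H eps (cond_pos eps).
  have [N HN] : exists N, forall x, In x F0 -> (x <= N)%nat.
    exists (list_max F0) => x Hx.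
    have := proj1 (list_max_le F0 (list_max F0)) (Nat.le_refl _).
    by move=> /Forall_forall /(_ x Hx).
  exists N => n Hn.
  have -> : sum_n f n = list_sum f (seq 0 (S n)).
    elim: n {Hn} => [|n IH]; first by rewrite sum_O /list_sum /=; lra.
    rewrite sum_Sn IH (seq_S (S n)) list_sum_app /plus /= /list_sum /=; lra.
  apply: HF0; first exact: seq_NoDup.
  move=> x Hx; apply/in_seq; have := HN x Hx; lia.
Qed.

Lemma tsum_Series (f : nat -> R) : summable f -> Series f = tsum f.
Proof. by move=> H; apply: is_series_unique; apply: is_sum_series; apply: tsum_is_sum. Qed.

Lemma summable_nat (f : nat -> R) : ex_series (fun n => Rabs (f n)) -> summable f.
Proof.
  move=> [l Hl]; exists l => F HF.
  have [N HN] : exists N, forall x, In x F -> (x <= N)%nat.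
    exists (list_max F) => x Hx.
    have := proj1 (list_max_le F (list_max F)) (Nat.le_refl _).
    by move=> /Forall_forall /(_ x Hx).
  apply: (Rle_trans _ (sum_n (fun n => Rabs (f n)) N)).
  - have -> : sum_n (fun n => Rabs (f n)) N = list_sum (fun n => Rabs (f n)) (seq 0 (S N)).
      elim: N {HN} => [|n IH]; first by rewrite sum_O /list_sum /=; lra.
      rewrite sum_Sn IH (seq_S (S n)) list_sum_app /plus /= /list_sum /=; lra.
    apply: list_sum_incl => //; first by move=> x; apply: Rabs_pos.
    move=> x Hx; apply/in_seq; have := HN x Hx; lia.
  - have Hlim : is_lim_seq (sum_n (fun n => Rabs (f n))) l by exact: Hl.
    apply: (is_lim_seq_incr_compare _ _ Hlim) => n.
    rewrite sum_Sn /plus /=; move: (Rabs_pos (f (S n))); lra.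
Qed.

Lemma is_sum_sum {A B : Type} (f : A + B -> R) s s' :
  is_sum (fun a => f (inl a)) s -> is_sum (fun b => f (inr b)) s' -> is_sum f (s + s').
Proof.
  move=> HA HB.
  have H1 : is_sum (fun x : A + B => match x with inl a => f (inl a) | inr _ => 0 end) s.
    apply: (is_sum_embed inl) => [x y []||] //.
    by move=> [a|b] // H; case: (H a).
  have H2 : is_sum (fun x : A + B => match x with inr a => f (inr a) | inl _ => 0 end) s'.
    apply: (is_sum_embed inr) => [x y []||] //.
    by move=> [a|b] // H; case: (H b).
  by apply: is_sum_ext (is_sum_plus _ _ _ _ H1 H2) => -[a|b]; ring.
Qed.

Lemma summable_sum {A B : Type} (f : A + B -> R) :
  summable (fun a => f (inl a)) -> summable (fun b => f (inr b)) -> summable f.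
Proof.
  by move=> /tsum_is_sum HA /tsum_is_sum HB; apply: is_sum_summable (is_sum_sum f _ _ HA HB).
Qed.

(** A bound by a function of the absolute value counts each natural number at
    most twice. *)
Lemma summable_Z (f : Z -> R) (g : nat -> R) :
  (forall n, Rabs (f n) <= g (Z.abs_nat n)) -> summable g -> summable f.
Proof.
  move=> H Hg.
  pose e (n : Z) : nat + nat := if Z_le_dec 0 n then inl (Z.to_nat n) else inr (Z.to_nat (- n)).
  have He x y : e x = e y -> x = y.
    by rewrite /e; case: Z_le_dec => Hx; case: Z_le_dec => Hy // [] ?; lia.
  pose G (s : nat + nat) := match s with inl n => g n | inr n => g n end.
  have HG : summable G by apply: summable_sum.
  apply: (summable_le _ (fun n => G (e n))); last exact: summable_comp_inj HG.
  move=> n; move: (H n); rewrite /G /e; case: Z_le_dec => Hn.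
  - by rewrite (_ : Z.abs_nat n = Z.to_nat n) //; lia.
  - by rewrite (_ : Z.abs_nat n = Z.to_nat (- n)) //; lia.
Qed.

Fixpoint zball (N : nat) : list Z :=
  match N with
  | O => (0 :: nil)%Z
  | S n => (Z.of_nat (S n) :: - Z.of_nat (S n) :: zball n)%Z
  end.

Lemma zball_in N x : In x (zball N) <-> (Z.abs x <= Z.of_nat N)%Z.
Proof.
  elim: N x => [|N IH] x; first by rewrite /=; lia.
  rewrite [zball _]/= -/(zball N) /In -/(In x (zball N)) IH; lia.
Qed.

Lemma zball_nodup N : NoDup (zball N).
Proof.
  elim: N => [|N IH]; first by apply/NoDup_cons_iff; split; [case|apply: NoDup_nil].
  rewrite [zball _]/=; apply/NoDup_cons_iff; split.
    rewrite /In -/(In _ (zball N)) zball_in; lia.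
  apply/NoDup_cons_iff; split=> //; rewrite zball_in; lia.
Qed.

Lemma is_sum_Z_lim (f : Z -> R) s :
  is_sum f s -> is_lim_seq (fun N => list_sum f (zball N)) s.
Proof.
  move=> /is_sum_eps H; apply/is_lim_seq_spec => eps.
  have [F0 HF0] := H eps (cond_pos eps).
  have [N HN] : exists N, forall x, In x F0 -> (Z.abs_nat x <= N)%nat.
    exists (list_max (map Z.abs_nat F0)) => x Hx.
    have := proj1 (list_max_le (map Z.abs_nat F0) (list_max (map Z.abs_nat F0))) (Nat.le_refl _).
    move=> /Forall_forall; apply; exact: in_map.
  exists N => n Hn; apply: HF0; first exact: zball_nodup.
  move=> x Hx; rewrite zball_in; have := HN x Hx; lia.
Qed.


(** * Termwise differentiation and exponentially decaying families *)

Lemma is_derive_eq (f : R -> R) x l l' : is_derive f x l -> l = l' -> is_derive f x l'.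
Proof. by move=> H <-. Qed.

Lemma is_derive_continuity_pt (f : R -> R) x l : is_derive f x l -> continuity_pt f x.
Proof.
  move=> H; apply/continuity_pt_filterlim.
  apply: (ex_derive_continuous (V := R_NormedModule)); by exists l.
Qed.

Lemma exp_le_compat x y : x <= y -> exp x <= exp y.
Proof. by move=> [H|->]; [apply: Rlt_le; apply: exp_increasing|apply: Rle_refl]. Qed.

(** Remainder of order two with a constant that is uniform in the family, which
    is what makes termwise differentiation of a sum possible. *)
Lemma taylor2_bound (u u1 u2 : R -> R) (M x0 r x : R) :
  (forall y, Rabs (y - x0) < r -> is_derive u y (u1 y)) ->
  (forall y, Rabs (y - x0) < r -> is_derive u1 y (u2 y)) ->
  (forall y, Rabs (y - x0) < r -> Rabs (u2 y) <= M) ->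
  Rabs (x - x0) < r ->
  Rabs (u x - u x0 - (x - x0) * u1 x0) <= M * (x - x0) ^ 2.
Proof.
  move=> H1 H2 HM Hx.
  have Hin y : Rmin x0 x <= y <= Rmax x0 x -> Rabs (y - x0) <= Rabs (x - x0).
    rewrite /Rmin /Rmax; case: Rle_dec => _ [] *; rewrite /Rabs; repeat case: Rcase_abs; lra.
  have [||xi [Hxi E1]] := MVT_gen u x0 x u1.
  - move=> y Hy; apply: H1; have := Hin y; lra.
  - move=> y Hy; apply/continuity_pt_filterlim; apply: (ex_derive_continuous (V := R_NormedModule)).
    exists (u1 y); apply: H1; have := Hin y Hy; lra.
  have Hxi' := Hin xi Hxi.
  have Hin2 y : Rmin x0 xi <= y <= Rmax x0 xi -> Rabs (y - x0) <= Rabs (xi - x0).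
    rewrite /Rmin /Rmax; case: Rle_dec => _ [] *; rewrite /Rabs; repeat case: Rcase_abs; lra.
  have [||et [Het E2]] := MVT_gen u1 x0 xi u2.
  - move=> y Hy; apply: H2; have := Hin2 y; lra.
  - move=> y Hy; apply/continuity_pt_filterlim; apply: (ex_derive_continuous (V := R_NormedModule)).
    exists (u2 y); apply: H2; have := Hin2 y Hy; lra.
  have Het' := Hin2 et Het.
  rewrite E1 (_ : _ - _ = u2 et * ((xi - x0) * (x - x0))).
    by rewrite (_ : u1 xi = u1 x0 + u2 et * (xi - x0)); [lra|ring].
  rewrite !Rabs_mult -(pow2_abs (x - x0)) /= Rmult_1_r.
  have HM' := HM et (ltac:(lra)).
  have P1 := Rabs_pos (u2 et); have P2 := Rabs_pos (xi - x0); have P3 := Rabs_pos (x - x0).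
  apply: Rmult_le_compat => //; first exact: Rmult_le_pos.
  apply: Rmult_le_compat_r; lra.
Qed.

(** The second derivatives have a summable majorant, so the sum of the
    first-order Taylor remainders is of order two. *)
Lemma is_derive_tsum {T : Type} (u u1 u2 : T -> R -> R) (M : T -> R) (x0 r : R) :
  0 < r ->
  (forall t x, Rabs (x - x0) < r -> is_derive (u t) x (u1 t x)) ->
  (forall t x, Rabs (x - x0) < r -> is_derive (u1 t) x (u2 t x)) ->
  (forall t x, Rabs (x - x0) < r -> Rabs (u2 t x) <= M t) ->
  summable M ->
  (forall x, Rabs (x - x0) < r -> summable (fun t => u t x)) ->
  summable (fun t => u1 t x0) ->
  is_derive (fun x => tsum (fun t => u t x)) x0 (tsum (fun t => u1 t x0)).
Proof.
  move=> Hr H1 H2 HM HMs Hu Hu1; apply/is_derive_Reals => eps He.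
  set K := tsum M.
  have HMp t : 0 <= M t.
    apply: Rle_trans (Rabs_pos _) (HM t x0 _).
    by rewrite Rminus_diag Rabs_R0.
  have HK : 0 <= K by apply: tsum_nonneg.
  have Hd : 0 < Rmin r (eps / (K + 1)).
    apply: Rmin_pos => //; apply: Rdiv_lt_0_compat; lra.
  exists (mkposreal _ Hd) => h Hh /= Hhd.
  have Hhr : Rabs h < r by apply: Rlt_le_trans Hhd (Rmin_l _ _).
  have Hhe : Rabs h < eps / (K + 1) by apply: Rlt_le_trans Hhd (Rmin_r _ _).
  have Hx : Rabs (x0 + h - x0) < r by rewrite (_ : _ - _ = h); [ring|].
  have H0 : Rabs (x0 - x0) < r by rewrite Rminus_diag Rabs_R0.
  have E : Rabs (tsum (fun t => u t (x0 + h)) - tsum (fun t => u t x0) - h * tsum (fun t => u1 t x0))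
     <= K * h ^ 2.
    rewrite -tsum_minus; [exact: Hu|exact: Hu|].
    rewrite -tsum_scal //.
    rewrite -tsum_minus; [apply: summable_minus; exact: Hu|exact: summable_scal|].
    rewrite Rmult_comm -tsum_scal //.
    apply: tsum_Rabs_le; last exact: summable_scal.
    move=> t.
    have := taylor2_bound (u t) (u1 t) (u2 t) (M t) x0 r (x0 + h) (H1 t) (H2 t) (HM t) Hx.
    by rewrite (_ : x0 + h - x0 = h); [ring|rewrite (Rmult_comm (M t))].
  rewrite (_ : _ / h - _ = (tsum (fun t => u t (x0 + h)) - tsum (fun t => u t x0) - h * tsum (fun t => u1 t x0)) / h).
    by field.
  rewrite Rabs_div //.
  have Hah : 0 < Rabs h by apply: Rabs_pos_lt.
  apply: (Rmult_lt_reg_r (Rabs h)) => //.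
  rewrite /Rdiv Rmult_assoc Rinv_l; [lra|rewrite Rmult_1_r].
  apply: Rle_lt_trans E _.
  rewrite -(pow2_abs h) /= Rmult_1_r -Rmult_assoc; apply: Rmult_lt_compat_r => //.
  apply: (Rle_lt_trans _ ((K + 1) * Rabs h)); first by apply: Rmult_le_compat_r; lra.
  apply: (Rmult_lt_reg_l (/ (K + 1))); first by apply: Rinv_0_lt_compat; lra.
  rewrite -Rmult_assoc Rinv_l; lra.
Qed.

Lemma summable_poly_exp (k : nat) (a : R) :
  0 < a -> summable (fun n : nat => INR n ^ k * exp (- a * INR n)).
Proof.
  elim: k a => [|k IH] a Ha.
  - apply: summable_nat; apply: (ex_series_ext (fun n => exp (- a) ^ n)).
      move=> n; rewrite /= Rmult_1_l Rabs_pos_eq; first by apply: Rlt_le; apply: exp_pos.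
      elim: n => [|n IH]; first by rewrite /= Rmult_0_r exp_0.
      rewrite -tech_pow_Rmult IH -exp_plus S_INR; congr exp; ring.
    apply: ex_series_geom; rewrite Rabs_pos_eq; first by apply: Rlt_le; apply: exp_pos.
    rewrite -exp_0; apply: exp_increasing; lra.
  - apply: (summable_le _ (fun n => 2 / a * (INR n ^ k * exp (- (a / 2) * INR n)))); last first.
      apply: summable_scal; apply: IH; lra.
    move=> n; have Hn := pos_INR n.
    have Hk : 0 <= INR n ^ k by apply: pow_le.
    have He := exp_pos (- a * INR n); have He2 := exp_pos (- (a / 2) * INR n).
    rewrite Rabs_pos_eq; first by apply: Rmult_le_pos; [apply: pow_le|lra].
    rewrite -tech_pow_Rmult.
    rewrite (_ : - a * INR n = - (a/2) * INR n + - (a / 2) * INR n); first by field.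
    rewrite exp_plus.
    rewrite (_ : INR n * INR n ^ k * (exp (- (a / 2) * INR n) * exp (- (a / 2) * INR n)) =
      (INR n * exp (- (a / 2) * INR n)) * (INR n ^ k * exp (- (a / 2) * INR n))); first ring.
    apply: Rmult_le_compat_r; first by apply: Rmult_le_pos; lra.
    have H1 : a / 2 * INR n <= exp (a / 2 * INR n).
      have := exp_ineq1_le (a / 2 * INR n); lra.
    have H2 : exp (a / 2 * INR n) * exp (- (a / 2) * INR n) = 1.
      rewrite -exp_plus -exp_0; congr exp; ring.
    apply: (Rmult_le_reg_l (a / 2)); first lra.
    rewrite (_ : a / 2 * (2 / a) = 1); first by field; lra.
    rewrite -H2 -Rmult_assoc; apply: Rmult_le_compat_r; lra.
Qed.

(** The class of families used for all Fourier coefficients below: it is stable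
    under products with polynomials in [n] and implies summability. *)
Definition expd (x : Z -> R) : Prop :=
  exists M a, 0 < a /\ forall n, Rabs (x n) <= M * exp (- a * Rabs (IZR n)).

Lemma Rabs_IZR_nat n : Rabs (IZR n) = INR (Z.abs_nat n).
Proof. by rewrite INR_IZR_INZ -abs_IZR; congr IZR; lia. Qed.

Lemma expd_summable x : expd x -> summable x.
Proof.
  move=> [M [a [Ha H]]].
  apply: (summable_Z _ (fun n => M * (INR n ^ 0 * exp (- a * INR n)))).
    by move=> n; rewrite /= Rmult_1_l -Rabs_IZR_nat.
  apply: summable_scal; exact: summable_poly_exp.
Qed.

Lemma expd_M_nonneg x M a : (forall n, Rabs (x n) <= M * exp (- a * Rabs (IZR n))) -> 0 <= M.
Proof.
  move=> /(_ 0%Z); rewrite Rabs_R0 Rmult_0_r exp_0 Rmult_1_r.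
  move: (Rabs_pos (x 0%Z)); lra.
Qed.

Lemma expd_ext x y : (forall n, x n = y n) -> expd x -> expd y.
Proof. by move=> E [M [a [Ha H]]]; exists M, a; split=> // n; rewrite -E. Qed.

Lemma expd_bdd K x y : expd x -> (forall n, Rabs (y n) <= K * Rabs (x n)) -> expd y.
Proof.
  move=> [M [a [Ha H]]] HK; exists (Rabs K * M), a; split=> // n.
  apply: Rle_trans (HK n) _; rewrite Rmult_assoc.
  apply: (Rle_trans _ (Rabs K * Rabs (x n))).
    apply: Rmult_le_compat_r; [exact: Rabs_pos|exact: Rle_abs].
  apply: Rmult_le_compat_l => //; exact: Rabs_pos.
Qed.

Lemma expd_mulb K x y : expd x -> (forall n, Rabs (y n) <= K) -> expd (fun n => y n * x n).
Proof.
  move=> Hx HK; apply: (expd_bdd K) Hx _ => n; rewrite Rabs_mult.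
  by apply: Rmult_le_compat_r => //; apply: Rabs_pos.
Qed.

Lemma expd_scal k x : expd x -> expd (fun n => k * x n).
Proof. by move=> Hx; apply: (expd_mulb (Rabs k)) => // n; lra. Qed.

Lemma expd_n x : expd x -> expd (fun n => IZR n * x n).
Proof.
  move=> [M [a [Ha H]]]; exists (2 / a * M), (a / 2); split; first lra.
  move=> n; rewrite Rabs_mult.
  have HM := expd_M_nonneg _ _ _ H.
  set y := Rabs (IZR n); have Hy : 0 <= y by apply: Rabs_pos.
  have H1 : y * (a / 2) <= exp (a / 2 * y) by have := exp_ineq1_le (a / 2 * y); lra.
  have H2 : y <= 2 / a * exp (a / 2 * y).
    apply: (Rmult_le_reg_r (a / 2)); first lra.
    rewrite (_ : 2 / a * _ * _ = exp (a / 2 * y)) //; field; lra.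
  apply: (Rle_trans _ ((2 / a * exp (a / 2 * y)) * (M * exp (- a * y)))).
    by apply: Rmult_le_compat => //; apply: Rabs_pos.
  rewrite (_ : exp (- (a / 2) * y) = exp (a / 2 * y) * exp (- a * y)); last by right; ring.
  by rewrite -exp_plus; congr exp; field.
Qed.

Lemma expd_plus x y : expd x -> expd y -> expd (fun n => x n + y n).
Proof.
  move=> [M [a [Ha H]]] [M' [a' [Ha' H']]].
  have HM := expd_M_nonneg _ _ _ H; have HM' := expd_M_nonneg _ _ _ H'.
  exists (M + M'), (Rmin a a'); split; first exact: Rmin_pos.
  have K b n : Rmin a a' <= b -> exp (- b * Rabs (IZR n)) <= exp (- Rmin a a' * Rabs (IZR n)).
    move=> Hb; apply: exp_le_compat; apply: Rmult_le_compat_r; [exact: Rabs_pos|lra].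
  move=> n; apply: Rle_trans (Rabs_triang _ _) _; rewrite Rmult_plus_distr_r.
  apply: Rplus_le_compat.
  - apply: Rle_trans (H n) _; apply: Rmult_le_compat_l => //; apply: K; exact: Rmin_l.
  - apply: Rle_trans (H' n) _; apply: Rmult_le_compat_l => //; apply: K; exact: Rmin_r.
Qed.

Lemma expd_opp x : expd x -> expd (fun n => - x n).
Proof. by move=> H; apply: (expd_bdd 1) H _ => n; rewrite Rabs_Ropp; lra. Qed.

Lemma expd_minus x y : expd x -> expd y -> expd (fun n => x n - y n).
Proof. by move=> Hx Hy; apply: expd_plus => //; apply: expd_opp. Qed.

(** ** Trigonometric series and convolution *)

Definition Ce (x : Z -> R) (th : R) : R := tsum (fun n => x n * cos (IZR n * th)).
Definition Se (x : Z -> R) (th : R) : R := tsum (fun n => x n * sin (IZR n * th)).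
Definition conv (x y : Z -> R) (n : Z) : R := tsum (fun m => x m * y (n - m)%Z).

Lemma Rabs_cos_le x : Rabs (cos x) <= 1.
Proof. by apply: Rabs_le; have := COS_bound x. Qed.

Lemma Rabs_sin_le x : Rabs (sin x) <= 1.
Proof. by apply: Rabs_le; have := SIN_bound x. Qed.

Lemma summable_cos x th : summable x -> summable (fun n => x n * cos (IZR n * th)).
Proof.
  move=> H; apply: (summable_le _ _ _ (summable_abs _ H)) => n; rewrite Rabs_mult.
  move: (Rabs_cos_le (IZR n * th)) (Rabs_pos (x n)) => H1 H2.
  by rewrite -[X in _ <= X]Rmult_1_r; apply: Rmult_le_compat_l.
Qed.

Lemma summable_sin x th : summable x -> summable (fun n => x n * sin (IZR n * th)).
Proof.
  move=> H; apply: (summable_le _ _ _ (summable_abs _ H)) => n; rewrite Rabs_mult.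
  move: (Rabs_sin_le (IZR n * th)) (Rabs_pos (x n)) => H1 H2.
  by rewrite -[X in _ <= X]Rmult_1_r; apply: Rmult_le_compat_l.
Qed.

Lemma Ce_ext x y th : (forall n, x n = y n) -> Ce x th = Ce y th.
Proof. by move=> E; apply: tsum_ext => n; rewrite E. Qed.

Lemma Se_ext x y th : (forall n, x n = y n) -> Se x th = Se y th.
Proof. by move=> E; apply: tsum_ext => n; rewrite E. Qed.

Lemma Ce_plus x y th : summable x -> summable y ->
  Ce (fun n => x n + y n) th = Ce x th + Ce y th.
Proof.
  move=> Hx Hy; rewrite -tsum_plus; [exact: summable_cos|exact: summable_cos|].
  by apply: tsum_ext => n; ring.
Qed.

Lemma Ce_scal k x th : summable x -> Ce (fun n => k * x n) th = k * Ce x th.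
Proof.
  move=> Hx; rewrite -tsum_scal; first exact: summable_cos.
  by apply: tsum_ext => n; ring.
Qed.


Lemma tsum_neg (f : Z -> R) : summable f -> tsum f = tsum (fun n => f (- n)%Z).
Proof. by apply: (tsum_bij Z.opp Z.opp) => x; lia. Qed.

Lemma tsum_shift (j : Z) (f : Z -> R) : summable f -> tsum f = tsum (fun n => f (n + j)%Z).
Proof. by apply: (tsum_bij (fun n => n + j)%Z (fun n => n - j)%Z) => x; lia. Qed.

Lemma is_sum_shift (j : Z) (f : Z -> R) s : is_sum f s -> is_sum (fun n => f (n + j)%Z) s.
Proof.
  move=> H; have Hs := is_sum_summable _ _ H.
  rewrite -(tsum_eq _ _ H) (tsum_shift j) //; apply: tsum_is_sum.
  apply: (summable_comp_inj (fun n => n + j)%Z) Hs => x y; lia.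
Qed.

Lemma tsum_odd (f : Z -> R) : summable f -> (forall n, f (- n)%Z = - f n) -> tsum f = 0.
Proof.
  move=> Hf E; have := tsum_neg f Hf; rewrite (tsum_ext _ _ E) tsum_opp //; lra.
Qed.

Lemma Se_even x th : summable x -> (forall n, x (- n)%Z = x n) -> Se x th = 0.
Proof.
  move=> Hx E; apply: tsum_odd; first exact: summable_sin.
  by move=> n; rewrite opp_IZR Ropp_mult_distr_l_reverse sin_neg E; ring.
Qed.

Lemma Ce_odd x th : summable x -> (forall n, x (- n)%Z = - x n) -> Ce x th = 0.
Proof.
  move=> Hx E; apply: tsum_odd; first exact: summable_cos.
  by move=> n; rewrite opp_IZR Ropp_mult_distr_l_reverse cos_neg E; ring.
Qed.

(** The lattice is summed along the lines on which the sum of the two indices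
    is constant. *)
Lemma tsum_conv (x y w : Z -> R) : summable x -> summable y -> (forall n, Rabs (w n) <= 1) ->
  tsum (fun p : Z * Z => x (fst p) * y (snd p) * w (fst p + snd p)%Z) =
  tsum (fun n => conv x y n * w n).
Proof.
  move=> Hx Hy Hw.
  have Hs : summable (fun p : Z * Z => x (fst p) * y (snd p) * w (fst p + snd p)%Z).
    apply: summable_le (summable_abs _ (summable_mult x y Hx Hy)) => p.
    rewrite Rabs_mult -[X in _ <= X]Rmult_1_r; apply: Rmult_le_compat_l => //; exact: Rabs_pos.
  rewrite (tsum_bij (fun p : Z * Z => (snd p, fst p - snd p)%Z) (fun p : Z * Z => (fst p + snd p, fst p)%Z)) //.
  - by move=> [n m] /=; congr pair; lia.
  - by move=> [n m] /=; congr pair; lia.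
  rewrite tsum_fubini.
    apply: (summable_comp_inj (fun p : Z * Z => (snd p, fst p - snd p)%Z)) Hs.
    move=> [n m] [n' m'] /= [] E1 E2; congr pair; lia.
  apply: tsum_ext => n /=; rewrite /conv Rmult_comm -tsum_scal.
    apply: (summable_comp_inj (fun m : Z => (m, n - m)%Z) _ _ (summable_mult x y Hx Hy)).
    by move=> m m' [].
  by apply: tsum_ext => m; rewrite (_ : m + (n - m) = n)%Z; [lia|ring].
Qed.

Lemma summable_conv (x y : Z -> R) : summable x -> summable y -> summable (conv x y).
Proof.
  move=> Hx Hy.
  have Hs := summable_mult x y Hx Hy.
  have H2 : summable (fun p : Z * Z => x (snd p) * y (fst p - snd p)%Z).
    apply: (summable_comp_inj (fun p : Z * Z => (snd p, fst p - snd p)%Z)) Hs.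
    move=> [n m] [n' m'] /= [] E1 E2; congr pair; lia.
  exact: summable_fubini H2.
Qed.

(** The real part of the product of the two complex Fourier series. *)
Lemma Ce_conv x y th : summable x -> summable y ->
  Ce (conv x y) th = Ce x th * Ce y th - Se x th * Se y th.
Proof.
  move=> Hx Hy.
  have Cx := summable_cos x th Hx; have Cy := summable_cos y th Hy.
  have Sx := summable_sin x th Hx; have Sy := summable_sin y th Hy.
  rewrite -(tsum_mult _ _ Cx Cy) -(tsum_mult _ _ Sx Sy).
  rewrite -(tsum_minus _ _ (summable_mult _ _ Cx Cy) (summable_mult _ _ Sx Sy)).
  refine (eq_trans (eq_sym (tsum_conv x y (fun n => cos (IZR n * th)) Hx Hy (fun n => Rabs_cos_le _))) _).
  by apply: tsum_ext => p; rewrite plus_IZR Rmult_plus_distr_r cos_plus; ring.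
Qed.

Lemma Se_conv x y th : summable x -> summable y ->
  Se (conv x y) th = Se x th * Ce y th + Ce x th * Se y th.
Proof.
  move=> Hx Hy.
  have Cx := summable_cos x th Hx; have Cy := summable_cos y th Hy.
  have Sx := summable_sin x th Hx; have Sy := summable_sin y th Hy.
  rewrite -(tsum_mult _ _ Sx Cy) -(tsum_mult _ _ Cx Sy).
  rewrite -(tsum_plus _ _ (summable_mult _ _ Sx Cy) (summable_mult _ _ Cx Sy)).
  refine (eq_trans (eq_sym (tsum_conv x y (fun n => sin (IZR n * th)) Hx Hy (fun n => Rabs_sin_le _))) _).
  by apply: tsum_ext => p; rewrite plus_IZR Rmult_plus_distr_r sin_plus; ring.
Qed.

Lemma is_derive_Ce x th : expd x -> is_derive (Ce x) th (- Se (fun n => IZR n * x n) th).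
Proof.
  move=> Hx; have Hx1 := expd_n _ Hx; have Hx2 := expd_n _ Hx1.
  rewrite /Se -tsum_opp; first by apply: summable_sin; apply: expd_summable.
  apply: (is_derive_tsum (fun n th => x n * cos (IZR n * th)) (fun n th => - (IZR n * x n * sin (IZR n * th)))
   (fun n th => - (IZR n * (IZR n * x n) * cos (IZR n * th)))
   (fun n => Rabs (IZR n * (IZR n * x n))) th 1); first lra.
  - by move=> n t _; auto_derive => //; ring.
  - by move=> n t _; auto_derive => //; ring.
  - move=> n t _; rewrite Rabs_Ropp Rabs_mult -[X in _ <= X]Rmult_1_r.
    by apply: Rmult_le_compat_l; [exact: Rabs_pos|exact: Rabs_cos_le].
  - by apply: summable_abs; apply: expd_summable.
  - by move=> t _; apply: summable_cos; apply: expd_summable.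
  - by apply: summable_opp; apply: (summable_sin (fun n => IZR n * x n)); apply: expd_summable.
Qed.

Lemma is_derive_Se x th : expd x -> is_derive (Se x) th (Ce (fun n => IZR n * x n) th).
Proof.
  move=> Hx; have Hx1 := expd_n _ Hx; have Hx2 := expd_n _ Hx1.
  apply: (is_derive_tsum (fun n th => x n * sin (IZR n * th)) (fun n th => (IZR n * x n * cos (IZR n * th)))
   (fun n th => - (IZR n * (IZR n * x n) * sin (IZR n * th)))
   (fun n => Rabs (IZR n * (IZR n * x n))) th 1); first lra.
  - by move=> n t _; auto_derive => //; ring.
  - by move=> n t _; auto_derive => //; ring.
  - move=> n t _; rewrite Rabs_Ropp Rabs_mult -[X in _ <= X]Rmult_1_r.
    by apply: Rmult_le_compat_l; [exact: Rabs_pos|exact: Rabs_sin_le].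
  - by apply: summable_abs; apply: expd_summable.
  - by move=> t _; apply: summable_sin; apply: expd_summable.
  - by apply: (summable_cos (fun n => IZR n * x n)); apply: expd_summable.
Qed.


(** * Hyperbolic Fourier coefficients *)

Lemma cosh_pos x : 0 < cosh x.
Proof. rewrite /cosh; move: (exp_pos x) (exp_pos (- x)); lra. Qed.

Lemma cosh_neq0 x : cosh x <> 0.
Proof. move: (cosh_pos x); lra. Qed.

Lemma cosh_neg x : cosh (- x) = cosh x.
Proof. rewrite /cosh Ropp_involutive; lra. Qed.

Lemma sinh_neg x : sinh (- x) = - sinh x.
Proof. rewrite /sinh Ropp_involutive; lra. Qed.

Lemma cosh2_sinh2 x : cosh x ^ 2 - sinh x ^ 2 = 1.
Proof.
  have H : exp x * exp (- x) = 1 by rewrite -exp_plus Rplus_opp_r exp_0.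
  rewrite /cosh /sinh; nra.
Qed.

Lemma sinh_plus x y : sinh (x + y) = sinh x * cosh y + cosh x * sinh y.
Proof. rewrite /sinh /cosh Ropp_plus_distr !exp_plus; field. Qed.

Lemma cosh_plus x y : cosh (x + y) = cosh x * cosh y + sinh x * sinh y.
Proof. rewrite /sinh /cosh Ropp_plus_distr !exp_plus; field. Qed.

Lemma sinh_pos x : 0 < x -> 0 < sinh x.
Proof.
  move=> Hx; rewrite /sinh; have : exp (- x) < exp x by apply: exp_increasing; lra.
  lra.
Qed.

Lemma sinh_nonneg x : 0 <= x -> 0 <= sinh x.
Proof. move=> [Hx|<-]; [by apply: Rlt_le; apply: sinh_pos|rewrite sinh_0; lra]. Qed.

Lemma cosh_ge1 x : 1 <= cosh x.
Proof. have := cosh2_sinh2 x; have := cosh_pos x; nra. Qed.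

Lemma cosh_Rabs x : cosh (Rabs x) = cosh x.
Proof. by rewrite /Rabs; case: Rcase_abs => _ //; rewrite cosh_neg. Qed.

Lemma sinh_Rabs x : sinh (Rabs x) = Rabs (sinh x).
Proof.
  rewrite {1}/Rabs; case: Rcase_abs => H.
  - have := sinh_pos (- x) (ltac:(lra)); rewrite sinh_neg => K.
    rewrite Rabs_left; lra.
  - rewrite Rabs_pos_eq //; apply: sinh_nonneg; lra.
Qed.

Lemma sinh_neq0 x : x <> 0 -> sinh x <> 0.
Proof.
  move=> Hx; have := sinh_pos (Rabs x) (Rabs_pos_lt _ Hx).
  by rewrite sinh_Rabs => H E; rewrite E Rabs_R0 in H; lra.
Qed.

Lemma exp_half_le_cosh x : exp (Rabs x) / 2 <= cosh x.
Proof. rewrite -cosh_Rabs /cosh; move: (exp_pos (- Rabs x)); lra. Qed.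

Lemma tanh_neg x : tanh (- x) = - tanh x.
Proof. rewrite /tanh sinh_neg cosh_neg; field; exact: cosh_neq0. Qed.

Lemma tanh_bound x : Rabs (tanh x) <= 1.
Proof.
  rewrite /tanh Rabs_div; first exact: cosh_neq0.
  rewrite (Rabs_pos_eq (cosh x)); first by have := cosh_pos x; lra.
  apply: (Rmult_le_reg_r (cosh x)); first exact: cosh_pos.
  rewrite /Rdiv Rmult_assoc Rinv_l; first exact: cosh_neq0.
  have := cosh2_sinh2 x; rewrite -(pow2_abs (sinh x)).
  move: (Rabs_pos (sinh x)) (cosh_pos x); nra.
Qed.

Lemma one_minus_tanh x : 0 <= x -> 0 <= 1 - tanh x <= exp (- x).
Proof.
  move=> Hx; have -> : 1 - tanh x = exp (- x) / cosh x.
    rewrite /tanh; field_simplify; try exact: cosh_neq0.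
    congr Rdiv; rewrite /cosh /sinh; field.
  have H1 := cosh_ge1 x; have H2 := exp_pos (- x); split.
  - apply: Rlt_le; apply: Rdiv_lt_0_compat; lra.
  - apply: (Rmult_le_reg_r (cosh x)); first lra.
    rewrite /Rdiv Rmult_assoc Rinv_l; [exact: cosh_neq0|nra].
Qed.

Definition sechs (a : R) (n : Z) : R := / cosh (IZR n * a).
Definition cschs (a : R) (n : Z) : R := / sinh (IZR n * a).
Definition tanhs (a : R) (n : Z) : R := tanh (IZR n * a).
Definition coths (a : R) (n : Z) : R := cosh (IZR n * a) / sinh (IZR n * a).

Lemma sechs_pos a n : 0 < sechs a n.
Proof. apply: Rinv_0_lt_compat; exact: cosh_pos. Qed.

Lemma sechs_le1 a n : sechs a n <= 1.
Proof. rewrite /sechs -Rinv_1; apply: Rinv_le_contravar; [lra|exact: cosh_ge1]. Qed.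

Lemma sechs_neg a n : sechs a (- n) = sechs a n.
Proof. by rewrite /sechs opp_IZR Ropp_mult_distr_l_reverse cosh_neg. Qed.

Lemma cschs_neg a n : cschs a (- n) = - cschs a n.
Proof. by rewrite /cschs opp_IZR Ropp_mult_distr_l_reverse sinh_neg Rinv_opp. Qed.

Lemma tanhs_neg a n : tanhs a (- n) = - tanhs a n.
Proof. by rewrite /tanhs opp_IZR Ropp_mult_distr_l_reverse tanh_neg. Qed.

Lemma coths_neg a n : coths a (- n) = - coths a n.
Proof.
  rewrite /coths opp_IZR Ropp_mult_distr_l_reverse sinh_neg cosh_neg /Rdiv Rinv_opp; ring.
Qed.

Lemma tanhs_0 a : tanhs a 0 = 0.
Proof. by rewrite /tanhs Rmult_0_l /tanh sinh_0 /Rdiv Rmult_0_l. Qed.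

Lemma cschs_0 a : cschs a 0 = 0.
Proof. by rewrite /cschs Rmult_0_l sinh_0 Rinv_0. Qed.

Lemma coths_0 a : coths a 0 = 0.
Proof. by rewrite /coths Rmult_0_l sinh_0 /Rdiv Rinv_0 Rmult_0_r. Qed.

Lemma sechs_0 a : sechs a 0 = 1.
Proof. by rewrite /sechs Rmult_0_l cosh_0 Rinv_1. Qed.

Lemma sechs_le a n : 0 < a -> sechs a n <= 2 * exp (- a * Rabs (IZR n)).
Proof.
  move=> Ha; have H := exp_half_le_cosh (IZR n * a).
  rewrite Rabs_mult (Rabs_pos_eq a) in H; first lra.
  have He := exp_pos (Rabs (IZR n) * a).
  rewrite (_ : - a * Rabs (IZR n) = - (Rabs (IZR n) * a)); first ring.
  rewrite exp_Ropp /sechs -(Rinv_inv 2) -Rinv_mult.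
  apply: Rinv_le_contravar; lra.
Qed.

Lemma expd_sechs a : 0 < a -> expd (sechs a).
Proof.
  move=> Ha; exists 2, a; split=> // n.
  rewrite Rabs_pos_eq; [by apply: Rlt_le; apply: sechs_pos|exact: sechs_le].
Qed.

Lemma cschs_le a a0 n : 0 < a0 <= a -> Rabs (cschs a n) <= cosh a0 / sinh a0 * sechs a n.
Proof.
  move=> [Ha0 Ha].
  have S0 := sinh_pos a0 Ha0; have C0 := cosh_pos a0.
  have [->|Hn] := Z.eq_dec n 0.
    rewrite cschs_0 Rabs_R0; apply: Rmult_le_pos.
    - by apply: Rlt_le; apply: Rdiv_lt_0_compat.
    - by apply: Rlt_le; apply: sechs_pos.
  have Hn1 : 1 <= Rabs (IZR n) by rewrite -abs_IZR; apply: IZR_le; lia.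
  rewrite /cschs /sechs Rabs_inv -sinh_Rabs -(cosh_Rabs (IZR n * a)) Rabs_mult (Rabs_pos_eq a); first lra.
  set y := Rabs (IZR n) * a.
  have Hy : a0 <= y by rewrite /y; nra.
  have Sy : 0 < sinh y by apply: sinh_pos; lra.
  have Cy := cosh_pos y.
  have := sinh_nonneg (y + - a0) (ltac:(lra)).
  rewrite sinh_plus sinh_neg cosh_neg => H.
  apply: (Rmult_le_reg_r (sinh y * sinh a0 * cosh y)).
    by apply: Rmult_lt_0_compat => //; apply: Rmult_lt_0_compat.
  rewrite (_ : / sinh y * _ = sinh a0 * cosh y); first by field; lra.
  rewrite (_ : _ * / cosh y * _ = cosh a0 * sinh y); first by field; lra.
  lra.
Qed.

Lemma expd_cschs a : 0 < a -> expd (cschs a).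
Proof.
  move=> Ha; apply: (expd_bdd (cosh a / sinh a) _ _ (expd_sechs a Ha)) => n.
  rewrite (Rabs_pos_eq (sechs a n)); first by apply: Rlt_le; apply: sechs_pos.
  apply: cschs_le; lra.
Qed.

Lemma coths_bound a n : 0 < a -> Rabs (coths a n) <= cosh a / sinh a.
Proof.
  move=> Ha; have H := cschs_le a a n (ltac:(lra)).
  rewrite /coths /Rdiv Rabs_mult -/(cschs a n) (Rabs_pos_eq (cosh _)).
    by apply: Rlt_le; apply: cosh_pos.
  apply: (Rle_trans _ (cosh (IZR n * a) * (cosh a / sinh a * sechs a n))).
    apply: Rmult_le_compat_l => //; apply: Rlt_le; exact: cosh_pos.
  right; rewrite /sechs; field; split; [apply: sinh_neq0; lra|exact: cosh_neq0].
Qed.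

(** ** Addition formulas behind the convolutions *)

(** Each product of two hyperbolic functions whose arguments have a fixed sum is
    a fixed factor times a sum of [tanh] and [coth], which telescopes in a
    convolution. *)
Lemma sech_mul_sech x y : sinh (x + y) <> 0 ->
  / cosh x * / cosh y = / sinh (x + y) * (tanh x + tanh y).
Proof.
  rewrite sinh_plus /tanh => H; field; repeat split => //; exact: cosh_neq0.
Qed.

Lemma csch_mul_sech x y : sinh x <> 0 ->
  / sinh x * / cosh y = / cosh (x + y) * (cosh x / sinh x + tanh y).
Proof.
  move=> H; have := cosh_neq0 (x + y); rewrite cosh_plus /tanh => H1.
  field; repeat split => //; exact: cosh_neq0.
Qed.

Lemma csch_mul_csch x y : sinh x <> 0 -> sinh y <> 0 -> sinh (x + y) <> 0 ->
  / sinh x * / sinh y = / sinh (x + y) * (cosh x / sinh x + cosh y / sinh y).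
Proof. move=> H1 H2; rewrite sinh_plus => H3; field; repeat split => //. Qed.

Lemma tanh_sub x y : tanh x - tanh y = sinh (x - y) * / cosh x * / cosh y.
Proof.
  rewrite /Rminus sinh_plus sinh_neg cosh_neg /tanh; field; split; exact: cosh_neq0.
Qed.

Section Telescoping.
Variable a : R.
Hypothesis Ha : 0 < a.
Notation c := (sechs a).
Notation z := (cschs a).
Notation t := (tanhs a).
Notation k := (coths a).

Let D m := t m - t (m - 1)%Z.

Lemma expd_tanh_step : expd D.
Proof.
  have Sa := sinh_pos a Ha.
  apply: (expd_bdd (sinh a) _ _ (expd_sechs a Ha)) => n.
  have -> : D n = sinh a * sechs a n * sechs a (n - 1).
    rewrite /D /tanhs tanh_sub /sechs (_ : IZR n * a - IZR (n - 1) * a = a) //.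
    by rewrite minus_IZR; ring.
  set S := sinh a in Sa *; rewrite 2!Rabs_mult (Rabs_pos_eq S); first lra.
  rewrite (Rabs_pos_eq (sechs a (n - 1))); first by apply: Rlt_le; apply: sechs_pos.
  rewrite -[X in _ <= X]Rmult_1_r; apply: Rmult_le_compat_l; last exact: sechs_le1.
  apply: Rmult_le_pos; [lra|exact: Rabs_pos].
Qed.

Lemma tanh_step_sym m : D (1 - m)%Z = D m.
Proof.
  have E1 : (1 - m - 1 = - m)%Z by lia.
  have E2 : (1 - m = - (m - 1))%Z by lia.
  by rewrite /D E1 E2 !tanhs_neg; ring.
Qed.

(** The telescoping sum of the increments of [tanh] from [-1] to [1]. *)
Lemma is_sum_tanh_step : is_sum D 2.
Proof.
  have Hs := expd_summable _ expd_tanh_step.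
  have H := tsum_is_sum _ Hs.
  suff <- : tsum D = 2 by [].
  have L := is_sum_Z_lim _ _ H.
  (* the symmetric partial sums telescope *)
  have E N : list_sum D (zball N) = t (Z.of_nat N) + t (Z.of_nat N + 1)%Z.
    elim: N => [|N IH].
      rewrite /list_sum /= /D tanhs_0 (tanhs_neg a 1); ring.
    rewrite [zball _]/= !list_sum_cons IH -/(Z.of_nat (S N)) Nat2Z.inj_succ.
    rewrite -Pos2Z.opp_pos Zpos_P_of_succ_nat /D.
    rewrite (_ : Z.succ (Z.of_nat N) - 1 = Z.of_nat N)%Z; first lia.
    rewrite (_ : - Z.succ (Z.of_nat N) - 1 = - (Z.succ (Z.of_nat N) + 1))%Z; first lia.
    rewrite (_ : Z.of_nat N + 1 = Z.succ (Z.of_nat N))%Z; first lia.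
    rewrite !tanhs_neg; ring.
  have B (m : Z) : (0 <= m)%Z -> 0 <= 1 - t m <= exp (- (IZR m * a)).
    move=> Hm; apply: one_minus_tanh; apply: Rmult_le_pos; [exact: IZR_le|lra].
  apply: NNPP => Hne.
  have He : 0 < Rabs (tsum D - 2) / 2 by have := Rabs_pos_lt (tsum D - 2); lra.
  move/is_lim_seq_spec: L => /(_ (mkposreal _ He)) [N0 HN0].
  have Hlim : is_lim_seq (fun n => exp (- a) ^ n) 0.
    apply: is_lim_seq_geom; rewrite Rabs_pos_eq; first by apply: Rlt_le; apply: exp_pos.
    rewrite -exp_0; apply: exp_increasing; lra.
  move/is_lim_seq_spec: Hlim => /(_ (mkposreal _ (is_pos_div_2 (mkposreal _ He)))) [N1 HN1].
  set N := max N0 N1.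
  have K1 := HN0 N (Nat.le_max_l _ _); have K2 := HN1 N (Nat.le_max_r _ _).
  rewrite /= E in K1; rewrite /= Rminus_0_r in K2.
  have Epow n : exp (- a) ^ n = exp (- (IZR (Z.of_nat n) * a)).
    elim: n => [|n IH]; first by rewrite /= Rmult_0_l Ropp_0 exp_0.
    rewrite -tech_pow_Rmult IH -exp_plus Nat2Z.inj_succ succ_IZR; congr exp; ring.
  rewrite Epow Rabs_pos_eq in K2; first by apply: Rlt_le; apply: exp_pos.
  have B1 := B (Z.of_nat N) (ltac:(lia)); have B2 := B (Z.of_nat N + 1)%Z (ltac:(lia)).
  have B3 : exp (- (IZR (Z.of_nat N + 1) * a)) <= exp (- (IZR (Z.of_nat N) * a)).
    apply: exp_le_compat; rewrite plus_IZR; lra.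
  move: K1 K2 B1 B2 B3; rewrite /Rabs; repeat case: Rcase_abs; lra.
Qed.

(** The increments are symmetric about [1 / 2], so their centre of mass, for
    total mass 2, gives first moment 1. *)
Lemma is_sum_tanh_step_id : is_sum (fun m => IZR m * D m) 1.
Proof.
  have H1 : summable (fun m => IZR m * D m) by apply: expd_summable; apply: expd_n; exact: expd_tanh_step.
  have H := tsum_is_sum _ H1; suff <- : tsum (fun m => IZR m * D m) = 1 by [].
  have E : tsum (fun m => IZR m * D m) = tsum (fun m => (1 - IZR m) * D m).
    rewrite (tsum_bij (fun m => 1 - m)%Z (fun m => 1 - m)%Z) //; try (move=> ?; lia).
    by apply: tsum_ext => m; rewrite tanh_step_sym minus_IZR.
  have E2 : tsum (fun m => (1 - IZR m) * D m) = 2 - tsum (fun m => IZR m * D m).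
    apply: tsum_eq; apply: is_sum_ext (is_sum_minus _ _ _ _ is_sum_tanh_step H) => m; ring.
  lra.
Qed.

(** The sums below start from the trivial case [n = 0] and are moved by one
    step of [n] through a shifted copy of the step sum. *)
Lemma is_sum_step_ind (w : Z -> R) (V : Z -> R) :
  V 0%Z = 0 ->
  (forall n, is_sum (fun m => w (m + n)%Z * D m) (V (n + 1)%Z - V n)) ->
  forall n, is_sum (fun m => w m * (t m - t (m - n)%Z)) (V n).
Proof.
  move=> V0 HV; have S n : is_sum (fun m => w m * (t (m - n)%Z - t (m - n - 1)%Z)) (V (n + 1)%Z - V n).
    apply: is_sum_ext (is_sum_shift (- n) _ _ (HV n)) => m.
    by rewrite /D (_ : m + - n + n = m)%Z; [lia|].
  apply: Z.peano_ind.
  - by rewrite V0; apply: is_sum_ext is_sum_0 => m; rewrite Z.sub_0_r; ring.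
  - move=> n IH; have := is_sum_plus _ _ _ _ IH (S n).
    rewrite (_ : V n + (V (n + 1)%Z - V n) = V (Z.succ n)); first by rewrite /Z.succ; ring.
    by apply: is_sum_ext => m; rewrite (_ : m - Z.succ n = m - n - 1)%Z; [lia|ring].
  - move=> n IH; have := is_sum_minus _ _ _ _ IH (S (Z.pred n)).
    rewrite (_ : (Z.pred n + 1)%Z = n); first lia.
    rewrite (_ : V n - (V n - V (Z.pred n)) = V (Z.pred n)); first ring.
    by apply: is_sum_ext => m; rewrite (_ : m - Z.pred n - 1 = m - n)%Z; [lia|ring].
Qed.

Lemma is_sum_tanh_diff n : is_sum (fun m => t m - t (m - n)%Z) (2 * IZR n).
Proof.
  apply: is_sum_ext (is_sum_step_ind (fun _ => 1) (fun n => 2 * IZR n) _ _ n).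
  - by move=> m; ring.
  - by ring.
  - move=> m; rewrite plus_IZR (_ : _ - _ = 2); first ring.
    by apply: is_sum_ext is_sum_tanh_step => i; ring.
Qed.

Lemma is_sum_tanh_diff_id n : is_sum (fun m => IZR m * (t m - t (m - n)%Z)) (IZR n ^ 2).
Proof.
  apply: (is_sum_step_ind IZR (fun n => IZR n ^ 2)); first by ring.
  move=> m; rewrite plus_IZR (_ : _ - _ = 1 + IZR m * 2); first ring.
  apply: is_sum_ext (is_sum_plus _ _ _ _ is_sum_tanh_step_id (is_sum_scal (IZR m) _ _ is_sum_tanh_step)) => i.
  by rewrite plus_IZR; ring.
Qed.

(** About the point [1 / 2] the increments are even, so only the cosine part of
    their Fourier transform survives; dividing by [2 sin (be / 2)] solves the
    difference equation in [n]. *)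
Lemma is_sum_tanh_diff_cos be : sin (be / 2) <> 0 ->
  exists mu, forall n, is_sum (fun m => cos (IZR m * be) * (t m - t (m - n)%Z)) (mu * sin (IZR n * be)).
Proof.
  move=> Hb.
  have Hs := expd_summable _ expd_tanh_step.
  have Hc : summable (fun m => cos ((IZR m - / 2) * be) * D m).
    apply: (summable_le _ _ _ (summable_abs _ Hs)) => m; rewrite Rabs_mult.
    by move: (Rabs_cos_le ((IZR m - / 2) * be)) (Rabs_pos (D m)); nra.
  have Hsn : summable (fun m => sin ((IZR m - / 2) * be) * D m).
    apply: (summable_le _ _ _ (summable_abs _ Hs)) => m; rewrite Rabs_mult.
    by move: (Rabs_sin_le ((IZR m - / 2) * be)) (Rabs_pos (D m)); nra.
  have E : tsum (fun m => sin ((IZR m - / 2) * be) * D m) = 0.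
    have E : tsum (fun m => sin ((IZR m - / 2) * be) * D m) = tsum (fun m => - (sin ((IZR m - / 2) * be) * D m)).
      rewrite (tsum_bij (fun m => 1 - m)%Z (fun m => 1 - m)%Z) //; try (move=> ?; lia).
      apply: tsum_ext => m; rewrite tanh_step_sym minus_IZR.
      rewrite (_ : (1 - IZR m - / 2) * be = - ((IZR m - / 2) * be)); first by field.
      by rewrite sin_neg; ring.
    rewrite tsum_opp // in E; lra.
  exists (tsum (fun m => cos ((IZR m - / 2) * be) * D m) / (2 * sin (be / 2))) => n.
  apply: (is_sum_step_ind (fun m => cos (IZR m * be)) (fun n => _ * sin (IZR n * be))).
    by rewrite Rmult_0_l sin_0 Rmult_0_r.
  clear n; move=> n; set nu := tsum _.
  have -> : nu / (2 * sin (be / 2)) * sin (IZR (n + 1) * be) - nu / (2 * sin (be / 2)) * sin (IZR n * be)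
     = cos ((IZR n + / 2) * be) * nu - sin ((IZR n + / 2) * be) * 0.
    rewrite plus_IZR (_ : (IZR n + 1) * be = (IZR n + / 2) * be + be / 2); first by field.
    rewrite [in sin (IZR n * be)](_ : IZR n * be = (IZR n + / 2) * be - be / 2); first by field.
    by rewrite sin_plus sin_minus; field.
  rewrite -E.
  have := is_sum_minus _ _ _ _ (is_sum_scal (cos ((IZR n + / 2) * be)) _ _ (tsum_is_sum _ Hc))
    (is_sum_scal (sin ((IZR n + / 2) * be)) _ _ (tsum_is_sum _ Hsn)).
  apply: is_sum_ext => m.
  rewrite plus_IZR (_ : (IZR m + IZR n) * be = (IZR n + / 2) * be + (IZR m - / 2) * be); first by field.
  by rewrite cos_plus; ring.
Qed.

End Telescoping.


(** * The function sum of cos(n th) / cosh(n a) and its differential equations *)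

(** Up to a linear change of the variable and a factor, Jacobi's function dn;
    [zeF] is then its zeta function and [kap] the mean value of [dnF ^ 2]. *)
Definition dnF (a th : R) : R := Ce (sechs a) th.
Definition dnF1 (a th : R) : R := - Se (fun n => IZR n * sechs a n) th.
Definition dnF2 (a th : R) : R := - Ce (fun n => IZR n * (IZR n * sechs a n)) th.
Definition zeF (a th : R) : R := Se (cschs a) th.
Definition zeF1 (a th : R) : R := Ce (fun n => IZR n * cschs a n) th.
Definition kap (a : R) : R := tsum (fun n => sechs a n * sechs a n).
Definition alF (a : R) : R :=
  kap a + 2 * tsum (fun n => IZR n * (coths a n - tanhs a n)).

Section Identities.
Variable a : R.
Hypothesis Ha : 0 < a.
Notation c := (sechs a).
Notation z := (cschs a).
Notation t := (tanhs a).
Notation k := (coths a).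

Let cexp : expd c := expd_sechs a Ha.
Let zexp : expd z := expd_cschs a Ha.

Lemma IZRa_neq0 n : n <> 0%Z -> IZR n * a <> 0.
Proof. move=> Hn; apply: Rmult_integral_contrapositive; split; [exact: not_0_IZR|lra]. Qed.

Lemma expd_nz : expd (fun n => IZR n * z n).
Proof. exact: expd_n. Qed.

Lemma expd_nc : expd (fun n => IZR n * c n).
Proof. exact: expd_n. Qed.

Lemma coth_sub_tanh n : n <> 0%Z -> k n - t n = z n * c n.
Proof.
  move=> Hn; have H1 := sinh_neq0 _ (IZRa_neq0 n Hn); have H2 := cosh_neq0 (IZR n * a).
  have E := cosh2_sinh2 (IZR n * a).
  rewrite /coths /tanhs /cschs /sechs /tanh.
  rewrite (_ : _ - _ = (cosh (IZR n * a) ^ 2 - sinh (IZR n * a) ^ 2) * (/ sinh (IZR n * a) * / cosh (IZR n * a))).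
    by field.
  by rewrite E; ring.
Qed.

Lemma coth_sub_tanh' n : k n - t n = z n * c n.
Proof.
  have [->|Hn] := Z.eq_dec n 0; last exact: coth_sub_tanh.
  rewrite coths_0 tanhs_0 cschs_0; ring.
Qed.

Lemma expd_coth_sub_tanh : expd (fun n => k n - t n).
Proof.
  apply: (expd_ext (fun n => c n * z n)); first by move=> n; rewrite coth_sub_tanh'; ring.
  apply: (expd_mulb 1) => // n; rewrite Rabs_pos_eq; last exact: sechs_le1.
  by apply: Rlt_le; apply: sechs_pos.
Qed.

(** This and the next convolutions are the Fourier coefficients of products of
    [dnF], [zeF] and their derivatives. *)
Lemma conv_sech_sech n : n <> 0%Z -> conv c c n = 2 * IZR n * z n.
Proof.
  move=> Hn; rewrite Rmult_comm; apply: tsum_eq.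
  apply: is_sum_ext (is_sum_scal (z n) _ _ (is_sum_tanh_diff a Ha n)) => m.
  have E : IZR m * a + IZR (n - m) * a = IZR n * a by rewrite minus_IZR; ring.
  rewrite /sechs sech_mul_sech E; first by apply: sinh_neq0; apply: IZRa_neq0.
  rewrite /cschs /tanhs (_ : IZR (m - n) * a = - (IZR (n - m) * a)); first by rewrite !minus_IZR; ring.
  by rewrite tanh_neg; ring.
Qed.

Lemma conv_sech_sech_cos be : sin (be / 2) <> 0 -> exists mu, forall n, n <> 0%Z ->
  conv c (fun m => 2 * cos (IZR m * be) * c m) n = 2 * mu * (z n * sin (IZR n * be)).
Proof.
  move=> /(is_sum_tanh_diff_cos a Ha) [mu Hmu]; exists mu => n Hn.
  rewrite (_ : 2 * mu * _ = 2 * z n * (mu * sin (IZR n * be))); first ring.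
  have Hc : summable (fun m => 2 * cos (IZR m * be) * c m).
    apply: expd_summable; apply: (expd_mulb 2) => // m.
    rewrite Rabs_mult Rabs_pos_eq; [lra|have := Rabs_cos_le (IZR m * be); lra].
  rewrite /conv; apply: tsum_eq.
  pose f m := (2 * cos (IZR m * be) * c m) * c (n - m)%Z.
  have H : is_sum f (2 * z n * (mu * sin (IZR n * be))).
    apply: is_sum_ext (is_sum_scal (2 * z n) _ _ (Hmu n)) => m.
    have E : IZR m * a + IZR (n - m) * a = IZR n * a by rewrite minus_IZR; ring.
    rewrite /f [in RHS]Rmult_assoc /sechs sech_mul_sech E; first by apply: sinh_neq0; apply: IZRa_neq0.
    rewrite /cschs /tanhs (_ : IZR (m - n) * a = - (IZR (n - m) * a)); first by rewrite !minus_IZR; ring.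
    by rewrite tanh_neg; ring.
  have Hs := is_sum_summable _ _ H.
  have <- : tsum f = 2 * z n * (mu * sin (IZR n * be)) by exact: tsum_eq.
  rewrite (tsum_bij (fun m => n - m)%Z (fun m => n - m)%Z) //; try (move=> ?; lia).
  have E m : f (n - m)%Z = c m * (2 * cos (IZR (n - m) * be) * c (n - m)%Z).
    by rewrite /f (_ : n - (n - m) = m)%Z; [lia|ring].
  rewrite (tsum_ext _ _ E); apply: tsum_is_sum; apply: summable_ext E _.
  apply: (summable_comp_inj (fun m => n - m)%Z) Hs => x y; lia.
Qed.

Lemma conv_nz_sech n :
  conv (fun m => IZR m * z m) c n = c n * (tsum (fun m => IZR m * (k m - t m)) + IZR n ^ 2).
Proof.
  apply: tsum_eq.
  have H1 := tsum_is_sum _ (expd_summable _ (expd_n _ expd_coth_sub_tanh)).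
  apply: is_sum_ext (is_sum_scal (c n) _ _ (is_sum_plus _ _ _ _ H1 (is_sum_tanh_diff_id a Ha n))) => m.
  have [->|Hm] := Z.eq_dec m 0; first ring.
  have E : IZR m * a + IZR (n - m) * a = IZR n * a by rewrite minus_IZR; ring.
  rewrite [in RHS]Rmult_assoc [in RHS]/sechs [in RHS]/cschs csch_mul_sech; first by apply: sinh_neq0; apply: IZRa_neq0.
  rewrite E /sechs /coths /tanhs (_ : IZR (m - n) * a = - (IZR (n - m) * a)); first by rewrite !minus_IZR; ring.
  by rewrite tanh_neg; ring.
Qed.

Lemma conv_csch_sech n : conv z c n = c n * (2 * IZR n - t n).
Proof.
  apply: tsum_eq.
  have Hs := expd_summable _ expd_coth_sub_tanh.
  have H1 : is_sum (fun m => k m - t m) 0.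
    rewrite -(tsum_odd (fun m => k m - t m) Hs); first by move=> m; rewrite coths_neg tanhs_neg; ring.
    exact: tsum_is_sum.
  have H2 := is_sum_single 0%Z (fun m => if Z.eq_dec m 0 then t n else 0).
  have {}H2 : is_sum (fun m => if Z.eq_dec m 0 then t n else 0) (t n).
    have := H2 (fun m => _); case: (Z.eq_dec 0 0) => // _; apply.
    by move=> m Hm; case: Z.eq_dec.
  rewrite (_ : 2 * IZR n - t n = 0 + 2 * IZR n - t n); first ring.
  have H3 := is_sum_minus _ _ _ _ (is_sum_plus _ _ _ _ H1 (is_sum_tanh_diff a Ha n)) H2.
  apply: is_sum_ext (is_sum_scal (c n) _ _ H3) => m.
  case: Z.eq_dec => [->|Hm].
    rewrite cschs_0 coths_0 tanhs_0 (_ : (0 - n = - n)%Z) ?tanhs_neg; [lia|ring].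
  have E : IZR m * a + IZR (n - m) * a = IZR n * a by rewrite minus_IZR; ring.
  rewrite [in RHS]/sechs [in RHS]/cschs csch_mul_sech; first by apply: sinh_neq0; apply: IZRa_neq0.
  rewrite E /sechs /coths /tanhs (_ : IZR (m - n) * a = - (IZR (n - m) * a)); first by rewrite !minus_IZR; ring.
  by rewrite tanh_neg; ring.
Qed.

Lemma conv_csch_csch n : n <> 0%Z -> conv z z n = z n * (2 * IZR n - 2 * k n).
Proof.
  move=> Hn; apply: tsum_eq.
  have Hs := expd_summable _ expd_coth_sub_tanh.
  have H1 := tsum_is_sum _ Hs.
  have H1' := is_sum_shift (- n) _ _ H1.
  have H2 m0 : is_sum (fun m => if Z.eq_dec m m0 then k n else 0) (k n).
    have := is_sum_single m0 (fun m => if Z.eq_dec m m0 then k n else 0).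
    case: (Z.eq_dec m0 m0) => // _; apply.
    by move=> m Hm; case: Z.eq_dec.
  set S := tsum (fun n : Z => k n - t n) in H1 H1'.
  rewrite (_ : 2 * IZR n - 2 * k n = (2 * IZR n + (S - S)) - (k n + k n)); first ring.
  have H3 := is_sum_minus _ _ _ _ (is_sum_plus _ _ _ _ (is_sum_tanh_diff a Ha n)
    (is_sum_minus _ _ _ _ H1 H1')) (is_sum_plus _ _ _ _ (H2 0%Z) (H2 n)).
  apply: is_sum_ext (is_sum_scal (z n) _ _ H3) => m.
  rewrite (_ : (m + - n = m - n)%Z); first lia.
  case: (Z.eq_dec m 0) => [->|Hm].
    case: Z.eq_dec => [E|_]; first by subst.
    rewrite cschs_0 coths_0 tanhs_0 (_ : (0 - n = - n)%Z) ?tanhs_neg ?coths_neg; [lia|ring].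
  case: Z.eq_dec => [->|Hmn].
    rewrite Z.sub_diag cschs_0 coths_0 tanhs_0; ring.
  have E : IZR m * a + IZR (n - m) * a = IZR n * a by rewrite minus_IZR; ring.
  have Hx := sinh_neq0 _ (IZRa_neq0 n Hn).
  have Hy := sinh_neq0 _ (IZRa_neq0 m Hm).
  have Hw := sinh_neq0 _ (IZRa_neq0 (n - m) (ltac:(lia))).
  rewrite [in RHS]/cschs csch_mul_csch ?E //.
  rewrite /cschs /coths /tanhs (_ : IZR (m - n) * a = - (IZR (n - m) * a)); first by rewrite !minus_IZR; ring.
  by rewrite tanh_neg sinh_neg cosh_neg; field; split.
Qed.

Lemma dnF_even th : dnF a (- th) = dnF a th.
Proof.
  apply: tsum_ext => n; by rewrite (_ : IZR n * - th = - (IZR n * th)) ?cos_neg; first ring.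
Qed.

Lemma is_derive_dnF th : is_derive (dnF a) th (dnF1 a th).
Proof. exact: is_derive_Ce. Qed.

Lemma is_derive_dnF1 th : is_derive (dnF1 a) th (dnF2 a th).
Proof. apply: (is_derive_opp (V := R_NormedModule)); exact: is_derive_Se expd_nc. Qed.

Lemma is_derive_zeF th : is_derive (zeF a) th (zeF1 a th).
Proof. exact: is_derive_Se. Qed.

Lemma Ce_single (x : Z -> R) (q : R) th : (forall n, n <> 0%Z -> x n = 0) -> x 0%Z = q -> Ce x th = q.
Proof.
  move=> H0 Hq; apply: tsum_eq; rewrite -[q]Rmult_1_r -Hq -cos_0 -(Rmult_0_l th).
  by apply: (is_sum_single 0%Z) => n Hn; rewrite H0 //; ring.
Qed.

Lemma Ce_but0 (x y : Z -> R) th : summable x -> summable y ->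
  (forall n, n <> 0%Z -> x n = y n) -> Ce x th = (x 0%Z - y 0%Z) + Ce y th.
Proof.
  move=> Hx Hy E.
  have := Ce_single (fun n => x n + -1 * y n) (x 0%Z - y 0%Z) th.
  rewrite Ce_plus ?Ce_scal //; first exact: summable_scal.
  move=> H; rewrite -H; [by move=> n /E ->; ring|ring|ring].
Qed.

Lemma conv_c_c_0 : conv c c 0%Z = kap a.
Proof.
  apply: tsum_ext => n; by rewrite (_ : (0 - n = - n)%Z) ?sechs_neg; first lia.
Qed.

(** The coefficients of the square are the convolution of [1 / cosh] with itself. *)
Lemma dnF_sq th : dnF a th ^ 2 = kap a + 2 * zeF1 a th.
Proof.
  have Hc := expd_summable _ cexp.
  have Hz := expd_summable _ expd_nz.
  have E := Ce_conv c c th Hc Hc.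
  rewrite Se_even // in E; first exact: sechs_neg.
  rewrite /= Rmult_1_r /dnF (_ : Ce c th * Ce c th = Ce (conv c c) th); first lra.
  rewrite (Ce_but0 _ (fun n => 2 * (IZR n * z n))) ?Ce_scal //.
  - exact: summable_conv.
  - exact: summable_scal.
  - by move=> n Hn; rewrite conv_sech_sech //; ring.
  - rewrite conv_c_c_0 Rmult_0_l /zeF1; ring.
Qed.

(** The product of [dnF] with [dnF ^ 2], the latter being written as
    [kap + 2 zeF1]. *)
Lemma dnF_cube th : dnF2 a th = / 2 * dnF a th * (alF a - dnF a th ^ 2).
Proof.
  have Hc := expd_summable _ cexp.
  have Hz := expd_summable _ expd_nz.
  have Hcc := expd_summable _ (expd_n _ expd_nc).
  have E := Ce_conv (fun m => IZR m * z m) c th Hz Hc.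
  rewrite (Se_even c) // in E; first exact: sechs_neg.
  set k2 := tsum (fun m => IZR m * (k m - t m)).
  have E2 : Ce (conv (fun m => IZR m * z m) c) th = k2 * dnF a th - dnF2 a th.
    rewrite (Ce_ext _ (fun n => k2 * c n + (IZR n * (IZR n * c n)))).
      by move=> n; rewrite conv_nz_sech -/k2; ring.
    rewrite Ce_plus ?Ce_scal //; first exact: summable_scal.
    rewrite /dnF /dnF2; ring.
  rewrite E2 -/(zeF1 a th) -/(dnF a th) in E.
  have := dnF_sq th; rewrite /alF -/k2; nra.
Qed.

(** The left-hand side is the termwise derivative in [a] at fixed [th].  The
    right-hand side is the derivative in [th] of the product [zeF * dnF], whose
    coefficients contain the factor [tanh]. *)
Lemma dnF_da th :
  - Ce (fun n => IZR n * t n * c n) th = 2 * dnF2 a th + zeF1 a th * dnF a th + zeF a th * dnF1 a th.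
Proof.
  have Hc := expd_summable _ cexp.
  have Hz := expd_summable _ zexp.
  have Hcc := expd_summable _ (expd_n _ expd_nc).
  have Htc : expd (fun n => t n * c n) by apply: (expd_mulb 1) => // n; exact: tanh_bound.
  have Hx : expd (fun n => c n * (2 * IZR n - t n)).
    apply: (expd_ext (fun n => 2 * (IZR n * c n) - t n * c n)); first by move=> n; ring.
    apply: expd_minus => //; apply: expd_scal; exact: expd_nc.
  have E u : zeF a u * dnF a u = Se (fun n => c n * (2 * IZR n - t n)) u.
    rewrite -(Se_ext _ _ u conv_csch_sech) Se_conv // (Ce_odd z) //; [exact: cschs_neg|].
    rewrite /zeF /dnF; ring.
  have D1 := is_derive_Se _ th Hx.
  have D2 : is_derive (fun u => zeF a u * dnF a u) th (zeF1 a th * dnF a th + zeF a th * dnF1 a th).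
    apply: (is_derive_mult (K := R_AbsRing)); [exact: is_derive_zeF|exact: is_derive_dnF|].
    by move=> *; apply: Rmult_comm.
  have D3 := is_derive_ext _ _ _ _ E D2.
  have := is_derive_unique _ _ _ D1; rewrite (is_derive_unique _ _ _ D3) => E3.
  have E4 : Ce (fun n => IZR n * (c n * (2 * IZR n - t n))) th =
     2 * Ce (fun n => IZR n * (IZR n * c n)) th + -1 * Ce (fun n => IZR n * t n * c n) th.
    have Hnt : summable (fun n => IZR n * t n * c n).
      apply: expd_summable; apply: expd_ext (expd_n _ Htc) => n; ring.
    rewrite -!Ce_scal // -Ce_plus; try exact: summable_scal.
    by apply: Ce_ext => n; ring.
  rewrite /dnF2; lra.
Qed.

(** The left-hand side is a product of two Fourier series whose convolution is,
    away from the constant term, proportional to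
    [sin (n be) / sinh (n a)]. *)
Lemma dnF_addition be : sin (be / 2) <> 0 -> exists g h, forall th,
  dnF a th * (dnF a (th + be) + dnF a (th - be)) = g + h * (zeF a (th + be) - zeF a (th - be)).
Proof.
  move=> Hb; have [mu Hmu] := conv_sech_sech_cos be Hb.
  have Hc := expd_summable _ cexp.
  have Hz := expd_summable _ zexp.
  set y := fun m => 2 * cos (IZR m * be) * c m.
  have Hy : summable y.
    apply: expd_summable; apply: (expd_mulb 2) => // m.
    rewrite Rabs_mult Rabs_pos_eq; [lra|have := Rabs_cos_le (IZR m * be); lra].
  set w := fun m => z m * sin (IZR m * be).
  have Hw : summable w by exact: summable_sin.
  exists (conv c y 0%Z), mu => th.
  have E1 : dnF a (th + be) + dnF a (th - be) = Ce y th.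
    rewrite -tsum_plus; try exact: summable_cos.
    apply: tsum_ext => n.
    by rewrite /Rminus !Rmult_plus_distr_l -!Ropp_mult_distr_r cos_plus cos_minus /y; ring.
  have E2 : zeF a (th + be) - zeF a (th - be) = 2 * Ce w th.
    rewrite -tsum_minus; try exact: summable_sin.
    rewrite -tsum_scal; first exact: summable_cos.
    apply: tsum_ext => n.
    by rewrite /Rminus !Rmult_plus_distr_l -!Ropp_mult_distr_r sin_plus sin_minus /w; ring.
  rewrite E1 E2.
  have E := Ce_conv c y th Hc Hy.
  rewrite (Se_even c) // in E; first exact: sechs_neg.
  rewrite /dnF (_ : Ce c th * Ce y th = Ce (conv c y) th); first lra.
  rewrite (Ce_but0 _ (fun n => 2 * mu * w n)) ?Ce_scal //.
  - exact: summable_conv.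
  - exact: summable_scal.
  - by rewrite /w cschs_0; ring.
Qed.

(** The second order equation [dnF_cube] has an energy integral. *)
Lemma dnF_first_integral th th' :
  dnF1 a th ^ 2 - / 2 * alF a * dnF a th ^ 2 + / 4 * dnF a th ^ 4 =
  dnF1 a th' ^ 2 - / 2 * alF a * dnF a th' ^ 2 + / 4 * dnF a th' ^ 4.
Proof.
  set Q := fun u => dnF1 a u ^ 2 - / 2 * alF a * dnF a u ^ 2 + / 4 * dnF a u ^ 4.
  rewrite -/(Q th) -/(Q th').
  have HQ u : is_derive Q u 0.
    have D0 := is_derive_dnF u; have D1 := is_derive_dnF1 u.
    have P1 := is_derive_pow _ 2 _ _ D1.
    have P2 := is_derive_scal _ _ (/ 2 * alF a) _ (is_derive_pow _ 2 _ _ D0).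
    have P4 := is_derive_scal _ _ (/ 4) _ (is_derive_pow _ 4 _ _ D0).
    apply: is_derive_eq (is_derive_plus _ _ _ _ _ (is_derive_minus _ _ _ _ _ P1 P2) P4) _.
    rewrite /minus /plus /opp /scal /= /mult /= dnF_cube; field.
  have [||x [_ E]] := MVT_gen Q th th' (fun _ => 0).
  - by move=> x _.
  - move=> x _; apply/continuity_pt_filterlim; apply: (ex_derive_continuous (V := R_NormedModule)).
    by exists 0.
  lra.
Qed.

End Identities.


(** * The null values and their differential system in the parameter *)

Definition f0 (a : R) : R := dnF a 0.
Definition fpi (a : R) : R := dnF a PI.
Definition CC (a : R) : R := f0 a ^ 2.
Definition BB (a : R) : R := fpi a ^ 2.
Definition AA (a : R) : R := CC a - BB a.

Lemma sin_IZR_PI n : sin (IZR n * PI) = 0.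
Proof. by apply: sin_eq_0_1; exists n. Qed.

Lemma cos_IZR_PI_sq n : cos (IZR n * PI) * cos (IZR n * PI) = 1.
Proof.
  have := sin2_cos2 (IZR n * PI); rewrite sin_IZR_PI /Rsqr; lra.
Qed.

Lemma cos_IZR_even k : cos (IZR (2 * k) * PI) = 1.
Proof.
  rewrite mult_IZR (_ : 2 * IZR k * PI = 2 * (IZR k * PI)); first ring.
  rewrite cos_2a sin_IZR_PI cos_IZR_PI_sq; ring.
Qed.

Lemma cos_IZR_odd k : cos (IZR (2 * k + 1) * PI) = -1.
Proof.
  rewrite plus_IZR Rmult_plus_distr_r cos_plus Rmult_1_l cos_IZR_even cos_PI sin_PI; ring.
Qed.

Lemma Ce_0 x : Ce x 0 = tsum x.
Proof. by apply: tsum_ext => n; rewrite Rmult_0_r cos_0 Rmult_1_r. Qed.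

Lemma Se_0 x : Se x 0 = 0.
Proof. by apply: tsum_0 => n; rewrite Rmult_0_r sin_0 Rmult_0_r. Qed.

Lemma Se_PI x : Se x PI = 0.
Proof. by apply: tsum_0 => n; rewrite sin_IZR_PI Rmult_0_r. Qed.

Lemma nz_nonneg a n : 0 < a -> 0 <= IZR n * cschs a n.
Proof.
  move=> Ha; have [->|Hn] := Z.eq_dec n 0; first by rewrite cschs_0; lra.
  have H p : 0 < IZR p -> 0 <= IZR p * cschs a p.
    move=> Hp; apply: Rmult_le_pos; first lra.
    by apply: Rlt_le; apply: Rinv_0_lt_compat; apply: sinh_pos; apply: Rmult_lt_0_compat.
  have [Hlt|Hgt] := Z_lt_le_dec n 0.
  - have := H (- n)%Z; rewrite cschs_neg opp_IZR.
    have := IZR_lt _ _ Hlt; lra.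
  - apply: H; apply: IZR_lt; lia.
Qed.

Lemma zeF1_0_gt a : 0 < a -> 0 < zeF1 a 0.
Proof.
  move=> Ha; rewrite /zeF1 Ce_0.
  have Hs := expd_summable _ (expd_nz a Ha).
  have H1 : 0 < IZR 1 * cschs a 1.
    rewrite Rmult_1_l; apply: Rinv_0_lt_compat; apply: sinh_pos; lra.
  apply: Rlt_le_trans H1 _.
  have H := is_sum_single 1%Z (fun n => if Z.eq_dec n 1 then IZR n * cschs a n else 0).
  rewrite /= in H.
  apply: is_sum_le _ (H _) (tsum_is_sum _ Hs).
  - move=> n; case: Z.eq_dec => _; [lra|exact: nz_nonneg].
  - by move=> n Hn; case: Z.eq_dec.
Qed.

Lemma zeF1_PI_lt a : 0 < a -> zeF1 a PI < zeF1 a 0.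
Proof.
  move=> Ha; apply: Rminus_gt_0_lt.
  have Hs := expd_summable _ (expd_nz a Ha).
  rewrite /zeF1 -tsum_minus; try exact: summable_cos.
  have H1 : 0 < IZR 1 * cschs a 1 * 2.
    rewrite Rmult_1_l; apply: Rmult_lt_0_compat; last lra.
    apply: Rinv_0_lt_compat; apply: sinh_pos; lra.
  apply: Rlt_le_trans H1 _.
  have H := is_sum_single 1%Z (fun n => if Z.eq_dec n 1 then IZR n * cschs a n * 2 else 0).
  rewrite /= in H.
  apply: is_sum_le _ (H _) (tsum_is_sum _ (summable_minus _ _ (summable_cos _ 0 Hs) (summable_cos _ PI Hs))).
  - move=> n; case: Z.eq_dec => [->|_].
      rewrite Rmult_0_r cos_0 (cos_IZR_odd 0); lra.
    rewrite Rmult_0_r cos_0 -Rmult_minus_distr_l; apply: Rmult_le_pos; first exact: nz_nonneg.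
    have := COS_bound (IZR n * PI); lra.
  - by move=> n Hn; case: Z.eq_dec.
Qed.

Lemma CC_kap a : 0 < a -> CC a = kap a + 2 * zeF1 a 0.
Proof. by move=> Ha; apply: dnF_sq. Qed.

Lemma BB_kap a : 0 < a -> BB a = kap a + 2 * zeF1 a PI.
Proof. by move=> Ha; apply: dnF_sq. Qed.

Lemma AA_pos a : 0 < a -> 0 < AA a.
Proof.
  move=> Ha; rewrite /AA CC_kap // BB_kap //; have := zeF1_PI_lt a Ha; lra.
Qed.

Lemma kap_lt_CC a : 0 < a -> kap a < CC a.
Proof. move=> Ha; rewrite CC_kap //; have := zeF1_0_gt a Ha; lra. Qed.

Lemma f0_ge1 a : 0 < a -> 1 <= f0 a.
Proof.
  move=> Ha; rewrite /f0 /dnF Ce_0.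
  have Hs := expd_summable _ (expd_sechs a Ha).
  have H := is_sum_single 0%Z (fun n => if Z.eq_dec n 0 then sechs a n else 0).
  rewrite /= sechs_0 in H.
  apply: is_sum_le _ (H _) (tsum_is_sum _ Hs).
  - move=> n; case: Z.eq_dec => _; [lra|by apply: Rlt_le; apply: sechs_pos].
  - by move=> n Hn; case: Z.eq_dec.
Qed.

Lemma CC_pos a : 0 < a -> 0 < CC a.
Proof. move=> Ha; have := f0_ge1 a Ha; rewrite /CC; nra. Qed.

Lemma dnF1_0 a : dnF1 a 0 = 0.
Proof. by rewrite /dnF1 Se_0 Ropp_0. Qed.

Lemma dnF1_PI a : dnF1 a PI = 0.
Proof. by rewrite /dnF1 Se_PI Ropp_0. Qed.

(** At [th = 0] and [th = PI] the first derivative vanishes; equating the two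
    values of the energy determines its coefficient. *)
Lemma alF_eq a : 0 < a -> alF a = (CC a + BB a) / 2.
Proof.
  move=> Ha; have := dnF_first_integral a Ha 0 PI.
  rewrite dnF1_0 dnF1_PI -/(f0 a) -/(fpi a) => H.
  have HA := AA_pos a Ha.
  apply: (Rmult_eq_reg_l (AA a)); last lra.
  move: H; rewrite /AA /CC /BB; nra.
Qed.

Lemma dnF1_sq a th : 0 < a ->
  dnF1 a th ^ 2 = / 4 * (CC a - dnF a th ^ 2) * (dnF a th ^ 2 - BB a).
Proof.
  move=> Ha; have := dnF_first_integral a Ha th 0.
  rewrite dnF1_0 alF_eq // -/(f0 a) (_ : f0 a ^ 4 = CC a ^ 2); first by rewrite /CC; ring.
  rewrite -/(CC a); nra.
Qed.

Lemma dnF2_eq a th : 0 < a ->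
  dnF2 a th = / 2 * dnF a th * ((CC a + BB a) / 2 - dnF a th ^ 2).
Proof. by move=> Ha; rewrite dnF_cube // alF_eq. Qed.

(** ** Derivatives with respect to the parameter *)

Lemma is_derive_tanh x : is_derive tanh x (/ cosh x ^ 2).
Proof.
  have H := cosh_neq0 x; have E := cosh2_sinh2 x.
  rewrite /tanh; auto_derive; first by [].
  field_simplify; try exact: H.
  by congr Rdiv; lra.
Qed.

Lemma sechs_near_le a x n : Rabs (x - a) < a / 2 -> 0 < a ->
  sechs x n <= 2 * exp (- (a / 2) * Rabs (IZR n)).
Proof.
  move=> Hx Ha; have Hx2 : a / 2 < x by move: Hx; rewrite /Rabs; case: Rcase_abs; lra.
  apply: Rle_trans (sechs_le x n _) _; first lra.
  apply: Rmult_le_compat_l; first lra.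
  apply: exp_le_compat; apply: Rmult_le_compat_r; [exact: Rabs_pos|lra].
Qed.

Lemma is_derive_dnF_a a th : 0 < a ->
  is_derive (fun x => dnF x th) a (- Ce (fun n => IZR n * tanhs a n * sechs a n) th).
Proof.
  move=> Ha.
  set E := fun n => exp (- (a / 2) * Rabs (IZR n)).
  have HE : expd E.
    exists 1, (a / 2); split; first lra.
    move=> n; rewrite Rabs_pos_eq; [by apply: Rlt_le; apply: exp_pos|rewrite /E; lra].
  have Hu1 : summable (fun n => IZR n * tanhs a n * sechs a n * cos (IZR n * th)).
    apply: summable_cos; apply: expd_summable.
    apply: expd_ext (expd_n _ (expd_mulb 1 _ (tanhs a) (expd_sechs a Ha) _)) => n; [ring|exact: tanh_bound].
  rewrite /Ce -tsum_opp //.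
  apply: (is_derive_tsum (fun n x => sechs x n * cos (IZR n * th))
    (fun n x => - (IZR n * tanhs x n * sechs x n * cos (IZR n * th)))
    (fun n x => IZR n * IZR n * (tanhs x n * tanhs x n - sechs x n * sechs x n) * sechs x n * cos (IZR n * th))
    (fun n => 4 * Rabs (IZR n * (IZR n * E n))) a (a / 2)); first lra.
  - move=> n x Hx; rewrite /sechs /tanhs /tanh; have H := cosh_neq0 (IZR n * x).
    by auto_derive => //; field.
  - move=> n x Hx; rewrite /sechs /tanhs.
    have H := cosh_neq0 (IZR n * x).
    have D1 := is_derive_tanh (IZR n * x).
    apply: (is_derive_ext (fun x => - (IZR n * cos (IZR n * th)) * (tanh (IZR n * x) * / cosh (IZR n * x)))).
      by move=> y /=; ring.
    have E2 := cosh2_sinh2 (IZR n * x).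
    rewrite /tanh; auto_derive; first by [].
    field_simplify_eq => //.
    rewrite (_ : cosh (IZR n * x) ^ 2 = 1 + sinh (IZR n * x) ^ 2); [lra|ring].
  - move=> n x Hx.
    have H1 : Rabs (tanhs x n * tanhs x n - sechs x n * sechs x n) <= 2.
      have A1 := tanh_bound (IZR n * x); rewrite -/(tanhs x n) in A1.
      have A2 := sechs_pos x n; have A3 := sechs_le1 x n.
      apply: Rabs_le; move: A1; rewrite /Rabs; case: Rcase_abs; nra.
    rewrite (_ : _ * cos _ = (IZR n * IZR n) * ((tanhs x n * tanhs x n - sechs x n * sechs x n) * (sechs x n * cos (IZR n * th)))); first ring.
    rewrite Rabs_mult (_ : IZR n * (IZR n * E n) = (IZR n * IZR n) * E n); first ring.
    rewrite (Rabs_mult (IZR n * IZR n) (E n)).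
    rewrite (Rabs_pos_eq (E n)); first by apply: Rlt_le; apply: exp_pos.
    rewrite (_ : 4 * (_ * E n) = Rabs (IZR n * IZR n) * (2 * (2 * E n * 1))); first ring.
    apply: Rmult_le_compat_l; first exact: Rabs_pos.
    rewrite Rabs_mult; apply: Rmult_le_compat => //; try exact: Rabs_pos.
    rewrite Rabs_mult; apply: Rmult_le_compat; try exact: Rabs_pos; last exact: Rabs_cos_le.
    rewrite Rabs_pos_eq; first by apply: Rlt_le; apply: sechs_pos.
    exact: sechs_near_le.
  - apply: summable_scal; apply: summable_abs; apply: expd_summable; apply: expd_n; exact: expd_n.
  - move=> x Hx; apply: summable_cos; apply: expd_summable; apply: expd_sechs.
    move: Hx; rewrite /Rabs; case: Rcase_abs; lra.
  - exact: summable_opp.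
Qed.

(** The evolution equation at [th = 0], where [zeF] vanishes and the second
    derivative is known. *)
Lemma is_derive_f0 a : 0 < a -> is_derive f0 a (/ 2 * f0 a * (BB a - kap a)).
Proof.
  move=> Ha; apply: is_derive_eq (is_derive_dnF_a a 0 Ha) _.
  rewrite dnF_da // dnF2_eq // dnF1_0 -/(f0 a) -/(CC a).
  have := CC_kap a Ha; nra.
Qed.

Lemma is_derive_fpi a : 0 < a -> is_derive fpi a (/ 2 * fpi a * (CC a - kap a)).
Proof.
  move=> Ha; apply: is_derive_eq (is_derive_dnF_a a PI Ha) _.
  rewrite dnF_da // dnF2_eq // dnF1_PI -/(fpi a) -/(BB a).
  have := BB_kap a Ha; nra.
Qed.

Lemma is_derive_CC a : 0 < a -> is_derive CC a (CC a * (BB a - kap a)).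
Proof.
  move=> Ha; apply: is_derive_eq (is_derive_pow _ 2 _ _ (is_derive_f0 a Ha)) _.
  rewrite /CC /=; field.
Qed.

Lemma is_derive_BB a : 0 < a -> is_derive BB a (BB a * (CC a - kap a)).
Proof.
  move=> Ha; apply: is_derive_eq (is_derive_pow _ 2 _ _ (is_derive_fpi a Ha)) _.
  rewrite /BB /=; field.
Qed.

Lemma is_derive_AA a : 0 < a -> is_derive AA a (- kap a * AA a).
Proof.
  move=> Ha; apply: is_derive_eq (is_derive_minus _ _ _ _ _ (is_derive_CC a Ha) (is_derive_BB a Ha)) _.
  rewrite /AA /minus /plus /opp /=; ring.
Qed.

Lemma is_derive_zeF1_a a : 0 < a ->
  is_derive (fun x => zeF1 x 0) a (- Ce (fun n => IZR n * (IZR n * (coths a n * cschs a n))) 0).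
Proof.
  move=> Ha.
  set E := fun n => exp (- (a / 2) * Rabs (IZR n)).
  have HE : expd E.
    exists 1, (a / 2); split; first lra.
    move=> n; rewrite Rabs_pos_eq; [by apply: Rlt_le; apply: exp_pos|rewrite /E; lra].
  have Hu1 : summable (fun n => IZR n * (IZR n * (coths a n * cschs a n))).
    apply: expd_summable; apply: expd_n; apply: expd_n.
    apply: (expd_mulb (cosh a / sinh a)) (expd_cschs a Ha) _ => n; exact: coths_bound.
  rewrite Ce_0 -tsum_opp //.
  apply: (is_derive_ext (fun x => tsum (fun n => IZR n * cschs x n))).
    by move=> x; rewrite /zeF1 Ce_0.
  set K := cosh (a / 2) / sinh (a / 2).
  have HK : 0 < K.
    apply: Rdiv_lt_0_compat; [exact: cosh_pos|apply: sinh_pos; lra].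
  have near x : Rabs (x - a) < a / 2 -> 0 < a / 2 <= x.
    by rewrite /Rabs; case: Rcase_abs; lra.
  apply: (is_derive_tsum (fun n x => IZR n * cschs x n)
    (fun n x => - (IZR n * (IZR n * (coths x n * cschs x n))))
    (fun n x => IZR n * (IZR n * IZR n) * (cschs x n * (1 + 2 * (cschs x n * cschs x n))))
    (fun n => (K * (1 + 2 * (K * K))) * 2 * Rabs (IZR n * (IZR n * (IZR n * E n)))) a (a / 2)); first lra.
  - move=> n x Hx; have Hx2 := near x Hx.
    have [->|Hn] := Z.eq_dec n 0.
      apply: (is_derive_ext (fun _ => 0)); first by move=> t; rewrite /= Rmult_0_l.
      by rewrite Rmult_0_l Ropp_0; apply: is_derive_const.
    have H : sinh (IZR n * x) <> 0 by apply: sinh_neq0; apply: IZRa_neq0 => //; lra.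
    by rewrite /cschs /coths; auto_derive => //; field.
  - move=> n x Hx; have Hx2 := near x Hx.
    have [->|Hn] := Z.eq_dec n 0.
      apply: (is_derive_ext (fun _ => 0)); first by move=> t; rewrite /= Rmult_0_l Ropp_0.
      by rewrite !Rmult_0_l; apply: is_derive_const.
    have H : sinh (IZR n * x) <> 0 by apply: sinh_neq0; apply: IZRa_neq0 => //; lra.
    have E2 := cosh2_sinh2 (IZR n * x).
    have E3 : cosh (IZR n * x) ^ 2 = 1 + sinh (IZR n * x) ^ 2 by lra.
    rewrite /cschs /coths; auto_derive => //.
    field_simplify_eq => //.
    rewrite E3; ring.
  - move=> n x Hx; have Hx2 := near x Hx.
    rewrite (_ : IZR n * (IZR n * (IZR n * E n)) = IZR n * (IZR n * IZR n) * E n); first ring.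
    rewrite !(Rabs_mult (IZR n * (IZR n * IZR n))).
    rewrite (Rabs_pos_eq (E n)); first by apply: Rlt_le; apply: exp_pos.
    rewrite (_ : _ * 2 * (_ * E n) = Rabs (IZR n * (IZR n * IZR n)) * (K * (1 + 2 * (K * K)) * (2 * E n))); first ring.
    apply: Rmult_le_compat_l; first exact: Rabs_pos.
    have Hz := cschs_le x (a / 2) n Hx2; rewrite -/K in Hz.
    have Hs := sechs_near_le a x n Hx Ha; rewrite -/(E n) in Hs.
    have S1 := sechs_le1 x n; have S0 := sechs_pos x n.
    have HzK : Rabs (cschs x n) <= K by nra.
    have P1 := Rabs_pos (cschs x n).
    rewrite Rabs_mult (Rabs_pos_eq (1 + _)).
      have : 0 <= cschs x n * cschs x n by apply: Rle_0_sqr.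
      lra.
    rewrite -(Rabs_pos_eq (cschs x n * cschs x n)); first exact: Rle_0_sqr.
    rewrite (Rabs_mult (cschs x n)).
    have Q1 : Rabs (cschs x n) * Rabs (cschs x n) <= K * K by apply: Rmult_le_compat.
    rewrite (_ : K * (1 + 2 * (K * K)) * (2 * E n) = (K * (2 * E n)) * (1 + 2 * (K * K))); first ring.
    apply: Rmult_le_compat => //; first nra; last lra.
    apply: Rle_trans Hz _; apply: Rmult_le_compat_l; lra.
  - apply: summable_scal; apply: summable_abs; apply: expd_summable; do 3 apply: expd_n; exact: HE.
  - move=> x Hx; apply: expd_summable; apply: expd_nz; have := near x Hx; lra.
  - exact: summable_opp.
Qed.

(** Both sides are half of the second derivative in [th] of [dnF ^ 2]. *)
Lemma dnF_sq_second a th : 0 < a ->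
  dnF1 a th ^ 2 + dnF2 a th * dnF a th = - Ce (fun n => IZR n * (IZR n * (IZR n * cschs a n))) th.
Proof.
  move=> Ha.
  have F1 u : is_derive (fun u => dnF a u ^ 2) u (2 * dnF1 a u * dnF a u).
    apply: is_derive_eq (is_derive_pow _ 2 _ _ (is_derive_dnF a Ha u)) _; rewrite /=; ring.
  have F2 u : is_derive (fun u => kap a + 2 * zeF1 a u) u (- 2 * Se (fun n => IZR n * (IZR n * cschs a n)) u).
    apply: is_derive_eq (is_derive_plus _ _ _ _ _ (is_derive_const _ _)
      (is_derive_scal _ _ 2 _ (is_derive_Ce _ _ (expd_nz a Ha)))) _.
    rewrite /plus /zero /=; ring.
  have G2 u : 2 * dnF1 a u * dnF a u = - 2 * Se (fun n => IZR n * (IZR n * cschs a n)) u.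
    rewrite -(is_derive_unique _ _ _ (F1 u)) -(is_derive_unique _ _ _ (F2 u)).
    by apply: Derive_ext => v; apply: dnF_sq.
  have F3 : is_derive (fun u => 2 * dnF1 a u * dnF a u) th (2 * (dnF1 a th ^ 2 + dnF2 a th * dnF a th)).
    have P := is_derive_mult _ _ _ _ _ (is_derive_scal _ _ 2 _ (is_derive_dnF1 a Ha th)) (is_derive_dnF a Ha th) (fun _ _ => Rmult_comm _ _).
    apply: is_derive_eq P _.
    rewrite /plus /mult /=; ring.
  have F4 : is_derive (fun u => - 2 * Se (fun n => IZR n * (IZR n * cschs a n)) u) th
     (- 2 * Ce (fun n => IZR n * (IZR n * (IZR n * cschs a n))) th).
    apply: is_derive_scal; apply: is_derive_Se; apply: expd_n; exact: expd_nz.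
  have G3 : 2 * (dnF1 a th ^ 2 + dnF2 a th * dnF a th) = - 2 * Ce (fun n => IZR n * (IZR n * (IZR n * cschs a n))) th.
    rewrite -(is_derive_unique _ _ _ F3) -(is_derive_unique _ _ _ F4).
    exact: Derive_ext.
  lra.
Qed.

(** The square of [zeF] has coefficients involving [coth (n a) / sinh (n a)],
    which are also the coefficients of the derivative in [a]; the second
    derivative at the origin compares the two. *)
Lemma zeF1_da_eq a : 0 < a ->
  - Ce (fun n => IZR n * (IZR n * (coths a n * cschs a n))) 0 = zeF1 a 0 ^ 2 + f0 a * dnF2 a 0.
Proof.
  move=> Ha.
  have Hz := expd_cschs a Ha; have Hzs := expd_summable _ Hz.
  have Hkz : expd (fun n => coths a n * cschs a n).
    apply: (expd_mulb (cosh a / sinh a)) (expd_cschs a Ha) _ => n; exact: coths_bound.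
  pose w n := cschs a n * (2 * IZR n - 2 * coths a n).
  have Hw : expd w.
    apply: (expd_ext (fun n => 2 * (IZR n * cschs a n) - 2 * (coths a n * cschs a n))).
      by move=> n; rewrite /w; ring.
    by apply: expd_minus; apply: expd_scal => //; apply: expd_n.
  (* the square of zeF *)
  have E1 th : - zeF a th ^ 2 = conv (cschs a) (cschs a) 0%Z + Ce w th.
    have := Ce_conv (cschs a) (cschs a) th Hzs Hzs.
    rewrite (Ce_odd (cschs a)) //; first exact: cschs_neg.
    rewrite (Ce_but0 (conv (cschs a) (cschs a)) w).
    - exact: summable_conv.
    - exact: expd_summable.
    - by move=> n Hn; rewrite conv_csch_csch.
    - rewrite {1}/w cschs_0 /zeF; lra.
  have D1 th : is_derive (fun u => - zeF a u ^ 2) th (- (2 * zeF1 a th * zeF a th)).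
    have D := is_derive_zeF a Ha th.
    apply: is_derive_eq (is_derive_opp _ _ _ (is_derive_pow _ 2 _ _ D)) _.
    rewrite /opp /=; ring.
  have D2 th : is_derive (fun u => conv (cschs a) (cschs a) 0%Z + Ce w u) th (- Se (fun n => IZR n * w n) th).
    apply: is_derive_eq (is_derive_plus _ _ _ _ _ (is_derive_const _ _) (is_derive_Ce _ _ Hw)) _.
    rewrite /plus /zero /=; ring.
  have E2 th : - (2 * zeF1 a th * zeF a th) = - Se (fun n => IZR n * w n) th.
    rewrite -(is_derive_unique _ _ _ (D1 th)) -(is_derive_unique _ _ _ (D2 th)).
    exact: Derive_ext.
  have D3 : is_derive (fun u => - (2 * zeF1 a u * zeF a u)) 0 (- 2 * zeF1 a 0 ^ 2).
    have D := is_derive_zeF a Ha 0.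
    have D' := is_derive_Ce _ 0 (expd_nz a Ha).
    have P := is_derive_opp _ _ _ (is_derive_mult _ _ _ _ _ (is_derive_scal _ _ 2 _ D') D (fun _ _ => Rmult_comm _ _)).
    apply: is_derive_eq P _.
    rewrite /zeF /zeF1 Se_0 /opp /plus /mult /=; ring.
  have D4 : is_derive (fun u => - Se (fun n => IZR n * w n) u) 0 (- Ce (fun n => IZR n * (IZR n * w n)) 0).
    apply: (is_derive_opp (V := R_NormedModule)); apply: is_derive_Se; exact: expd_n.
  have E3 : - 2 * zeF1 a 0 ^ 2 = - Ce (fun n => IZR n * (IZR n * w n)) 0.
    rewrite -(is_derive_unique _ _ _ D3) -(is_derive_unique _ _ _ D4).
    exact: Derive_ext.
  have G3 := dnF_sq_second a 0 Ha; rewrite dnF1_0 -/(f0 a) in G3.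
  have H4 : Ce (fun n => IZR n * (IZR n * w n)) 0 =
    2 * Ce (fun n => IZR n * (IZR n * (IZR n * cschs a n))) 0
    + -2 * Ce (fun n => IZR n * (IZR n * (coths a n * cschs a n))) 0.
    have S1 : summable (fun n => IZR n * (IZR n * (IZR n * cschs a n))).
      apply: expd_summable; do 3 apply: expd_n; exact: Hz.
    have S2 : summable (fun n => IZR n * (IZR n * (coths a n * cschs a n))).
      apply: expd_summable; do 2 apply: expd_n; exact: Hkz.
    rewrite -!Ce_scal // -Ce_plus; try exact: summable_scal.
    by apply: Ce_ext => n; rewrite /w; ring.
  lra.
Qed.

(** As [CC = kap + 2 zeF1 0], the last missing derivative is that of [zeF1 0]. *)
Lemma is_derive_kap a : 0 < a -> is_derive kap a ((BB a * CC a - kap a ^ 2) / 2).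
Proof.
  move=> Ha.
  have H : is_derive (fun x => CC x - 2 * zeF1 x 0) a ((BB a * CC a - kap a ^ 2) / 2).
    apply: is_derive_eq (is_derive_minus _ _ _ _ _ (is_derive_CC a Ha)
      (is_derive_scal _ _ 2 _ (is_derive_zeF1_a a Ha))) _.
    rewrite zeF1_da_eq // dnF2_eq // -/(f0 a) -/(CC a) /minus /plus /opp /=.
    have E := CC_kap a Ha.
    rewrite (_ : f0 a * (/ 2 * f0 a * ((CC a + BB a) / 2 - CC a)) = / 2 * CC a * ((CC a + BB a) / 2 - CC a)).
      by rewrite /CC; field.
    have -> : zeF1 a 0 = (CC a - kap a) / 2 by lra.
    by field.
  apply: (is_derive_ext_loc (fun x => CC x - 2 * zeF1 x 0)) H.
  have Ha2 : 0 < a / 2 by lra.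
  exists (mkposreal _ Ha2) => x; rewrite /ball /= /AbsRing_ball /= /abs /minus /plus /opp /= => Hx.
  have Hx0 : 0 < x by move: Hx; rewrite /Rabs; case: Rcase_abs; lra.
  rewrite CC_kap //; ring.
Qed.


(** ** Behaviour at both ends, and multiplication of the parameter by 2 and 3 *)

(** For [a >= 1] all terms but the constant one are [O (exp (- a))], uniformly
    in the family. *)
Lemma Ce_tail : exists K, 0 < K /\ forall a x th, 1 <= a ->
  (forall n, Rabs (x n) <= 2 * exp (- a * Rabs (IZR n))) ->
  Rabs (Ce x th - x 0%Z) <= K * exp (- a).
Proof.
  pose E n := exp (- Rabs (IZR n)).
  have HE : expd E.
    exists 1, 1; split; first lra.
    move=> n; rewrite Rabs_pos_eq; first by apply: Rlt_le; apply: exp_pos.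
    by right; rewrite /E Rmult_1_l; congr exp; ring.
  have HE0 : 0 <= tsum E by apply: tsum_nonneg; [move=> n; apply: Rlt_le; apply: exp_pos|exact: expd_summable].
  have He := exp_pos 1.
  exists (2 * exp 1 * (tsum E + 1)); split; first by apply: Rmult_lt_0_compat; lra.
  move=> a x th Ha Hx.
  have Hxe : expd x by exists 2, a; split=> //; lra.
  have Hs := expd_summable _ Hxe.
  pose y n := if Z.eq_dec n 0 then 0 else x n.
  have Hy : expd y.
    apply: (expd_bdd 1) Hxe _ => n; rewrite /y Rmult_1_l; case: Z.eq_dec => _; last lra.
    rewrite Rabs_R0; exact: Rabs_pos.
  rewrite (Ce_but0 x y) //; first exact: expd_summable.
    by move=> n Hn; rewrite /y; case: Z.eq_dec.
  rewrite (_ : x 0%Z - y 0%Z + Ce y th - x 0%Z = Ce y th); first by rewrite /y /=; ring.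
  apply: Rle_trans (_ : _ <= tsum (fun n => 2 * exp 1 * exp (- a) * E n)) _.
    apply: tsum_Rabs_le; last by apply: summable_scal; exact: expd_summable.
    move=> n; rewrite /y; case: Z.eq_dec => Hn.
      rewrite Rmult_0_l Rabs_R0; apply: Rlt_le; apply: Rmult_lt_0_compat; last exact: exp_pos.
      apply: Rmult_lt_0_compat; [lra|exact: exp_pos].
    rewrite Rabs_mult; apply: (Rle_trans _ (Rabs (x n) * 1)).
      apply: Rmult_le_compat_l; [exact: Rabs_pos|exact: Rabs_cos_le].
    rewrite Rmult_1_r; apply: Rle_trans (Hx n) _.
    rewrite Rmult_assoc Rmult_assoc -!exp_plus; apply: Rmult_le_compat_l; first lra.
    apply: exp_le_compat.
    have : 1 <= Rabs (IZR n) by rewrite -abs_IZR; apply: IZR_le; lia.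
    nra.
  rewrite tsum_scal; first exact: expd_summable.
  have := exp_pos (- a); nra.
Qed.

Lemma f0_tail : exists K, 0 < K /\ forall a, 1 <= a -> Rabs (f0 a - 1) <= K * exp (- a).
Proof.
  have [K [HK H]] := Ce_tail; exists K; split=> // a Ha.
  rewrite -(sechs_0 a); apply: H => // n.
  rewrite Rabs_pos_eq; [by apply: Rlt_le; apply: sechs_pos|apply: sechs_le; lra].
Qed.

Lemma fpi_tail : exists K, 0 < K /\ forall a, 1 <= a -> Rabs (fpi a - 1) <= K * exp (- a).
Proof.
  have [K [HK H]] := Ce_tail; exists K; split=> // a Ha.
  rewrite -(sechs_0 a); apply: H => // n.
  rewrite Rabs_pos_eq; [by apply: Rlt_le; apply: sechs_pos|apply: sechs_le; lra].
Qed.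

Lemma is_lim_exp_tail (f : R -> R) l K :
  (forall a, 1 <= a -> Rabs (f a - l) <= K * exp (- a)) -> is_lim f p_infty l.
Proof.
  move=> H.
  have He : is_lim (fun a => K * exp (- a)) p_infty 0.
    rewrite (_ : Finite 0 = Rbar_mult K 0); first by rewrite /= Rmult_0_r.
    apply: is_lim_scal_l; apply: (is_lim_comp exp (fun a => - a) p_infty 0 m_infty).
    - exact: is_lim_exp_m.
    - by apply: (is_lim_opp id p_infty p_infty); exact: is_lim_id.
    - by exists 0.
  apply: (is_lim_le_le_loc (fun a => l - K * exp (- a)) (fun a => l + K * exp (- a))).
  - exists 1 => a Ha; have := H a (Rlt_le _ _ Ha); rewrite /Rabs; case: Rcase_abs; lra.
  - rewrite [X in Finite X](_ : l = l - 0); first ring.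
    by apply: is_lim_minus'; [exact: is_lim_const|].
  - rewrite [X in Finite X](_ : l = l + 0); first ring.
    by apply: is_lim_plus'; [exact: is_lim_const|].
Qed.

Lemma is_lim_f0 : is_lim f0 p_infty 1.
Proof. have [K [_ H]] := f0_tail; exact: is_lim_exp_tail H. Qed.

Lemma is_lim_fpi : is_lim fpi p_infty 1.
Proof. have [K [_ H]] := fpi_tail; exact: is_lim_exp_tail H. Qed.

Lemma is_lim_mult_fin (f g : R -> R) x (l l' : R) :
  is_lim f x l -> is_lim g x l' -> is_lim (fun y => f y * g y) x (l * l').
Proof. by move=> Hf Hg; apply: (is_lim_mult f g x l l'). Qed.

Lemma is_lim_CC : is_lim CC p_infty 1.
Proof.
  have H := is_lim_mult_fin _ _ _ _ _ is_lim_f0 is_lim_f0; rewrite Rmult_1_l in H.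
  by apply: is_lim_ext H => a; rewrite /CC; ring.
Qed.

Lemma is_lim_BB : is_lim BB p_infty 1.
Proof.
  have H := is_lim_mult_fin _ _ _ _ _ is_lim_fpi is_lim_fpi; rewrite Rmult_1_l in H.
  by apply: is_lim_ext H => a; rewrite /BB; ring.
Qed.

Lemma is_lim_AA : is_lim AA p_infty 0.
Proof. rewrite -(Rminus_diag 1); apply: is_lim_minus'; [exact: is_lim_CC|exact: is_lim_BB]. Qed.

Lemma sechs_mul a k n : sechs (IZR k * a) n = sechs a (k * n).
Proof. by rewrite /sechs mult_IZR; congr (/ cosh _); ring. Qed.

(** Passing from [a] to [k a] keeps the frequencies divisible by [k], which a
    suitable average over shifted arguments selects. *)
Lemma dnF_mul (k : Z) a th (w : Z -> R) : 0 < a -> (0 < k)%Z ->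
  (forall n, Rabs (w n) <= 1) ->
  (forall n, w (k * n)%Z = cos (IZR n * th)) -> (forall n, (n mod k <> 0)%Z -> w n = 0) ->
  dnF (IZR k * a) th = tsum (fun n => sechs a n * w n).
Proof.
  move=> Ha Hk Hw1 Hw Hw0; rewrite (tsum_embed (fun n => k * n)%Z).
  - move=> x y; nia.
  - move=> b Hb; rewrite Hw0; last ring.
    by move=> /Z.mod_divide -/(_ (ltac:(lia))) [q E]; apply: (Hb q); lia.
  - apply: expd_summable; apply: (expd_ext (fun n => w n * sechs a n)); first by move=> n; ring.
    by apply: (expd_mulb 1) => //; apply: expd_sechs.
  by apply: tsum_ext => n; rewrite sechs_mul Hw.
Qed.

Lemma mod2_cases n : (n mod 2 <> 0 -> n = 2 * (n / 2) + 1)%Z.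
Proof. have := Z_div_mod_eq_full n 2; have := Z.mod_pos_bound n 2; lia. Qed.

Lemma f0_double a : 0 < a -> f0 (2 * a) = (f0 a + fpi a) / 2.
Proof.
  move=> Ha; have Hs := expd_summable _ (expd_sechs a Ha).
  rewrite /f0 (dnF_mul 2 a 0 (fun n => / 2 * (cos (IZR n * 0) + cos (IZR n * PI)))) //.
  - move=> n; have := Rabs_cos_le (IZR n * PI); rewrite Rmult_0_r cos_0 /Rabs.
    repeat case: Rcase_abs; lra.
  - by move=> n; rewrite !Rmult_0_r cos_0 cos_IZR_even; field.
  - by move=> n /mod2_cases ->; rewrite Rmult_0_r cos_0 cos_IZR_odd; field.
  rewrite (_ : (dnF a 0 + fpi a) / 2 = / 2 * (dnF a 0 + fpi a)); first by field.
  rewrite /fpi /dnF -tsum_plus; try exact: summable_cos.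
  rewrite -tsum_scal; first by apply: summable_plus; exact: summable_cos.
  by apply: tsum_ext => n; ring.
Qed.

Lemma fpi_double a : 0 < a -> fpi (2 * a) = dnF a (PI / 2).
Proof.
  move=> Ha; rewrite /fpi (dnF_mul 2 a PI (fun n => cos (IZR n * (PI / 2)))) //.
  - by move=> n; exact: Rabs_cos_le.
  - by move=> n; rewrite mult_IZR; congr cos; field.
  - move=> n /mod2_cases ->.
    rewrite plus_IZR mult_IZR (_ : (2 * IZR (n / 2) + 1) * (PI / 2) = IZR (n / 2) * PI + PI / 2); first by field.
    by rewrite cos_plus sin_IZR_PI cos_PI2; ring.
Qed.

Lemma cos_IZR_2PI_3 n : 1 + 2 * cos (IZR n * (2 * PI / 3)) = if Z.eq_dec (n mod 3) 0 then 3 else 0.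
Proof.
  have E := Z_div_mod_eq_full n 3; have B := Z.mod_pos_bound n 3.
  have -> : cos (IZR n * (2 * PI / 3)) = cos (IZR (n mod 3) * (2 * PI / 3)).
    rewrite {1}E plus_IZR mult_IZR.
    rewrite (_ : (3 * IZR (n / 3) + IZR (n mod 3)) * (2 * PI / 3) =
      IZR (2 * (n / 3)) * PI + IZR (n mod 3) * (2 * PI / 3)); first by rewrite mult_IZR; field.
    by rewrite cos_plus sin_IZR_PI cos_IZR_even; ring.
  have Hc : cos (2 * (PI / 3)) = - / 2 by rewrite cos_2PI3; field.
  case: Z.eq_dec => [->|Hn]; first by rewrite Rmult_0_l cos_0; ring.
  have [->|->] : (n mod 3 = 1 \/ n mod 3 = 2)%Z by lia.
  - rewrite (_ : 1 * (2 * PI / 3) = 2 * (PI / 3)) ?Hc; by field.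
  - rewrite (_ : 2 * (2 * PI / 3) = - (2 * (PI / 3)) + 2 * PI); first by field.
    by rewrite cos_plus cos_2PI sin_2PI cos_neg Hc; field.
Qed.

Lemma mul3_mod3 n : ((3 * n) mod 3 = 0)%Z.
Proof. by rewrite Z.mul_comm Z.mod_mul. Qed.

Lemma f0_triple a : 0 < a -> f0 (3 * a) = (f0 a + 2 * dnF a (2 * PI / 3)) / 3.
Proof.
  move=> Ha; have Hs := expd_summable _ (expd_sechs a Ha).
  rewrite /f0 (dnF_mul 3 a 0 (fun n => / 3 * (1 + 2 * cos (IZR n * (2 * PI / 3))))) //.
  - move=> n; rewrite cos_IZR_2PI_3; case: Z.eq_dec => _; apply: Rabs_le; lra.
  - move=> n; rewrite cos_IZR_2PI_3 mul3_mod3 /=.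
    by rewrite Rmult_0_r cos_0; field.
  - by move=> n Hn; rewrite cos_IZR_2PI_3; case: Z.eq_dec => // _; ring.
  rewrite (_ : (dnF a 0 + 2 * dnF a (2 * PI / 3)) / 3 = / 3 * (dnF a 0 + 2 * dnF a (2 * PI / 3))); first by field.
  rewrite /dnF -[2 * Ce _ _]tsum_scal; first exact: summable_cos.
  rewrite -tsum_plus; [exact: summable_cos|by apply: summable_scal; exact: summable_cos|].
  rewrite -tsum_scal; first by apply: summable_plus; [|apply: summable_scal]; exact: summable_cos.
  by apply: tsum_ext => n; rewrite Rmult_0_r cos_0; ring.
Qed.

Lemma fpi_triple a : 0 < a -> fpi (3 * a) = (fpi a + 2 * dnF a (PI / 3)) / 3.
Proof.
  move=> Ha; have Hs := expd_summable _ (expd_sechs a Ha).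
  have Hc n : cos (IZR n * (PI / 3)) = cos (IZR n * PI) * cos (IZR n * (2 * PI / 3)).
    rewrite (_ : IZR n * (PI / 3) = IZR n * PI - IZR n * (2 * PI / 3)); first by field.
    by rewrite cos_minus sin_IZR_PI; ring.
  rewrite /fpi (dnF_mul 3 a PI (fun n => / 3 * (cos (IZR n * PI) * (1 + 2 * cos (IZR n * (2 * PI / 3)))))) //.
  - move=> n; rewrite cos_IZR_2PI_3; have := COS_bound (IZR n * PI).
    case: Z.eq_dec => _ H; apply: Rabs_le; lra.
  - move=> n; rewrite cos_IZR_2PI_3 mul3_mod3 /=.
    rewrite (_ : IZR (3 * n) * PI = IZR (2 * n) * PI + IZR n * PI); first by rewrite !mult_IZR; ring.
    by rewrite cos_plus cos_IZR_even sin_IZR_PI; field.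
  - by move=> n Hn; rewrite cos_IZR_2PI_3; case: Z.eq_dec => // _; ring.
  rewrite (_ : (dnF a PI + 2 * dnF a (PI / 3)) / 3 = / 3 * (dnF a PI + 2 * dnF a (PI / 3))); first by field.
  rewrite /dnF -[2 * Ce _ _]tsum_scal; first exact: summable_cos.
  rewrite -tsum_plus; [exact: summable_cos|by apply: summable_scal; exact: summable_cos|].
  rewrite -tsum_scal; first by apply: summable_plus; [|apply: summable_scal]; exact: summable_cos.
  by apply: tsum_ext => n; rewrite Hc; ring.
Qed.

(** The addition formula for the shift [PI], where the difference on its right
    side vanishes by periodicity. *)
Lemma dnF_half_period a th : 0 < a -> dnF a th * dnF a (th + PI) = f0 a * fpi a.
Proof.
  move=> Ha.
  have Hp : sin (PI / 2) <> 0 by rewrite sin_PI2; lra.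
  have [g [h H]] := dnF_addition a Ha PI Hp.
  have E u : dnF a (u - PI) = dnF a (u + PI).
    apply: tsum_ext => n.
    by rewrite /Rminus !Rmult_plus_distr_l -Ropp_mult_distr_r !cos_plus cos_neg sin_neg sin_IZR_PI; ring.
  have E' u : zeF a (u - PI) = zeF a (u + PI).
    apply: tsum_ext => n.
    by rewrite /Rminus !Rmult_plus_distr_l -Ropp_mult_distr_r !sin_plus cos_neg sin_neg sin_IZR_PI; ring.
  have H1 := H th; have H2 := H 0; rewrite E E' in H1; rewrite E E' in H2.
  rewrite Rplus_0_l -/(f0 a) -/(fpi a) in H2; lra.
Qed.

Lemma fpi_double_sq a : 0 < a -> fpi (2 * a) ^ 2 = f0 a * fpi a.
Proof.
  move=> Ha; rewrite fpi_double // -(dnF_half_period a (- (PI / 2)) Ha).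
  rewrite dnF_even // (_ : - (PI / 2) + PI = PI / 2); first by field.
  ring.
Qed.

Lemma pow2_unbounded M a : 0 < a -> exists n, M < 2 ^ n * a.
Proof.
  move=> Ha.
  have [n Hn] := Pow_x_infinity 2 (ltac:(rewrite Rabs_pos_eq; lra)) ((M + 1) / a).
  exists n; have := Hn n (le_n _); rewrite Rabs_pos_eq; first by apply: pow_le; lra.
  move=> Hge; have := Rmult_le_compat_r a _ _ (Rlt_le _ _ Ha) (Rge_le _ _ Hge).
  rewrite /Rdiv Rmult_assoc Rinv_l; lra.
Qed.

(** By [fpi_double_sq] a zero at [a] would propagate to all [2 ^ n * a], but
    [fpi] tends to 1 at infinity. *)
Lemma fpi_pos a : 0 < a -> 0 < fpi a.
Proof.
  have Hnn x : 0 < x -> 0 <= fpi x.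
    move=> Hx; have := fpi_double_sq x Hx; have := f0_ge1 x Hx.
    have : 0 <= fpi (2 * x) ^ 2 by apply: pow2_ge_0.
    nra.
  move=> Ha; case: (Hnn a Ha) => // H0.
  have Hz n : fpi (2 ^ n * a) = 0.
    elim: n => [|n IH]; first by rewrite /= Rmult_1_l.
    have Hp : 0 < 2 ^ n * a by apply: Rmult_lt_0_compat => //; apply: pow_lt; lra.
    have := fpi_double_sq _ Hp; rewrite IH Rmult_0_r -Rmult_assoc -/(2 ^ S n).
    by move=> E; apply: Rsqr_0_uniq; rewrite Rsqr_pow2.
  have L := is_lim_fpi.
  move/is_lim_spec: L => /(_ (mkposreal _ Rlt_0_1)) [M HM].
  have [n Hn] := pow2_unbounded M a Ha.
  have := HM _ Hn; rewrite Hz /= Rminus_0_l Rabs_Ropp Rabs_R1; lra.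
Qed.

Lemma BB_pos a : 0 < a -> 0 < BB a.
Proof. move=> /fpi_pos H; rewrite /BB; nra. Qed.

Lemma fpi_le1 a : 0 < a -> fpi a <= 1.
Proof.
  move=> Ha; apply: Rnot_lt_le => Hlt.
  have Hinc x : a <= x -> fpi a <= fpi x.
    move=> [Hx|<-]; last lra.
    have [||y [Hy E]] := MVT_gen fpi a x (fun y => / 2 * fpi y * (CC y - kap y)).
    - move=> y; rewrite Rmin_left; first lra.
      move=> Hy; apply: is_derive_fpi; lra.
    - move=> y; rewrite Rmin_left; first lra.
      move=> Hy; apply/continuity_pt_filterlim; apply: (ex_derive_continuous (V := R_NormedModule)).
      eexists; apply: is_derive_fpi; lra.
    rewrite Rmin_left in Hy; first lra.
    have Hy0 : 0 < y by lra.
    have P1 := fpi_pos y Hy0; have P2 := kap_lt_CC y Hy0.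
    have : 0 <= / 2 * fpi y * (CC y - kap y) * (x - a).
      apply: Rmult_le_pos; last lra.
      apply: Rmult_le_pos; nra.
    lra.
  have L := is_lim_fpi.
  have He : 0 < fpi a - 1 by lra.
  move/is_lim_spec: L => /(_ (mkposreal _ He)) [M HM].
  have := HM (Rmax (M + 1) a); have := Rmax_l (M + 1) a; have := Rmax_r (M + 1) a => H1 H2.
  move=> /(_ (ltac:(lra))) /=; have := Hinc _ H1; rewrite /Rabs; case: Rcase_abs; lra.
Qed.

(** Comparison of [a * f0 a] with the integral of [1 / cosh], whose primitive is
    [atan (sinh x)], by monotonicity on each interval. *)
Lemma f0_small a : 0 < a -> Rabs (a * f0 a - PI) <= a.
Proof.
  move=> Ha.
  have Hs := expd_summable _ (expd_sechs a Ha).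
  set G := fun x => atan (sinh x).
  have DG x : is_derive G x (/ cosh x).
    have H := cosh2_sinh2 x; have Hc := cosh_neq0 x.
    rewrite /G; auto_derive; first by [].
    rewrite (_ : 1 + sinh x * (sinh x * 1) = cosh x ^ 2); first lra.
    by field.
  have step n : a * sechs a (Z.of_nat (S n)) <= G (INR (S n) * a) - G (INR n * a) <= a * sechs a (Z.of_nat n).
    have Hlt : INR n * a < INR (S n) * a by rewrite S_INR; lra.
    have [||y [Hy E]] := MVT_gen G (INR n * a) (INR (S n) * a) (fun y => / cosh y).
    - by move=> y _; apply: DG.
    - move=> y _; apply/continuity_pt_filterlim; apply: (ex_derive_continuous (V := R_NormedModule)).
      eexists; exact: DG.
    rewrite Rmin_left ?Rmax_right in Hy; try lra.
    rewrite E S_INR (_ : (INR n + 1) * a - INR n * a = a); first ring.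
    rewrite S_INR in Hy.
    have Hn0 : 0 <= INR n * a by apply: Rmult_le_pos; [exact: pos_INR|lra].
    have mono u v : 0 <= u <= v -> / cosh v <= / cosh u.
      move=> [Hu Huv]; apply: Rinv_le_contravar; first exact: cosh_pos.
      have [-> |Hlt'] : u = v \/ u < v by lra.
        lra.
      have [||w [Hw Ew]] := MVT_gen cosh u v sinh.
      - by move=> w _; auto_derive => //; ring.
      - move=> w _; apply/continuity_pt_filterlim; apply: (ex_derive_continuous (V := R_NormedModule)).
        by auto_derive.
      rewrite Rmin_left ?Rmax_right in Hw; try lra.
      have := sinh_nonneg w; nra.
    rewrite /sechs -!INR_IZR_INZ !(Rmult_comm a) S_INR; split; apply: Rmult_le_compat_r; try lra.
    - apply: mono; lra.
    - apply: mono; lra.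
  have E N : list_sum (sechs a) (zball N) = 1 + 2 * list_sum (fun k => sechs a (Z.of_nat (S k))) (seq 0 N).
    elim: N => [|N IH]; first by rewrite /list_sum /= sechs_0; ring.
    have -> : zball (S N) = (Z.of_nat (S N) :: - Z.of_nat (S N) :: zball N)%Z by [].
    rewrite seq_S list_sum_app !list_sum_cons IH sechs_neg Nat.add_0_l.
    rewrite (_ : list_sum _ nil = 0) //; ring.
  have U N : a * list_sum (fun k => sechs a (Z.of_nat (S k))) (seq 0 N) <= G (INR N * a).
    elim: N => [|N IH].
      by rewrite /list_sum /= Rmult_0_l /G sinh_0 atan_0; lra.
    rewrite seq_S list_sum_app Nat.add_0_l list_sum_cons (_ : list_sum _ nil = 0) //.
    have := step N; lra.
  have L N : G (INR N * a) <= a * (1 + list_sum (fun k => sechs a (Z.of_nat (S k))) (seq 0 N)) - a * sechs a (Z.of_nat N).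
    elim: N => [|N IH].
      by rewrite /list_sum /= Rmult_0_l /G sinh_0 atan_0 sechs_0; lra.
    rewrite seq_S list_sum_app Nat.add_0_l list_sum_cons (_ : list_sum _ nil = 0) //.
    have := step N; lra.
  have Hlim := is_sum_Z_lim _ _ (tsum_is_sum _ Hs).
  have -> : f0 a = tsum (sechs a) by rewrite /f0 /dnF Ce_0.
  apply: Rabs_le; split.
  - suff H de : 0 < de -> PI - 2 * de - a <= a * tsum (sechs a).
      apply: Rnot_lt_le => Hlt.
      have := H ((- a - (a * tsum (sechs a) - PI)) / 4); lra.
    move=> Hde; set v := tan (PI / 2 - Rmin de 1).
    have Hm : 0 < Rmin de 1 <= 1 by split; [apply: Rmin_pos; lra|exact: Rmin_r].
    have [N HN] := INR_unbounded (v / a).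
    have HN1 : v < INR N * a.
      have := Rmult_lt_compat_r a _ _ Ha HN; rewrite /Rdiv Rmult_assoc Rinv_l; lra.
    have Hsx x : 0 <= x -> x <= sinh x.
      move=> [Hx|<-]; last by rewrite sinh_0; lra.
      have [||w [Hw Ew]] := MVT_gen sinh 0 x cosh.
      - by move=> w _; auto_derive => //; ring.
      - move=> w _; apply/continuity_pt_filterlim; apply: (ex_derive_continuous (V := R_NormedModule)).
        by auto_derive.
      rewrite sinh_0 in Ew; have := cosh_ge1 w; nra.
    have Hn0 : 0 <= INR N * a by apply: Rmult_le_pos; [exact: pos_INR|lra].
    have HG : PI / 2 - Rmin de 1 <= G (INR N * a).
      have := PI2_1 => Hpi.
      rewrite -(atan_tan (PI / 2 - Rmin de 1)); first lra.
      rewrite -/v /G; have [Hlt|->] : v < sinh (INR N * a) \/ v = sinh (INR N * a).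
      + have := Hsx _ Hn0; lra.
      + by apply: Rlt_le; apply: atan_increasing.
      + lra.
    have HL := L N; have HE := E N.
    have := list_sum_le_tsum (sechs a) (zball N) (fun n => Rlt_le _ _ (sechs_pos a n)) Hs (zball_nodup N).
    rewrite HE => H1.
    have H2 := Rmult_le_compat_l a _ _ (Rlt_le _ _ Ha) H1.
    have := sechs_pos a (Z.of_nat N); have := Rmin_l de 1; nra.
  - have H : Rbar_le (a * tsum (sechs a)) (PI + a).
      apply: (is_lim_seq_le (fun N => a * list_sum (sechs a) (zball N)) (fun _ => PI + a)).
      + move=> N; rewrite E; have := U N; have := atan_bound (sinh (INR N * a)); rewrite -/(G _); lra.
      + by apply: is_lim_seq_scal_l (Finite (tsum _)) _.
      + exact: is_lim_seq_const.
    rewrite /= in H; lra.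
Qed.


(** * The null values at the self-dual parameter *)

Lemma eq_0_of_small x K : (forall de, 0 < de < 1 -> Rabs x <= K * de) -> x = 0.
Proof.
  move=> H; apply: NNPP => Hx; have Hp := Rabs_pos_lt _ Hx.
  have HK : 0 < K by have := H (/ 2) (ltac:(lra)); lra.
  have Hd : 0 < Rabs x / (2 * K) by apply: Rdiv_lt_0_compat; lra.
  set m := Rmin (/ 2) (Rabs x / (2 * K)).
  have H0 : 0 < m by apply: Rmin_pos; lra.
  have H1 : m <= / 2 by exact: Rmin_l.
  have H2 : m <= Rabs x / (2 * K) by exact: Rmin_r.
  have H3 := H m (ltac:(lra)).
  have : K * m <= K * (Rabs x / (2 * K)) by apply: Rmult_le_compat_l; lra.
  rewrite (_ : K * (Rabs x / (2 * K)) = Rabs x / 2); [by field; lra|lra].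
Qed.

Lemma const_of_derive_0 (f : R -> R) (x y : R) :
  (forall t, Rmin x y <= t <= Rmax x y -> is_derive f t 0) -> f x = f y.
Proof.
  move=> H; have [||z [_ E]] := MVT_gen f x y (fun _ => 0).
  - by move=> t Ht; apply: H; lra.
  - move=> t Ht; apply/continuity_pt_filterlim; apply: (ex_derive_continuous (V := R_NormedModule)).
    by exists 0; apply: H.
  lra.
Qed.

Section Inverse.
Variables (s ds Y : R -> R).
Hypothesis Hs : forall a, 0 < a -> is_derive s a (ds a).
Hypothesis Hds : forall a, 0 < a -> 0 < ds a.
Hypothesis HY : forall u, 0 < Y u.
Hypothesis HsY : forall u, s (Y u) = u.

Lemma pos_derive_increasing x y : 0 < x -> x < y -> s x < s y.
Proof.
  move=> Hx Hxy; have [||z [Hz E]] := MVT_gen s x y ds.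
  - by move=> t; rewrite Rmin_left; [lra|move=> Ht; apply: Hs; lra].
  - move=> t; rewrite Rmin_left; first lra.
    move=> Ht; apply/continuity_pt_filterlim; apply: (ex_derive_continuous (V := R_NormedModule)).
    eexists; apply: Hs; lra.
  rewrite Rmin_left in Hz; first lra.
  have := Hds z (ltac:(lra)); nra.
Qed.

Lemma pos_derive_le_inv x y : 0 < x -> 0 < y -> s x < s y -> x < y.
Proof.
  move=> Hx Hy H; apply: Rnot_le_lt => -[Hlt|E]; last by subst; lra.
  have := pos_derive_increasing y x Hy Hlt; lra.
Qed.

Lemma inverse_left a : 0 < a -> Y (s a) = a.
Proof.
  move=> Ha; have HYa := HY (s a).
  have [H|[H|H]] := Rtotal_order (Y (s a)) a => //.
  - have := pos_derive_increasing _ _ HYa H; rewrite HsY; lra.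
  - have := pos_derive_increasing _ _ Ha H; rewrite HsY; lra.
Qed.

Lemma inverse_continuous u0 eps : 0 < eps ->
  exists de, 0 < de /\ forall u, Rabs (u - u0) < de -> Rabs (Y u - Y u0) < eps.
Proof.
  move=> He; have H0 := HY u0.
  set e := Rmin eps (Y u0 / 2).
  have He' : 0 < e by apply: Rmin_pos; lra.
  have He1 : e <= eps by exact: Rmin_l.
  have He2 : e <= Y u0 / 2 by exact: Rmin_r.
  have I1 := pos_derive_increasing (Y u0) (Y u0 + e) H0 (ltac:(lra)).
  have I2 := pos_derive_increasing (Y u0 - e) (Y u0) (ltac:(lra)) (ltac:(lra)).
  rewrite HsY in I1; rewrite HsY in I2.
  exists (Rmin (s (Y u0 + e) - u0) (u0 - s (Y u0 - e))); split; first by apply: Rmin_pos; lra.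
  move=> u Hu.
  have A1 := Rlt_le_trans _ _ _ Hu (Rmin_l _ _).
  have A2 := Rlt_le_trans _ _ _ Hu (Rmin_r _ _).
  have B1 : Y u < Y u0 + e.
    apply: pos_derive_le_inv; [exact: HY|lra|rewrite HsY].
    move: A1; rewrite /Rabs; case: Rcase_abs; lra.
  have B2 : Y u0 - e < Y u.
    apply: pos_derive_le_inv; [lra|exact: HY|rewrite HsY].
    move: A2; rewrite /Rabs; case: Rcase_abs; lra.
  rewrite /Rabs; case: Rcase_abs; lra.
Qed.

Lemma is_derive_inverse u0 : is_derive Y u0 (/ ds (Y u0)).
Proof.
  apply/is_derive_Reals => eps He.
  set d := ds (Y u0); have Hd : 0 < d by apply: Hds.
  set eta := Rmin (d / 2) (eps * d * d / 4).
  have Heta : 0 < eta.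
    apply: Rmin_pos; first lra.
    apply: Rdiv_lt_0_compat; last lra.
    by apply: Rmult_lt_0_compat => //; apply: Rmult_lt_0_compat.
  have He1 : eta <= d / 2 by exact: Rmin_l.
  have He2 : eta <= eps * d * d / 4 by exact: Rmin_r.
  have /is_derive_Reals Hd1 := Hs (Y u0) (HY u0).
  have [de1 H1] := Hd1 eta Heta.
  have [de2 [Hde2 H2]] := inverse_continuous u0 de1 (cond_pos de1).
  exists (mkposreal _ Hde2) => h Hh /= Hhd.
  have Hk := H2 (u0 + h); rewrite (_ : u0 + h - u0 = h) in Hk; first ring.
  have {}Hk := Hk Hhd.
  set k := Y (u0 + h) - Y u0 in Hk *.
  have Ek : s (Y u0 + k) = u0 + h by rewrite /k (_ : Y u0 + (Y (u0 + h) - Y u0) = Y (u0 + h)) ?HsY; first ring.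
  have Hk0 : k <> 0.
    move=> E0; rewrite E0 Rplus_0_r HsY in Ek; lra.
  have := H1 k Hk0 Hk; rewrite Ek HsY -/d (_ : u0 + h - u0 = h); first ring.
  move=> Hq; set q := h / k in Hq.
  have Hq1 : d / 2 <= q by move: Hq; rewrite /Rabs; case: Rcase_abs; lra.
  rewrite (_ : k / h - / d = (d - q) / (q * d)).
    by rewrite /q; field; repeat split => //; lra.
  rewrite Rabs_div; first by apply: Rmult_integral_contrapositive; lra.
  rewrite (Rabs_pos_eq (q * d)); first nra.
  rewrite Rabs_minus_sym.
  apply: (Rmult_lt_reg_r (q * d)); first nra.
  rewrite /Rdiv Rmult_assoc Rinv_l; first nra.
  have Hed : 0 < eps * d by apply: Rmult_lt_0_compat; lra.
  have : 0 < eps * d * (q - d / 4) by apply: Rmult_lt_0_compat; lra.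
  lra.
Qed.

End Inverse.

(** Its derivative in [a] is [CC], so it is a global coordinate on the half-line
    in which the reflection [u -> - u] exchanges [AA / CC] and
    [BB / CC]. *)
Definition logmod (a : R) : R := ln (BB a / AA a).

Lemma is_derive_logmod a : 0 < a -> is_derive logmod a (CC a).
Proof.
  move=> Ha; have HA := AA_pos a Ha; have HB := BB_pos a Ha.
  have DA := is_derive_AA a Ha; have DB := is_derive_BB a Ha.
  have HBA : 0 < BB a / AA a by apply: Rdiv_lt_0_compat.
  have D := is_derive_div _ _ _ _ _ DB DA (ltac:(lra)).
  have P := is_derive_comp ln (fun t => BB t / AA t) a _ _ (is_derive_ln _ HBA) D.
  rewrite /logmod; apply: is_derive_eq P _.
  rewrite /scal /= /mult /=; field; lra.
Qed.

Lemma exp_logmod a : 0 < a -> BB a = exp (logmod a) * AA a.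
Proof.
  move=> Ha; have HA := AA_pos a Ha; have HB := BB_pos a Ha.
  rewrite /logmod exp_ln; [exact: Rdiv_lt_0_compat|field; lra].
Qed.

Lemma logmod_surj u : exists a, 0 < a /\ logmod a = u.
Proof.
  have Heu := exp_pos u.
  have Hcmp a : 0 < a -> (logmod a < u <-> BB a < exp u * AA a) /\ (u < logmod a <-> exp u * AA a < BB a).
    move=> Ha; have HA := AA_pos a Ha; rewrite (exp_logmod a Ha).
    split; split=> H.
    - by apply: Rmult_lt_compat_r => //; apply: exp_increasing.
    - by apply: exp_lt_inv; apply: Rmult_lt_reg_r H.
    - by apply: Rmult_lt_compat_r => //; apply: exp_increasing.
    - by apply: exp_lt_inv; apply: Rmult_lt_reg_r H.
  have [a1 [Ha1 L1]] : exists a, 0 < a /\ logmod a < u.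
    have Hem := exp_pos (- u).
    set a := / (1 + exp (- u)).
    have Ha : 0 < a by apply: Rinv_0_lt_compat; lra.
    have Ha1 : a <= 1 by rewrite /a -Rinv_1; apply: Rinv_le_contravar; lra.
    exists a; split=> //; apply/(proj1 (Hcmp a Ha)).
    have H := f0_small a Ha; have Hpi := PI2_1.
    have Hge : 1 + exp (- u) <= f0 a.
      apply: (Rmult_le_reg_l a) => //.
      rewrite {1}/a Rinv_l; first lra.
      move: H; rewrite /Rabs; case: Rcase_abs; lra.
    have HC : 1 + exp (- u) < CC a by rewrite /CC; nra.
    have HB1 : BB a <= 1 by have := fpi_le1 a Ha; have := fpi_pos a Ha; rewrite /BB; nra.
    have HE : exp u * exp (- u) = 1 by rewrite -exp_plus Rplus_opp_r exp_0.
    have HA : exp (- u) < AA a by rewrite /AA; lra.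
    have := Rmult_lt_compat_l (exp u) _ _ Heu HA; lra.
  have [a2 [Ha2 L2]] : exists a, 0 < a /\ u < logmod a.
    have L : is_lim (fun a => BB a - exp u * AA a) p_infty (1 - exp u * 0).
      apply: is_lim_minus'; first exact: is_lim_BB.
      by apply: (is_lim_scal_l AA (exp u) p_infty 0); exact: is_lim_AA.
    rewrite Rmult_0_r Rminus_0_r in L.
    move/is_lim_spec: L => /(_ (mkposreal _ Rlt_0_1)) [M HM].
    have HM2 := HM (Rmax (M + 1) 1) _.
    set a := Rmax (M + 1) 1 in HM2.
    have Ha : 0 < a by have := Rmax_r (M + 1) 1; rewrite -/a; lra.
    exists a; split=> //; apply/(proj2 (Hcmp a Ha)).
    have {}HM2 := HM2 (ltac:(have := Rmax_l (M + 1) 1; rewrite -/a; lra)).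
    move: HM2; rewrite /= /Rabs; case: Rcase_abs; lra.
  have H12 : a1 < a2.
    apply: (pos_derive_le_inv logmod CC is_derive_logmod CC_pos) => //; lra.
  have HC a : a1 <= a <= a2 -> continuity_pt (fun a => logmod a - u) a.
    move=> Ha; have Ha0 : 0 < a by lra.
    exact: is_derive_continuity_pt (is_derive_minus _ _ _ _ _ (is_derive_logmod a Ha0) (is_derive_const u a)).
  have [z [Hz Ez]] := IVT_interv (fun a => logmod a - u) a1 a2 HC H12 (ltac:(lra)) (ltac:(lra)).
  exists z; split; lra.
Qed.

(** In the variable [logmod], [f0] solves a linear equation of order two whose
    coefficient is even; hence so does its reflection, and the Wronskian of
    the two solutions is constant.  Consequently their quotient is an affine
    function of [a], whose constants are read off as [a -> 0], where
    [a * f0 a -> PI]. *)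
Theorem self_dual_values : AA PI = BB PI /\ kap PI = BB PI + / PI.
Proof.
  have HPI := PI_RGT_0.
  pose Y u := proj1_sig (constructive_indefinite_description _ (logmod_surj u)).
  have HY u : 0 < Y u by exact: (proj1 (proj2_sig (constructive_indefinite_description _ (logmod_surj u)))).
  have HsY u : logmod (Y u) = u by exact: (proj2 (proj2_sig (constructive_indefinite_description _ (logmod_surj u)))).
  clearbody Y.
  have DY := is_derive_inverse logmod CC Y is_derive_logmod CC_pos HY HsY.
  have YL := inverse_left logmod CC Y is_derive_logmod CC_pos HY HsY.
  (* [g] is [f0] in the variable [logmod], [g1] its derivative *)
  pose g u := f0 (Y u).
  pose g1 u := / 2 * ((BB (Y u) - kap (Y u)) / f0 (Y u)).
  pose q u := AA (Y u) * BB (Y u) / (4 * CC (Y u) ^ 2).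
  have Hg u : 1 <= g u by apply: f0_ge1.
  have HCg u : CC (Y u) = g u ^ 2 by [].
  have Dg u : is_derive g u (g1 u).
    have P := is_derive_comp f0 Y u _ _ (is_derive_f0 (Y u) (HY u)) (DY u).
    apply: is_derive_eq P _; rewrite /scal /= /mult /= /g1 HCg -/(g u).
    by have Hgu := Hg u; field; lra.
  have Dg1 u : is_derive g1 u (q u * g u).
    have Pf := is_derive_f0 (Y u) (HY u).
    have PB := is_derive_BB (Y u) (HY u).
    have PK := is_derive_kap (Y u) (HY u).
    have Hf : f0 (Y u) <> 0 by have := Hg u; rewrite /g; lra.
    have P1 := is_derive_scal _ _ (/ 2) _ (is_derive_div _ _ _ _ _ (is_derive_minus _ _ _ _ _ PB PK) Pf Hf).
    have P := is_derive_comp _ Y u _ _ P1 (DY u).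
    apply: is_derive_eq P _.
    rewrite /scal /= /mult /= /minus /plus /opp /= /q /g.
    have -> : AA (Y u) = CC (Y u) - BB (Y u) by [].
    have -> : CC (Y u) = f0 (Y u) ^ 2 by [].
    by field.
  have Hq u : q u = exp u / (4 * (1 + exp u) ^ 2).
    have HA := AA_pos _ (HY u); have EB := exp_logmod _ (HY u); rewrite HsY in EB.
    have EC : CC (Y u) = (1 + exp u) * AA (Y u) by rewrite /AA in EB *; lra.
    have He := exp_pos u.
    by rewrite /q EC EB; field; lra.
  have Hqe u : q (- u) = q u.
    rewrite !Hq exp_Ropp; have He := exp_pos u; field; lra.
  (* the Wronskian of [g] and of its reflection *)
  pose E u := g1 (- u) * g u + g (- u) * g1 u.
  have Dneg (f f' : R -> R) : (forall u, is_derive f u (f' u)) -> forall u, is_derive (fun v => f (- v)) u (- f' (- u)).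
    move=> H u.
    have P := is_derive_comp f (fun v => - v) u _ _ (H (- u)) (is_derive_opp _ _ _ (is_derive_id u)).
    apply: is_derive_eq P _; rewrite /scal /= /mult /= /opp /one /=; ring.
  have DE u : is_derive E u 0.
    have P := is_derive_plus _ _ _ _ _
      (is_derive_mult _ _ _ _ _ (Dneg _ _ Dg1 u) (Dg u) (fun _ _ => Rmult_comm _ _))
      (is_derive_mult _ _ _ _ _ (Dneg _ _ Dg u) (Dg1 u) (fun _ _ => Rmult_comm _ _)).
    apply: is_derive_eq P _; rewrite /plus /mult /= Hqe; ring.
  have EE u : E u = E 0 by apply: const_of_derive_0 => t _; apply: DE.
  set e := E 0 in EE.
  (* the derivative of [g (- u) / g u] is [- E u] times that of [Y] *)
  pose rho u := g (- u) / g u + e * Y u.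
  have Drho u : is_derive rho u 0.
    have Hgu : g u <> 0 by have := Hg u; lra.
    have P := is_derive_plus _ _ _ _ _
      (is_derive_div _ _ _ _ _ (Dneg _ _ Dg u) (Dg u) Hgu)
      (is_derive_scal _ _ e _ (DY u)).
    apply: is_derive_eq P _; rewrite /plus /= HCg -(EE u) /E; field; lra.
  have Er u : rho u = rho 0 by apply: const_of_derive_0 => t _; apply: Drho.
  set c0 := rho 0 in Er.
  have Rel u : g (- u) = (c0 - e * Y u) * g u.
    rewrite -(Er u) /rho; have Hgu := Hg u; field; lra.
  (* small [a] are reflections of large ones, where [f0] tends to 1 *)
  have Small de : 0 < de < 1 -> exists a, 0 < a < de /\ Rabs ((c0 - e * a) * f0 a - 1) < de.
    move=> Hde.
    have L := is_lim_f0; move/is_lim_spec: L => /(_ (mkposreal _ (proj1 Hde))) [M HM].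
    set N := Rmax (M + 1) (Y (- logmod de) + 1).
    have HN1 : M + 1 <= N by exact: Rmax_l.
    have HN2 : Y (- logmod de) + 1 <= N by exact: Rmax_r.
    have HN : 0 < N by have := HY (- logmod de); lra.
    exists (Y (- logmod N)); split.
    - split; first exact: HY.
      apply: (pos_derive_le_inv logmod CC is_derive_logmod CC_pos) => //; first lra.
      rewrite HsY.
      have := pos_derive_increasing logmod CC is_derive_logmod CC_pos (Y (- logmod de)) N (HY _) (ltac:(lra)).
      rewrite HsY; lra.
    - have := Rel (- logmod N); rewrite Ropp_involutive /g YL // => <-.
      by apply: HM; lra.
  have Hc0 : c0 * PI = 0.
    apply: (eq_0_of_small _ (Rabs c0 + Rabs e * (PI + 1) + 2)) => de Hde.
    have [a [Ha H]] := Small de Hde.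
    have Hf := f0_small a (proj1 Ha).
    rewrite (_ : c0 * PI = a * ((c0 - e * a) * f0 a - 1) + a - c0 * (a * f0 a - PI) + a * (e * (a * f0 a))); first ring.
    have P1 := Rabs_pos c0; have P2 := Rabs_pos e.
    have Q : Rabs (a * f0 a) <= PI + 1 by move: Hf; rewrite /Rabs; repeat case: Rcase_abs; lra.
    have T x y w : Rabs (x + a - y + w) <= Rabs x + a + Rabs y + Rabs w.
      rewrite /Rabs; repeat case: Rcase_abs; lra.
    apply: Rle_trans (T _ _ _) _.
    rewrite (Rabs_mult a ((c0 - e * a) * f0 a - 1)) (Rabs_mult c0) (Rabs_mult a (e * _)) (Rabs_mult e).
    rewrite (Rabs_pos_eq a); first lra.
    have K1 : a * Rabs ((c0 - e * a) * f0 a - 1) <= de by have := Rabs_pos ((c0 - e * a) * f0 a - 1); nra.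
    have K2 : Rabs c0 * Rabs (a * f0 a - PI) <= Rabs c0 * de by apply: Rmult_le_compat_l; lra.
    have K3 : Rabs e * Rabs (a * f0 a) <= Rabs e * (PI + 1) by apply: Rmult_le_compat_l.
    have K4 : a * (Rabs e * Rabs (a * f0 a)) <= de * (Rabs e * (PI + 1)).
      apply: Rmult_le_compat; try lra.
      apply: Rmult_le_pos => //; exact: Rabs_pos.
    lra.
  have {}Hc0 : c0 = 0 by apply: (Rmult_eq_reg_r PI); lra.
  have He : e * PI + 1 = 0.
    apply: (eq_0_of_small _ (Rabs e + 1)) => de Hde.
    have [a [Ha H]] := Small de Hde.
    have Hf := f0_small a (proj1 Ha).
    rewrite Hc0 in H.
    rewrite (_ : e * PI + 1 = - ((0 - e * a) * f0 a - 1) - e * (a * f0 a - PI)); first ring.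
    apply: Rle_trans (Rabs_triang _ _) _; rewrite !Rabs_Ropp (Rabs_mult e).
    have : Rabs e * Rabs (a * f0 a - PI) <= Rabs e * de.
      by apply: Rmult_le_compat_l; [exact: Rabs_pos|lra].
    lra.
  have Ee : e = - / PI by apply: (Rmult_eq_reg_r PI); last lra; rewrite -Ropp_mult_distr_l Rinv_l; lra.
  have Y0 : Y 0 = PI.
    have := Rel 0; rewrite Ropp_0 Hc0 Ee => H.
    have Hg0 := Hg 0.
    have H1 : g 0 * (Y 0 / PI - 1) = 0.
      rewrite {1}(_ : g 0 * (Y 0 / PI - 1) = (0 - - / PI * Y 0) * g 0 - g 0); last lra.
      by field; lra.
    have [|H2] := Rmult_integral _ _ H1; first lra.
    rewrite (_ : Y 0 = (Y 0 / PI) * PI); [field; lra|].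
    have -> : Y 0 / PI = 1 by lra.
    ring.
  have EB := exp_logmod PI HPI.
  have E0 : logmod PI = 0 by rewrite -Y0 HsY.
  rewrite E0 exp_0 Rmult_1_l in EB.
  split; first by [].
  have : e = E 0 by [].
  rewrite /E Ropp_0 Ee /g1 /g Y0.
  have Hf := f0_ge1 PI HPI.
  rewrite (_ : _ + _ = BB PI - kap PI); [by field; lra|lra].
Qed.


(** * Trisection and the values at three times the self-dual parameter *)

Lemma sin_PI3_neq0 : sin (2 * PI / 3 / 2) <> 0.
Proof.
  rewrite (_ : 2 * PI / 3 / 2 = PI / 3); first by field.
  apply: Rgt_not_eq; apply: sin_gt_0; have := PI_RGT_0; lra.
Qed.

Lemma dnF_4PI_3 a : dnF a (2 * PI / 3 + 2 * PI / 3) = dnF a (2 * PI / 3).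
Proof.
  apply: tsum_ext => n; congr Rmult.
  rewrite (_ : IZR n * (2 * PI / 3 + 2 * PI / 3) = - (IZR n * (2 * PI / 3)) + IZR (2 * n) * PI).
    by rewrite mult_IZR; field.
  by rewrite cos_plus sin_IZR_PI cos_IZR_even cos_neg; ring.
Qed.

Lemma dnF1_4PI_3 a : 0 < a -> dnF1 a (2 * PI / 3 + 2 * PI / 3) = - dnF1 a (2 * PI / 3).
Proof.
  move=> Ha; have Hs := expd_summable _ (expd_nc a Ha).
  rewrite /dnF1; congr Ropp; rewrite /Se -tsum_opp; first exact: summable_sin.
  apply: tsum_ext => n.
  rewrite (_ : IZR n * (2 * PI / 3 + 2 * PI / 3) = - (IZR n * (2 * PI / 3)) + IZR (2 * n) * PI).
    by rewrite mult_IZR; field.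
  by rewrite sin_plus sin_IZR_PI cos_IZR_even sin_neg; ring.
Qed.

Definition f3 (a : R) : R := dnF a (2 * PI / 3).

Lemma f3_lt_f0 a : 0 < a -> f3 a < f0 a.
Proof.
  move=> Ha; apply: Rminus_gt_0_lt.
  have Hs := expd_summable _ (expd_sechs a Ha).
  rewrite /f3 /f0 /dnF -tsum_minus; try exact: summable_cos.
  have H1 : 0 < sechs a 1 * (3 / 2) by apply: Rmult_lt_0_compat; [exact: sechs_pos|lra].
  apply: Rlt_le_trans H1 _.
  have H := is_sum_single 1%Z (fun n => if Z.eq_dec n 1 then sechs a n * (3 / 2) else 0).
  rewrite /= in H.
  apply: is_sum_le _ (H _) (tsum_is_sum _ (summable_minus _ _ (summable_cos _ 0 Hs) (summable_cos _ _ Hs))).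
  - move=> n; case: Z.eq_dec => [->|_].
      have := cos_IZR_2PI_3 1; rewrite /= Rmult_0_r cos_0 => H3.
      have := sechs_pos a 1; nra.
    rewrite Rmult_0_r cos_0 -Rmult_minus_distr_l; apply: Rmult_le_pos.
      by apply: Rlt_le; apply: sechs_pos.
    have := COS_bound (IZR n * (2 * PI / 3)); lra.
  - by move=> n Hn; case: Z.eq_dec.
Qed.

(** The half-period relation at [PI / 3], as [PI / 3 + PI] is twice [2 PI / 3]. *)
Lemma f3_half a : 0 < a -> dnF a (PI / 3) * f3 a = f0 a * fpi a.
Proof.
  move=> Ha; rewrite -(dnF_half_period a (PI / 3) Ha) /f3 -dnF_4PI_3.
  by congr (_ * dnF a _); field.
Qed.

Lemma f3_pos a : 0 < a -> 0 < f3 a.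
Proof.
  move=> Ha.
  have P0 := f0_ge1 a Ha; have P1 := fpi_pos a Ha.
  have P3 := fpi_pos (3 * a) (ltac:(lra)).
  have H0 := f0_triple a Ha; have P4 := f0_ge1 (3 * a) (ltac:(lra)).
  rewrite -/(f3 a) in H0.
  rewrite fpi_triple // in P3; have Hh := f3_half a Ha.
  apply: Rnot_le_lt => Hle.
  have : fpi a * f3 a + 2 * (f0 a * fpi a) <= 0 by rewrite -Hh; nra.
  nra.
Qed.

(** The addition formula with shift [be = 2 PI / 3], differentiated once and
    twice at [th = be]: the three arguments that occur are then [0], [be] and
    [2 be], and the last has the same value as [be] by symmetry.  Eliminating
    the constant [h] leaves a relation between [f3], [f0] and [fpi]. *)
Lemma f3_relation a : 0 < a ->
  BB a * (CC a + 2 * f0 a * f3 a) = f3 a ^ 4 + 2 * f0 a * f3 a ^ 3.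
Proof.
  move=> Ha; set be := 2 * PI / 3.
  have [g [h H]] := dnF_addition a Ha be sin_PI3_neq0.
  have sh (f f' : R -> R) k : (forall t, is_derive f t (f' t)) -> forall t, is_derive (fun t => f (t + k)) t (f' (t + k)).
    move=> Hf t.
    have P := is_derive_comp f (fun t => t + k) t _ _ (Hf (t + k))
       (is_derive_plus _ _ _ _ _ (is_derive_id t) (is_derive_const k t)).
    apply: is_derive_eq P _; rewrite /scal /plus /one /zero /= /mult /=; ring.
  have D0 := is_derive_dnF a Ha; have D1 := is_derive_dnF1 a Ha; have Dz := is_derive_zeF a Ha.
  have Ez t : zeF1 a t = (dnF a t ^ 2 - kap a) / 2 by rewrite dnF_sq //; field.
  have Dz1 t : is_derive (zeF1 a) t (dnF a t * dnF1 a t).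
    apply: (is_derive_ext (fun t => / 2 * (dnF a t ^ 2 - kap a))); first by move=> u; rewrite Ez /=; field.
    apply: is_derive_eq (is_derive_scal _ _ _ _ (is_derive_minus _ _ _ _ _ (is_derive_pow _ 2 _ _ (D0 t)) (is_derive_const _ t))) _.
    rewrite /minus /plus /opp /zero /=; field.
  pose p t := dnF a (t + be) + dnF a (t - be).
  pose p1 t := dnF1 a (t + be) + dnF1 a (t - be).
  pose p2 t := dnF2 a (t + be) + dnF2 a (t - be).
  have Dp t : is_derive p t (p1 t).
    by apply: (is_derive_plus (V := R_NormedModule)); [apply: sh|apply: (sh _ _ (- be))].
  have Dp1 t : is_derive p1 t (p2 t).
    by apply: (is_derive_plus (V := R_NormedModule)); [apply: sh|apply: (sh _ _ (- be))].
  have L1 t : is_derive (fun t => dnF a t * p t) t (dnF1 a t * p t + dnF a t * p1 t).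
    apply: (is_derive_mult (K := R_AbsRing)) => //; move=> *; exact: Rmult_comm.
  have R1 t : is_derive (fun t => g + h * (zeF a (t + be) - zeF a (t - be))) t (h * (zeF1 a (t + be) - zeF1 a (t - be))).
    apply: is_derive_eq (is_derive_plus _ _ _ _ _ (is_derive_const g t)
      (is_derive_scal _ _ h _ (is_derive_minus _ _ _ _ _ (sh _ _ be Dz t) (sh _ _ (- be) Dz t)))) _.
    rewrite /minus /plus /opp /zero /= /Rminus; ring.
  have E1 t : dnF1 a t * p t + dnF a t * p1 t = h * (zeF1 a (t + be) - zeF1 a (t - be)).
    rewrite -(is_derive_unique _ _ _ (L1 t)) -(is_derive_unique _ _ _ (R1 t)).
    exact: Derive_ext.
  have L2 t : is_derive (fun t => dnF1 a t * p t + dnF a t * p1 t) t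
      (dnF2 a t * p t + dnF1 a t * p1 t + (dnF1 a t * p1 t + dnF a t * p2 t)).
    by apply: (is_derive_plus (V := R_NormedModule)); apply: (is_derive_mult (K := R_AbsRing)) => //;
      move=> *; exact: Rmult_comm.
  have R2 t : is_derive (fun t => h * (zeF1 a (t + be) - zeF1 a (t - be))) t
      (h * (dnF a (t + be) * dnF1 a (t + be) - dnF a (t - be) * dnF1 a (t - be))).
    apply: is_derive_eq (is_derive_scal _ _ h _ (is_derive_minus _ _ _ _ _ (sh _ _ be Dz1 t) (sh _ _ (- be) Dz1 t))) _.
    by rewrite /minus /plus /opp /=.
  have E2 t : dnF2 a t * p t + dnF1 a t * p1 t + (dnF1 a t * p1 t + dnF a t * p2 t) =
      h * (dnF a (t + be) * dnF1 a (t + be) - dnF a (t - be) * dnF1 a (t - be)).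
    rewrite -(is_derive_unique _ _ _ (L2 t)) -(is_derive_unique _ _ _ (R2 t)).
    exact: Derive_ext.
  (* at [be] the three arguments are [0], [be] and [2 be], the last equivalent to [- be] *)
  have K1 := E1 be; have K2 := E2 be.
  rewrite !Ez /p /p1 in K1; rewrite /p /p1 /p2 in K2.
  rewrite Rminus_diag dnF_4PI_3 dnF1_4PI_3 // -/(f3 a) -/(f0 a) dnF1_0 in K1.
  rewrite !dnF2_eq // Rminus_diag dnF_4PI_3 dnF1_4PI_3 // -/(f3 a) -/(f0 a) dnF1_0 in K2.
  have K3 := dnF1_sq a be Ha; rewrite -/be -/(f3 a) in K3 K1 K2.
  have Hlt := f3_lt_f0 a Ha; have Hp := f3_pos a Ha.
  have EC : CC a = f0 a ^ 2 by [].
  rewrite -EC in K1.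
  set u := f3 a in K1 K2 K3 Hlt Hp *; set v := dnF1 a be in K1 K2 K3.
  set f := f0 a in K1 K2 Hlt EC *; set B := BB a in K2 K3 *; set C := CC a in K1 K2 K3 EC *.
  have K1' : v * f = h * (u ^ 2 - C) / 2 by lra.
  have Hne : u ^ 2 - C <> 0 by rewrite EC; nra.
  set X := / 2 * u * ((C + B) / 2 - u ^ 2) * (u + f) + / 2 * u * ((C + B) / 2 - u ^ 2) * u
    + u * (/ 2 * f * ((C + B) / 2 - f ^ 2)) - 2 * v ^ 2.
  have K2' : X = - h * u * v by rewrite /X; lra.
  have K4 : (X - / 2 * u * f * (u ^ 2 - B)) * (u ^ 2 - C) = 0.
    rewrite Rmult_minus_distr_r K2' (_ : - h * u * v * (u ^ 2 - C) = - 2 * u * v * (v * f)); first by rewrite K1'; field.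
    rewrite (_ : - 2 * u * v * (v * f) = - 2 * u * f * v ^ 2); first ring.
    by rewrite K3; field.
  have [K5|] := Rmult_integral _ _ K4; last by [].
  move: K5; rewrite /X K3 -EC; lra.
Qed.

(** With [d = f3 / f0], the relation reads [B / C = d^3 (d + 2) / (2 d + 1)],
    the classical rational parametrization of cubic transformations. *)
Lemma triple_values a : 0 < a -> let d := f3 a / f0 a in
  0 < d < 1 /\ BB a * (2 * d + 1) = CC a * (d ^ 3 * (d + 2)) /\
  CC (3 * a) = CC a * (2 * d + 1) ^ 2 / 9 /\
  BB (3 * a) = BB a * (d + 2) ^ 2 / (9 * d ^ 2).
Proof.
  move=> Ha d.
  have P0 := f0_ge1 a Ha; have P3 := f3_pos a Ha; have P4 := f3_lt_f0 a Ha.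
  have Hd : 0 < d by apply: Rdiv_lt_0_compat; lra.
  have Eu : f3 a = d * f0 a by rewrite /d; field; lra.
  split; [|split; [|split]].
  - split=> //; apply: (Rmult_lt_reg_r (f0 a)); lra.
  - have := f3_relation a Ha; rewrite Eu /CC => H.
    apply: (Rmult_eq_reg_r (f0 a ^ 2)); last by have := pow_lt (f0 a) 2; lra.
    lra.
  - rewrite /CC f0_triple // -/(f3 a) Eu; field.
  - have Hh := f3_half a Ha; rewrite Eu in Hh.
    have -> : BB (3 * a) = ((fpi a + 2 * dnF a (PI / 3)) / 3) ^ 2 by rewrite /BB fpi_triple.
    have -> : dnF a (PI / 3) = fpi a / d.
      apply: (Rmult_eq_reg_r (d * f0 a)); last by apply: Rgt_not_eq; apply: Rmult_lt_0_compat; lra.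
      by rewrite Hh; field; lra.
    by rewrite /BB; field; lra.
Qed.

Lemma ex_derive_f3 a : 0 < a -> ex_derive f3 a.
Proof. by move=> Ha; eexists; apply: is_derive_dnF_a. Qed.

(** Logarithmic derivatives of the tripling formula for [f0], in which the
    derivative of [d] comes from its algebraic relation with [BB / CC]. *)
Lemma triple_kap a : 0 < a -> let d := f3 a / f0 a in
  kap (3 * a) = BB (3 * a) - (BB a - kap a) / 3 - 2 / 9 * (AA a * (d * (d + 2)) / (d + 1) ^ 2).
Proof.
  move=> Ha d.
  have P0 := f0_ge1 a Ha.
  have H0 : f0 a <> 0 by lra.
  have [Hd [R1 _]] := triple_values a Ha; rewrite -/d in Hd R1.
  have [u' Du] := ex_derive_f3 a Ha.
  pose D x := f3 x / f0 x.
  have [d' Dd] : ex_derive D a.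
    eexists; exact: is_derive_div _ _ _ _ _ Du (is_derive_f0 a Ha) H0.
  have near (P Q : R -> R) : (forall x, 0 < x -> P x = Q x) -> locally a (fun x => P x = Q x).
    move=> HPQ; have Ha2 : 0 < a / 2 by lra.
    exists (mkposreal _ Ha2) => x; rewrite /ball /= /AbsRing_ball /= /abs /minus /plus /opp /= => Hx.
    by apply: HPQ; move: Hx; rewrite /Rabs; case: Rcase_abs; lra.
  (* derivative of the rational parametrization *)
  have DL := is_derive_mult _ _ _ _ _ (is_derive_BB a Ha)
    (is_derive_plus _ _ _ _ _ (is_derive_scal _ _ 2 _ Dd) (is_derive_const 1 a)) (fun _ _ => Rmult_comm _ _).
  have DR := is_derive_mult _ _ _ _ _ (is_derive_CC a Ha)
    (is_derive_mult _ _ _ _ _ (is_derive_pow _ 3 _ _ Dd) (is_derive_plus _ _ _ _ _ Dd (is_derive_const 2 a)) (fun _ _ => Rmult_comm _ _)) (fun _ _ => Rmult_comm _ _).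
  have E1 : BB a * (CC a - kap a) * (2 * d + 1) + BB a * (2 * d') =
     CC a * (BB a - kap a) * (d ^ 3 * (d + 2)) + CC a * (3 * d' * d ^ 2 * (d + 2) + d ^ 3 * d').
    have DL' := is_derive_ext_loc _ _ _ _ (near _ _ (fun x Hx => proj1 (proj2 (triple_values x Hx)))) DL.
    have := is_derive_unique _ _ _ DL'; rewrite (is_derive_unique _ _ _ DR).
    rewrite /plus /mult /zero /= -/(D a) (_ : D a = d) //; lra.
  have E2 : d' * (6 * (d + 1) ^ 2) = AA a * (d * (d + 2) * (2 * d + 1)).
    have HC := CC_pos a Ha.
    have EB : BB a = CC a * (d ^ 3 * (d + 2)) / (2 * d + 1) by rewrite -R1; field; lra.
    apply: (Rmult_eq_reg_l (CC a * d ^ 2)); last first.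
      by apply: Rgt_not_eq; apply: Rmult_lt_0_compat => //; apply: pow_lt; lra.
    have -> : CC a * d ^ 2 * (AA a * (d * (d + 2) * (2 * d + 1))) =
       AA a * (CC a * (d ^ 3 * (d + 2))) * (2 * d + 1) by ring.
    rewrite -R1 /AA.
    have E3 : (BB a * (CC a - kap a) * (2 * d + 1) - BB a * (2 * d + 1) * (BB a - kap a)) * (2 * d + 1)
      = d' * (CC a * (4 * d ^ 3 + 6 * d ^ 2) * (2 * d + 1) - 2 * (BB a * (2 * d + 1))).
      have E0 : CC a * (BB a - kap a) * (d ^ 3 * (d + 2)) = BB a * (2 * d + 1) * (BB a - kap a) by rewrite R1; ring.
      rewrite (_ : BB a * (CC a - kap a) * (2 * d + 1) - _ = d' * (CC a * (4 * d ^ 3 + 6 * d ^ 2) - 2 * BB a)); first lra.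
      ring.
    rewrite (_ : 2 * (BB a * (2 * d + 1)) = 2 * (CC a * (d ^ 3 * (d + 2)))) in E3; first by rewrite R1.
    lra.
  (* derivative of the tripling formula *)
  have DL3 : is_derive (fun x => f0 (3 * x)) a (3 * (/ 2 * f0 (3 * a) * (BB (3 * a) - kap (3 * a)))).
    have P := is_derive_comp f0 (fun x => 3 * x) a _ _ (is_derive_f0 (3 * a) (ltac:(lra))) (is_derive_scal _ _ 3 _ (is_derive_id a)).
    apply: is_derive_eq P _; rewrite /scal /one /= /mult /=; ring.
  have DR3 := is_derive_scal _ _ (/ 3) _ (is_derive_mult _ _ _ _ _ (is_derive_f0 a Ha)
    (is_derive_plus _ _ _ _ _ (is_derive_scal _ _ 2 _ Dd) (is_derive_const 1 a)) (fun _ _ => Rmult_comm _ _)).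
  have F3 x : 0 < x -> f0 (3 * x) = / 3 * (f0 x * (2 * D x + 1)).
    move=> Hx; rewrite f0_triple // -/(f3 x) /D; have := f0_ge1 x Hx => H1; field; lra.
  have E4 : 3 * (/ 2 * f0 (3 * a) * (BB (3 * a) - kap (3 * a))) =
     / 3 * (/ 2 * f0 a * (BB a - kap a) * (2 * d + 1) + f0 a * (2 * d')).
    have DL3' := is_derive_ext_loc _ _ _ _ (near _ _ F3) DL3.
    have := is_derive_unique _ _ _ DL3'; rewrite (is_derive_unique _ _ _ DR3).
    rewrite /plus /mult /zero /= -/(D a) (_ : D a = d) //; lra.
  rewrite F3 // -/(D a) (_ : D a = d) // in E4.
  have E5 : d' = AA a * (d * (d + 2) * (2 * d + 1)) / (6 * (d + 1) ^ 2).
    apply: (Rmult_eq_reg_r (6 * (d + 1) ^ 2)); last by have := pow_lt (d + 1) 2; lra.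
    by rewrite E2; field; lra.
  have E6 : BB (3 * a) - kap (3 * a) = (BB a - kap a) / 3 + 4 / 3 * (d' / (2 * d + 1)).
    apply: (Rmult_eq_reg_l (/ 2 * (f0 a * (2 * d + 1)))); last by apply: Rgt_not_eq; nra.
    transitivity (/ 3 * (/ 2 * f0 a * (BB a - kap a) * (2 * d + 1) + f0 a * (2 * d'))); first lra.
    by field; lra.
  have -> : kap (3 * a) = BB (3 * a) - ((BB a - kap a) / 3 + 4 / 3 * (d' / (2 * d + 1))) by lra.
  rewrite E5; field; lra.
Qed.

Lemma r_pow4 : let r := Rpower 12 (1 / 4) in 0 < r /\ r ^ 4 = 12.
Proof.
  move=> r; split; first exact: exp_pos.
  rewrite -Rpower_pow; first exact: exp_pos.
  rewrite Rpower_mult /= (_ : 1 / 4 * (1 + 1 + 1 + 1) = 1); first by field.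
  by apply: Rpower_1; lra.
Qed.

(** At [a = PI] one has [BB = CC / 2], so the parameter [d] of the cubic
    transformation solves [2 d^4 + 4 d^3 - 2 d - 1 = 0].  All three claims then
    become identities in [r], valid modulo [r^4 = 12]. *)
Theorem triple_dual_values :
  let r := Rpower 12 (1 / 4) in
  let z := - 8 * (74977 + 40284 * r + 21644 * r ^ 2 + 11629 * r ^ 3) in
  let a := 1 / 18 * (1038 + 558 * r + 300 * r ^ 2 + 161 * r ^ 3) in
  let b := 1 / 3 * (387 + 208 * r + 112 * r ^ 2 + 60 * r ^ 3) in
  let A := AA (3 * PI) in let B := BB (3 * PI) in let C := CC (3 * PI) in
  z * A ^ 2 = - 4 * (B * C) /\ 3 * b * A = B + C /\ 3 * PI * a * A = PI * kap (3 * PI) - 1 / 3.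
Proof.
  move=> r z a b A B C.
  have [Hr Hr4] := r_pow4; rewrite -/r in Hr Hr4.
  have HPI := PI_RGT_0.
  have [HAB HK] := self_dual_values.
  have HC := CC_pos PI HPI.
  have HB : BB PI = CC PI / 2 by move: HAB; rewrite /AA; lra.
  have [Hd [R1 [RC RB]]] := triple_values PI HPI.
  have RK := triple_kap PI HPI.
  set d := f3 PI / f0 PI in Hd R1 RC RB RK.
  have Hd4 : 2 * d ^ 4 + 4 * d ^ 3 - 2 * d - 1 = 0.
    apply: (Rmult_eq_reg_l (CC PI)); last lra.
    rewrite HB in R1; lra.
  (* the quartic is quadratic in d^2 + d *)
  have Hw : d ^ 2 + d = (1 + r ^ 2 / 2) / 2.
    set w' := (1 + r ^ 2 / 2) / 2.
    have Hr2 : 3 < r ^ 2 by nra.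
    have F : (d ^ 2 + d - w') * (d ^ 2 + d + w' - 1) = 0.
      rewrite (_ : _ * _ = (2 * d ^ 4 + 4 * d ^ 3 - 2 * d - 1) / 2 - (r ^ 4 - 12) / 16); last by rewrite Hd4 Hr4; field.
      by rewrite /w'; field.
    have [|K] := Rmult_integral _ _ F; first lra.
    have : 1 < w' by rewrite /w'; lra.
    nra.
  (* the value of [2 d + 1], the positive square root of [3 + r ^ 2] *)
  set e := r / 2 + r ^ 3 / 4.
  have He2 : e ^ 2 = 3 + r ^ 2.
    rewrite (_ : e ^ 2 = 3 + r ^ 2 + (r ^ 4 - 12) * (r ^ 2 / 16 + 1 / 4)); last by rewrite Hr4; ring.
    by rewrite /e; field.
  have He0 : 0 < e by rewrite /e; have := pow_lt r 3 Hr; lra.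
  have Ede : 2 * d + 1 = e by nra.
  have Ed : d = (e - 1) / 2 by lra.
  have He1 : 1 < e by lra.
  have He3 : e ^ 3 = 9 / 2 * r + 5 / 4 * r ^ 3.
    rewrite (_ : e ^ 3 = e * e ^ 2); first ring.
    rewrite He2 (_ : _ * _ = 9 / 2 * r + 5 / 4 * r ^ 3 + r / 4 * (r ^ 4 - 12)); last by rewrite Hr4; field.
    by rewrite /e; field.
  set N := 48 + 36 * r + 24 * r ^ 2 + 10 * r ^ 3.
  set D := - 48 + 36 * r - 24 * r ^ 2 + 10 * r ^ 3.
  have EN : (e - 1) * (e + 3) ^ 3 = N.
    rewrite (_ : _ * _ = (e ^ 2) ^ 2 + 8 * e ^ 3 + 18 * e ^ 2 - 27); first ring.
    rewrite He3 He2 /N (_ : (3 + r ^ 2) ^ 2 = 9 + 6 * r ^ 2 + r ^ 4); first ring.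
    by rewrite Hr4; field.
  have EC : C = CC PI * e ^ 2 / 9 by rewrite /C RC Ede.
  have EB : B = CC PI * N / (144 * e).
    rewrite /B RB -EN HB.
    have -> : CC PI / 2 = CC PI * (d ^ 3 * (d + 2)) / (2 * d + 1).
      by rewrite -R1 HB; field; lra.
    rewrite Ed; field; lra.
  have EA : A = CC PI * D / (144 * e).
    rewrite /A /AA -/B -/C EB EC (_ : D = 16 * e ^ 3 - N); first by rewrite He3 /D /N; field.
    by field; lra.
  (* the cofactors of [r ^ 4 - 12] below come from polynomial division *)
  split; [|split].
  - rewrite EA EB EC.
    have P1 : z * D ^ 2 = - 64 * e ^ 3 * N.
      apply: Rminus_diag_uniq; rewrite He3.
      transitivity (- (r ^ 4 - 12) * ((-115164672) + (110871936) * r ^ 1 + (-120374784) * r ^ 2 + (69683712) * r ^ 3 + (-27340160) * r ^ 4 + (9303200) * r ^ 5)).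
        by rewrite /z /D /N; field.
      by rewrite Hr4; ring.
    transitivity (CC PI ^ 2 * (z * D ^ 2) / (144 * e) ^ 2); first by field; lra.
    by rewrite P1; field; lra.
  - rewrite EA EB EC.
    have P2 : 3 * b * D = 16 * e ^ 3 + N.
      apply: Rminus_diag_uniq; rewrite He3.
      transitivity ((r ^ 4 - 12) * (1552 + (-320) * r + 600 * r ^ 2)).
        by rewrite /b /D /N; field.
      by rewrite Hr4; ring.
    transitivity (CC PI * (3 * b * D) / (144 * e)); first by field; lra.
    by rewrite P2; field; lra.
  - rewrite RK HB HK HB -/B EA EB.
    have -> : AA PI = CC PI / 2 by rewrite HAB HB.
    rewrite Ed.
    have He2' : (e + 1) ^ 2 = 4 + r ^ 2 + 2 * e by rewrite (_ : (e + 1) ^ 2 = e ^ 2 + 2 * e + 1); [ring|lra].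
    have Hem : (e - 1) * (e + 3) = r ^ 2 + 2 * e by rewrite (_ : (e - 1) * (e + 3) = e ^ 2 + 2 * e - 3); [ring|lra].
    have P3 : 3 * a * D * (e + 1) ^ 2 = N * (e + 1) ^ 2 - 16 * e * ((e - 1) * (e + 3)).
      symmetry; apply: Rminus_diag_uniq; rewrite He2' Hem.
      transitivity ((r ^ 4 - 12) * ((-2784) + (-120) * r + (-4882/3) * r ^ 2 + (-1417/3) * r ^ 3 + (-589/3) * r ^ 4 + (-805/6) * r ^ 5)).
        by rewrite /a /D /N /e; field.
      by rewrite Hr4; ring.
    transitivity (PI * CC PI * (3 * a * D * (e + 1) ^ 2) / (144 * e * (e + 1) ^ 2)); first by field; lra.
    rewrite P3; field; lra.
Qed.


(** * The inhomogeneous hypergeometric equation *)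

(** The quotient [(1)_n / (1/2)_n], by its recurrence. *)
Fixpoint pochq (n : nat) : R :=
  match n with O => 1 | S m => pochq m * ((INR m + 1) / (INR m + / 2)) end.

(** The value at 0 is 0, as [/ 0 = 0], so that the power series starts at [n = 1]. *)
Definition cq (n : nat) : R := pochq n ^ 3 / INR n ^ 3.


Lemma cq_0 : cq 0 = 0.
Proof. by rewrite /cq /= Rmult_0_l /Rdiv Rinv_0 Rmult_0_r. Qed.

Lemma cq_1 : cq 1 = 8.
Proof. rewrite /cq /=; field. Qed.

Lemma cq_rec n : (1 <= n)%nat -> cq (S n) * (INR (S n) - / 2) ^ 3 = INR n ^ 3 * cq n.
Proof.
  move=> Hn; have H : 1 <= INR n by apply: (le_INR 1).
  rewrite /cq [pochq (S n)]/= S_INR; field; lra.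
Qed.

Lemma cq_bound n : 0 <= cq n <= 8.
Proof.
  case: n => [|n]; first by rewrite cq_0; lra.
  elim: n => [|n [IH0 IH]]; first by rewrite cq_1; lra.
  have Hr := cq_rec (S n) (ltac:(lia)).
  have H : 1 <= INR (S n) by apply: (le_INR 1); lia.
  have E : cq (S (S n)) = cq (S n) * (INR (S n) / (INR (S (S n)) - / 2)) ^ 3.
    rewrite S_INR in Hr *.
    apply: (Rmult_eq_reg_r ((INR (S n) + 1 - / 2) ^ 3)); last first.
      by apply: Rgt_not_eq; apply: pow_lt; lra.
    by rewrite Hr; field; lra.
  have B : 0 <= (INR (S n) / (INR (S (S n)) - / 2)) ^ 3 <= 1.
    have B1 : 0 <= INR (S n) / (INR (S (S n)) - / 2) <= 1.
      rewrite (S_INR (S n)); split; first by apply: Rlt_le; apply: Rdiv_lt_0_compat; lra.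
      apply: (Rmult_le_reg_r (INR (S n) + 1 - / 2)); first lra.
      rewrite /Rdiv Rmult_assoc Rinv_l; lra.
    split; first by apply: pow_le; lra.
    rewrite -(pow1 3); apply: pow_incr; lra.
  rewrite E; split; first by apply: Rmult_le_pos; lra.
  apply: Rle_trans (_ : cq (S n) * 1 <= _); last lra.
  by apply: Rmult_le_compat_l; lra.
Qed.

(** [WW k] is the image of the generating series [WW 0] of [cq] under the [k]-th
    power of the Euler operator [t d/dt]. *)
Definition cqk (k n : nat) : R := INR n ^ k * cq n.

Definition WW (k : nat) (t : R) : R := PSeries (cqk k) t.

Lemma CV_radius_cqk k : Rbar_le 1 (CV_radius (cqk k)).
Proof.
  elim: k => [|k IH].
  - apply: (proj1 (CV_radius_bounded (cqk 0))); exists 8 => n.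
    rewrite /cqk pow1 /= Rmult_1_l Rmult_1_r; have := cq_bound n.
    rewrite /Rabs; case: Rcase_abs; lra.
  - rewrite (CV_radius_ext _ (PS_incr_1 (PS_derive (cqk k)))).
      move=> [|n]; first by rewrite /cqk cq_0 /= Rmult_0_r.
      by rewrite /PS_incr_1 /PS_derive /cqk /=; ring.
    by rewrite CV_radius_incr_1 CV_radius_derive.
Qed.

Lemma cqk_inside k t : Rabs t < 1 -> Rbar_lt (Rabs t) (CV_radius (cqk k)).
Proof. by move=> Ht; apply: Rbar_lt_le_trans (CV_radius_cqk k). Qed.

Lemma is_derive_WW k t : Rabs t < 1 -> exists d, is_derive (WW k) t d /\ t * d = WW (S k) t.
Proof.
  move=> Ht; exists (PSeries (PS_derive (cqk k)) t); split.
    by apply: is_derive_PSeries; exact: cqk_inside.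
  rewrite -PSeries_incr_1 /WW; apply: PSeries_ext => -[|n].
  - by rewrite /cqk cq_0 /= Rmult_0_r.
  - by rewrite /PS_incr_1 /PS_derive /cqk /=; ring.
Qed.

(** The recurrence [cq_rec] in operator form,
    [(D - 1/2)^3 W - t D^3 W = t] with [D = t d/dt]; the right-hand side is the
    contribution of the first coefficient. *)
Lemma WW_equation t : Rabs t < 1 ->
  WW 3 t - 3 / 2 * WW 2 t + 3 / 4 * WW 1 t - / 8 * WW 0 t - t * WW 3 t = t.
Proof.
  move=> Ht.
  have Hex k : ex_series (fun n => cqk k n * t ^ n).
    by have := CV_radius_inside _ _ (cqk_inside k t Ht); rewrite ex_pseries_R.
  have Hd : Series (fun n => (if Nat.eq_dec n 1 then 1 else 0) * t ^ n) = t.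
    apply: is_series_unique; apply: is_sum_series.
    have := is_sum_single 1%nat (fun n => (if Nat.eq_dec n 1 then 1 else 0) * t ^ n).
    rewrite /= Rmult_1_l Rmult_1_r; apply.
    by move=> n Hn; case: Nat.eq_dec => // _; ring.
  have Hexd : ex_series (fun n => (if Nat.eq_dec n 1 then 1 else 0) * t ^ n).
    exists t; apply: is_sum_series.
    have := is_sum_single 1%nat (fun n => (if Nat.eq_dec n 1 then 1 else 0) * t ^ n).
    rewrite /= Rmult_1_l Rmult_1_r; apply.
    by move=> n Hn; case: Nat.eq_dec => // _; ring.
  have Hexi : ex_series (fun n => PS_incr_1 (cqk 3) n * t ^ n).
    have : ex_pseries (PS_incr_1 (cqk 3)) t.
      by apply: CV_radius_inside; rewrite CV_radius_incr_1; exact: cqk_inside.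
    by rewrite ex_pseries_R.
  rewrite -[t * WW 3 t]PSeries_incr_1 -[X in _ = X]Hd /WW /PSeries.
  rewrite -!Series_scal_l.
  have Sx k x : ex_series (fun n => x * (cqk k n * t ^ n)) by apply: (ex_series_scal x).
  rewrite -Series_minus; [exact: Hex|exact: Sx|].
  rewrite -Series_plus; [apply: (ex_series_minus (V := R_NormedModule)); [exact: Hex|exact: Sx]|exact: Sx|].
  rewrite -Series_minus; [|exact: Sx|].
    apply: (ex_series_plus (V := R_NormedModule)); last exact: Sx.
    by apply: (ex_series_minus (V := R_NormedModule)); [exact: Hex|exact: Sx].
  rewrite -Series_minus.
  - apply: (ex_series_minus (V := R_NormedModule)); last exact: Sx.
    apply: (ex_series_plus (V := R_NormedModule)); last exact: Sx.
    by apply: (ex_series_minus (V := R_NormedModule)); [exact: Hex|exact: Sx].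
  - exact: Hexi.
  apply: Series_ext => n.
  have <- : cqk 3 n - 3 / 2 * cqk 2 n + 3 / 4 * cqk 1 n - / 8 * cqk 0 n - PS_incr_1 (cqk 3) n =
     (if Nat.eq_dec n 1 then 1 else 0); last by ring.
  rewrite /cqk; case: n => [|[|n]].
  - rewrite cq_0 (_ : PS_incr_1 _ 0 = 0) //; case: (Nat.eq_dec 0 1) => // _; ring.
  - rewrite (_ : PS_incr_1 _ 1 = INR 0 ^ 3 * cq 0) // cq_0 cq_1 /=; case: (Nat.eq_dec 1 1) => // _; field.
  - rewrite (_ : PS_incr_1 _ (S (S n)) = INR (S n) ^ 3 * cq (S n)) //; case: (Nat.eq_dec (S (S n)) 1) => // _.
    have := cq_rec (S n) (ltac:(lia)); lra.
Qed.

Lemma WW0_bound t : Rabs t <= / 2 -> Rabs (WW 0 t) <= 16 * Rabs t.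
Proof.
  move=> Ht.
  have [G1 G2] : is_series (fun n => 8 * Rabs t * Rabs t ^ n) (8 * Rabs t * / (1 - Rabs t)) /\ True.
    split=> //; apply: (is_series_scal (8 * Rabs t)); apply: is_series_geom.
    rewrite Rabs_Rabsolu; lra.
  have Hs : summable (fun n => 8 * Rabs t * Rabs t ^ n).
    apply: summable_nat; apply: (ex_series_ext (fun n => 8 * Rabs t * Rabs t ^ n)).
      move=> n; rewrite (Rabs_pos_eq (8 * Rabs t * _)) //; apply: Rmult_le_pos; last by apply: pow_le; exact: Rabs_pos.
      have := Rabs_pos t; lra.
    by eexists; exact: G1.
  have E : WW 0 t = Series (fun n => cqk 0 (S n) * t ^ S n).
    rewrite /WW /PSeries Series_incr_1.
      have := CV_radius_inside _ _ (cqk_inside 0 t (ltac:(lra))); by rewrite ex_pseries_R.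
    rewrite {1}/cqk cq_0; ring.
  have B n : Rabs (cqk 0 (S n) * t ^ S n) <= 8 * Rabs t * Rabs t ^ n.
    rewrite Rabs_mult -RPow_abs -tech_pow_Rmult Rmult_assoc.
    apply: Rmult_le_compat_r.
      by apply: Rmult_le_pos; [exact: Rabs_pos|apply: pow_le; exact: Rabs_pos].
    rewrite /cqk [_ ^ 0]/= Rmult_1_l; have := cq_bound (S n).
    rewrite /Rabs; case: Rcase_abs; lra.
  rewrite E tsum_Series; first exact: summable_le B Hs.
  apply: Rle_trans (tsum_Rabs_le _ _ B Hs) _.
  rewrite -(tsum_Series _ Hs) (is_series_unique _ _ G1).
  have P := Rabs_pos t.
  have : / (1 - Rabs t) <= / / 2 by apply: Rinv_le_contravar; lra.
  rewrite Rinv_inv; nra.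
Qed.

(** The argument at which the hypergeometric series is evaluated; at [3 PI] it
    is [1 / z]. *)
Definition TT (a : R) : R := - (AA a ^ 2 / (4 * BB a * CC a)).

Lemma is_derive_TT a : 0 < a -> is_derive TT a (- (BB a + CC a) * TT a).
Proof.
  move=> Ha; have HB := BB_pos a Ha; have HC := CC_pos a Ha.
  have DA := is_derive_AA a Ha; have DB := is_derive_BB a Ha; have DC := is_derive_CC a Ha.
  have Hne : 4 * BB a * CC a <> 0 by apply: Rgt_not_eq; nra.
  have P := is_derive_opp _ _ _ (is_derive_div _ _ _ _ _ (is_derive_pow _ 2 _ _ DA)
     (is_derive_mult _ _ _ _ _ (is_derive_scal _ _ 4 _ DB) DC (fun _ _ => Rmult_comm _ _)) Hne).
  apply: is_derive_eq P _; rewrite /opp /plus /mult /= /TT; field; lra.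
Qed.

Section Transport.
Variable a : R.
Hypothesis Ha : 0 < a.
Hypothesis HT : Rabs (TT a) < 1.

Lemma is_derive_WT k : is_derive (fun x => WW k (TT x)) a (- (BB a + CC a) * WW (S k) (TT a)).
Proof.
  have [d [Dd Ed]] := is_derive_WW k (TT a) HT.
  have P := is_derive_comp (WW k) TT a _ _ Dd (is_derive_TT a Ha).
  apply: is_derive_eq P _; rewrite -Ed /scal /= /mult /=; ring.
Qed.

(** The functions [V0], [V1], [V2] are successive derivatives in [a]. *)
Definition V0 (x : R) : R := WW 0 (TT x) / AA x.
Definition V1 (x : R) : R := (kap x * WW 0 (TT x) - (BB x + CC x) * WW 1 (TT x)) / AA x.
Definition V2 (x : R) : R :=
  ((BB x * CC x + kap x ^ 2) / 2 * WW 0 (TT x)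
   - (2 * BB x * CC x + kap x * (BB x + CC x)) * WW 1 (TT x)
   + (BB x + CC x) ^ 2 * WW 2 (TT x)) / AA x.

Let HA := AA_pos a Ha.
Let HAn : AA a <> 0. Proof. lra. Qed.
Let DA := is_derive_AA a Ha.
Let DB := is_derive_BB a Ha.
Let DC := is_derive_CC a Ha.
Let DK := is_derive_kap a Ha.

Lemma is_derive_V0 : is_derive V0 a (V1 a).
Proof.
  have P := is_derive_div _ _ _ _ _ (is_derive_WT 0) DA HAn.
  apply: is_derive_eq P _; rewrite /V1 /=; field; lra.
Qed.

Lemma is_derive_V1 : is_derive V1 a (V2 a).
Proof.
  have P := is_derive_div _ _ _ _ _ (is_derive_minus _ _ _ _ _
    (is_derive_mult _ _ _ _ _ DK (is_derive_WT 0) (fun _ _ => Rmult_comm _ _))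
    (is_derive_mult _ _ _ _ _ (is_derive_plus _ _ _ _ _ DB DC) (is_derive_WT 1) (fun _ _ => Rmult_comm _ _))) DA HAn.
  apply: is_derive_eq P _; rewrite /minus /plus /opp /mult /= /V2; field; lra.
Qed.

(** All terms in [WW 0], [WW 1], [WW 2] cancel by the homogeneous part of
    [WW_equation]; only its inhomogeneous part contributes. *)
Lemma is_derive_V2 : is_derive V2 a (CC a ^ 2 - BB a ^ 2).
Proof.
  have DBC := is_derive_mult _ _ _ _ _ DB DC (fun _ _ => Rmult_comm _ _).
  have Ds := is_derive_plus _ _ _ _ _ DB DC.
  have P := is_derive_div _ _ _ _ _ (is_derive_plus _ _ _ _ _ (is_derive_minus _ _ _ _ _
    (is_derive_mult _ _ _ _ _ (is_derive_scal _ _ (/ 2) _ (is_derive_plus _ _ _ _ _ DBC (is_derive_pow _ 2 _ _ DK))) (is_derive_WT 0) (fun _ _ => Rmult_comm _ _))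
    (is_derive_mult _ _ _ _ _ (is_derive_plus _ _ _ _ _ (is_derive_scal _ _ 2 _ DBC)
       (is_derive_mult _ _ _ _ _ DK Ds (fun _ _ => Rmult_comm _ _))) (is_derive_WT 1) (fun _ _ => Rmult_comm _ _)))
    (is_derive_mult _ _ _ _ _ (is_derive_pow _ 2 _ _ Ds) (is_derive_WT 2) (fun _ _ => Rmult_comm _ _))) DA HAn.
  have {}P := is_derive_ext _ V2 _ _ _ P.
  apply: is_derive_eq (P _) _.
    by move=> t; rewrite /V2 /minus /plus /opp /mult /=; congr Rdiv; field.
  rewrite /minus /plus /opp /mult /=.
  have HB := BB_pos a Ha; have HC := CC_pos a Ha.
  have W3 : WW 3 (TT a) = (4 * BB a * CC a) / (BB a + CC a) ^ 2 *
     (3 / 2 * WW 2 (TT a) - 3 / 4 * WW 1 (TT a) + / 8 * WW 0 (TT a) - AA a ^ 2 / (4 * BB a * CC a)).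
    have E := WW_equation (TT a) HT.
    have E1 : WW 3 (TT a) * (1 - TT a) = 3 / 2 * WW 2 (TT a) - 3 / 4 * WW 1 (TT a) + / 8 * WW 0 (TT a) + TT a by lra.
    have E2 : 1 - TT a = (BB a + CC a) ^ 2 / (4 * BB a * CC a) by rewrite /TT /AA; field; lra.
    rewrite E2 in E1.
    apply: (Rmult_eq_reg_r ((BB a + CC a) ^ 2 / (4 * BB a * CC a))); last first.
      apply: Rgt_not_eq; apply: Rdiv_lt_0_compat; [apply: pow_lt; lra|nra].
    rewrite E1 /TT; field; lra.
  rewrite W3.
  have EA : AA a = CC a - BB a by [].
  have HA' : CC a - BB a <> 0 by rewrite -EA.
  rewrite EA; field; lra.
Qed.

End Transport.


(** * The double exponential series as third primitive of a weight four form *)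

Definition oddR (i : nat) : R := 2 * INR i + 1.

Lemma oddR_ge1 i : 1 <= oddR i.
Proof. rewrite /oddR; have := pos_INR i; lra. Qed.

Definition hterm (m : nat) (p : nat * nat) (a : R) : R :=
  2 * (oddR (fst p) * oddR (snd p)) ^ m / oddR (snd p) ^ 3
  * exp (- (oddR (fst p) * oddR (snd p)) * a).

(** [Hh 0] is the sum of [1 / (k^3 sinh (k a))] over odd [k], with [1 / sinh]
    expanded in exponentials, and [Hh m] is its [m]-th derivative up to the
    sign [(-1)^m]. *)
Definition Hh (m : nat) (a : R) : R := tsum (fun p => hterm m p a).

Lemma pow_le_exp m b : 0 < b -> exists K, 0 < K /\ forall y, 0 <= y -> y ^ m <= K * exp (b * y).
Proof.
  elim: m b => [|m IH] b Hb.
    exists 1; split; first lra.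
    move=> y Hy; rewrite /= Rmult_1_l.
    have := exp_ineq1_le (b * y); have : 0 <= b * y by apply: Rmult_le_pos; lra.
    lra.
  have Hb2 : 0 < b / 2 by lra.
  have [K [HK H]] := IH _ Hb2.
  exists (2 / b * K); split; first by apply: Rmult_lt_0_compat => //; apply: Rdiv_lt_0_compat; lra.
  move=> y Hy.
  have H1 : y <= 2 / b * exp (b / 2 * y).
    have := exp_ineq1_le (b / 2 * y) => H1.
    apply: (Rmult_le_reg_l (b / 2)) => //.
    rewrite -Rmult_assoc (_ : b / 2 * (2 / b) = 1); [by field; lra|lra].
  rewrite -tech_pow_Rmult.
  apply: (Rle_trans _ ((2 / b * exp (b / 2 * y)) * (K * exp (b / 2 * y)))).
    by apply: Rmult_le_compat => //; [apply: pow_le|apply: H].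
  right; rewrite (_ : b * y = b / 2 * y + b / 2 * y); first by field.
  by rewrite exp_plus; ring.
Qed.

Lemma summable_exp_pair b : 0 < b ->
  summable (fun p : nat * nat => exp (- (oddR (fst p) * oddR (snd p)) * b)).
Proof.
  move=> Hb; have H := summable_poly_exp 0 b Hb.
  apply: summable_le _ (summable_mult _ _ H H) => -[i j] /=.
  rewrite !Rmult_1_l -exp_plus Rabs_pos_eq; first by apply: Rlt_le; apply: exp_pos.
  apply: exp_le_compat; rewrite /oddR.
  have := pos_INR i; have := pos_INR j; move=> Hj Hi.
  have : 0 <= INR i * INR j by apply: Rmult_le_pos.
  nra.
Qed.

Lemma hterm_nonneg m p a : 0 <= hterm m p a.
Proof.
  rewrite /hterm; have H1 := oddR_ge1 (fst p); have H2 := oddR_ge1 (snd p).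
  apply: Rmult_le_pos; last by apply: Rlt_le; apply: exp_pos.
  apply: Rmult_le_pos; last by apply: Rlt_le; apply: Rinv_0_lt_compat; apply: pow_lt; lra.
  apply: Rmult_le_pos; first lra.
  by apply: pow_le; nra.
Qed.

Lemma hterm_le m a : 0 < a -> exists K, 0 < K /\ forall p x, a <= x ->
  hterm m p x <= K * exp (- (oddR (fst p) * oddR (snd p)) * (x - a / 2)).
Proof.
  move=> Ha; have [K [HK H]] := pow_le_exp m (a / 2) (ltac:(lra)).
  exists (2 * K); split; first lra.
  move=> p x Hx; rewrite /hterm.
  have H1 := oddR_ge1 (fst p); have H2 := oddR_ge1 (snd p).
  set n := oddR (fst p) * oddR (snd p).
  have Hn : 0 <= n by apply: Rmult_le_pos; lra.
  rewrite (_ : - n * (x - a / 2) = a / 2 * n + - n * x); first by field.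
  rewrite exp_plus -Rmult_assoc; apply: Rmult_le_compat_r; first by apply: Rlt_le; exact: exp_pos.
  have Hk : 1 <= oddR (snd p) ^ 3 by apply: pow_R1_Rle.
  apply: (Rmult_le_reg_r (oddR (snd p) ^ 3)); first lra.
  rewrite /Rdiv (Rmult_assoc (2 * n ^ m)) Rinv_l; first lra.
  have := H n Hn; have := exp_pos (a / 2 * n); have : 0 <= n ^ m by apply: pow_le.
  move=> P1 P2 P3.
  have : 2 * K * exp (a / 2 * n) * 1 <= 2 * K * exp (a / 2 * n) * oddR (snd p) ^ 3.
    by apply: Rmult_le_compat_l => //; nra.
  lra.
Qed.

Lemma summable_hterm m a : 0 < a -> summable (fun p => hterm m p a).
Proof.
  move=> Ha; have [K [HK H]] := hterm_le m a Ha.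
  apply: summable_le (summable_scal K _ (summable_exp_pair (a / 2) (ltac:(lra)))) => p.
  rewrite Rabs_pos_eq; first exact: hterm_nonneg.
  have := H p a (Rle_refl a); by rewrite (_ : a - a / 2 = a / 2); first by field.
Qed.

Lemma is_derive_Hh m a : 0 < a -> is_derive (Hh m) a (- Hh (S m) a).
Proof.
  move=> Ha; rewrite /Hh -tsum_opp; first exact: summable_hterm.
  have Ha2 : 0 < a / 2 by lra.
  have [K [HK H]] := hterm_le (S (S m)) (a / 2) Ha2.
  have D k p x : is_derive (hterm k p) x (- hterm (S k) p x).
    by rewrite /hterm; auto_derive => //=; field; have := oddR_ge1 (snd p); lra.
  have near x : Rabs (x - a) < a / 2 -> a / 2 <= x by rewrite /Rabs; case: Rcase_abs; lra.
  apply: (is_derive_tsum (hterm m) (fun p x => - hterm (S m) p x) (fun p x => hterm (S (S m)) p x)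
    (fun p => K * exp (- (oddR (fst p) * oddR (snd p)) * (a / 4))) a (a / 2)) => //.
  - move=> p x _; rewrite -[hterm (S (S m)) p x]Ropp_involutive.
    by apply: (is_derive_opp (V := R_NormedModule)).
  - move=> p x /near Hx; rewrite Rabs_pos_eq; first exact: hterm_nonneg.
    apply: Rle_trans (H p x Hx) _; apply: Rmult_le_compat_l; first lra.
    apply: exp_le_compat.
    have H1 := oddR_ge1 (fst p); have H2 := oddR_ge1 (snd p).
    have : 0 <= oddR (fst p) * oddR (snd p) by apply: Rmult_le_pos; lra.
    nra.
  - apply: summable_scal; apply: summable_exp_pair; lra.
  - by move=> x /near Hx; apply: summable_hterm; lra.
  - by apply: summable_opp; apply: summable_hterm.
Qed.

Lemma Hh_tail : exists K, forall a, 1 <= a -> Rabs (Hh 0 a - 0) <= K * exp (- a).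
Proof.
  have Hs := summable_hterm 0 1 Rlt_0_1.
  exists (exp 1 * Hh 0 1) => a Ha; rewrite Rminus_0_r /Hh.
  rewrite (_ : exp 1 * _ * exp (- a) = (exp 1 * exp (- a)) * tsum (fun p => hterm 0 p 1)); first ring.
  rewrite -tsum_scal //; apply: tsum_Rabs_le; last exact: summable_scal.
  move=> p; rewrite Rabs_pos_eq; first exact: hterm_nonneg.
  rewrite /hterm -exp_plus.
  have H1 := oddR_ge1 (fst p); have H2 := oddR_ge1 (snd p).
  set n := oddR (fst p) * oddR (snd p).
  have Hn : 1 <= n by rewrite /n; nra.
  rewrite (_ : exp (1 + - a) * _ = 2 * n ^ 0 / oddR (snd p) ^ 3 * (exp (1 + - a) * exp (- n * 1))); first ring.
  apply: Rmult_le_compat_l.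
    apply: Rmult_le_pos; first by rewrite /=; lra.
    by apply: Rlt_le; apply: Rinv_0_lt_compat; apply: pow_lt; lra.
  rewrite -exp_plus; apply: exp_le_compat; nra.
Qed.

Lemma sum_odd_exp u : 0 < u -> is_sum (fun j => 2 * exp (- oddR j * u)) (/ sinh u).
Proof.
  move=> Hu.
  have Hq : 0 < exp (- (2 * u)) < 1.
    split; first exact: exp_pos.
    rewrite -exp_0; apply: exp_increasing; lra.
  have E j : 2 * exp (- oddR j * u) = 2 * exp (- u) * exp (- (2 * u)) ^ j.
    elim: j => [|j IH]; first by rewrite /oddR /= Rmult_1_r; congr (2 * exp _); ring.
    rewrite -tech_pow_Rmult (_ : 2 * exp (- u) * (exp (- (2 * u)) * _) = exp (- (2 * u)) * (2 * exp (- u) * exp (- (2 * u)) ^ j)); first ring.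
    rewrite -IH /oddR S_INR.
    rewrite (_ : - (2 * (INR j + 1) + 1) * u = - (2 * u) + - (2 * INR j + 1) * u); first ring.
    by rewrite exp_plus; ring.
  have Hs : summable (fun j => 2 * exp (- oddR j * u)).
    apply: (summable_le _ (fun j => 2 * exp (- u) * (INR j ^ 0 * exp (- (2 * u) * INR j)))).
      move=> j; rewrite Rabs_pos_eq; first by have := exp_pos (- oddR j * u); lra.
      right; rewrite /= Rmult_1_l Rmult_assoc -exp_plus; congr (2 * exp _); rewrite /oddR; ring.
    apply: summable_scal; apply: summable_poly_exp; lra.
  have <- : Series (fun j => 2 * exp (- oddR j * u)) = / sinh u.
    apply: is_series_unique; apply: (is_series_ext _ _ _ (fun n => eq_sym (E n))).
    have G := is_series_scal (2 * exp (- u)) _ _ (is_series_geom (exp (- (2 * u))) _).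
    rewrite (_ : / sinh u = scal (2 * exp (- u)) (/ (1 - exp (- (2 * u))))); last first.
      by apply: G; rewrite Rabs_pos_eq; lra.
    rewrite /scal /= /mult /= /sinh (_ : - (2 * u) = - u + - u); first ring.
    have H1 := exp_pos (- u); have H3 : exp (- u) < 1 by rewrite -exp_0; apply: exp_increasing; lra.
    have H2 : exp u = / exp (- u) by rewrite -exp_Ropp Ropp_involutive.
    rewrite exp_plus H2; field; repeat split; nra.
  rewrite tsum_Series //; exact: tsum_is_sum.
Qed.

(** The factor [1 - cos (n PI)] is 2 at odd [n] and 0 at even [n]; the odd
    integers come in pairs of opposite sign. *)
Lemma tsum_odd_Z (x : Z -> R) : summable x -> (forall n, x (- n)%Z = x n) ->
  tsum (fun n => x n * (1 - cos (IZR n * PI))) = 4 * tsum (fun i : nat => x (2 * Z.of_nat i + 1)%Z).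
Proof.
  move=> Hx He.
  pose e (s : nat + nat) : Z := match s with inl i => (2 * Z.of_nat i + 1)%Z | inr i => (- (2 * Z.of_nat i + 1))%Z end.
  have He1 s s' : e s = e s' -> s = s'.
    case: s s' => [i|i] [j|j]; rewrite /e; cbv iota beta => E.
    - by have -> : i = j by lia.
    - by exfalso; lia.
    - by exfalso; lia.
    - by have -> : i = j by lia.
  have Hinj : forall i j : nat, (2 * Z.of_nat i + 1 = 2 * Z.of_nat j + 1)%Z -> i = j by move=> *; lia.
  have Ho := summable_comp_inj (fun i : nat => (2 * Z.of_nat i + 1)%Z) x Hinj Hx.
  have S1 : summable (fun n => x n * (1 - cos (IZR n * PI))).
    apply: summable_le (summable_scal 2 _ (summable_abs _ Hx)) => n.
    rewrite Rabs_mult Rmult_comm; apply: Rmult_le_compat_r; first exact: Rabs_pos.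
    by apply: Rabs_le; have := COS_bound (IZR n * PI); lra.
  rewrite (tsum_embed e _ He1) //.
  - move=> n Hn; rewrite (_ : cos (IZR n * PI) = 1); last ring.
    have [E|E] := Z.eq_dec (n mod 2) 0.
      have := Z_div_mod_eq_full n 2; rewrite E Z.add_0_r => ->; exact: cos_IZR_even.
    exfalso; have E2 := mod2_cases n E.
    have [Hp|Hp] := Z_lt_le_dec n 0.
    - apply: (Hn (inr (Z.to_nat (- n / 2)))); rewrite /e; cbv iota beta.
      have := Z_div_mod_eq_full (- n) 2; have := Z.mod_pos_bound (- n) 2; lia.
    - apply: (Hn (inl (Z.to_nat (n / 2)))); rewrite /e; cbv iota beta.
      have := Z.div_pos n 2; lia.
  apply: tsum_eq; rewrite (_ : 4 * _ = 2 * tsum (fun i : nat => x (2 * Z.of_nat i + 1)%Z) + 2 * tsum (fun i : nat => x (2 * Z.of_nat i + 1)%Z)).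
    ring.
  apply: is_sum_sum; apply: is_sum_ext (is_sum_scal 2 _ _ (tsum_is_sum _ Ho)) => i.
  - by rewrite /e cos_IZR_odd; ring.
  - rewrite /e opp_IZR Ropp_mult_distr_l_reverse cos_neg cos_IZR_odd He; ring.
Qed.

(** Second derivatives at [th = 0] and [th = PI] of the Fourier series of
    [dnF ^ 2]: their difference selects the odd frequencies of
    [n^3 / sinh (n a)]. *)
Lemma CC2_BB2 a : 0 < a -> CC a ^ 2 - BB a ^ 2 = 16 * Hh 3 a.
Proof.
  move=> Ha.
  have E0 := dnF_sq_second a 0 Ha; have E1 := dnF_sq_second a PI Ha.
  rewrite dnF1_0 dnF2_eq // -/(f0 a) -/(CC a) in E0.
  rewrite dnF1_PI dnF2_eq // -/(fpi a) -/(BB a) in E1.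
  set x := fun n => IZR n * (IZR n * (IZR n * cschs a n)).
  rewrite -/x in E0 E1.
  have Hx : summable x by apply: expd_summable; do 3 apply: expd_n; exact: expd_cschs.
  have E2 : CC a ^ 2 - BB a ^ 2 = 4 * (Ce x 0 - Ce x PI).
    have F0 : / 2 * f0 a * ((CC a + BB a) / 2 - CC a) * f0 a = / 2 * CC a * ((CC a + BB a) / 2 - CC a) by rewrite /CC; ring.
    have F1 : / 2 * fpi a * ((CC a + BB a) / 2 - BB a) * fpi a = / 2 * BB a * ((CC a + BB a) / 2 - BB a) by rewrite /BB; ring.
    rewrite F0 in E0; rewrite F1 in E1; lra.
  have E3 : Ce x 0 - Ce x PI = 4 * tsum (fun i : nat => x (2 * Z.of_nat i + 1)%Z).
    rewrite -tsum_odd_Z //.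
      by move=> n; rewrite /x opp_IZR cschs_neg; ring.
    rewrite -tsum_minus; try exact: summable_cos.
    by apply: tsum_ext => n; rewrite Rmult_0_r cos_0; ring.
  rewrite E2 E3 /Hh tsum_fubini; first exact: summable_hterm.
  rewrite -Rmult_assoc (_ : 4 * 4 = 16); first ring.
  congr Rmult; apply: tsum_ext => i.
  have Hi := oddR_ge1 i.
  have S := is_sum_scal (oddR i ^ 3) _ _ (sum_odd_exp (oddR i * a) (ltac:(nra))).
  have -> : x (2 * Z.of_nat i + 1)%Z = oddR i ^ 3 * / sinh (oddR i * a).
    rewrite /x /cschs plus_IZR mult_IZR -INR_IZR_INZ /oddR; ring.
  symmetry; apply: tsum_eq; apply: is_sum_ext S => j.
  rewrite /hterm /=; have Hj := oddR_ge1 j.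
  rewrite (_ : - (oddR i * oddR j) * a = - oddR j * (oddR i * a)); first ring.
  field; lra.
Qed.

(** [U] is a quadratic polynomial with limit zero; both Taylor coefficients are
    combinations of the values at [a0 + x], [a0 + 2 x] and [a0 + 4 x]. *)
Lemma zero_of_third_derivative (U U1 U2 : R -> R) a0 :
  (forall a, a0 <= a -> is_derive U a (U1 a)) -> (forall a, a0 <= a -> is_derive U1 a (U2 a)) ->
  (forall a, a0 <= a -> is_derive U2 a 0) -> is_lim U p_infty 0 -> U a0 = 0 /\ U1 a0 = 0.
Proof.
  move=> H0 H1 H2 HL.
  have C2 a : a0 <= a -> U2 a = U2 a0.
    move=> Ha; apply: const_of_derive_0 => t; rewrite Rmin_right // => Ht; apply: H2; lra.
  have C1 a : a0 <= a -> U1 a = U1 a0 + U2 a0 * (a - a0).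
    move=> Ha.
    have : U1 a - U2 a0 * (a - a0) = U1 a0 - U2 a0 * (a0 - a0); last lra.
    apply: (const_of_derive_0 (fun a => U1 a - U2 a0 * (a - a0))) => t; rewrite Rmin_right // => Ht.
    apply: is_derive_eq (is_derive_minus _ _ _ _ _ (H1 t (proj1 Ht))
       (is_derive_scal _ _ (U2 a0) _ (is_derive_minus _ _ _ _ _ (is_derive_id t) (is_derive_const a0 t)))) _.
    rewrite C2 /minus /plus /opp /one /zero /=; lra.
  have C0 x : 0 <= x -> U (a0 + x) = U a0 + U1 a0 * x + U2 a0 * x ^ 2 / 2.
    move=> Hx.
    have : U (a0 + x) - (U1 a0 * (a0 + x - a0) + U2 a0 / 2 * (a0 + x - a0) ^ 2) =
       U a0 - (U1 a0 * (a0 - a0) + U2 a0 / 2 * (a0 - a0) ^ 2); last first.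
      rewrite Rminus_diag (_ : a0 + x - a0 = x); [ring|lra].
    apply: (const_of_derive_0 (fun a => U a - (U1 a0 * (a - a0) + U2 a0 / 2 * (a - a0) ^ 2))) => t.
    rewrite Rmin_right; first lra.
    move=> Ht.
    have Dm := is_derive_minus _ _ _ _ _ (is_derive_id t) (is_derive_const a0 t).
    apply: is_derive_eq (is_derive_minus _ _ _ _ _ (H0 t (proj1 Ht)) (is_derive_plus _ _ _ _ _
       (is_derive_scal _ _ (U1 a0) _ Dm) (is_derive_scal _ _ (U2 a0 / 2) _ (is_derive_pow _ 2 _ _ Dm)))) _.
    rewrite C1 /minus /plus /opp /one /zero /=; lra.
  have Small de : 0 < de < 1 -> exists x, 1 <= x /\ Rabs (U (a0 + x)) < de /\ Rabs (U (a0 + 2 * x)) < de /\ Rabs (U (a0 + 4 * x)) < de.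
    move=> Hde; move/is_lim_spec: HL => /(_ (mkposreal _ (proj1 Hde))) [M HM].
    exists (Rmax 1 (M - a0 + 1)); have K1 := Rmax_l 1 (M - a0 + 1); have K2 := Rmax_r 1 (M - a0 + 1).
    have HM' y : M < y -> Rabs (U y) < de by move=> /HM /=; rewrite Rminus_0_r.
    repeat split => //; apply: HM'; lra.
  split.
  - apply: (eq_0_of_small _ 5) => de /Small [x [Hx [X1 [X2 X4]]]].
    rewrite C0 in X1; first lra.
    rewrite C0 in X2; first lra.
    rewrite C0 in X4; first lra.
    move: X1 X2 X4; rewrite /Rabs; repeat case: Rcase_abs; lra.
  - apply: (eq_0_of_small _ 5) => de /Small [x [Hx [X1 [X2 X4]]]].
    rewrite C0 in X1; first lra.
    rewrite C0 in X2; first lra.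
    rewrite C0 in X4; first lra.
    have : Rabs (U1 a0 * x) <= 5 * de.
      move: X1 X2 X4; rewrite /Rabs; repeat case: Rcase_abs; lra.
    rewrite Rabs_mult (Rabs_pos_eq x); first lra.
    have := Rabs_pos (U1 a0); nra.
Qed.

Lemma TT_3PI : let r := Rpower 12 (1 / 4) in
  let z := - 8 * (74977 + 40284 * r + 21644 * r ^ 2 + 11629 * r ^ 3) in
  z < -1 /\ TT (3 * PI) = / z.
Proof.
  move=> r z; have HPI := PI_RGT_0.
  have [Hr _] := r_pow4; rewrite -/r in Hr.
  have Hz : z < -1.
    rewrite /z; have := pow_lt r 2 Hr; have := pow_lt r 3 Hr; lra.
  split=> //.
  have [E _] := triple_dual_values; rewrite -/r -/z in E.
  have HA := AA_pos (3 * PI) (ltac:(lra)).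
  have HB := BB_pos (3 * PI) (ltac:(lra)).
  have HC := CC_pos (3 * PI) (ltac:(lra)).
  rewrite /TT; apply: (Rmult_eq_reg_l (z * (4 * BB (3 * PI) * CC (3 * PI)))); last first.
    apply: Rlt_not_eq; have : 0 < 4 * BB (3 * PI) * CC (3 * PI) by nra.
    nra.
  transitivity (- (z * AA (3 * PI) ^ 2)); first by field; lra.
  rewrite E; field; lra.
Qed.

(** In terms of [exp (logmod a)], which increases with [a], the absolute value
    of [TT] is [1 / (4 u (1 + u))], so the bound at [3 PI] persists. *)
Lemma TT_lt1 a : 3 * PI <= a -> Rabs (TT a) < 1.
Proof.
  have HPI := PI_RGT_0; move=> Ha.
  have key x : 0 < x -> Rabs (TT x) = / (4 * exp (logmod x) * (1 + exp (logmod x))).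
    move=> Hx; have HA := AA_pos x Hx; have EB := exp_logmod x Hx; have He := exp_pos (logmod x).
    have EC : CC x = (1 + exp (logmod x)) * AA x by rewrite /AA in EB *; lra.
    rewrite /TT Rabs_Ropp EC EB Rabs_pos_eq; last by field; lra.
    apply: Rlt_le; apply: Rdiv_lt_0_compat; first by apply: pow_lt.
    apply: Rmult_lt_0_compat; last by apply: Rmult_lt_0_compat; lra.
    by apply: Rmult_lt_0_compat; [lra|apply: Rmult_lt_0_compat; lra].
  have H3 : Rabs (TT (3 * PI)) < 1.
    have [Hz ->] := TT_3PI; move: Hz; set z := _ * (_ + _) => Hz.
    rewrite Rabs_inv Rabs_left; first lra.
    rewrite -Rinv_1; apply: Rinv_lt_contravar; lra.
  have Hmon : exp (logmod (3 * PI)) <= exp (logmod a).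
    case: Ha => [Hlt|<-]; last lra.
    apply: Rlt_le; apply: exp_increasing.
    by apply: (pos_derive_increasing logmod CC is_derive_logmod CC_pos) => //; lra.
  rewrite key; first lra.
  rewrite key in H3; first lra.
  have He := exp_pos (logmod (3 * PI)).
  apply: Rle_lt_trans H3; apply: Rinv_le_contravar; nra.
Qed.

Lemma is_lim_V0 : is_lim V0 p_infty 0.
Proof.
  have LB : is_lim (fun a => BB a * CC a) p_infty 1.
    by have := is_lim_mult_fin _ _ _ _ _ is_lim_BB is_lim_CC; rewrite Rmult_1_l.
  apply: (is_lim_le_le_loc (fun a => - (8 * AA a)) (fun a => 8 * AA a)).
  - have LA := is_lim_AA.
    move/is_lim_spec: LB => /(_ (mkposreal (/ 2) (ltac:(lra)))) [M1 H1].
    move/is_lim_spec: LA => /(_ (mkposreal (/ 2) (ltac:(lra)))) [M2 H2].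
    exists (Rmax (Rmax M1 M2) 1) => a Ha.
    have K1 := Rmax_l (Rmax M1 M2) 1; have K2 := Rmax_r (Rmax M1 M2) 1.
    have K3 := Rmax_l M1 M2; have K4 := Rmax_r M1 M2.
    have {}H1 := H1 a (ltac:(lra)); have {}H2 := H2 a (ltac:(lra)).
    rewrite /= in H1; rewrite /= Rminus_0_r in H2.
    have Ha0 : 0 < a by lra.
    have HA := AA_pos a Ha0; have HB := BB_pos a Ha0; have HC := CC_pos a Ha0.
    have HA2 : AA a < / 2 by move: H2; rewrite Rabs_pos_eq; lra.
    have HBC : / 2 < BB a * CC a by move: H1; rewrite /Rabs; case: Rcase_abs; lra.
    have HT : Rabs (TT a) <= AA a ^ 2 / 2.
      rewrite /TT Rabs_Ropp Rabs_pos_eq.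
        apply: Rlt_le; apply: Rdiv_lt_0_compat; [exact: pow_lt|nra].
      apply: Rmult_le_compat_l; first by apply: pow_le; lra.
      apply: Rinv_le_contravar; lra.
    have HW := WW0_bound (TT a) (ltac:(nra)).
    have : Rabs (V0 a) <= 8 * AA a.
      rewrite /V0 Rabs_div; first lra.
      rewrite (Rabs_pos_eq (AA a)); first lra.
      apply: (Rmult_le_reg_r (AA a)) => //; rewrite /Rdiv Rmult_assoc Rinv_l; [lra|nra].
    rewrite /Rabs; case: Rcase_abs; lra.
  - rewrite -Ropp_0; apply: (is_lim_opp (fun a => 8 * AA a) p_infty 0).
    rewrite (_ : Finite 0 = Rbar_mult 8 0); first by rewrite /= Rmult_0_r.
    by apply: is_lim_scal_l; exact: is_lim_AA.
  - rewrite (_ : Finite 0 = Rbar_mult 8 0); first by rewrite /= Rmult_0_r.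
    by apply: is_lim_scal_l; exact: is_lim_AA.
Qed.

(** [V0 + 16 Hh 0] has third derivative zero and limit zero. *)
Lemma V_eq_Hh : V0 (3 * PI) = - 16 * Hh 0 (3 * PI) /\ V1 (3 * PI) = 16 * Hh 1 (3 * PI).
Proof.
  have HPI := PI_RGT_0.
  have [||||E0 E1] := zero_of_third_derivative (fun a => V0 a + 16 * Hh 0 a) (fun a => V1 a - 16 * Hh 1 a)
    (fun a => V2 a + 16 * Hh 2 a) (3 * PI).
  - move=> a Ha; have Ha0 : 0 < a by lra.
    apply: is_derive_eq (is_derive_plus _ _ _ _ _ (is_derive_V0 a Ha0 (TT_lt1 a Ha))
      (is_derive_scal _ _ 16 _ (is_derive_Hh 0 a Ha0))) _.
    rewrite /plus /=; ring.
  - move=> a Ha; have Ha0 : 0 < a by lra.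
    apply: is_derive_eq (is_derive_minus _ _ _ _ _ (is_derive_V1 a Ha0 (TT_lt1 a Ha))
      (is_derive_scal _ _ 16 _ (is_derive_Hh 1 a Ha0))) _.
    rewrite /minus /plus /opp /=; ring.
  - move=> a Ha; have Ha0 : 0 < a by lra.
    apply: is_derive_eq (is_derive_plus _ _ _ _ _ (is_derive_V2 a Ha0 (TT_lt1 a Ha))
      (is_derive_scal _ _ 16 _ (is_derive_Hh 2 a Ha0))) _.
    rewrite /plus /= CC2_BB2 //; ring.
  - rewrite [X in Finite X](_ : 0 = 0 + 16 * 0); first ring.
    apply: is_lim_plus'; first exact: is_lim_V0.
    apply: (is_lim_scal_l (Hh 0) 16 p_infty 0).
    have [K HK] := Hh_tail; exact: is_lim_exp_tail HK.
  split; lra.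
Qed.

(** With [triple_dual_values], the combination [a WW 0 - b WW 1] at [1 / z] is a
    combination of [V0] and [V1] at [3 PI]. *)
Theorem hypergeometric_side :
  let r := Rpower 12 (1 / 4) in
  let z := - 8 * (74977 + 40284 * r + 21644 * r ^ 2 + 11629 * r ^ 3) in
  let a := 1 / 18 * (1038 + 558 * r + 300 * r ^ 2 + 161 * r ^ 3) in
  let b := 1 / 3 * (387 + 208 * r + 112 * r ^ 2 + 60 * r ^ 3) in
  a * WW 0 (/ z) - b * WW 1 (/ z) = 16 / (9 * PI) * (Hh 0 (3 * PI) + 3 * PI * Hh 1 (3 * PI)).
Proof.
  move=> r z a b; have HPI := PI_RGT_0.
  have [_ ET] := TT_3PI; rewrite -/r -/z in ET.
  have [_ [Eb Ea]] := triple_dual_values; rewrite -/r -/a -/b in Ea Eb.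
  have [E0 E1] := V_eq_Hh; rewrite /V0 ET in E0; rewrite /V1 ET in E1.
  have HA := AA_pos (3 * PI) (ltac:(lra)).
  have HB := BB_pos (3 * PI) (ltac:(lra)).
  have HC := CC_pos (3 * PI) (ltac:(lra)).
  set A := AA (3 * PI) in E0 E1 Ea Eb HA; set K := kap (3 * PI) in E1 Ea.
  set S := BB (3 * PI) + CC (3 * PI) in E1 Eb.
  have HS : 0 < S by rewrite /S; lra.
  set H0 := Hh 0 (3 * PI) in E0 *; set H1 := Hh 1 (3 * PI) in E1 *.
  have F0 : WW 0 (/ z) = - 16 * A * H0.
    have -> : WW 0 (/ z) = A * (WW 0 (/ z) / A) by field; lra.
    by rewrite E0; ring.
  have F1 : S * WW 1 (/ z) = K * (- 16 * A * H0) - 16 * A * H1.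
    have : K * WW 0 (/ z) - S * WW 1 (/ z) = A * ((K * WW 0 (/ z) - S * WW 1 (/ z)) / A) by field; lra.
    rewrite E1 F0; lra.
  have F2 : b * WW 1 (/ z) = S * WW 1 (/ z) / (3 * A) by rewrite -Eb; field; lra.
  have F3 : a * A = (PI * K - 1 / 3) / (3 * PI) by rewrite -Ea; field; lra.
  rewrite F2 F1 F0 (_ : a * (- 16 * A * H0) = - 16 * H0 * (a * A)); first ring.
  rewrite F3; field; lra.
Qed.


(** * Partial fractions from the Dirichlet kernel *)

(** The Dirichlet kernel, and below its primitive [RK] that vanishes at [PI]. *)
Fixpoint DK (N : nat) (th : R) : R :=
  match N with O => 1 | S n => DK n th + 2 * cos (INR (S n) * th) end.

Fixpoint RK (N : nat) (th : R) : R :=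
  match N with O => th - PI | S n => RK n th + 2 * sin (INR (S n) * th) / INR (S n) end.

Lemma DK_sin N th : DK N th * sin (th / 2) = sin ((INR N + / 2) * th).
Proof.
  elim: N => [|N IH]; first by rewrite /= Rmult_1_l; congr sin; field.
  rewrite [DK _ _]/= -/(INR (S N)) Rmult_plus_distr_r IH.
  have E u v : 2 * cos u * sin v = sin (u + v) - sin (u - v) by rewrite sin_plus sin_minus; ring.
  rewrite E S_INR (_ : (INR N + 1) * th - th / 2 = (INR N + / 2) * th); first by field.
  rewrite (_ : (INR N + 1) * th + th / 2 = (INR N + 1 + / 2) * th); [by field|ring].
Qed.

Lemma is_derive_sin_freq q t : q <> 0 -> is_derive (fun t => 2 * sin (q * t) / q) t (2 * cos (q * t)).
Proof. by move=> Hq; auto_derive => //; field. Qed.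

Lemma is_derive_cos_freq q t : q <> 0 ->
  is_derive (fun t => 2 * cos (q * t) / q ^ 2) t (- (2 * sin (q * t) / q)).
Proof. by move=> Hq; auto_derive => //; field. Qed.

Lemma is_derive_RK N th : is_derive (RK N) th (DK N th).
Proof.
  elim: N => [|N IH]; first by rewrite /RK /DK; auto_derive => //; ring.
  have HN : INR (S N) <> 0 by apply: not_0_INR.
  have D : is_derive (fun t => 2 * sin (INR (S N) * t) / INR (S N)) th (2 * cos (INR (S N) * th)).
    exact: is_derive_sin_freq.
  exact: (is_derive_plus _ _ _ _ _ IH D).
Qed.

Lemma RK_PI N : RK N PI = 0.
Proof.
  elim: N => [|N IH]; first by rewrite /=; ring.
  rewrite [RK _ _]/= -/(INR (S N)) IH INR_IZR_INZ sin_IZR_PI; rewrite /Rdiv; ring.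
Qed.

Lemma RK_0 N : RK N 0 = - PI.
Proof.
  elim: N => [|N IH]; first by rewrite /=; ring.
  rewrite [RK _ _]/= -/(INR (S N)) IH Rmult_0_r sin_0; rewrite /Rdiv; ring.
Qed.

Lemma mono_decr (f f' : R -> R) x y : x <= y ->
  (forall t, x <= t <= y -> is_derive f t (f' t)) -> (forall t, x <= t <= y -> f' t <= 0) -> f y <= f x.
Proof.
  move=> Hxy H1 H2; have [||z [Hz E]] := MVT_gen f x y f'.
  - move=> t; rewrite Rmin_left // Rmax_right // => Ht; apply: H1; lra.
  - move=> t; rewrite Rmin_left // Rmax_right // => Ht; exact: is_derive_continuity_pt (H1 t Ht).
  rewrite Rmin_left // Rmax_right // in Hz.
  have := H2 z Hz; nra.
Qed.

Lemma half_sin_lower th : 0 <= th <= PI -> th / 4 <= sin (th / 2).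
Proof.
  move=> Hth; set v := th / 4.
  have Hv : 0 <= v <= PI / 4 by rewrite /v; lra.
  have HPI := PI_RGT_0.
  have Hs : v * cos v <= sin v.
    have := mono_decr (fun t => t * cos t - sin t) (fun t => - (t * sin t)) 0 v (proj1 Hv).
    rewrite sin_0 Rmult_0_l Rminus_0_r => H.
    have {}H : v * cos v - sin v <= 0; last lra.
    apply: H => t Ht; first by auto_derive => //; ring.
    have : 0 <= sin t by apply: sin_ge_0; lra.
    nra.
  have Hc : 0 <= cos v by apply: cos_ge_0; lra.
  have Hc2 : 0 <= cos (2 * v) by apply: cos_ge_0; lra.
  have E := cos_2a_cos v.
  rewrite (_ : th / 2 = 2 * v); first by rewrite /v; field.
  rewrite sin_2a; nra.
Qed.

Lemma half_sin_pos th : 0 < th <= PI -> 0 < sin (th / 2).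
Proof. move=> Hth; have := half_sin_lower th; lra. Qed.

Lemma cos_half_odd N : cos ((INR N + / 2) * PI) = 0.
Proof.
  rewrite Rmult_plus_distr_r cos_plus INR_IZR_INZ sin_IZR_PI (_ : / 2 * PI = PI / 2); first by field.
  rewrite cos_PI2; ring.
Qed.

(** Integration by parts, carried out on primitives: the oscillating integral
    of [1 / sin (th / 2)] is bounded by its monotone weight. *)
Lemma RK_bound N th : 0 < th <= PI -> Rabs (RK N th) <= 2 / ((INR N + / 2) * sin (th / 2)).
Proof.
  move=> Hth; set M := INR N + / 2.
  have HM : 0 < M by rewrite /M; have := pos_INR N; lra.
  have HPI := PI_RGT_0.
  pose Psi t := / (M * sin (t / 2)).
  pose Phi t := RK N t + cos (M * t) / (M * sin (t / 2)).
  have DPsi t : 0 < t <= PI -> is_derive Psi t (- (cos (t / 2) / (2 * M * sin (t / 2) ^ 2))).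
    move=> Ht; have Hs := half_sin_pos t Ht.
    rewrite /Psi; auto_derive; first by apply: Rgt_not_eq; apply: Rmult_lt_0_compat.
    by rewrite /Rdiv; field; lra.
  have DPhi t : 0 < t <= PI -> is_derive Phi t (- (cos (M * t) * cos (t / 2) / (2 * M * sin (t / 2) ^ 2))).
    move=> Ht; have Hs := half_sin_pos t Ht.
    have D1 : is_derive (fun t => cos (M * t) / (M * sin (t / 2))) t
       (- sin (M * t) / sin (t / 2) - cos (M * t) * cos (t / 2) / (2 * M * sin (t / 2) ^ 2)).
      auto_derive; first by apply: Rgt_not_eq; apply: Rmult_lt_0_compat.
      by rewrite /Rdiv; field; lra.
    apply: is_derive_eq (is_derive_plus _ _ _ _ _ (is_derive_RK N t) D1) _.
    rewrite /plus /= (_ : DK N t = sin (M * t) / sin (t / 2)); last by field; lra.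
    by rewrite -DK_sin; field; lra.
  have P1 : Phi PI = 0.
    rewrite /Phi RK_PI /M cos_half_odd; rewrite /Rdiv; ring.
  have P2 : Psi PI = / M.
    by rewrite /Psi sin_PI2 Rmult_1_r.
  have W t : 0 < t <= PI -> 0 <= cos (t / 2) / (2 * M * sin (t / 2) ^ 2).
    move=> Ht; have Hs := half_sin_pos t Ht.
    apply: Rmult_le_pos; first by apply: cos_ge_0; lra.
    apply: Rlt_le; apply: Rinv_0_lt_compat; apply: Rmult_lt_0_compat; [lra|exact: pow_lt].
  have B1 : Phi th <= Psi th - / M.
    have := mono_decr (fun t => Psi t - Phi t) (fun t => - (cos (t / 2) / (2 * M * sin (t / 2) ^ 2)) * (1 - cos (M * t))) th PI (proj2 Hth).
    rewrite P1 P2 => H; have : / M - 0 <= Psi th - Phi th; last lra.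
    apply: H => t Ht.
    - apply: is_derive_eq (is_derive_minus _ _ _ _ _ (DPsi t _) (DPhi t _)) _; try lra.
      rewrite /minus /plus /opp /=; rewrite /Rdiv; ring.
    - have := W t (ltac:(lra)); have := COS_bound (M * t); nra.
  have B2 : - Phi th <= Psi th - / M.
    have := mono_decr (fun t => Psi t + Phi t) (fun t => - (cos (t / 2) / (2 * M * sin (t / 2) ^ 2)) * (1 + cos (M * t))) th PI (proj2 Hth).
    rewrite P1 P2 => H; have : / M + 0 <= Psi th + Phi th; last lra.
    apply: H => t Ht.
    - apply: is_derive_eq (is_derive_plus _ _ _ _ _ (DPsi t _) (DPhi t _)) _; try lra.
      rewrite /plus /=; rewrite /Rdiv; ring.
    - have := W t (ltac:(lra)); have := COS_bound (M * t); nra.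
  have HiM : 0 < / M by apply: Rinv_0_lt_compat.
  have E : RK N th = Phi th - cos (M * th) * Psi th by rewrite /Phi /Psi; rewrite /Rdiv; ring.
  have HPsi : 0 < Psi th.
    by apply: Rinv_0_lt_compat; apply: Rmult_lt_0_compat => //; apply: half_sin_pos.
  rewrite (_ : 2 / (M * sin (th / 2)) = 2 * Psi th) // E.
  have := COS_bound (M * th) => Hc; apply: Rabs_le; nra.
Qed.

Lemma inv_half_lim C : is_lim_seq (fun N => C / (INR N + / 2)) 0.
Proof.
  rewrite (_ : Finite 0 = Rbar_mult C 0); first by rewrite /= Rmult_0_r.
  apply: (is_lim_seq_scal_l (fun N => / (INR N + / 2)) C 0).
  apply: (is_lim_seq_inv _ p_infty) => //.
  apply: (is_lim_seq_plus _ _ p_infty (/ 2)) => //; [exact: is_lim_seq_INR|exact: is_lim_seq_const].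
Qed.

Lemma lim_of_bound (s : nat -> R) l C :
  (forall N, Rabs (s N - l) <= C / (INR N + / 2)) -> is_lim_seq s l.
Proof.
  move=> H; have L := inv_half_lim C.
  apply: (is_lim_seq_le_le (fun N => l - C / (INR N + / 2)) s (fun N => l + C / (INR N + / 2))).
  - move=> N; have := H N; rewrite /Rabs; case: Rcase_abs; lra.
  - rewrite [X in Finite X](_ : l = l - 0); first ring.
    by apply: is_lim_seq_minus'; [exact: is_lim_seq_const|].
  - rewrite [X in Finite X](_ : l = l + 0); first ring.
    by apply: is_lim_seq_plus'; [exact: is_lim_seq_const|].
Qed.

Fixpoint sym_partial (J : Z -> R -> R) (N : nat) (t : R) : R :=
  match N with O => J 0%Z t | S n => sym_partial J n t + 2 * J (Z.of_nat (S n)) t end.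

Lemma sym_partial_S J N t :
  sym_partial J (S N) t = sym_partial J N t + 2 * J (Z.of_nat (S N)) t.
Proof. by []. Qed.

(** Pointwise convergence at the origin of the cosine series of [g], the
    coefficients being presented through primitives [J].  The hypothesis on
    [g1] compensates the singularity of [RK_bound] at the origin. *)
Lemma cosine_series_at_0 (g g1 : R -> R) (J : Z -> R -> R) (F : Z -> R) K :
  (forall t, 0 <= t <= PI -> is_derive g t (g1 t)) ->
  (forall t, 0 <= t <= PI -> Rabs (g1 t) <= K * t) ->
  (forall m t, is_derive (J m) t (g t * cos (IZR m * t))) ->
  (forall m, J m PI - J m 0 = F m) -> (forall m, F (- m)%Z = F m) ->
  summable F -> tsum F = PI * g 0.
Proof.
  move=> Hg HK HJ HF HE HS; have HPI := PI_RGT_0.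
  pose JJ := sym_partial J.
  have DJ N t : is_derive (JJ N) t (g t * DK N t).
    elim: N => [|N IH].
      apply: is_derive_eq (HJ 0%Z t) _; rewrite Rmult_0_l cos_0 /=; ring.
    apply: is_derive_eq (is_derive_plus _ _ _ _ _ IH (is_derive_scal _ _ 2 _ (HJ (Z.of_nat (S N)) t))) _.
    rewrite /plus [DK (S N) t]/= -/(INR (S N)) -INR_IZR_INZ /=; ring.
  have EJ N : JJ N PI - JJ N 0 = list_sum F (zball N).
    elim: N => [|N IH]; first by rewrite /list_sum /= HF; ring.
    have -> : zball (S N) = (Z.of_nat (S N) :: - Z.of_nat (S N) :: zball N)%Z by [].
    rewrite !list_sum_cons -IH HE -(HF (Z.of_nat (S N))) /JJ !sym_partial_S; ring.
  have HKp : 0 <= K.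
    have := HK PI (ltac:(lra)); have := Rabs_pos (g1 PI); nra.
  have B N : Rabs (list_sum F (zball N) - PI * g 0) <= (8 * K * PI) / (INR N + / 2).
    have HN : 0 < INR N + / 2 by have := pos_INR N; lra.
    rewrite -EJ.
    have [||z [Hz E]] := MVT_gen (fun t => JJ N t - g t * RK N t) 0 PI (fun t => - (g1 t * RK N t)).
    - move=> t; rewrite Rmin_left ?Rmax_right; try lra.
      move=> Ht.
      apply: is_derive_eq (is_derive_minus _ _ _ _ _ (DJ N t)
        (is_derive_mult _ _ _ _ _ (Hg t _) (is_derive_RK N t) (fun _ _ => Rmult_comm _ _))) _; first lra.
      rewrite /minus /plus /opp /mult /=; ring.
    - move=> t; rewrite Rmin_left ?Rmax_right; try lra.
      move=> Ht; apply: is_derive_continuity_pt.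
      apply: (is_derive_minus _ _ _ _ _ (DJ N t)
        (is_derive_mult _ _ _ _ _ (Hg t Ht) (is_derive_RK N t) (fun _ _ => Rmult_comm _ _))).
    rewrite Rmin_left ?Rmax_right in Hz; try lra.
    rewrite RK_PI RK_0 in E.
    rewrite (_ : JJ N PI - JJ N 0 - PI * g 0 = - (g1 z * RK N z) * (PI - 0)); first lra.
    rewrite Rminus_0_r Rabs_mult Rabs_Ropp (Rabs_pos_eq PI); first lra.
    rewrite (_ : 8 * K * PI / (INR N + / 2) = 8 * K / (INR N + / 2) * PI); first by field; lra.
    apply: Rmult_le_compat_r; first lra.
    rewrite Rabs_mult; have [Hz0|Hz0] : z = 0 \/ 0 < z by lra.
      have := HK z Hz; rewrite Hz0 Rmult_0_r => H0.
      have -> : Rabs (g1 0) = 0 by have := Rabs_pos (g1 0); lra.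
      rewrite Rmult_0_l; apply: Rmult_le_pos; first lra.
      by apply: Rlt_le; apply: Rinv_0_lt_compat.
    have Hs := half_sin_lower z Hz; have Hs0 := half_sin_pos z (ltac:(lra)).
    have HR := RK_bound N z (ltac:(lra)).
    apply: (Rle_trans _ ((K * z) * (2 / ((INR N + / 2) * sin (z / 2))))).
      by apply: Rmult_le_compat; try exact: Rabs_pos => //; [exact: HK|exact: HR].
    apply: (Rmult_le_reg_r ((INR N + / 2) * sin (z / 2))); first exact: Rmult_lt_0_compat.
    rewrite (_ : K * z * _ * _ = 2 * K * z); first by field; lra.
    rewrite (_ : 8 * K / _ * _ = 8 * K * sin (z / 2)); first by field; lra.
    have := Rmult_le_compat_l K _ _ HKp Hs; lra.
  have L1 := lim_of_bound _ _ _ B.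
  have L2 := is_sum_Z_lim _ _ (tsum_is_sum _ HS).
  have := is_lim_seq_unique _ _ L1; rewrite (is_lim_seq_unique _ _ L2).
  by move=> [].
Qed.

Lemma cosh_le u v : 0 <= u <= v -> cosh u <= cosh v.
Proof.
  move=> [Hu Huv].
  have := mono_decr (fun t => - cosh t) (fun t => - sinh t) u v Huv.
  move=> H; have : - cosh v <= - cosh u; last lra.
  apply: H => t Ht; first by auto_derive => //; ring.
  have := sinh_nonneg t; lra.
Qed.

Lemma sinh_le u : 0 <= u -> sinh u <= u * cosh u.
Proof.
  move=> Hu.
  have := mono_decr (fun t => sinh t - t * cosh t) (fun t => - (t * sinh t)) 0 u Hu.
  rewrite sinh_0 Rmult_0_l Rminus_0_r => H.
  have {}H : sinh u - u * cosh u <= 0; last lra.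
  apply: H => t Ht; first by auto_derive => //; ring.
  have := sinh_nonneg t (proj1 Ht); nra.
Qed.

(** ** Summability of inverse squares *)

Lemma summable_inv_sq : summable (fun n : nat => / (INR n + 1) ^ 2).
Proof.
  exists 2 => F HF.
  have Hp n : 0 < / (INR n + 1) ^ 2.
    by apply: Rinv_0_lt_compat; apply: pow_lt; have := pos_INR n; lra.
  have [N HN] : exists N, forall x, In x F -> (x <= N)%nat.
    exists (list_max F) => x Hx.
    have := proj1 (list_max_le F (list_max F)) (Nat.le_refl _).
    by move=> /Forall_forall /(_ x Hx).
  apply: (Rle_trans _ (list_sum (fun n => / (INR n + 1) ^ 2) (seq 0 (S N)))).
    rewrite (list_sum_ext _ (fun n => / (INR n + 1) ^ 2)).
      by move=> x _; rewrite Rabs_pos_eq //; apply: Rlt_le.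
    apply: list_sum_incl => //; first by move=> x; apply: Rlt_le.
    move=> x Hx; apply/in_seq; have := HN x Hx; lia.
  have : list_sum (fun n => / (INR n + 1) ^ 2) (seq 0 (S N)) <= 2 - / (INR N + 1).
    elim: N {HN} => [|N IH]; first by rewrite /list_sum /=; lra.
    rewrite seq_S list_sum_app list_sum_cons (_ : list_sum _ nil = 0) // Nat.add_0_l S_INR.
    have HN := pos_INR N.
    have : / (INR N + 1) - / (INR N + 1 + 1) - / (INR N + 1 + 1) ^ 2 = / ((INR N + 1) * (INR N + 1 + 1) ^ 2).
      by field; lra.
    have : 0 < / ((INR N + 1) * (INR N + 1 + 1) ^ 2).
      by apply: Rinv_0_lt_compat; apply: Rmult_lt_0_compat; [lra|apply: pow_lt; lra].
    lra.
  have : 0 < / (INR N + 1) by apply: Rinv_0_lt_compat; have := pos_INR N; lra.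
  lra.
Qed.

Lemma summable_Z_inv_sq : summable (fun n : Z => / (1 + IZR n ^ 2)).
Proof.
  apply: (summable_Z _ (fun n => 2 * / (INR n + 1) ^ 2)); last first.
    by apply: summable_scal; exact: summable_inv_sq.
  move=> n; rewrite -(pow2_abs (IZR n)) Rabs_IZR_nat.
  have Hn := pos_INR (Z.abs_nat n); set x := INR (Z.abs_nat n) in Hn *.
  have H1 : 0 < 1 + x ^ 2 by nra.
  rewrite Rabs_pos_eq; first by apply: Rlt_le; apply: Rinv_0_lt_compat.
  apply: (Rmult_le_reg_r ((1 + x ^ 2) * (x + 1) ^ 2)); first by apply: Rmult_lt_0_compat => //; apply: pow_lt; lra.
  rewrite (_ : / (1 + x ^ 2) * _ = (x + 1) ^ 2); first by field; lra.
  rewrite (_ : 2 * / (x + 1) ^ 2 * _ = 2 * (1 + x ^ 2)); first by field; lra.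
  have := pow2_ge_0 (x - 1); nra.
Qed.

Lemma summable_inv_shift x : 0 < x -> summable (fun n : Z => / (x ^ 2 + IZR n ^ 2)).
Proof.
  move=> Hx; have Hx2 : 0 < x ^ 2 by apply: pow_lt.
  apply: summable_le (summable_scal (1 + / x ^ 2) _ summable_Z_inv_sq) => n.
  have Hn : 0 <= IZR n ^ 2 by apply: pow2_ge_0.
  rewrite Rabs_pos_eq; first by apply: Rlt_le; apply: Rinv_0_lt_compat; lra.
  apply: (Rmult_le_reg_r ((x ^ 2 + IZR n ^ 2) * (1 + IZR n ^ 2))); first by apply: Rmult_lt_0_compat; lra.
  rewrite (_ : / (x ^ 2 + IZR n ^ 2) * _ = 1 + IZR n ^ 2); first by field; lra.
  have Hi : 0 < / x ^ 2 by apply: Rinv_0_lt_compat.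
  rewrite (_ : _ * _ = x ^ 2 + IZR n ^ 2 + 1 + / x ^ 2 * IZR n ^ 2); last nra.
  by field; lra.
Qed.

(** ** The cosecant expansions *)

(** The cosine series of [cosh (x t)] at the origin. *)
Lemma csch_expansion x : 0 < x ->
  tsum (fun n => cos (IZR n * PI) / (x ^ 2 + IZR n ^ 2)) = PI / (x * sinh (PI * x)).
Proof.
  move=> Hx; have HPI := PI_RGT_0.
  have Hs : 0 < sinh (PI * x) by apply: sinh_pos; apply: Rmult_lt_0_compat.
  have Hd m : 0 < x ^ 2 + IZR m ^ 2.
    have := pow_lt x 2 Hx; have := pow2_ge_0 (IZR m); lra.
  have HS : summable (fun n => cos (IZR n * PI) / (x ^ 2 + IZR n ^ 2)).
    apply: summable_le (summable_inv_shift x Hx) => n.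
    rewrite Rabs_mult Rabs_inv (Rabs_pos_eq (x ^ 2 + _)); first by apply: Rlt_le.
    rewrite -[X in _ <= X]Rmult_1_l; apply: Rmult_le_compat_r; last exact: Rabs_cos_le.
    by apply: Rlt_le; apply: Rinv_0_lt_compat.
  have := cosine_series_at_0 (fun t => cosh (x * t)) (fun t => x * sinh (x * t))
    (fun m t => (x * sinh (x * t) * cos (IZR m * t) + IZR m * cosh (x * t) * sin (IZR m * t)) / (x ^ 2 + IZR m ^ 2))
    (fun m => (x * sinh (PI * x)) * (cos (IZR m * PI) / (x ^ 2 + IZR m ^ 2)))
    (x * (x * cosh (x * PI))).
  rewrite Rmult_0_r cosh_0 Rmult_1_r tsum_scal // => H.
  apply: (Rmult_eq_reg_l (x * sinh (PI * x))); last by apply: Rgt_not_eq; apply: Rmult_lt_0_compat.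
  rewrite H.
  - by move=> t _; auto_derive => //; ring.
  - move=> t Ht; have Hxt : 0 <= x * t by nra.
    have Hsn := sinh_nonneg _ Hxt.
    rewrite Rabs_pos_eq; first by apply: Rmult_le_pos; lra.
    rewrite Rmult_assoc; apply: Rmult_le_compat_l; first lra.
    apply: Rle_trans (sinh_le _ Hxt) _.
    have := cosh_le (x * t) (x * PI) (ltac:(nra)); have := cosh_pos (x * t); nra.
  - move=> m t; have Hm := Hd m; auto_derive => //; field; lra.
  - move=> m; have Hm := Hd m.
    rewrite sin_IZR_PI !Rmult_0_r sin_0 sinh_0 (Rmult_comm x PI); field; lra.
  - move=> m; rewrite opp_IZR Ropp_mult_distr_l_reverse cos_neg.
    by rewrite (_ : (- IZR m) ^ 2 = IZR m ^ 2); first ring.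
  - exact: summable_scal.
  - by field; lra.
Qed.

(** The cosine series of [t sinh (x t)], which vanishes at the origin; its
    coefficients combine the first and the second powers. *)
Lemma csch_expansion_sq x : 0 < x ->
  tsum (fun n => cos (IZR n * PI) / (x ^ 2 + IZR n ^ 2) ^ 2) =
  PI / (2 * x ^ 3 * sinh (PI * x)) + PI ^ 2 * cosh (PI * x) / (2 * x ^ 2 * sinh (PI * x) ^ 2).
Proof.
  move=> Hx; have HPI := PI_RGT_0.
  have Hs : 0 < sinh (PI * x) by apply: sinh_pos; apply: Rmult_lt_0_compat.
  have Hx2 := pow_lt x 2 Hx.
  have Hd m : 0 < x ^ 2 + IZR m ^ 2.
    have := pow2_ge_0 (IZR m); lra.
  have HS : summable (fun n => cos (IZR n * PI) / (x ^ 2 + IZR n ^ 2)).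
    apply: summable_le (summable_inv_shift x Hx) => n.
    rewrite Rabs_mult Rabs_inv (Rabs_pos_eq (x ^ 2 + _)); first by apply: Rlt_le.
    rewrite -[X in _ <= X]Rmult_1_l; apply: Rmult_le_compat_r; last exact: Rabs_cos_le.
    by apply: Rlt_le; apply: Rinv_0_lt_compat.
  have HS2 : summable (fun n => cos (IZR n * PI) / (x ^ 2 + IZR n ^ 2) ^ 2).
    apply: summable_le (summable_scal (/ x ^ 2) _ (summable_abs _ HS)) => n.
    have Hn := Hd n; have Hi := Rinv_0_lt_compat _ Hn.
    rewrite (_ : _ / _ ^ 2 = / (x ^ 2 + IZR n ^ 2) * (cos (IZR n * PI) / (x ^ 2 + IZR n ^ 2))); first by field; lra.
    rewrite Rabs_mult; apply: Rmult_le_compat_r; first exact: Rabs_pos.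
    rewrite Rabs_pos_eq; first lra.
    apply: Rinv_le_contravar => //; have := pow2_ge_0 (IZR n); lra.
  set s := sinh (PI * x) in Hs *; set c := cosh (PI * x).
  have Hc : 0 < c by exact: cosh_pos.
  have := cosine_series_at_0 (fun t => t * sinh (x * t)) (fun t => sinh (x * t) + x * t * cosh (x * t))
    (fun m t => (sinh (x * t) * cos (IZR m * t) + x * t * cosh (x * t) * cos (IZR m * t)
                 + IZR m * t * sinh (x * t) * sin (IZR m * t)) / (x ^ 2 + IZR m ^ 2)
      - 2 * x * (x * sinh (x * t) * cos (IZR m * t) + IZR m * cosh (x * t) * sin (IZR m * t)) / (x ^ 2 + IZR m ^ 2) ^ 2)
    (fun m => (s + x * PI * c) * (cos (IZR m * PI) / (x ^ 2 + IZR m ^ 2))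
       - 2 * x ^ 2 * s * (cos (IZR m * PI) / (x ^ 2 + IZR m ^ 2) ^ 2))
    (2 * x * cosh (x * PI)).
  rewrite tsum_minus; [exact: summable_scal|exact: summable_scal|].
  rewrite !tsum_scal // csch_expansion // -/s => H.
  have {}H : (s + x * PI * c) * (PI / (x * s)) - 2 * x ^ 2 * s * tsum (fun n => cos (IZR n * PI) / (x ^ 2 + IZR n ^ 2) ^ 2) = 0.
    rewrite H; last ring.
    - by move=> t _; auto_derive => //; ring.
    - move=> t Ht; have Hxt : 0 <= x * t by nra.
      have Hsn := sinh_nonneg _ Hxt; have Hcp := cosh_pos (x * t).
      have H1 := sinh_le _ Hxt.
      have H2 := cosh_le (x * t) (x * PI) (ltac:(nra)).
      rewrite Rabs_pos_eq; first nra.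
      nra.
    - move=> m t; have Hm := Hd m; auto_derive => //; field; lra.
    - move=> m; have Hm := Hd m.
      rewrite sin_IZR_PI !Rmult_0_r sin_0 sinh_0 (Rmult_comm x PI) -/s -/c; field; lra.
    - move=> m; rewrite opp_IZR Ropp_mult_distr_l_reverse cos_neg.
      by rewrite (_ : (- IZR m) ^ 2 = IZR m ^ 2); first ring.
    - by apply: summable_minus; apply: summable_scal.
  apply: (Rmult_eq_reg_l (2 * x ^ 2 * s)); last by apply: Rgt_not_eq; nra.
  rewrite (_ : _ * tsum _ = (s + x * PI * c) * (PI / (x * s))); first lra.
  field; lra.
Qed.

(** ** Sums of cosines over squares *)

Fixpoint PK (N : nat) (t : R) : R :=
  match N with O => t ^ 2 / 2 - PI * t | S n => PK n t - 2 * cos (INR (S n) * t) / INR (S n) ^ 2 end.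

(** [PK] is a primitive of [RK], which tends to zero uniformly on [al, be]. *)
Lemma cos_series_sq al be : 0 < al -> al <= be -> be <= PI ->
  tsum (fun n : nat => (cos (INR (S n) * al) - cos (INR (S n) * be)) / INR (S n) ^ 2) =
  (PI * (be - al) - (be ^ 2 - al ^ 2) / 2) / 2.
Proof.
  move=> Hal Hab Hbe.
  have HS : summable (fun n : nat => (cos (INR (S n) * al) - cos (INR (S n) * be)) / INR (S n) ^ 2).
    apply: summable_le (summable_scal 2 _ summable_inv_sq) => n.
    rewrite S_INR Rabs_mult Rabs_inv (Rabs_pos_eq ((INR n + 1) ^ 2)); first exact: pow2_ge_0.
    apply: Rmult_le_compat_r.
      by apply: Rlt_le; apply: Rinv_0_lt_compat; apply: pow_lt; have := pos_INR n; lra.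
    apply: Rabs_le; have := COS_bound ((INR n + 1) * al); have := COS_bound ((INR n + 1) * be); lra.
  have DP N t : is_derive (PK N) t (RK N t).
    elim: N => [|N IH]; first by rewrite /RK /PK; auto_derive => //; field.
    have HN : INR (S N) <> 0 by apply: not_0_INR.
    have D : is_derive (fun t => 2 * cos (INR (S N) * t) / INR (S N) ^ 2) t (- (2 * sin (INR (S N) * t) / INR (S N))).
      exact: is_derive_cos_freq.
    apply: is_derive_eq (is_derive_minus _ _ _ _ _ IH D) _.
    rewrite /minus /plus /opp [RK (S N) t]/= -/(INR (S N)); rewrite /=; ring.
  have EP N : PK N be - PK N al = (be ^ 2 - al ^ 2) / 2 - PI * (be - al) +
     2 * sum_n (fun n => match n with O => 0 | S k => (cos (INR (S k) * al) - cos (INR (S k) * be)) / INR (S k) ^ 2 end) N.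
    elim: N => [|N IH]; first by rewrite sum_O /=; field.
    rewrite sum_Sn (_ : forall x y : R, plus x y = x + y) // [PK (S N) be]/= [PK (S N) al]/= -/(INR (S N)).
    set q := INR (S N).
    rewrite (_ : PK N be - 2 * cos (q * be) / q ^ 2 - (PK N al - 2 * cos (q * al) / q ^ 2) =
       (PK N be - PK N al) + 2 * ((cos (q * al) - cos (q * be)) / q ^ 2)); first by rewrite /Rdiv; ring.
    rewrite IH; cbv iota beta; rewrite -/q /Rdiv; ring.
  have B N : Rabs ((PK N be - PK N al) - 0) <= (8 / al * (be - al)) / (INR N + / 2).
    have HN : 0 < INR N + / 2 by have := pos_INR N; lra.
    have [||z [Hz E]] := MVT_gen (PK N) al be (RK N).
    - by move=> t _; apply: DP.
    - by move=> t _; exact: is_derive_continuity_pt (DP N t).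
    rewrite Rmin_left ?Rmax_right in Hz; try lra.
    rewrite Rminus_0_r E Rabs_mult (Rabs_pos_eq (be - al)); first lra.
    rewrite (_ : _ / (INR N + / 2) = (8 / (al * (INR N + / 2))) * (be - al)); first by field; lra.
    apply: Rmult_le_compat_r; first lra.
    apply: Rle_trans (RK_bound N z (ltac:(lra))) _.
    have Hs := half_sin_lower z (ltac:(lra)); have Hs0 := half_sin_pos z (ltac:(lra)).
    apply: (Rmult_le_reg_r (al * ((INR N + / 2) * sin (z / 2)))).
      by apply: Rmult_lt_0_compat => //; apply: Rmult_lt_0_compat.
    rewrite (_ : 2 / _ * _ = 2 * al); first by field; lra.
    rewrite (_ : 8 / _ * _ = 8 * sin (z / 2)); first by field; lra.
    lra.
  have L1 := lim_of_bound _ _ _ B.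
  set T := tsum _.
  have L2 : is_lim_seq (fun N => PK N be - PK N al) ((be ^ 2 - al ^ 2) / 2 - PI * (be - al) + 2 * T).
    apply: (is_lim_seq_ext _ _ _ (fun N => eq_sym (EP N))).
    apply: is_lim_seq_plus'; first exact: is_lim_seq_const.
    apply: (is_lim_seq_scal_l _ 2 T).
    have G : is_series (fun n => match n with O => 0 | S k => (cos (INR (S k) * al) - cos (INR (S k) * be)) / INR (S k) ^ 2 end) T.
      apply: (is_series_decr_1 (V := R_NormedModule)).
      rewrite (_ : plus T _ = T); first by rewrite /plus /opp /=; ring.
      by apply: is_sum_series; apply: tsum_is_sum.
    exact: G.
  have := is_lim_seq_unique _ _ L1; rewrite (is_lim_seq_unique _ _ L2).
  by move=> [] ?; lra.
Qed.


(** * Sums of two squares *)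

Definition gauss (a : R) (n : Z) : R := exp (- a * IZR n ^ 2).
Definition th3 (a : R) : R := tsum (gauss a).
Definition th4 (a : R) : R := Ce (gauss a) PI.

Lemma IZR_sq_ge_abs n : Rabs (IZR n) <= IZR n ^ 2.
Proof.
  rewrite -pow2_abs -abs_IZR pow_IZR; apply: IZR_le.
  by have := Z.abs_nonneg n; nia.
Qed.

Lemma gauss_le a n : 0 < a -> Rabs (gauss a n) <= exp (- a * Rabs (IZR n)).
Proof.
  move=> Ha; rewrite Rabs_pos_eq; first by apply: Rlt_le; apply: exp_pos.
  apply: exp_le_compat; have := IZR_sq_ge_abs n; nra.
Qed.

Lemma expd_gauss a : 0 < a -> expd (gauss a).
Proof. by move=> Ha; exists 1, a; split=> // n; rewrite Rmult_1_l; apply: gauss_le. Qed.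

Lemma gauss_neg a n : gauss a (- n) = gauss a n.
Proof. by rewrite /gauss opp_IZR; congr exp; ring. Qed.

(** Up to the order of the coordinates, multiplication of [u + i v] by [1 + i]:
    it doubles the norm, and its image is the set of pairs with even sum. *)
Definition rot (p : Z * Z) : Z * Z := (fst p + snd p, fst p - snd p)%Z.

Lemma rot_inj p q : rot p = rot q -> p = q.
Proof. case: p => u v; case: q => s t [] /= E1 E2; congr pair; lia. Qed.

Lemma rot_image p : ((fst p + snd p) mod 2 = 0)%Z -> exists q, rot q = p.
Proof.
  case: p => u v /= H; exists ((u + v) / 2, (u - v) / 2)%Z; rewrite /rot /=.
  have E1 := Z_div_mod_eq_full (u + v) 2; have E2 := Z_div_mod_eq_full (u - v) 2.
  have B := Z.mod_pos_bound (u - v) 2.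
  congr pair; lia.
Qed.

Lemma rot_sum p : (fst (rot p) + snd (rot p) = 2 * fst p)%Z.
Proof. rewrite /rot; cbn [fst snd]; lia. Qed.

Lemma cos_IZR_PI_add u v : cos (IZR (u + v) * PI) = cos (IZR u * PI) * cos (IZR v * PI).
Proof. rewrite plus_IZR Rmult_plus_distr_r cos_plus !sin_IZR_PI; ring. Qed.

Lemma cos_IZR_PI_neg u : cos (IZR (- u) * PI) = cos (IZR u * PI).
Proof. by rewrite opp_IZR Ropp_mult_distr_l_reverse cos_neg. Qed.

Lemma gauss_rot a p : gauss a (fst (rot p)) * gauss a (snd (rot p)) =
  gauss (2 * a) (fst p) * gauss (2 * a) (snd p).
Proof.
  rewrite /gauss -!exp_plus /rot /= plus_IZR minus_IZR; congr exp; ring.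
Qed.

(** The square of [th3] plus that of [th4] is twice the sum over pairs of even
    sum, that is over the image of [rot]. *)
Lemma theta_mean a : 0 < a -> th3 a ^ 2 + th4 a ^ 2 = 2 * th3 (2 * a) ^ 2.
Proof.
  move=> Ha; have Hs := expd_summable _ (expd_gauss a Ha).
  have Hs2 := expd_summable _ (expd_gauss (2 * a) (ltac:(lra))).
  have Hc := summable_cos _ PI Hs.
  have sq x : x ^ 2 = x * x by ring.
  have M1 := summable_mult _ _ Hs Hs; have M2 := summable_mult _ _ Hc Hc.
  have M3 := summable_mult _ _ Hs2 Hs2.
  rewrite !sq /th3 /th4 /Ce -!tsum_mult //.
  rewrite -tsum_plus //.
  rewrite -(tsum_scal 2 (fun p : Z * Z => gauss (2 * a) (fst p) * gauss (2 * a) (snd p))) //.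
  rewrite (tsum_embed rot _ rot_inj).
  - move=> p Hp.
    have Ho : ((fst p + snd p) mod 2 <> 0)%Z by move=> /rot_image [q E]; exact: (Hp q).
    have := cos_IZR_PI_add (fst p) (snd p); rewrite (mod2_cases _ Ho) cos_IZR_odd => E.
    rewrite (_ : _ + _ = gauss a (fst p) * gauss a (snd p) * (1 + cos (IZR (fst p) * PI) * cos (IZR (snd p) * PI))); first ring.
    by rewrite -E; ring.
  - exact: summable_plus.
  apply: tsum_ext => p.
  rewrite (_ : _ + _ = gauss a (fst (rot p)) * gauss a (snd (rot p)) * (1 + cos (IZR (fst (rot p)) * PI) * cos (IZR (snd (rot p)) * PI))); first ring.
  rewrite -cos_IZR_PI_add gauss_rot rot_sum cos_IZR_even; ring.
Qed.

(** In the product the pairs of odd sum cancel, and on the image of [rot] the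
    sign of the second factor is [(-1)^(u + v)]. *)
Lemma theta_geo a : 0 < a -> th3 a * th4 a = th4 (2 * a) ^ 2.
Proof.
  move=> Ha; have Hs := expd_summable _ (expd_gauss a Ha).
  have Hs2 := expd_summable _ (expd_gauss (2 * a) (ltac:(lra))).
  have Hc := summable_cos _ PI Hs; have Hc2 := summable_cos _ PI Hs2.
  have M1 := summable_mult _ _ Hs Hc; have M2 := summable_mult _ _ Hc Hs.
  have M3 := summable_mult _ _ Hc2 Hc2.
  have E1 : th3 a * th4 a = tsum (fun p : Z * Z => gauss a (fst p) * (gauss a (snd p) * cos (IZR (snd p) * PI))).
    by rewrite /th3 /th4 /Ce -tsum_mult.
  have E2 : th4 a * th3 a = tsum (fun p : Z * Z => (gauss a (fst p) * cos (IZR (fst p) * PI)) * gauss a (snd p)).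
    by rewrite /th3 /th4 /Ce -tsum_mult.
  have E : th3 a * th4 a = tsum (fun p : Z * Z => / 2 * (gauss a (fst p) * (gauss a (snd p) * cos (IZR (snd p) * PI))
     + (gauss a (fst p) * cos (IZR (fst p) * PI)) * gauss a (snd p))).
    rewrite tsum_scal; first exact: summable_plus.
    rewrite tsum_plus //.
    rewrite -E1 -E2; field.
  rewrite E (_ : th4 (2 * a) ^ 2 = th4 (2 * a) * th4 (2 * a)); first ring.
  rewrite /th4 /Ce -tsum_mult // (tsum_embed rot _ rot_inj).
  - move=> p Hp.
    have Ho : ((fst p + snd p) mod 2 <> 0)%Z by move=> /rot_image [q E']; exact: (Hp q).
    have := cos_IZR_PI_add (fst p) (snd p); rewrite (mod2_cases _ Ho) cos_IZR_odd => E3.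
    have S1 := cos_IZR_PI_sq (fst p).
    have E4 : cos (IZR (snd p) * PI) = - cos (IZR (fst p) * PI).
      rewrite -[LHS]Rmult_1_l -S1 Rmult_assoc -E3; ring.
    rewrite E4; ring.
  - apply: summable_scal; exact: summable_plus.
  apply: tsum_ext => p.
  rewrite (_ : / 2 * _ = gauss a (fst (rot p)) * gauss a (snd (rot p)) * (/ 2 * (cos (IZR (fst (rot p)) * PI) + cos (IZR (snd (rot p)) * PI)))); first ring.
  rewrite gauss_rot /rot /= /Z.sub !cos_IZR_PI_add cos_IZR_PI_neg; field.
Qed.

(** ** Comparison of two solutions of the arithmetic-geometric relations *)

Section AGM.
Variables c b c' b' : R -> R.
Hypothesis Hpos : forall a, 0 < a -> 0 < b a < c a.
Hypothesis Hpos' : forall a, 0 < a -> 0 < b' a < c' a.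
Hypothesis Hm : forall a, 0 < a -> c (2 * a) = (c a + b a) / 2.
Hypothesis Hm' : forall a, 0 < a -> c' (2 * a) = (c' a + b' a) / 2.
Hypothesis Hg : forall a, 0 < a -> b (2 * a) ^ 2 = c a * b a.
Hypothesis Hg' : forall a, 0 < a -> b' (2 * a) ^ 2 = c' a * b' a.

Let close L U a := L * c' a <= c a <= U * c' a /\
  L * (c' a - b' a) <= c a - b a <= U * (c' a - b' a).

(** The descending step in closed form: the difference at [a] is determined by
    the values at [2 a] and [4 a]. *)
Lemma agm_delta (c0 b0 : R -> R) a : (forall a, 0 < a -> c0 (2 * a) = (c0 a + b0 a) / 2) ->
  (forall a, 0 < a -> b0 (2 * a) ^ 2 = c0 a * b0 a) -> 0 < a ->
  (c0 a - b0 a) ^ 2 = 8 * c0 (2 * (2 * a)) * (c0 (2 * a) - b0 (2 * a)).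
Proof.
  move=> H1 H2 Ha; rewrite (H1 (2 * a)); first lra.
  transitivity (4 * (c0 (2 * a) ^ 2 - b0 (2 * a) ^ 2)); last by field.
  rewrite H2 // H1 //; field.
Qed.

(** The two-sided bounds are transported from [2 a] and [4 a] to [a]. *)
Lemma agm_step L U a : 0 < L -> 0 < a -> close L U (2 * a) -> close L U (2 * (2 * a)) -> close L U a.
Proof.
  move=> HL Ha [H1 H2] [H3 _].
  have P := Hpos a Ha; have P' := Hpos' a Ha.
  have Q' := Hpos' (2 * a) (ltac:(lra)); have W' := Hpos' (2 * (2 * a)) (ltac:(lra)).
  have Q := Hpos (2 * a) (ltac:(lra)); have W := Hpos (2 * (2 * a)) (ltac:(lra)).
  have E := agm_delta c b a Hm Hg Ha; have E' := agm_delta c' b' a Hm' Hg' Ha.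
  set d := c a - b a in E *; set d' := c' a - b' a in E' *.
  have Hd : 0 < d by rewrite /d; lra.
  have Hd' : 0 < d' by rewrite /d'; lra.
  set x := c (2 * (2 * a)) in E H3 W; set x' := c' (2 * (2 * a)) in E' H3 W'.
  set y := c (2 * a) - b (2 * a) in E H2; set y' := c' (2 * a) - b' (2 * a) in E' H2.
  have Hx' : 0 < x' by lra.
  have Hy' : 0 < y' by rewrite /y'; lra.
  have HU : 0 < U.
    have : L * x' <= U * x' by lra.
    move=> K; have : 0 < L * x' by apply: Rmult_lt_0_compat.
    nra.
  have B1 : (L * d') ^ 2 <= d ^ 2.
    rewrite E (_ : (L * d') ^ 2 = 8 * ((L * x') * (L * y'))); last first.
      have : (L * x') * (L * y') <= x * y; last lra.
      apply: Rmult_le_compat; try lra; apply: Rmult_le_pos; lra.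
    by rewrite (_ : (L * d') ^ 2 = L ^ 2 * d' ^ 2); [ring|rewrite E'; ring].
  have B2 : d ^ 2 <= (U * d') ^ 2.
    rewrite E (_ : (U * d') ^ 2 = 8 * ((U * x') * (U * y'))); last first.
      have : x * y <= (U * x') * (U * y'); last lra.
      have : 0 < L * x' by apply: Rmult_lt_0_compat.
      have : 0 < L * y' by apply: Rmult_lt_0_compat.
      move=> K1 K2; apply: Rmult_le_compat; lra.
    by rewrite (_ : (U * d') ^ 2 = U ^ 2 * d' ^ 2); [ring|rewrite E'; ring].
  have C1 : L * d' <= d by apply: Rsqr_incr_0; rewrite ?Rsqr_pow2 //; try lra; apply: Rmult_le_pos; lra.
  have C2 : d <= U * d' by apply: Rsqr_incr_0; rewrite ?Rsqr_pow2 //; try lra; apply: Rmult_le_pos; lra.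
  rewrite /close -/d -/d'; split; last lra.
  have F : c a = c (2 * a) + d / 2 by rewrite Hm // /d; field.
  have F' : c' a = c' (2 * a) + d' / 2 by rewrite Hm' // /d'; field.
  rewrite F F'; split; lra.
Qed.

Hypothesis Hlim : forall L U, 0 < L < 1 -> 1 < U -> exists M, forall a, 0 < a -> M < a -> close L U a.

(** Bounds valid for large [a] are carried down to every [a] by repeated
    halving, without loss in the constants. *)
Lemma agm_unique a : 0 < a -> c a = c' a.
Proof.
  move=> Ha.
  have H L U : 0 < L < 1 -> 1 < U -> L * c' a <= c a <= U * c' a.
    move=> HL HU; have [M HM] := Hlim L U HL HU.
    have [n Hn] := pow2_unbounded M a Ha.
    have K : forall n x, 0 < x -> M < 2 ^ n * x -> close L U x /\ close L U (2 * x).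
      elim=> [|k IH] x Hx Hk.
        rewrite /= Rmult_1_l in Hk; split; apply: HM; lra.
      have [A1 A2] : close L U (2 * x) /\ close L U (2 * (2 * x)).
        by apply: IH; [lra|move: Hk; rewrite /=; lra].
      by split=> //; apply: agm_step => //; lra.
    by have [[]] := K n a Ha Hn.
  have P' := Hpos' a Ha; have P := Hpos a Ha.
  have E : c a / c' a - 1 = 0.
    apply: (eq_0_of_small _ 1) => de Hde.
    have [H1 H2] := H (1 - de) (1 + de) (ltac:(lra)) (ltac:(lra)).
    have F : c a / c' a * c' a = c a by field; lra.
    apply: Rabs_le; split.
    - apply: (Rmult_le_reg_r (c' a)); first lra.
      rewrite Rmult_minus_distr_r F; lra.
    - apply: (Rmult_le_reg_r (c' a)); first lra.
      rewrite Rmult_minus_distr_r F; lra.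
  rewrite (_ : c a = c a / c' a * c' a); first by field; lra.
  have -> : c a / c' a = 1 by lra.
  ring.
Qed.

End AGM.

Lemma odd_tail : exists K, 0 < K /\ forall a (y : nat -> R), 1 <= a ->
  (forall i, Rabs (y i) <= 2 * exp (- a * (2 * INR i + 1))) -> Rabs (tsum y - y 0%nat) <= K * exp (- a) ^ 2.
Proof.
  have HE := summable_poly_exp 0 1 Rlt_0_1.
  set E := fun n : nat => _ in HE.
  have EE n : E n = exp (- INR n) by rewrite /E /= Rmult_1_l; congr exp; ring.
  have HE0 : 0 <= tsum E by apply: tsum_nonneg => // n; rewrite EE; apply: Rlt_le; apply: exp_pos.
  exists (2 * (tsum E + 1)); split; first lra.
  move=> a y Ha Hy.
  have Hbd i : i <> 0%nat -> exp (- a * (2 * INR i + 1)) <= exp (- a) ^ 2 * E i.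
    move=> Hi; rewrite EE /= Rmult_1_r -!exp_plus; apply: exp_le_compat.
    have : 1 <= INR i by apply: (le_INR 1); lia.
    nra.
  have Hs : summable y.
    apply: (summable_le _ (fun i => 2 * E i)); last exact: summable_scal.
    move=> i; apply: Rle_trans (Hy i) _; apply: Rmult_le_compat_l; first lra.
    rewrite EE; apply: exp_le_compat; have := pos_INR i; nra.
  have H0 := is_sum_single 0%nat (fun i => if Nat.eq_dec i 0 then y i else 0).
  rewrite /= in H0.
  have {}H0 := H0 (fun i Hi => match Nat.eq_dec i 0 as s return ((if s then y i else 0) = 0) with left e => False_ind _ (Hi e) | right _ => eq_refl end).
  rewrite -(tsum_eq _ _ (is_sum_minus _ _ _ _ (tsum_is_sum _ Hs) H0)).
  apply: Rle_trans (_ : tsum (fun i => 2 * exp (- a) ^ 2 * E i) <= _); last first.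
    rewrite tsum_scal //; have := pow_lt _ 2 (exp_pos (- a)); nra.
  apply: tsum_Rabs_le; last exact: summable_scal.
  move=> i; case: Nat.eq_dec => Hi.
  - rewrite Rminus_diag Rabs_R0 EE.
    by apply: Rlt_le; apply: Rmult_lt_0_compat; [have := pow_lt _ 2 (exp_pos (- a)); lra|exact: exp_pos].
  - rewrite Rminus_0_r; apply: Rle_trans (Hy i) _; rewrite Rmult_assoc.
    by apply: Rmult_le_compat_l; [lra|exact: Hbd].
Qed.

Lemma th3_tail : exists K, 0 < K /\ forall a, 1 <= a -> Rabs (th3 a - 1) <= K * exp (- a).
Proof.
  have [K [HK H]] := Ce_tail; exists K; split=> // a Ha.
  rewrite /th3 -Ce_0 (_ : 1 = gauss a 0).
    by rewrite /gauss (_ : - a * 0 ^ 2 = 0) ?exp_0; first ring.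
  apply: H => // n; apply: Rle_trans (gauss_le a n _) _; first lra.
  have := exp_pos (- a * Rabs (IZR n)); lra.
Qed.

Lemma th4_tail : exists K, 0 < K /\ forall a, 1 <= a -> Rabs (th4 a - 1) <= K * exp (- a).
Proof.
  have [K [HK H]] := Ce_tail; exists K; split=> // a Ha.
  rewrite /th4 (_ : 1 = gauss a 0).
    by rewrite /gauss (_ : - a * 0 ^ 2 = 0) ?exp_0; first ring.
  apply: H => // n; apply: Rle_trans (gauss_le a n _) _; first lra.
  have := exp_pos (- a * Rabs (IZR n)); lra.
Qed.

Lemma Ce_gap (x : Z -> R) : summable x -> (forall n, x (- n)%Z = x n) ->
  tsum x - Ce x PI = 4 * tsum (fun i : nat => x (2 * Z.of_nat i + 1)%Z).
Proof.
  move=> Hx He; rewrite -tsum_odd_Z // /Ce -tsum_minus //; first exact: summable_cos.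
  by apply: tsum_ext => n; ring.
Qed.

(** The gap between the values at [0] and [PI] comes from the odd frequencies,
    and to first order from the frequencies [1] and [-1]. *)
Lemma is_lim_gap (D : R -> Z -> R) (y0 : R) :
  (forall a, 0 < a -> summable (D a)) -> (forall a n, D a (- n)%Z = D a n) ->
  (forall a n, 0 < a -> Rabs (D a n) <= 2 * exp (- a * Rabs (IZR n))) ->
  (forall a, 1 <= a -> Rabs (exp a * D a 1%Z - y0) <= 2 * exp (- a)) ->
  is_lim (fun a => exp a * (tsum (D a) - Ce (D a) PI)) p_infty (4 * y0).
Proof.
  move=> H1 H2 H3 H4; have [K [HK HT]] := odd_tail.
  apply: (is_lim_exp_tail _ _ (4 * K + 8)) => a Ha.
  rewrite Ce_gap //; first by apply: H1; lra.
  have := HT a (fun i : nat => D a (2 * Z.of_nat i + 1)%Z) Ha.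
  set T := tsum _; rewrite [D a (2 * Z.of_nat 0 + 1)%Z]/= => H5.
  have {}H5 : Rabs (T - D a 1%Z) <= K * exp (- a) ^ 2.
    apply: H5 => i; apply: Rle_trans (H3 a _ _) _; first lra.
    right; congr (2 * exp (_ * _)).
    by rewrite plus_IZR mult_IZR -INR_IZR_INZ Rabs_pos_eq; [have := pos_INR i; lra|].
  have He := exp_pos a; have Hem := exp_pos (- a).
  have EE : exp a * exp (- a) = 1 by rewrite -exp_plus Rplus_opp_r exp_0.
  rewrite (_ : exp a * (4 * T) - 4 * y0 = 4 * (exp a * (T - D a 1%Z)) + 4 * (exp a * D a 1%Z - y0)); first ring.
  have Tri u v : Rabs (4 * u + 4 * v) <= 4 * Rabs u + 4 * Rabs v.
    rewrite /Rabs; repeat case: Rcase_abs; lra.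
  apply: Rle_trans (Tri _ _) _; rewrite (Rabs_mult (exp a) (_ - D a 1%Z)) (Rabs_pos_eq (exp a)); first lra.
  have := H4 a Ha.
  have : exp a * Rabs (T - D a 1%Z) <= exp a * (K * exp (- a) ^ 2) by apply: Rmult_le_compat_l; lra.
  rewrite (_ : exp a * (K * exp (- a) ^ 2) = K * exp (- a) * (exp a * exp (- a))); first ring.
  rewrite EE; lra.
Qed.

Lemma is_lim_gap_f : is_lim (fun a => exp a * (f0 a - fpi a)) p_infty 8.
Proof.
  have H := is_lim_gap sechs 2.
  rewrite (_ : 4 * 2 = 8) in H; first ring.
  apply: (is_lim_ext (fun a => exp a * (tsum (sechs a) - Ce (sechs a) PI))).
    by move=> a; rewrite /f0 /fpi /dnF Ce_0.
  apply: H.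
  - by move=> a Ha; apply: expd_summable; apply: expd_sechs.
  - exact: sechs_neg.
  - move=> a n Ha; rewrite Rabs_pos_eq; [by apply: Rlt_le; apply: sechs_pos|exact: sechs_le].
  - move=> a Ha; rewrite /sechs Rmult_1_l /cosh.
    have He := exp_pos a; have Hem := exp_pos (- a).
    have EE : exp a * exp (- a) = 1 by rewrite -exp_plus Rplus_opp_r exp_0.
    have E1 : exp a = / exp (- a) by rewrite -exp_Ropp Ropp_involutive.
    have Hlt : exp (- a) < 1 by rewrite -exp_0; apply: exp_increasing; lra.
    rewrite (_ : _ - 2 = - (2 * exp (- a) ^ 2 / (1 + exp (- a) ^ 2))); first by rewrite E1; field; nra.
    rewrite Rabs_Ropp Rabs_pos_eq; first by apply: Rlt_le; apply: Rdiv_lt_0_compat; nra.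
    apply: (Rmult_le_reg_r (1 + exp (- a) ^ 2)); first nra.
    rewrite /Rdiv Rmult_assoc Rinv_l; nra.
Qed.

Lemma is_lim_gap_th : is_lim (fun a => exp a * (th3 a - th4 a)) p_infty 4.
Proof.
  have H := is_lim_gap gauss 1.
  rewrite Rmult_1_r in H; apply: H.
  - by move=> a Ha; apply: expd_summable; apply: expd_gauss.
  - exact: gauss_neg.
  - move=> a n Ha; apply: Rle_trans (gauss_le a n Ha) _.
    have := exp_pos (- a * Rabs (IZR n)); lra.
  - move=> a Ha; rewrite /gauss -exp_plus (_ : a + - a * 1 ^ 2 = 0) ?exp_0; first ring.
    rewrite Rminus_diag Rabs_R0; have := exp_pos (- a); lra.
Qed.

Lemma is_lim_th3 : is_lim th3 p_infty 1.
Proof. have [K [_ H]] := th3_tail; exact: is_lim_exp_tail H. Qed.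

Lemma is_lim_th4 : is_lim th4 p_infty 1.
Proof. have [K [_ H]] := th4_tail; exact: is_lim_exp_tail H. Qed.

Lemma th3_pos a : 0 < a -> 1 <= th3 a.
Proof.
  move=> Ha; have Hs := expd_summable _ (expd_gauss a Ha).
  have H := list_sum_le_tsum (gauss a) (0%Z :: nil) (fun n => Rlt_le _ _ (exp_pos _)) Hs (zball_nodup 0).
  move: H; rewrite /list_sum /= /gauss (_ : - a * 0 ^ 2 = 0) ?exp_0; first ring.
  rewrite /th3 /gauss; lra.
Qed.

Lemma th4_lt a : 0 < a -> th4 a < th3 a.
Proof.
  move=> Ha; have Hs := expd_summable _ (expd_gauss a Ha).
  have := Ce_gap _ Hs (gauss_neg a); rewrite -/(th3 a) -/(th4 a) => E.
  have Hso : summable (fun i : nat => gauss a (2 * Z.of_nat i + 1)).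
    by apply: (summable_comp_inj (fun i : nat => (2 * Z.of_nat i + 1)%Z)) Hs => *; lia.
  have H := list_sum_le_tsum (fun i : nat => gauss a (2 * Z.of_nat i + 1)) (0%nat :: nil)
    (fun n => Rlt_le _ _ (exp_pos _)) Hso (seq_NoDup 1 0).
  rewrite list_sum_cons (_ : list_sum _ nil = 0) // in H.
  have : 0 < gauss a (2 * Z.of_nat 0 + 1) by exact: exp_pos.
  lra.
Qed.

Lemma th4_pos a : 0 < a -> 0 < th4 a.
Proof.
  have Hnn x : 0 < x -> 0 <= th4 x.
    move=> Hx; have := theta_geo x Hx; have := th3_pos x Hx.
    have : 0 <= th4 (2 * x) ^ 2 by apply: pow2_ge_0.
    nra.
  move=> Ha; case: (Hnn a Ha) => // H0.
  have Hz n : th4 (2 ^ n * a) = 0.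
    elim: n => [|n IH]; first by rewrite /= Rmult_1_l.
    have Hp : 0 < 2 ^ n * a by apply: Rmult_lt_0_compat => //; apply: pow_lt; lra.
    have := theta_geo _ Hp; rewrite IH Rmult_0_r -Rmult_assoc -/(2 ^ S n).
    by move=> E; apply: Rsqr_0_uniq; rewrite Rsqr_pow2.
  have L := is_lim_th4.
  move/is_lim_spec: L => /(_ (mkposreal _ Rlt_0_1)) [M HM].
  have [n Hn] := pow2_unbounded M a Ha.
  have := HM _ Hn; rewrite Hz /= Rminus_0_l Rabs_Ropp Rabs_R1; lra.
Qed.

(** Both sides satisfy the arithmetic-geometric relations under doubling of
    the parameter, with the same behaviour at infinity. *)
Theorem f0_theta a : 0 < a -> f0 a = th3 a ^ 2.
Proof.
  apply: (agm_unique f0 fpi (fun a => th3 a ^ 2) (fun a => th4 a ^ 2)).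
  - move=> x Hx; split; first exact: fpi_pos.
    have := AA_pos x Hx; rewrite /AA /CC /BB.
    have := fpi_pos x Hx; have := f0_ge1 x Hx; nra.
  - move=> x Hx; have := th4_pos x Hx; have := th4_lt x Hx; have := th3_pos x Hx; nra.
  - exact: f0_double.
  - by move=> x Hx; have := theta_mean x Hx; lra.
  - exact: fpi_double_sq.
  - move=> x Hx; rewrite -(theta_geo x Hx); ring.
  - move=> L U HL HU.
    have near (F : R -> R) (l e : R) : is_lim F p_infty l -> 0 < e -> exists M, forall x, M < x -> Rabs (F x - l) < e.
      by move=> /is_lim_spec HF He; have [M HM] := HF (mkposreal _ He); exists M.
    have Lth : is_lim (fun x => exp x * (th3 x ^ 2 - th4 x ^ 2)) p_infty 8.
      have L1 := is_lim_mult_fin _ _ _ _ _ is_lim_gap_th (is_lim_plus' _ _ _ _ _ is_lim_th3 is_lim_th4).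
      rewrite (_ : 4 * (1 + 1) = 8) in L1; first ring.
      by apply: is_lim_ext L1 => x; ring.
    have Lth3 : is_lim (fun x => th3 x ^ 2) p_infty 1.
      have L1 := is_lim_mult_fin _ _ _ _ _ is_lim_th3 is_lim_th3; rewrite Rmult_1_l in L1.
      by apply: is_lim_ext L1 => x; ring.
    have comb (F G : R -> R) (l : R) : is_lim F p_infty l -> is_lim G p_infty l -> 0 < l ->
       exists M, forall x, M < x -> L * G x <= F x <= U * G x.
      move=> HF HG Hl.
      have L1 : is_lim (fun x => F x - L * G x) p_infty (l - L * l).
        by apply: is_lim_minus' => //; apply: (is_lim_scal_l G L p_infty l).
      have L2 : is_lim (fun x => U * G x - F x) p_infty (U * l - l).
        by apply: is_lim_minus' => //; apply: (is_lim_scal_l G U p_infty l).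
      have P1 : 0 < l - L * l by nra.
      have P2 : 0 < U * l - l by nra.
      have [M1 H1] := near _ _ _ L1 P1; have [M2 H2] := near _ _ _ L2 P2.
      exists (Rmax M1 M2) => x Hx; have K1 := Rmax_l M1 M2; have K2 := Rmax_r M1 M2.
      have := H1 x (ltac:(lra)); have := H2 x (ltac:(lra)).
      rewrite /Rabs; repeat case: Rcase_abs; lra.
    have [M1 H1] := comb _ _ _ is_lim_f0 Lth3 Rlt_0_1.
    have [M2 H2] := comb _ _ _ is_lim_gap_f Lth (ltac:(lra)).
    exists (Rmax M1 M2) => x Hx0 Hx; have K1 := Rmax_l M1 M2; have K2 := Rmax_r M1 M2.
    split; first by apply: H1; lra.
    have := H2 x (ltac:(lra)); have He := exp_pos x => -[J1 J2]; split.
    - apply: (Rmult_le_reg_l (exp x)) => //; lra.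
    - apply: (Rmult_le_reg_l (exp x)) => //; lra.
Qed.


(** ** The number of representations by two squares, in summatory form *)

Definition chi4 (n : nat) : R :=
  if Nat.eq_dec (n mod 4) 1 then 1 else if Nat.eq_dec (n mod 4) 3 then -1 else 0.

Definition chi3 (n : nat) : R :=
  if Nat.eq_dec (n mod 3) 1 then 1 else if Nat.eq_dec (n mod 3) 2 then -1 else 0.

Lemma chi4_bound n : Rabs (chi4 n) <= 1.
Proof.
  rewrite /chi4; case: Nat.eq_dec => _; first by rewrite Rabs_R1; lra.
  case: Nat.eq_dec => _; [by rewrite Rabs_Ropp Rabs_R1; lra|by rewrite Rabs_R0; lra].
Qed.

Lemma chi3_bound n : Rabs (chi3 n) <= 1.
Proof.
  rewrite /chi3; case: Nat.eq_dec => _; first by rewrite Rabs_R1; lra.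
  case: Nat.eq_dec => _; [by rewrite Rabs_Ropp Rabs_R1; lra|by rewrite Rabs_R0; lra].
Qed.

Lemma chi4_even j : chi4 (2 * j) = 0.
Proof.
  rewrite /chi4; have E := Nat.div_mod_eq (2 * j) 4.
  case: Nat.eq_dec => H1; first lia.
  case: Nat.eq_dec => H2 //; lia.
Qed.

Lemma chi4_odd j : chi4 (2 * j + 1) = (-1) ^ j.
Proof.
  have H k : chi4 (4 * k + 1) = 1 /\ chi4 (4 * k + 3) = -1.
    rewrite /chi4; have E1 : ((4 * k + 1) mod 4 = 1)%nat by rewrite Nat.add_comm Nat.mul_comm Nat.Div0.mod_add.
    have E3 : ((4 * k + 3) mod 4 = 3)%nat by rewrite Nat.add_comm Nat.mul_comm Nat.Div0.mod_add.
    rewrite E1 E3; split; by repeat case: Nat.eq_dec.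
  have [k [E|E]] : exists k, (j = 2 * k \/ j = 2 * k + 1)%nat.
    by exists (j / 2)%nat; have := Nat.div_mod_eq j 2; have := Nat.mod_upper_bound j 2; lia.
  - rewrite E (_ : (2 * (2 * k) + 1 = 4 * k + 1)%nat); first lia.
    by rewrite (proj1 (H k)) pow_1_even.
  - rewrite E (_ : (2 * (2 * k + 1) + 1 = 4 * k + 3)%nat); first lia.
    by rewrite (proj2 (H k)) Nat.add_1_r pow_1_odd.
Qed.

(** A geometric series with ratio [- exp (- 2 u)]. *)
Lemma sum_chi4_exp u : 0 < u -> is_sum (fun i => chi4 (S i) * exp (- INR (S i) * u)) (/ 2 * / cosh u).
Proof.
  move=> Hu.
  have Hq : 0 < exp (- (2 * u)) < 1.
    split; first exact: exp_pos.
    rewrite -exp_0; apply: exp_increasing; lra.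
  have E j : chi4 (S (2 * j)) * exp (- INR (S (2 * j)) * u) = exp (- u) * (- exp (- (2 * u))) ^ j.
    rewrite -Nat.add_1_r chi4_odd plus_INR mult_INR (_ : - exp (- (2 * u)) = -1 * exp (- (2 * u))); first ring.
    rewrite Rpow_mult_distr.
    have -> : exp (- (2 * u)) ^ j = exp (- (2 * u) * INR j).
      elim: j => [|j IH]; first by rewrite /= Rmult_0_r exp_0.
      rewrite -tech_pow_Rmult IH -exp_plus S_INR; congr exp; ring.
    rewrite -Rmult_assoc (Rmult_comm (exp _)) Rmult_assoc -exp_plus; congr (_ * exp _).
    rewrite /=; ring.
  have Hs : summable (fun i => chi4 (S i) * exp (- INR (S i) * u)).
    apply: (summable_le _ (fun i => 1 * (INR i ^ 0 * exp (- u * INR i)))).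
      move=> i; rewrite Rabs_mult; apply: Rmult_le_compat; try exact: Rabs_pos; first exact: chi4_bound.
      rewrite Rabs_pos_eq; first by apply: Rlt_le; exact: exp_pos.
      rewrite /= -/(INR (S i)) Rmult_1_l; apply: exp_le_compat; rewrite S_INR; lra.
    by apply: summable_scal; exact: summable_poly_exp.
  have Ht := tsum_is_sum _ Hs.
  rewrite (tsum_embed (fun j => 2 * j)%nat) // in Ht.
  - by move=> x y; lia.
  - move=> b Hb.
    have [k [Ek|Ek]] : exists k, (b = 2 * k \/ b = 2 * k + 1)%nat.
      by exists (b / 2)%nat; have := Nat.div_mod_eq b 2; have := Nat.mod_upper_bound b 2; lia.
    + by case: (Hb k).
    + by rewrite Ek (_ : (S (2 * k + 1) = 2 * (k + 1))%nat); [lia|rewrite chi4_even; ring].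
  suff <- : tsum (fun j => chi4 (S (2 * j)) * exp (- INR (S (2 * j)) * u)) = / 2 * / cosh u by [].
  rewrite (tsum_ext _ _ E) -tsum_Series.
    apply: summable_nat; apply: (ex_series_ext (fun j => exp (- u) * exp (- (2 * u)) ^ j)).
      move=> j; rewrite Rabs_mult -RPow_abs Rabs_Ropp !Rabs_pos_eq; try lra.
      by apply: Rlt_le; exact: exp_pos.
    apply: ex_series_scal_l; apply: ex_series_geom; rewrite Rabs_pos_eq; lra.
  apply: is_series_unique.
  have G := is_series_scal (exp (- u)) _ _ (is_series_geom (- exp (- (2 * u))) _).
  rewrite (_ : / 2 * / cosh u = scal (exp (- u)) (/ (1 - - exp (- (2 * u))))); last first.
    by apply: G; rewrite Rabs_Ropp Rabs_pos_eq; lra.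
  rewrite /scal /= /mult /= /cosh (_ : - (2 * u) = - u + - u); first ring.
  have H1 := exp_pos (- u).
  have H2 : exp u = / exp (- u) by rewrite -exp_Ropp Ropp_involutive.
  rewrite exp_plus H2; field; repeat split; nra.
Qed.

Lemma tsum_even_Z (x : Z -> R) : summable x -> (forall n, x (- n)%Z = x n) ->
  tsum x = x 0%Z + 2 * tsum (fun i : nat => x (Z.of_nat (S i))).
Proof.
  move=> Hx He.
  pose e (s : unit + (nat + nat)) : Z :=
    match s with inl _ => 0%Z | inr (inl i) => Z.of_nat (S i) | inr (inr i) => (- Z.of_nat (S i))%Z end.
  have Hi : summable (fun i : nat => x (Z.of_nat (S i))).
    by apply: (summable_comp_inj (fun i : nat => Z.of_nat (S i))) Hx => *; lia.
  have H : is_sum x (x 0%Z + (tsum (fun i : nat => x (Z.of_nat (S i))) + tsum (fun i : nat => x (Z.of_nat (S i))))).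
    apply: (is_sum_embed e).
    - move=> [[]|[i|i]] [[]|[j|j]]; rewrite /e; cbv iota beta => E //; try (exfalso; lia).
      + by have -> : i = j by lia.
      + by have -> : i = j by lia.
    - move=> b Hb; exfalso.
      have [Hp|[Hp|Hp]] := Z.lt_trichotomy b 0.
      + apply: (Hb (inr (inr (Z.to_nat (- b - 1))))); rewrite /e; cbv iota beta; lia.
      + by apply: (Hb (inl tt)).
      + apply: (Hb (inr (inl (Z.to_nat (b - 1))))); rewrite /e; cbv iota beta; lia.
    - apply: is_sum_sum; last apply: is_sum_sum.
      + by apply: (is_sum_single tt) => -[].
      + exact: tsum_is_sum.
      + by apply: is_sum_ext (tsum_is_sum _ Hi) => i; rewrite /e He.
  rewrite (tsum_eq _ _ H); ring.
Qed.

Lemma summable_exp_pair1 b : 0 < b ->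
  summable (fun p : nat * nat => exp (- (INR (S (fst p)) * INR (S (snd p))) * b)).
Proof.
  move=> Hb; have H := summable_poly_exp 0 b Hb.
  apply: summable_le _ (summable_mult _ _ H H) => -[i j] /=.
  rewrite !Rmult_1_l -exp_plus Rabs_pos_eq; first by apply: Rlt_le; apply: exp_pos.
  apply: exp_le_compat; rewrite -/(INR (S i)) -/(INR (S j)) !S_INR.
  have := pos_INR i; have := pos_INR j; move=> Hj Hi.
  have : 0 <= INR i * INR j by apply: Rmult_le_pos.
  nra.
Qed.

Lemma summable_chi4_pair a : 0 < a -> summable (fun p : nat * nat =>
    chi4 (S (fst p)) * exp (- INR (S (fst p) * S (snd p)) * a)).
Proof.
  move=> Ha; apply: summable_le (summable_exp_pair1 a Ha) => p.
  rewrite Rabs_mult mult_INR (Rabs_pos_eq (exp _)); first by apply: Rlt_le; exact: exp_pos.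
  rewrite -[X in _ <= X]Rmult_1_l; apply: Rmult_le_compat_r; last exact: chi4_bound.
  by apply: Rlt_le; exact: exp_pos.
Qed.

(** Each [1 / cosh] is expanded by [sum_chi4_exp]. *)
Lemma f0_lambert a : 0 < a -> f0 a = 1 + 4 * tsum (fun p : nat * nat =>
    chi4 (S (fst p)) * exp (- INR (S (fst p) * S (snd p)) * a)).
Proof.
  move=> Ha; have Hs := expd_summable _ (expd_sechs a Ha).
  rewrite /f0 /dnF Ce_0 tsum_even_Z //; first exact: sechs_neg.
  rewrite sechs_0 tsum_swap; first exact: summable_chi4_pair.
  rewrite (_ : 4 = 2 * 2); first ring.
  rewrite (Rmult_assoc 2) -(tsum_scal 2 (fun b => tsum _)).
    have H := summable_chi4_pair a Ha.
    apply: (summable_fubini (fun p : nat * nat => chi4 (S (snd p)) * exp (- INR (S (snd p) * S (fst p)) * a))).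
    by apply: (summable_comp_inj (fun p : nat * nat => (snd p, fst p))) H => -[x y] [x' y'] /= [-> ->].
  congr (1 + 2 * _); apply: tsum_ext => j.
  have Hj : 0 < INR (S j) * a by apply: Rmult_lt_0_compat => //; apply: lt_0_INR; lia.
  have := tsum_eq _ _ (sum_chi4_exp _ Hj) => E.
  rewrite /sechs -INR_IZR_INZ (_ : / cosh _ = 2 * (/ 2 * / cosh (INR (S j) * a))); first by field; exact: cosh_neq0.
  rewrite -E; congr Rmult; apply: tsum_ext => i.
  by rewrite [fst _]/= [snd _]/= mult_INR; congr (_ * exp _); ring.
Qed.

Definition normsq (p : Z * Z) : nat := Z.abs_nat (fst p * fst p + snd p * snd p).

Lemma INR_normsq p : INR (normsq p) = IZR (fst p) ^ 2 + IZR (snd p) ^ 2.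
Proof.
  rewrite INR_IZR_INZ /normsq Zabs2Nat.id_abs Z.abs_eq; first nia.
  rewrite plus_IZR !mult_IZR; ring.
Qed.

Lemma exp_normsq a p : exp (- INR (normsq p) * a) = gauss a (fst p) * gauss a (snd p).
Proof. rewrite INR_normsq /gauss -exp_plus; congr exp; ring. Qed.

Lemma summable_exp_normsq a : 0 < a -> summable (fun p => exp (- INR (normsq p) * a)).
Proof.
  move=> Ha; have Hs := expd_summable _ (expd_gauss a Ha).
  by apply: summable_ext (summable_mult _ _ Hs Hs) => p; rewrite exp_normsq.
Qed.

Lemma th3_normsq a : 0 < a -> th3 a ^ 2 = tsum (fun p => exp (- INR (normsq p) * a)).
Proof.
  move=> Ha; have Hs := expd_summable _ (expd_gauss a Ha).
  rewrite (_ : th3 a ^ 2 = th3 a * th3 a); first ring.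
  rewrite /th3 -tsum_mult //; apply: tsum_ext => p; by rewrite exp_normsq.
Qed.

(** The first nonzero coefficient would dominate for large [a]. *)
Lemma exp_coef_unique (h : nat -> R) :
  (forall a, 0 < a -> summable (fun n => h n * exp (- INR n * a))) ->
  (forall a, 0 < a -> tsum (fun n => h n * exp (- INR n * a)) = 0) -> forall n, h n = 0.
Proof.
  move=> Hs H0; apply: (well_founded_induction lt_wf) => n IH.
  have HS := Hs 1 Rlt_0_1; have HSa := summable_abs _ HS.
  set Sm := tsum (fun n => Rabs (h n * exp (- INR n * 1))).
  have HSm : 0 <= Sm by apply: tsum_nonneg => // k; exact: Rabs_pos.
  apply: (eq_0_of_small _ (Sm * exp (INR n + 1))) => de Hde.
  set a := 1 + / de.
  have Hide : 0 < / de by apply: Rinv_0_lt_compat; lra.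
  have Ha : 1 <= a by rewrite /a; lra.
  have Hed : exp (- a) <= de.
    rewrite exp_Ropp -[de]Rinv_inv; apply: Rinv_le_contravar => //.
    have := exp_ineq1_le a; rewrite /a; lra.
  have Hsum := Hs a (ltac:(lra)).
  have Hsg : is_sum (fun k => if Nat.eq_dec k n then h n * exp (- INR n * a) else 0) (h n * exp (- INR n * a)).
    set f := fun k => _; have -> : h n * exp (- INR n * a) = f n by rewrite /f; case: Nat.eq_dec.
    by apply: is_sum_single => k Hk; rewrite /f; case: Nat.eq_dec.
  have E := tsum_eq _ _ (is_sum_minus _ _ _ _ Hsg (tsum_is_sum _ Hsum)).
  rewrite (H0 a) ?Rminus_0_r in E; first lra.
  have B : Rabs (h n * exp (- INR n * a)) <= exp (- (a - 1) * (INR n + 1)) * Sm.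
    rewrite -E -tsum_scal //; apply: tsum_Rabs_le; last exact: summable_scal.
    move=> k; case: Nat.eq_dec => Hk.
      rewrite Hk Rminus_diag Rabs_R0; apply: Rmult_le_pos; [by apply: Rlt_le; exact: exp_pos|exact: Rabs_pos].
    have [Hlt|Hgt] : (k < n)%nat \/ (n < k)%nat by lia.
      rewrite IH // !Rmult_0_l Rminus_0_r Rabs_R0 Rmult_0_r; lra.
    rewrite Rminus_0_l Rabs_Ropp !Rabs_mult !(Rabs_pos_eq (exp _)); try by apply: Rlt_le; exact: exp_pos.
    rewrite (Rmult_comm (exp _)) Rmult_assoc -exp_plus; apply: Rmult_le_compat_l; first exact: Rabs_pos.
    apply: exp_le_compat.
    have : INR n + 1 <= INR k by rewrite -S_INR; apply: le_INR; lia.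
    nra.
  rewrite Rabs_mult (Rabs_pos_eq (exp _)) in B; first by apply: Rlt_le; exact: exp_pos.
  have He := exp_pos (- INR n * a).
  have {}B : Rabs (h n) <= Sm * exp (INR n + 1) * exp (- a).
    apply: (Rmult_le_reg_r (exp (- INR n * a))) => //; apply: Rle_trans B _.
    right; rewrite Rmult_assoc Rmult_assoc -!exp_plus Rmult_comm; congr (_ * exp _); ring.
  apply: Rle_trans B _; apply: Rmult_le_compat_l => //.
  by apply: Rmult_le_pos => //; apply: Rlt_le; exact: exp_pos.
Qed.

Lemma tsum_fiber {T : Type} (phi : T -> nat) (w : T -> R) (F : nat -> R) :
  (forall n, summable (fun t => if Nat.eq_dec (phi t) n then w t else 0)) ->
  summable (fun t => w t * F (phi t)) ->
  let W n := tsum (fun t => if Nat.eq_dec (phi t) n then w t else 0) in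
  summable (fun n => W n * F n) /\ tsum (fun t => w t * F (phi t)) = tsum (fun n => W n * F n).
Proof.
  move=> Hw Hs W.
  pose G (p : nat * T) := if Nat.eq_dec (phi (snd p)) (fst p) then w (snd p) * F (phi (snd p)) else 0.
  have Hinj : forall s t : T, (phi s, s) = (phi t, t) -> s = t by move=> s t [].
  have H0 : forall p, (forall t : T, (phi t, t) <> p) -> G p = 0.
    move=> [n t] Hp; rewrite /G /=; case: Nat.eq_dec => // E; by case: (Hp t); rewrite E.
  have Hd t : G (phi t, t) = w t * F (phi t) by rewrite /G /=; case: Nat.eq_dec.
  have HG : summable G.
    by apply: (summable_embed (fun t => (phi t, t))) => //; apply: summable_ext Hs.
  have E n : tsum (fun t => G (n, t)) = W n * F n.
    rewrite /W Rmult_comm -tsum_scal //; apply: tsum_ext => t.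
    by rewrite /G /=; case: Nat.eq_dec => [->|_]; ring.
  split.
  - by apply: summable_ext E _; exact: summable_fubini HG.
  - rewrite -(tsum_ext _ _ E) -tsum_fubini // (tsum_embed (fun t => (phi t, t)) G Hinj H0 HG).
    by apply: tsum_ext => t; rewrite Hd.
Qed.

Lemma summable_fiber {T : Type} (phi : T -> nat) (w : T -> R) a :
  summable (fun t => w t * exp (- INR (phi t) * a)) ->
  forall n, summable (fun t => if Nat.eq_dec (phi t) n then w t else 0).
Proof.
  move=> H n; apply: summable_le (summable_scal (exp (INR n * a)) _ (summable_abs _ H)) => t.
  have P : 0 <= Rabs (w t * exp (- INR (phi t) * a)) by exact: Rabs_pos.
  have He := exp_pos (INR n * a).
  case: Nat.eq_dec => [<-|_]; last by rewrite Rabs_R0; nra.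
  rewrite Rabs_mult (Rabs_pos_eq (exp _)); first by apply: Rlt_le; exact: exp_pos.
  rewrite (Rmult_comm (Rabs _)) -Rmult_assoc -exp_plus (_ : _ + _ = 0); first ring.
  rewrite exp_0; lra.
Qed.

(** Jacobi's two-square theorem, weighted by an arbitrary function of the
    norm.  The two ways of writing [f0], by [f0_theta] and [f0_lambert], give
    the equality for exponential weights, and these determine the number of
    representations of each integer. *)
Theorem two_squares (F : nat -> R) : F 0%nat = 0 ->
  summable (fun p : Z * Z => F (normsq p)) ->
  summable (fun p : nat * nat => chi4 (S (fst p)) * F (S (fst p) * S (snd p))%nat) ->
  tsum (fun p : Z * Z => F (normsq p)) =
  4 * tsum (fun p : nat * nat => chi4 (S (fst p)) * F (S (fst p) * S (snd p))%nat).
Proof.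
  move=> F0 H1 H2.
  pose phi (p : nat * nat) := (S (fst p) * S (snd p))%nat.
  pose w (p : nat * nat) := chi4 (S (fst p)).
  pose one (p : Z * Z) := 1.
  have S1 a : 0 < a -> summable (fun p => one p * exp (- INR (normsq p) * a)).
    by move=> Ha; apply: summable_ext (summable_exp_normsq a Ha) => p; rewrite /one; ring.
  have S2 a : 0 < a -> summable (fun p => w p * exp (- INR (phi p) * a)).
    by move=> Ha; exact: summable_chi4_pair.
  have f1 := summable_fiber normsq one 1 (S1 1 Rlt_0_1).
  have f2 := summable_fiber phi w 1 (S2 1 Rlt_0_1).
  set W1 := fun n => tsum (fun t => if Nat.eq_dec (normsq t) n then one t else 0).
  set W2 := fun n => tsum (fun t => if Nat.eq_dec (phi t) n then w t else 0).
  pose dl n : R := if Nat.eq_dec n 0 then 1 else 0.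
  have Sd (G : nat -> R) : is_sum (fun n => dl n * G n) (G 0%nat).
    have := is_sum_single 0%nat (fun n => dl n * G n); rewrite {2}/dl /= Rmult_1_l; apply.
    by move=> n Hn; rewrite /dl; case: Nat.eq_dec => // _; ring.
  have K n : W1 n - dl n - 4 * W2 n = 0.
    apply: (exp_coef_unique (fun n => W1 n - dl n - 4 * W2 n)).
    - move=> a Ha.
      have [A1 _] := tsum_fiber normsq one (fun n => exp (- INR n * a)) f1 (S1 a Ha).
      have [A2 _] := tsum_fiber phi w (fun n => exp (- INR n * a)) f2 (S2 a Ha).
      have A3 := is_sum_summable _ _ (Sd (fun n => exp (- INR n * a))).
      apply: summable_ext (summable_minus _ _ (summable_minus _ _ A1 A3) (summable_scal 4 _ A2)) => m.
      rewrite -/(W1 m) -/(W2 m); ring.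
    - move=> a Ha.
      have [A1 B1] := tsum_fiber normsq one (fun n => exp (- INR n * a)) f1 (S1 a Ha).
      have [A2 B2] := tsum_fiber phi w (fun n => exp (- INR n * a)) f2 (S2 a Ha).
      have A3 := Sd (fun n => exp (- INR n * a)).
      have E := tsum_eq _ _ (is_sum_minus _ _ _ _ (is_sum_minus _ _ _ _ (tsum_is_sum _ A1) A3)
        (is_sum_scal 4 _ _ (tsum_is_sum _ A2))).
      rewrite -B1 -B2 in E.
      rewrite (tsum_ext _ (fun x => W1 x * exp (- INR x * a) - dl x * exp (- INR x * a) - 4 * (W2 x * exp (- INR x * a)))).
        by move=> m; ring.
      rewrite E.
      have := f0_theta a Ha; rewrite f0_lambert // th3_normsq // => E2.
      rewrite (tsum_ext (fun t => one t * _) (fun p => exp (- INR (normsq p) * a))).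
        by move=> p; rewrite /one; ring.
      rewrite -E2 /w /phi (_ : - INR 0 * a = 0) ?exp_0; first by rewrite /=; ring.
      ring.
  have H1' : summable (fun p => one p * F (normsq p)).
    by apply: summable_ext H1 => p; rewrite /one; ring.
  have [A1 B1] := tsum_fiber normsq one F f1 H1'.
  have [A2 B2] := tsum_fiber phi w F f2 H2.
  rewrite (tsum_ext _ (fun p => one p * F (normsq p))); first by move=> p; rewrite /one; ring.
  rewrite B1 -/W1 (_ : tsum (fun p : nat * nat => _) = tsum (fun n => W2 n * F n)); first exact: B2.
  rewrite -tsum_scal //; apply: tsum_ext => n.
  have := K n; rewrite /dl; case: Nat.eq_dec => [->|_] E.
  - rewrite F0; ring.
  - by rewrite -/(W1 n) (_ : W1 n = 4 * W2 n); [lra|ring].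
Qed.

(** ** The L-values involved *)

Definition L4v : R := tsum (fun i : nat => chi4 (S i) / INR (S i) ^ 2).
Definition L3v : R := tsum (fun i : nat => chi3 (S i) / INR (S i) ^ 2).

Lemma summable_chi (x : nat -> R) : (forall n, Rabs (x n) <= 1) ->
  summable (fun i : nat => x (S i) / INR (S i) ^ 2).
Proof.
  move=> Hx; apply: summable_le summable_inv_sq => i; rewrite S_INR.
  have Hp : 0 < / (INR i + 1) ^ 2.
    by apply: Rinv_0_lt_compat; apply: pow_lt; have := pos_INR i; lra.
  rewrite Rabs_mult (Rabs_pos_eq (/ _)); first lra.
  by rewrite -[X in _ <= X]Rmult_1_l; apply: Rmult_le_compat_r; [lra|exact: Hx].
Qed.

(** The character modulo 12 as a finite Fourier transform. *)
Lemma cos_two_diff n : (cos (INR n * (PI / 6)) - cos (INR n * (5 * PI / 6))) = sqrt 3 * (chi4 n * chi3 n).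
Proof.
  have E : cos (INR n * (PI / 6)) - cos (INR n * (5 * PI / 6)) = 2 * sin (INR n * (PI / 2)) * sin (INR n * (PI / 3)).
    rewrite (_ : INR n * (PI / 6) = INR n * (PI / 2) - INR n * (PI / 3)); first by field.
    rewrite (_ : INR n * (5 * PI / 6) = INR n * (PI / 2) + INR n * (PI / 3)); first by field.
    rewrite cos_minus cos_plus; ring.
  have P6 k r : sin (INR (6 * k + r) * (PI / 3)) = sin (INR r * (PI / 3)).
    rewrite plus_INR mult_INR (_ : (INR 6 * INR k + INR r) * (PI / 3) = INR r * (PI / 3) + 2 * INR k * PI).
      by rewrite /=; field.
    exact: sin_period.
  have S2 j : sin (INR (2 * j) * (PI / 2)) = 0.
    rewrite mult_INR (_ : INR 2 * INR j * (PI / 2) = IZR (Z.of_nat j) * PI); first by rewrite -INR_IZR_INZ /=; field.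
    exact: sin_IZR_PI.
  have S1 j : sin (INR (2 * j + 1) * (PI / 2)) = (-1) ^ j.
    rewrite plus_INR mult_INR (_ : (INR 2 * INR j + INR 1) * (PI / 2) = IZR (Z.of_nat j) * PI + PI / 2); first by rewrite -INR_IZR_INZ /=; field.
    rewrite sin_plus sin_PI2 cos_PI2 sin_IZR_PI Rmult_0_l Rplus_0_l Rmult_1_r.
    elim: j => [|j IH]; first by rewrite Rmult_0_l cos_0.
    rewrite Nat2Z.inj_succ succ_IZR Rmult_plus_distr_r cos_plus IH sin_IZR_PI Rmult_1_l cos_PI /=; ring.
  rewrite E.
  have [j [Hj|Hj]] : exists j, (n = 2 * j \/ n = 2 * j + 1)%nat.
    by exists (n / 2)%nat; have := Nat.div_mod_eq n 2; have := Nat.mod_upper_bound n 2; lia.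
  - rewrite Hj S2 chi4_even; ring.
  - have -> : chi4 n = (-1) ^ j by rewrite Hj chi4_odd.
    have -> : sin (INR n * (PI / 2)) = (-1) ^ j by rewrite Hj S1.
    have En := Nat.div_mod_eq n 6; have Bn := Nat.mod_upper_bound n 6 (ltac:(lia)).
    rewrite {1}En P6.
    have Hsin1 : sin (INR 1 * (PI / 3)) = sqrt 3 / 2.
      by rewrite Rmult_1_l sin_PI3.
    have Hsin3 : sin (INR 3 * (PI / 3)) = 0.
      by rewrite (_ : INR 3 * (PI / 3) = PI) ?sin_PI //=; field.
    have Hsin5 : sin (INR 5 * (PI / 3)) = - (sqrt 3 / 2).
      rewrite (_ : INR 5 * (PI / 3) = - (PI / 3) + 2 * INR 1 * PI); first by rewrite /=; field.
      by rewrite sin_period sin_neg sin_PI3.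
    have C k r : chi3 (6 * k + r) = chi3 r.
      by rewrite /chi3 (_ : (6 * k + r = r + (2 * k) * 3)%nat) ?Nat.Div0.mod_add; first lia.
    rewrite {2}En C.
    have [H|[H|H]] : (n mod 6 = 1 \/ n mod 6 = 3 \/ n mod 6 = 5)%nat by lia.
    + rewrite H Hsin1 (_ : chi3 1 = 1) //; field.
    + rewrite H Hsin3 (_ : chi3 3 = 0) //; field.
    + rewrite H Hsin5 (_ : chi3 5 = -1) //; field.
Qed.

Lemma L12_value : tsum (fun i : nat => chi4 (S i) * chi3 (S i) / INR (S i) ^ 2) = PI ^ 2 / (6 * sqrt 3).
Proof.
  have HPI := PI_RGT_0.
  have H3 : 0 < sqrt 3 by apply: sqrt_lt_R0; lra.
  have E := cos_series_sq (PI / 6) (5 * PI / 6) (ltac:(lra)) (ltac:(lra)) (ltac:(lra)).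
  rewrite (tsum_ext _ (fun i : nat => sqrt 3 * (chi4 (S i) * chi3 (S i) / INR (S i) ^ 2))) in E.
    by move=> i; rewrite cos_two_diff /Rdiv; ring.
  rewrite tsum_scal in E.
    apply: (summable_chi (fun n => chi4 n * chi3 n)) => n; rewrite Rabs_mult.
    have := chi4_bound n; have := chi3_bound n; have := Rabs_pos (chi4 n); have := Rabs_pos (chi3 n); nra.
  apply: (Rmult_eq_reg_l (sqrt 3)); last lra.
  rewrite E; field; lra.
Qed.

(** The sums over even indices of the cosine series at [PI / 2] and at [PI] are
    rational multiples of [zeta(2)], so [cos_series_sq] determines it. *)
Lemma zeta2_value : tsum (fun i : nat => / INR (S i) ^ 2) = PI ^ 2 / 6.
Proof.
  have HPI := PI_RGT_0.
  have Hs : summable (fun i : nat => / INR (S i) ^ 2).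
    by apply: summable_ext summable_inv_sq => i; rewrite S_INR.
  have E := cos_series_sq (PI / 2) PI (ltac:(lra)) (ltac:(lra)) (ltac:(lra)).
  set Z2 := tsum _.
  (* families supported on the even indices *)
  have Hinj : forall x y : nat, (2 * x + 1 = 2 * y + 1)%nat -> x = y by move=> *; lia.
  pose ev (h : nat -> R) (m : nat) := h (S (2 * m + 1)).
  have Eev : forall h : nat -> R, summable (fun i => h (S i)) -> (forall j, h (2 * j + 1)%nat = 0) ->
     tsum (fun i => h (S i)) = tsum (fun m => h (2 * S m)%nat).
    move=> h Hh H0; rewrite (tsum_embed (fun m => (2 * m + 1)%nat) (fun i => h (S i)) Hinj _ Hh).
      move=> b Hb.
      have [k [Ek|Ek]] : exists k, (b = 2 * k \/ b = 2 * k + 1)%nat.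
        by exists (b / 2)%nat; have := Nat.div_mod_eq b 2; have := Nat.mod_upper_bound b 2; lia.
      - by rewrite Ek -Nat.add_1_r.
      - by case: (Hb k).
    by apply: tsum_ext => m; congr h; lia.
  have c1 j : cos (INR (2 * j + 1) * (PI / 2)) = 0.
    rewrite plus_INR mult_INR (_ : (INR 2 * INR j + INR 1) * (PI / 2) = IZR (Z.of_nat j) * PI + PI / 2); first by rewrite -INR_IZR_INZ /=; field.
    by rewrite cos_plus cos_PI2 sin_IZR_PI; ring.
  have c2 m : cos (INR (2 * m) * (PI / 2)) = cos (INR m * PI).
    by rewrite mult_INR; congr cos; rewrite /=; field.
  have c3 m : cos (INR (2 * m) * PI) = 1.
    by rewrite INR_IZR_INZ Nat2Z.inj_mul cos_IZR_even.
  have c4 m : cos (INR (2 * m + 1) * PI) = -1.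
    by rewrite INR_IZR_INZ Nat2Z.inj_add Nat2Z.inj_mul cos_IZR_odd.
  have Scos t : summable (fun i : nat => cos (INR (S i) * t) / INR (S i) ^ 2).
    apply: (summable_chi (fun n => cos (INR n * t))) => n; exact: Rabs_cos_le.
  pose P := tsum (fun i : nat => cos (INR (S i) * PI) / INR (S i) ^ 2).
  have I2 m : INR (2 * S m) ^ 2 = 4 * INR (S m) ^ 2 by rewrite mult_INR; rewrite [INR 2]/=; ring.
  have EP1 : tsum (fun i : nat => cos (INR (S i) * (PI / 2)) / INR (S i) ^ 2) = / 4 * P.
    rewrite (Eev (fun n => cos (INR n * (PI / 2)) / INR n ^ 2)) //.
      by move=> j; rewrite c1 /Rdiv; ring.
    rewrite -tsum_scal //; apply: tsum_ext => m; rewrite c2 I2 /Rdiv Rinv_mult; ring.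
  have EP2 : P + Z2 = / 2 * Z2.
    rewrite /P /Z2 -tsum_plus //.
    rewrite (tsum_ext _ (fun i : nat => (1 + cos (INR (S i) * PI)) / INR (S i) ^ 2)); first by move=> i; rewrite /Rdiv; ring.
    rewrite (Eev (fun n => (1 + cos (INR n * PI)) / INR n ^ 2)).
    - by apply: summable_ext (summable_plus _ _ (Scos PI) Hs) => i; rewrite /Rdiv; ring.
    - by move=> j; rewrite c4 /Rdiv; ring.
    rewrite -tsum_scal //; apply: tsum_ext => m; rewrite c3 I2 /Rdiv Rinv_mult; field.
    by apply: not_0_INR.
  have E3 : / 4 * P - P = (PI * (PI - PI / 2) - (PI ^ 2 - (PI / 2) ^ 2) / 2) / 2.
    rewrite -E -EP1 /P -tsum_minus //; apply: tsum_ext => i; rewrite /Rdiv; ring.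
  have -> : PI ^ 2 / 6 = Z2; last by [].
  lra.
Qed.


(** * Lattice sums with congruence conditions *)

Definition wt (p : Z * Z) : R := / (IZR (fst p) ^ 2 + IZR (snd p) ^ 2) ^ 2.

(** The origin contributes nothing, since [/ 0 = 0]. *)
Definition LS (phi : Z * Z -> R) : R := tsum (fun p => phi p * wt p).

Lemma wt_normsq p : wt p = / INR (normsq p) ^ 2.
Proof. by rewrite /wt INR_normsq. Qed.

Lemma wt_nonneg p : 0 <= wt p.
Proof. by rewrite /wt -pow_inv; exact: pow2_ge_0. Qed.

Lemma summable_wt : summable wt.
Proof.
  have B := summable_Z_inv_sq.
  apply: summable_le (summable_scal 3 _ (summable_mult _ _ B B)) => p.
  rewrite Rabs_pos_eq; first exact: wt_nonneg.
  rewrite wt_normsq.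
  have H1 := pow2_ge_0 (IZR (fst p)); have H2 := pow2_ge_0 (IZR (snd p)).
  have P1 : 0 < / (1 + IZR (fst p) ^ 2) * / (1 + IZR (snd p) ^ 2).
    by apply: Rmult_lt_0_compat; apply: Rinv_0_lt_compat; lra.
  have [E0|Hne] := Nat.eq_dec (normsq p) 0.
    rewrite E0 (_ : INR 0 ^ 2 = 0) ?Rinv_0; [by rewrite /=; ring|lra].
  have HN : 1 <= INR (normsq p) by apply: (le_INR 1); lia.
  rewrite INR_normsq in HN *; set N := IZR (fst p) ^ 2 + IZR (snd p) ^ 2 in HN *.
  have HN2 : 0 < N ^ 2 by apply: pow_lt; lra.
  apply: (Rmult_le_reg_r (N ^ 2 * ((1 + IZR (fst p) ^ 2) * (1 + IZR (snd p) ^ 2)))).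
    by apply: Rmult_lt_0_compat => //; apply: Rmult_lt_0_compat; lra.
  rewrite (_ : / N ^ 2 * _ = (1 + IZR (fst p) ^ 2) * (1 + IZR (snd p) ^ 2)); first by field; lra.
  rewrite (_ : 3 * _ * _ = 3 * N ^ 2); first by field; lra.
  have : IZR (fst p) ^ 2 * IZR (snd p) ^ 2 <= N ^ 2.
    by rewrite /N; nra.
  have : N <= N ^ 2 by nra.
  rewrite {1}/N; nra.
Qed.

Lemma summable_LS phi : (exists K, forall p, Rabs (phi p) <= K) -> summable (fun p => phi p * wt p).
Proof.
  move=> [K HK]; apply: summable_le (summable_scal K _ summable_wt) => p.
  rewrite Rabs_mult (Rabs_pos_eq (wt p)); first exact: wt_nonneg.
  by apply: Rmult_le_compat_r; [exact: wt_nonneg|exact: HK].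
Qed.

(** The double sum of [two_squares] splits, as [x] is multiplicative. *)
Lemma two_squares_char (x : nat -> R) : (forall n, Rabs (x n) <= 1) ->
  (forall m n, x (m * n)%nat = x m * x n) ->
  LS (fun p => x (normsq p)) =
  4 * (tsum (fun i : nat => chi4 (S i) * x (S i) / INR (S i) ^ 2) * tsum (fun j : nat => x (S j) / INR (S j) ^ 2)).
Proof.
  move=> Hx Hm.
  have Hc n : Rabs (chi4 n * x n) <= 1.
    rewrite Rabs_mult; have := chi4_bound n; have := Hx n; have := Rabs_pos (chi4 n); have := Rabs_pos (x n); nra.
  have S1 := summable_chi (fun n => chi4 n * x n) Hc.
  have S2 := summable_chi x Hx.
  have E p : chi4 (S (fst p)) * (x (S (fst p) * S (snd p))%nat / INR (S (fst p) * S (snd p)) ^ 2) =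
     (chi4 (S (fst p)) * x (S (fst p)) / INR (S (fst p)) ^ 2) * (x (S (snd p)) / INR (S (snd p)) ^ 2).
    by rewrite Hm mult_INR; field; split; apply: not_0_INR.
  have E0 p : x (normsq p) * wt p = x (normsq p) / INR (normsq p) ^ 2 by rewrite wt_normsq.
  rewrite /LS (tsum_ext _ _ E0) (two_squares (fun n => x n / INR n ^ 2)).
  - by rewrite /= Rmult_0_l /Rdiv Rinv_0 Rmult_0_r.
  - by apply: summable_ext E0 _; apply: (summable_LS (fun p => x (normsq p))); exists 1.
  - by apply: summable_ext (summable_mult _ _ S1 S2) => p; rewrite E.
  rewrite -tsum_mult //; congr Rmult; apply: tsum_ext => p; by rewrite E.
Qed.

(** Change of variables along an injection that multiplies the norm by a
    constant. *)
Lemma LS_embed (e : Z * Z -> Z * Z) k phi : (exists K, forall p, Rabs (phi p) <= K) ->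
  (forall p p', e p = e p' -> p = p') -> (forall p, (forall p', e p' <> p) -> phi p = 0) ->
  (forall p, wt (e p) = k * wt p) -> LS phi = k * LS (fun p => phi (e p)).
Proof.
  move=> [K HK] Hi H0 Hw; have Hs := summable_LS phi (ex_intro _ K HK).
  have Hs' : summable (fun p => phi (e p) * wt p) by apply: (summable_LS (fun p => phi (e p))); exists K.
  rewrite /LS (tsum_embed e) //; first by move=> p Hp; rewrite H0 // Rmult_0_l.
  rewrite -tsum_scal //; apply: tsum_ext => p; rewrite Hw; ring.
Qed.

Lemma LS_plus phi psi : (exists K, forall p, Rabs (phi p) <= K) -> (exists K, forall p, Rabs (psi p) <= K) ->
  LS (fun p => phi p + psi p) = LS phi + LS psi.
Proof.
  move=> /summable_LS H1 /summable_LS H2; rewrite /LS -tsum_plus //.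
  by apply: tsum_ext => p; ring.
Qed.

Lemma LS_scal k phi : (exists K, forall p, Rabs (phi p) <= K) -> LS (fun p => k * phi p) = k * LS phi.
Proof.
  by move=> /summable_LS H; rewrite /LS -tsum_scal //; apply: tsum_ext => p; ring.
Qed.

Lemma LS_ext phi psi : (forall p, phi p = psi p) -> LS phi = LS psi.
Proof. by move=> E; apply: tsum_ext => p; rewrite E. Qed.

Definition dv3 (n : Z) : R := if Z.eq_dec (n mod 3) 0 then 1 else 0.
(** The sign [(-1)^n], in the form in which it occurs in Fourier series. *)
Definition cs (n : Z) : R := cos (IZR n * PI).

Lemma dv3_cases n : dv3 n = 0 \/ dv3 n = 1.
Proof. by rewrite /dv3; case: Z.eq_dec => _; [right|left]. Qed.

Lemma cs_cases n : (cs n = 1 /\ (n mod 2 = 0)%Z) \/ (cs n = -1 /\ (n mod 2 = 1)%Z).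
Proof.
  have En := Z_div_mod_eq_full n 2; have Bn := Z.mod_pos_bound n 2.
  have [E|E] : (n mod 2 = 0 \/ n mod 2 = 1)%Z by lia.
  - by left; rewrite /cs {1}En E Z.add_0_r cos_IZR_even.
  - by right; rewrite /cs {1}En E cos_IZR_odd.
Qed.

Lemma dv3_1 n : dv3 (3 * n) = 1.
Proof. by rewrite /dv3 Z.mul_comm Z.mod_mul. Qed.

Lemma dv3_neq0 n : dv3 n <> 0 -> exists m, (n = 3 * m)%Z.
Proof.
  rewrite /dv3; case: Z.eq_dec => // E _; exists (n / 3)%Z.
  have := Z_div_mod_eq_full n 3; lia.
Qed.


Definition bounded (phi : Z * Z -> R) : Prop := exists K, forall p, Rabs (phi p) <= K.

Lemma bounded_const c : bounded (fun _ => c).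
Proof. by exists (Rabs c) => _; apply: Rle_refl. Qed.

Lemma bounded_plus phi psi : bounded phi -> bounded psi -> bounded (fun p => phi p + psi p).
Proof.
  move=> [K H] [L H']; exists (K + L) => p.
  have := Rabs_triang (phi p) (psi p); have := H p; have := H' p; lra.
Qed.

Lemma bounded_mult phi psi : bounded phi -> bounded psi -> bounded (fun p => phi p * psi p).
Proof.
  move=> [K H] [L H']; exists (K * L) => p; rewrite Rabs_mult.
  by apply: Rmult_le_compat; try exact: Rabs_pos.
Qed.

Lemma bounded_dv3 (f : Z * Z -> Z) : bounded (fun p => dv3 (f p)).
Proof. by exists 1 => p; case: (dv3_cases (f p)) => ->; rewrite ?Rabs_R0 ?Rabs_R1; lra. Qed.

Lemma bounded_cs (f : Z * Z -> Z) : bounded (fun p => cs (f p)).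
Proof. by exists 1 => p; exact: Rabs_cos_le. Qed.

Ltac bdd := repeat first [ exact: bounded_dv3 | exact: bounded_cs | exact: bounded_const
  | apply: bounded_plus | apply: bounded_mult ].

Definition qv (p : Z * Z) : R := dv3 (snd p).
(** Indicator function of the pairs of even sum. *)
Definition ev (p : Z * Z) : R := / 2 * (1 + cs (fst p) * cs (snd p)).

Lemma LS_1 : LS (fun _ => 1) = 4 * (PI ^ 2 / 6 * L4v).
Proof.
  rewrite (two_squares_char (fun _ => 1)).
  - by move=> _; rewrite Rabs_R1; lra.
  - by move=> _ _; ring.
  rewrite Rmult_comm (Rmult_comm (PI ^ 2 / 6)) (Rmult_comm 4) -zeta2_value; congr (_ * _ * 4).
  - by apply: tsum_ext => i; rewrite Rmult_1_r.
  - by apply: tsum_ext => i; rewrite /Rdiv Rmult_1_l.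
Qed.

Lemma chi3_mult m n : chi3 (m * n) = chi3 m * chi3 n.
Proof.
  have [Bm Bn] := (Nat.mod_upper_bound m 3 (ltac:(lia)), Nat.mod_upper_bound n 3 (ltac:(lia))).
  rewrite /chi3 Nat.Div0.mul_mod.
  have [->|[->|->]] : (m mod 3 = 0 \/ m mod 3 = 1 \/ m mod 3 = 2)%nat by lia.
  all: have [->|[->|->]] : (n mod 3 = 0 \/ n mod 3 = 1 \/ n mod 3 = 2)%nat by lia.
  all: cbv [Nat.mul Nat.add Nat.modulo Nat.divmod Nat.sub fst snd]; repeat case: Nat.eq_dec => // _; ring.
Qed.

(** A square modulo 3 is 0 or 1, so [chi3 (u^2 + v^2)] is 0, 1 or -1 according to
    the number of multiples of 3 among [u] and [v]. *)
Lemma chi3_normsq p :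
  chi3 (normsq p) = 2 * dv3 (fst p) + 2 * dv3 (snd p) - 3 * (dv3 (fst p) * dv3 (snd p)) - 1.
Proof.
  case: p => u v; rewrite /chi3 /normsq /dv3; cbn [fst snd].
  have E : (Z.of_nat (Z.abs_nat (u * u + v * v) mod 3) = ((u mod 3) * (u mod 3) + (v mod 3) * (v mod 3)) mod 3)%Z.
    rewrite Nat2Z.inj_mod Zabs2Nat.id_abs Z.abs_eq; first nia.
    by rewrite Z.add_mod // (Z.mul_mod u u) // (Z.mul_mod v v) // -Z.add_mod.
  have [Bu Bv] := (Z.mod_pos_bound u 3 (ltac:(lia)), Z.mod_pos_bound v 3 (ltac:(lia))).
  have BM := Nat.mod_upper_bound (Z.abs_nat (u * u + v * v)) 3 (ltac:(lia)).
  move: (Z.abs_nat (u * u + v * v) mod 3)%nat E BM => M E BM.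
  have [Hu|[Hu|Hu]] : (u mod 3 = 0 \/ u mod 3 = 1 \/ u mod 3 = 2)%Z by lia.
  all: have [Hv|[Hv|Hv]] : (v mod 3 = 0 \/ v mod 3 = 1 \/ v mod 3 = 2)%Z by lia.
  all: rewrite Hu Hv in E *.
  all: have [HM|[HM|HM]] : (M = 0 \/ M = 1 \/ M = 2)%nat by lia.
  all: rewrite HM in E *; try by vm_compute in E.
  all: repeat (case: Z.eq_dec => // ?); repeat (case: Nat.eq_dec => // ?); ring.
Qed.

Lemma LS_scale_inj k (p p' : Z * Z) : k <> 0%Z -> ((k * fst p)%Z, (k * snd p)%Z) = ((k * fst p')%Z, (k * snd p')%Z) -> p = p'.
Proof. by case: p p' => [u v] [u' v'] Hk [] /= /Z.mul_reg_l -/(_ Hk) -> /Z.mul_reg_l -/(_ Hk) ->. Qed.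

Lemma wt_scale k p : IZR k <> 0 -> wt ((k * fst p)%Z, (k * snd p)%Z) = / IZR k ^ 4 * wt p.
Proof.
  move=> Hk; rewrite /wt; cbn [fst snd]; rewrite !mult_IZR -Rinv_mult; congr Rinv; ring.
Qed.

Lemma LS_dv3_both : LS (fun p => dv3 (fst p) * dv3 (snd p)) = / 81 * LS (fun _ => 1).
Proof.
  rewrite (LS_embed (fun p => (3 * fst p, 3 * snd p)%Z) (/ 81)); try by bdd.
  - by move=> p p'; exact: LS_scale_inj.
  - move=> [u v] H; cbn [fst snd].
    case: (dv3_cases u) => Hu; first by rewrite Hu Rmult_0_l.
    case: (dv3_cases v) => Hv; first by rewrite Hv Rmult_0_r.
    have [|a Ea] := dv3_neq0 u; first lra.
    have [|b Eb] := dv3_neq0 v; first lra.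
    by case: (H (a, b)); rewrite /= Ea Eb.
  - by move=> p; rewrite wt_scale; [lra|congr (/ _ * _); ring].
  by congr Rmult; apply: LS_ext => p; rewrite !dv3_1 Rmult_1_r.
Qed.

Lemma LS_dv3_fst : LS (fun p => dv3 (fst p)) = LS qv.
Proof.
  rewrite (LS_embed (fun p => (snd p, fst p)) 1); try by bdd.
  - by move=> [a b] [c d] [-> ->].
  - by move=> [a b] H; case: (H (b, a)).
  - by move=> p; rewrite /wt Rmult_1_l; cbn [fst snd]; congr (/ (_ ^ 2)); ring.
  by rewrite Rmult_1_l.
Qed.

Lemma LS_chi3 : LS (fun p => chi3 (normsq p)) = 4 * LS qv - 28 / 27 * LS (fun _ => 1).
Proof.
  rewrite (LS_ext _ (fun p => 2 * dv3 (fst p) + (2 * qv p + (-3 * (dv3 (fst p) * dv3 (snd p)) + -1 * 1)))).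
    by move=> p; rewrite chi3_normsq /qv; ring.
  rewrite /qv !LS_plus; try by bdd.
  rewrite !LS_scal; try by bdd.
  rewrite LS_dv3_both LS_dv3_fst /qv; field.
Qed.

(** The reflection [v -> - v] exchanges the conditions [3 | u - v] and
    [3 | u + v], and the two indicator functions add up to a combination of
    those of [3 | u] and [3 | v]. *)
Lemma LS_dv3_diff : LS (fun p => dv3 (fst p - snd p)) = 14 / 27 * LS (fun _ => 1) - LS qv.
Proof.
  have R : LS (fun p => dv3 (fst p + snd p)) = LS (fun p => dv3 (fst p - snd p)).
    rewrite (LS_embed (fun p => (fst p, - snd p)%Z) 1); try by bdd.
    - move=> [a b] [c d] [] /= -> H; congr pair; lia.
    - by move=> [a b] H; case: (H (a, (- b)%Z)); cbn [fst snd]; congr pair; lia.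
    - by move=> p; rewrite /wt Rmult_1_l; cbn [fst snd]; rewrite opp_IZR; congr (/ (_ ^ 2)); ring.
    by rewrite Rmult_1_l.
  have E : LS (fun p => dv3 (fst p - snd p) + dv3 (fst p + snd p)) =
     LS (fun p => 1 + (-1 * dv3 (fst p) + (-1 * qv p + 3 * (dv3 (fst p) * dv3 (snd p))))).
    apply: LS_ext => -[u v]; rewrite /qv /dv3; cbn [fst snd].
    have [Eu Ev] := (Z_div_mod_eq_full u 3, Z_div_mod_eq_full v 3).
    have [Bu Bv] := (Z.mod_pos_bound u 3 (ltac:(lia)), Z.mod_pos_bound v 3 (ltac:(lia))).
    have [Em Ep] := (Z_div_mod_eq_full (u - v) 3, Z_div_mod_eq_full (u + v) 3).
    have [Bm Bp] := (Z.mod_pos_bound (u - v) 3 (ltac:(lia)), Z.mod_pos_bound (u + v) 3 (ltac:(lia))).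
    case: Z.eq_dec => H1; case: Z.eq_dec => H2; case: Z.eq_dec => H3; case: Z.eq_dec => H4; try ring; exfalso; lia.
  rewrite /qv !LS_plus in E; try by bdd.
  rewrite !LS_scal in E; try by bdd.
  rewrite LS_dv3_both LS_dv3_fst R in E; rewrite /qv in E *; lra.
Qed.

Lemma LS_qv_even : LS (fun p => qv p * ev p) = / 4 * LS (fun p => dv3 (fst p - snd p)).
Proof.
  rewrite (LS_embed rot (/ 4)).
  - by rewrite /qv /ev; bdd.
  - exact: rot_inj.
  - move=> [u v] H; rewrite /ev; cbn [fst snd].
    case: (cs_cases u) => -[-> Hu]; case: (cs_cases v) => -[-> Hv]; try ring; exfalso.
    + by have [|p Hp] := rot_image (u, v); [cbn [fst snd]; rewrite Z.add_mod // Hu Hv|exact: (H p)].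
    + by have [|p Hp] := rot_image (u, v); [cbn [fst snd]; rewrite Z.add_mod // Hu Hv|exact: (H p)].
  - move=> p; rewrite /wt /rot; cbn [fst snd]; rewrite plus_IZR minus_IZR -Rinv_mult; congr Rinv; ring.
  congr Rmult; apply: LS_ext => p; rewrite /ev /cs.
  rewrite -cos_IZR_PI_add rot_sum cos_IZR_even /qv /rot; cbn [fst snd]; field.
Qed.

Lemma LS_qv_even_both : LS (fun p => qv p * (/ 4 * ((1 + cs (fst p)) * (1 + cs (snd p))))) = / 16 * LS qv.
Proof.
  rewrite (LS_embed (fun p => (2 * fst p, 2 * snd p)%Z) (/ 16)).
  - by rewrite /qv; bdd.
  - by move=> p p'; exact: LS_scale_inj.
  - move=> [u v] H; cbn [fst snd].
    case: (cs_cases u) => -[-> Hu]; case: (cs_cases v) => -[-> Hv]; try ring; exfalso.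
    apply: (H ((u / 2)%Z, (v / 2)%Z)); cbn [fst snd].
    by have := Z_div_mod_eq_full u 2; have := Z_div_mod_eq_full v 2; rewrite Hu Hv !Z.add_0_r => <- <-.
  - by move=> p; rewrite wt_scale; [lra|congr (/ _ * _); ring].
  congr Rmult; apply: LS_ext => -[u v]; rewrite /qv /cs !cos_IZR_even; cbn [fst snd].
  rewrite /dv3; have E := Z_div_mod_eq_full v 3; have B := Z.mod_pos_bound v 3.
  have E' := Z_div_mod_eq_full (2 * v) 3; have B' := Z.mod_pos_bound (2 * v) 3.
  case: Z.eq_dec => H; case: Z.eq_dec => H'; try field; exfalso; lia.
Qed.

Definition even_part : R := LS (fun p => qv p * (/ 2 * (1 + cs (snd p)))).
Definition odd_part : R := LS (fun p => qv p * (/ 2 * (1 + -1 * cs (snd p))) * cs (fst p)).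

(** Since [cs] takes the values 1 and -1, the two weights add up to
    [1 - 2 ev] plus twice the indicator function of both coordinates even. *)
Lemma even_plus_odd : 48 / PI ^ 2 * (even_part + odd_part) = 140 / 27 * L4v + 13 / sqrt 3 * L3v.
Proof.
  have HPI := PI_RGT_0.
  have H3 : 0 < sqrt 3 by apply: sqrt_lt_R0; lra.
  have E : even_part + odd_part = 9 / 8 * LS qv - 2 * LS (fun p => qv p * ev p).
    rewrite /even_part /odd_part -LS_plus; try by rewrite /qv; bdd.
    have -> : 9 / 8 * LS qv - 2 * LS (fun p => qv p * ev p) = LS (fun p => qv p + (-2 * (qv p * ev p) + 2 * (qv p * (/ 4 * ((1 + cs (fst p)) * (1 + cs (snd p))))))).
      rewrite !LS_plus; try by rewrite /qv /ev; bdd.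
      rewrite !LS_scal; try by rewrite /qv /ev; bdd.
      rewrite LS_qv_even_both; field.
    by apply: LS_ext => p; rewrite /ev; field.
  have EX : LS (fun p => chi3 (normsq p)) = 4 * (PI ^ 2 / (6 * sqrt 3) * L3v).
    by rewrite (two_squares_char chi3 chi3_bound chi3_mult) L12_value.
  rewrite E LS_qv_even LS_dv3_diff.
  have -> : LS qv = / 4 * LS (fun p => chi3 (normsq p)) + 7 / 27 * LS (fun _ => 1).
    rewrite LS_chi3; field.
  rewrite EX LS_1; field; lra.
Qed.


(** * The Epstein zeta function as a lattice sum *)

Lemma list_sum_restrict {T : Type} (D : T -> Prop) (f h : T -> R) (F G : list T) :
  (forall p, D p -> f p = h p) -> (forall p, ~ D p -> h p = 0) ->
  NoDup F -> NoDup G -> List.Forall D F -> (forall p, D p -> In p F <-> In p G) ->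
  list_sum f F = list_sum h G.
Proof.
  move=> Hf H0 HF HG HD HI.
  pose d p := if excluded_middle_informative (D p) then true else false.
  have Hd p : d p = true <-> D p by rewrite /d; case: excluded_middle_informative.
  have -> : list_sum h G = list_sum h (filter d G).
    elim: G {HG HI} => [|x G IH] //=; rewrite list_sum_cons IH /d.
    by case: excluded_middle_informative => H //; rewrite H0 // Rplus_0_l.
  rewrite -(list_sum_perm h F); last first.
    by apply: list_sum_ext => x Hx; apply: Hf; move/Forall_forall: HD; apply.
  apply: NoDup_Permutation => //; first exact: NoDup_filter.
  move=> x; rewrite filter_In Hd; split=> [Hx|[Hx HDx]]; last by apply/HI.
  have HDx : D x by move/Forall_forall: HD; apply.
  by split=> //; apply/HI.
Qed.

(** Terms that vanish outside [D] do not affect finite sums, so the two notions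
    of summation have the same limits. *)
Lemma sum_over_tsum {T : Type} (D : T -> Prop) (f h : T -> R) :
  (forall p, D p -> f p = h p) -> (forall p, ~ D p -> h p = 0) ->
  summable h -> sum_over D f = tsum h.
Proof.
  move=> Hf H0 Hs.
  pose d p := if excluded_middle_informative (D p) then true else false.
  have Hd p : d p = true <-> D p by rewrite /d; case: excluded_middle_informative.
  have HFd F : List.Forall D (filter d F) by apply/Forall_forall => x; rewrite filter_In Hd => -[].
  have U s : filterlim (list_sum f) (finite_subsets D) (locally s) -> is_sum h s.
    move=> H; apply/is_sum_eps => eps He.
    have [F0 [D0 HF0]] := H (ball s eps) (locally_ball s (mkposreal eps He)).
    exists F0 => F HF HI.
    rewrite -(list_sum_restrict D f h (filter d F) F) //; first exact: NoDup_filter.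
      by move=> p Hp; rewrite filter_In Hd; tauto.
    apply: HF0 => //; first exact: NoDup_filter.
    move=> x Hx; rewrite filter_In Hd; split; first exact: HI.
    by move/Forall_forall: D0; apply.
  have H : filterlim (list_sum f) (finite_subsets D) (locally (tsum h)).
    move=> P [eps HP]; have /is_sum_eps H := tsum_is_sum h Hs.
    have [F0 HF0] := H eps (cond_pos eps).
    exists (filter d F0); split=> // F HF HDF HI; apply: HP.
    have [G [HG [HG1 HG2]]] := exists_nodup (F ++ F0).
    rewrite (list_sum_restrict D f h F G) //.
      move=> p Hp; split=> [Hx|/HG2 Hx]; first by apply: HG1; apply: in_or_app; left.
      have [//|Hx'] := in_app_or _ _ _ Hx.
      by apply: HI; rewrite filter_In Hd.
    by apply: HF0 => // x Hx; apply: HG1; apply: in_or_app; right.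
  apply: (is_sum_uniq h); last exact: tsum_is_sum.
  apply: (U (sum_over D f)); rewrite /sum_over; apply: (iota_correct (fun s => filterlim (list_sum f) (finite_subsets D) (locally s))).
  exists (tsum h); split=> // s /U /tsum_eq //.
Qed.

Lemma snd_scale_inj k (p p' : Z * Z) : k <> 0%Z -> (fst p, (k * snd p)%Z) = (fst p', (k * snd p')%Z) -> p = p'.
Proof. by case: p p' => [u v] [u' v'] Hk [] /= -> /Z.mul_reg_l -/(_ Hk) ->. Qed.

Lemma epstein_even_part : epstein 1 0 36 2 = even_part.
Proof.
  rewrite /even_part /LS (tsum_embed (fun p : Z * Z => (fst p, 6 * snd p)%Z)).
  - by move=> p p'; exact: snd_scale_inj.
  - move=> [u v] H; rewrite /qv; cbn [fst snd].
    have [Hv|Hv] := dv3_cases v; first by rewrite Hv; ring.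
    have [|b Eb] := dv3_neq0 v; first lra.
    have [[_ Hc]|[-> _]] := cs_cases v; last by ring.
    exfalso; apply: (H (u, (b / 2)%Z)); cbn [fst snd]; congr pair.
    have := Z_div_mod_eq_full v 2; have := Z_div_mod_eq_full b 2; have := Z.mod_pos_bound b 2; lia.
  - by apply: summable_LS; rewrite -/(bounded _) /qv; bdd.
  have Hq p : qv (fst p, (6 * snd p)%Z) * (/ 2 * (1 + cs (snd (fst p, (6 * snd p)%Z)))) = 1.
    rewrite /qv /cs; cbn [fst snd]; rewrite (_ : (6 * snd p = 2 * (3 * snd p))%Z); first lia.
    by rewrite cos_IZR_even (_ : (2 * (3 * snd p) = 3 * (2 * snd p))%Z) ?dv3_1; [lia|field].
  rewrite /epstein; apply: sum_over_tsum.
  - move=> [n m] Hp; cbv zeta; rewrite Hq /wt [RHS]Rmult_1_l; cbn [fst snd]; rewrite mult_IZR.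
    set N := 1 * _ + _ + _; have -> : IZR n ^ 2 + (6 * IZR m) ^ 2 = N by rewrite /N; ring.
    have HN : 0 < N.
      rewrite /N; have H1 := pow2_ge_0 (IZR n); have H2 := pow2_ge_0 (IZR m).
      have [En|Hn] := Z.eq_dec n 0.
        have Hm : m <> 0%Z by move=> Em; apply: Hp; rewrite En Em.
        by have := pow2_gt_0 (IZR m) (not_0_IZR _ Hm); nra.
      by have := pow2_gt_0 (IZR n) (not_0_IZR _ Hn); nra.
    by rewrite Rpower_Ropp -(Rpower_pow 2) // ; congr (/ Rpower _ _); rewrite /=; ring.
  - move=> p /NNPP ->; rewrite /wt; cbn [fst snd]; rewrite Z.mul_0_r.
    by rewrite (_ : (0 ^ 2 + 0 ^ 2) ^ 2 = 0) ?Rinv_0; ring.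
  - apply: (summable_comp_inj (fun p : Z * Z => (fst p, (6 * snd p)%Z)) (fun p => qv p * (/ 2 * (1 + cs (snd p))) * wt p)).
      by move=> p p'; exact: snd_scale_inj.
    by apply: summable_LS; rewrite -/(bounded _) /qv; bdd.
Qed.

(** ** The odd part in terms of hyperbolic functions *)

(** The derivative of [sum_odd_exp], obtained from the shift of the index. *)
Lemma sum_odd_lin_exp u : 0 < u -> is_sum (fun j => 2 * oddR j * exp (- oddR j * u)) (cosh u / sinh u ^ 2).
Proof.
  move=> Hu.
  have S0 := sum_odd_exp u Hu.
  have Hs : summable (fun j => 2 * oddR j * exp (- oddR j * u)).
    apply: summable_le (summable_plus _ _ (summable_scal 4 _ (summable_poly_exp 1 u Hu)) (summable_scal 2 _ (summable_poly_exp 0 u Hu))) => j.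
    have Hj := oddR_ge1 j; have He := exp_pos (- oddR j * u).
    rewrite Rabs_pos_eq; first by nra.
    apply: (Rle_trans _ (2 * oddR j * exp (- u * INR j))).
      apply: Rmult_le_compat_l; first lra.
      by apply: exp_le_compat; rewrite /oddR; have := pos_INR j; nra.
    right; rewrite /oddR /=; ring.
  have HS := tsum_is_sum _ Hs; set V := tsum _ in HS.
  suff <- : V = cosh u / sinh u ^ 2 by [].
  (* the shift of the index by one multiplies the exponential by exp (-2u) *)
  have Hx := exp_pos (- u).
  have E : V = 2 * exp (- u) + exp (- u) ^ 2 * (V + 2 * / sinh u).
    rewrite {1}/V -tsum_Series // Series_incr_1; first by exists V; exact: is_sum_series.
    congr Rplus; first by rewrite /oddR /= Rmult_0_r Rplus_0_l !Rmult_1_r; congr (_ * exp _); ring.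
    apply: is_series_unique; apply: is_sum_series.
    apply: is_sum_ext (is_sum_scal (exp (- u) ^ 2) _ _ (is_sum_plus _ _ _ _ HS (is_sum_scal 2 _ _ S0))) => j.
    rewrite (_ : - oddR (S j) * u = - oddR j * u + (- u + - u)); first by rewrite /oddR S_INR; ring.
    rewrite !exp_plus /oddR S_INR; ring.
  have Hlt : exp (- u) < 1 by rewrite -exp_0; apply: exp_increasing; lra.
  have H2 : exp u = / exp (- u) by rewrite -exp_Ropp Ropp_involutive.
  have Hx2 : 0 < 1 - exp (- u) ^ 2 by nra.
  move: E; rewrite /sinh /cosh H2; move: (exp (- u)) Hx Hlt Hx2 => x Hx Hlt Hx2 E.
  apply: (Rmult_eq_reg_r (1 - x ^ 2)); last lra.
  rewrite (_ : V * (1 - x ^ 2) = V - x ^ 2 * V); first ring.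
  rewrite {1}E; field; split; nra.
Qed.

Lemma Hh_fubini m a : 0 < a -> is_sum (fun j => tsum (fun i => hterm m (i, j) a)) (Hh m a).
Proof.
  move=> Ha; have H := summable_hterm m a Ha.
  rewrite /Hh tsum_swap //; apply: tsum_is_sum.
  apply: (summable_fubini (fun p : nat * nat => hterm m (snd p, fst p) a)).
  by apply: (summable_comp_inj (fun p : nat * nat => (snd p, fst p))) H => -[i j] [i' j'] [-> ->].
Qed.

Lemma Hh0_sinh a : 0 < a -> is_sum (fun j => / (oddR j ^ 3 * sinh (oddR j * a))) (Hh 0 a).
Proof.
  move=> Ha; apply: is_sum_ext (Hh_fubini 0 a Ha) => j; have Hj := oddR_ge1 j.
  rewrite Rinv_mult; apply: tsum_eq.
  apply: is_sum_ext (is_sum_scal (/ oddR j ^ 3) _ _ (sum_odd_exp (oddR j * a) (ltac:(nra)))) => i.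
  rewrite /hterm; cbn [fst snd pow]; rewrite (_ : - oddR i * (oddR j * a) = - (oddR i * oddR j) * a); first ring.
  by field; lra.
Qed.

Lemma Hh1_sinh a : 0 < a ->
  is_sum (fun j => cosh (oddR j * a) / (oddR j ^ 2 * sinh (oddR j * a) ^ 2)) (Hh 1 a).
Proof.
  move=> Ha; apply: is_sum_ext (Hh_fubini 1 a Ha) => j; have Hj := oddR_ge1 j.
  rewrite (_ : cosh _ / _ = / oddR j ^ 2 * (cosh (oddR j * a) / sinh (oddR j * a) ^ 2)).
    by rewrite /Rdiv Rinv_mult; ring.
  apply: tsum_eq.
  apply: is_sum_ext (is_sum_scal (/ oddR j ^ 2) _ _ (sum_odd_lin_exp (oddR j * a) (ltac:(nra)))) => i.
  rewrite /hterm; cbn [fst snd pow]; rewrite (_ : - oddR i * (oddR j * a) = - (oddR i * oddR j) * a); first ring.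
  by field; lra.
Qed.

(** The inner sum over [u] is [csch_expansion_sq] at [x = 3 k], [k] odd. *)
Lemma odd_part_value : odd_part = PI / 27 * (Hh 0 (3 * PI) + 3 * PI * Hh 1 (3 * PI)).
Proof.
  have HPI := PI_RGT_0.
  pose G (p : Z * Z) := / 2 * cs (fst p) * wt (fst p, (3 * snd p)%Z).
  have Hinj : forall p p' : Z * Z, (fst p, (3 * snd p)%Z) = (fst p', (3 * snd p')%Z) -> p = p'.
    by move=> p p'; exact: snd_scale_inj.
  have HG : summable G.
    apply: (summable_comp_inj (fun p : Z * Z => (fst p, (3 * snd p)%Z)) (fun p => / 2 * cs (fst p) * wt p)) => //.
    by apply: summable_LS; rewrite -/(bounded _); bdd.
  have E1 : odd_part = tsum (fun p => G p * (1 - cs (snd p))).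
    rewrite /odd_part /LS (tsum_embed _ _ Hinj).
    - move=> [u v] H; rewrite /qv; cbn [fst snd].
      have [Hv|Hv] := dv3_cases v; first by rewrite Hv; ring.
      have [|b Eb] := dv3_neq0 v; first lra.
      by case: (H (u, b)); cbn [fst snd]; rewrite Eb.
    - by apply: summable_LS; rewrite -/(bounded _) /qv; bdd.
    apply: tsum_ext => p; rewrite /qv /G; cbn [fst snd]; rewrite dv3_1.
    have -> : cs (3 * snd p) = cs (snd p).
      rewrite /cs (_ : (3 * snd p = snd p + 2 * snd p)%Z); first lia.
      by rewrite cos_IZR_PI_add cos_IZR_even Rmult_1_r.
    ring.
  have HG2 : summable (fun p => G p * (1 - cs (snd p))).
    apply: summable_le (summable_scal 2 _ (summable_abs _ HG)) => p.
    rewrite Rabs_mult Rmult_comm; apply: Rmult_le_compat_r; first exact: Rabs_pos.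
    by apply: Rabs_le; rewrite /cs; have := COS_bound (IZR (snd p) * PI); lra.
  pose x (v : Z) := tsum (fun u => G (u, v)).
  have HGs : summable (fun p : Z * Z => G (snd p, fst p)).
    by apply: (summable_comp_inj (fun p : Z * Z => (snd p, fst p))) HG => -[a b] [c d] [-> ->].
  have Hx : summable x by exact: (summable_fubini (fun p : Z * Z => G (snd p, fst p))).
  have HGu v : summable (fun u => G (u, v)).
    by apply: (summable_comp_inj (fun u => (u, v))) HG => a b [].
  have E2 : odd_part = tsum (fun v => x v * (1 - cos (IZR v * PI))).
    rewrite E1 tsum_swap //; apply: tsum_ext => v.
    rewrite Rmult_comm -tsum_scal //; apply: tsum_ext => u; cbn [snd]; rewrite /cs; ring.
  rewrite E2 tsum_odd_Z //.
    by move=> v; apply: tsum_ext => u; rewrite /G /wt; cbn [fst snd]; rewrite !mult_IZR opp_IZR; congr (_ * / (_ ^ 2)); ring.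
  have Ha : 0 < 3 * PI by lra.
  have Hk j : 0 < oddR j by have := oddR_ge1 j; lra.
  have Hsh j : 0 < sinh (oddR j * (3 * PI)).
    by rewrite -sinh_0; apply: sinh_lt; apply: Rmult_lt_0_compat.
  have V i : 4 * x (2 * Z.of_nat i + 1)%Z = PI / 27 * / (oddR i ^ 3 * sinh (oddR i * (3 * PI))) +
     PI ^ 2 / 9 * (cosh (oddR i * (3 * PI)) / (oddR i ^ 2 * sinh (oddR i * (3 * PI)) ^ 2)).
    have Ei : IZR (3 * (2 * Z.of_nat i + 1)) = 3 * oddR i.
      by rewrite mult_IZR plus_IZR mult_IZR -INR_IZR_INZ.
    have C := csch_expansion_sq (3 * oddR i) (ltac:(have := Hk i; lra)).
    have -> : x (2 * Z.of_nat i + 1)%Z = / 2 * tsum (fun n => cos (IZR n * PI) / ((3 * oddR i) ^ 2 + IZR n ^ 2) ^ 2).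
      rewrite -tsum_scal.
        apply: summable_ext (summable_scal 2 _ (HGu (2 * Z.of_nat i + 1)%Z)) => n.
        rewrite /G /wt; cbn [fst snd]; rewrite Ei /cs (Rplus_comm (_ ^ 2)) /Rdiv; field.
        have := pow2_ge_0 (IZR n); have := Hk i; nra.
      apply: tsum_ext => n; rewrite /G /wt; cbn [fst snd]; rewrite Ei /cs (Rplus_comm (_ ^ 2)) /Rdiv; ring.
    rewrite C (_ : PI * (3 * oddR i) = oddR i * (3 * PI)); first ring.
    have := Hk i; have := Hsh i; move=> H1 H2; field; lra.
  rewrite (_ : PI / 27 * (Hh 0 (3 * PI) + 3 * PI * Hh 1 (3 * PI)) = PI / 27 * Hh 0 (3 * PI) + PI ^ 2 / 9 * Hh 1 (3 * PI)); first by field.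
  rewrite -tsum_scal; first by apply: (summable_comp_inj (fun i : nat => (2 * Z.of_nat i + 1)%Z)) Hx => *; lia.
  apply: tsum_eq; apply: is_sum_ext (fun i => eq_sym (V i)) _.
  by apply: is_sum_plus; apply: is_sum_scal; [exact: Hh0_sinh|exact: Hh1_sinh].
Qed.


(** * The Kronecker symbols of discriminants -4 and -3 *)

Definition square_test (k : Z) (p : nat) : bool :=
  existsb (fun x => ((Z.of_nat x ^ 2 - k) mod Z.of_nat p =? 0)%Z) (List.seq 0 p).

Lemma square_test_nat c p : (0 < p)%nat ->
  square_test (- Z.of_nat c) p = true <-> exists x, (x < p)%nat /\ ((x * x + c) mod p = 0)%nat.
Proof.
  move=> p0; have E x : ((Z.of_nat x ^ 2 - - Z.of_nat c) mod Z.of_nat p =? 0)%Z = true <-> ((x * x + c) mod p = 0)%nat.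
    rewrite Z.eqb_eq (_ : (Z.of_nat x ^ 2 - - Z.of_nat c = Z.of_nat (x * x + c))%Z); first by lia.
    by rewrite -Nat2Z.inj_mod; lia.
  rewrite /square_test existsb_exists; split=> [[x [/in_seq [_ Hx] /E H]]|[x [Hx /E H]]]; exists x.
  - by split=> //; lia.
  - by split=> //; apply/in_seq; lia.
Qed.

Module QuadraticCharacter.
Import all_boot.
Import all_algebra.
Import finfield.
Import GRing.Theory.
Local Open Scope ring_scope.

(** A positive exponent below [#|F| - 1] does not kill the multiplicative group,
    as [X^m - 1] has at most [m] roots. *)
Lemma exists_nontrivial_power (F : finFieldType) (m : nat) :
  (0 < m)%N -> (m < #|F|.-1)%N -> exists y : F, (y != 0) && (y ^+ m != 1).
Proof.
move=> m0 ltm; apply/existsP; apply: contraTT ltm => H; rewrite -leqNgt.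
have P0 : 'X^m - 1 != 0 :> {poly F} by rewrite -size_poly_gt0 size_XnsubC.
have := @max_poly_roots F _ (enum [pred y : F | y != 0]) P0.
rewrite size_XnsubC // -cardE => A.
have -> : #|F|.-1 = #|[pred y : F | y != 0]|.
  by rewrite (cardD1 0) inE add1n /=; apply: eq_card => y; rewrite !inE andbT.
rewrite -ltnS; apply: A; last exact: enum_uniq.
apply/allP => y; rewrite mem_enum inE => y0.
move: H; rewrite negb_exists => /forallP /(_ y); rewrite y0 /= negbK => /eqP E.
by rewrite rootE !hornerE E subrr.
Qed.

Lemma square_2w1 (R : comNzRingType) (w : R) :
  (2 * w + 1) * (2 * w + 1) + (2 * 2 - 1) = 2 * 2 * (w ^+ 2 + w + 1).
Proof.
rewrite -expr2 sqrrD exprMn expr1n mulr1 -(mulr_natl (2 * w) 2) (mulrA 2 2 w) (expr2 2) addrA (addrAC _ 1 (2 * 2)) addrK.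
by rewrite (mulrDr (2 * 2) (w ^+ 2 + w)) (mulrDr (2 * 2) (w ^+ 2)) (mulr1 (2 * 2)).
Qed.

Lemma cube_sub1 (R : comNzRingType) (w : R) : w ^+ 3 - 1 = (w - 1) * (w ^+ 2 + w + 1).
Proof. by rewrite subrX1 !big_ord_recl big_ord0 /= addr0 expr0 expr1 (addrC 1) (addrC w (w ^+ _)). Qed.
Section Fp.
Variables (p : nat) (pr : prime p).

Lemma Fp_power (y : 'F_p) : y ^+ p = y.
Proof. by have := expf_card y; rewrite card_Fp. Qed.

Lemma Fp_power_pred (y : 'F_p) : y != 0 -> y ^+ p.-1 = 1.
Proof.
move=> y0; apply: (mulfI y0); rewrite mulr1 -exprS prednK ?prime_gt0 //; exact: Fp_power.
Qed.

Lemma dvd_Fp n : (p %| n)%N = (n%:R == 0 :> 'F_p).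
Proof. by apply: dvdn_pcharf; exact: pchar_Fp. Qed.

Lemma Fp_lift c : (exists x, (x < p)%N /\ (p %| x * x + c)%N) <-> exists y : 'F_p, y * y + c%:R = 0.
Proof.
split=> [[x [_ ]]|[y E]].
- by rewrite dvd_Fp natrD natrM => /eqP E; exists x%:R.
- exists y; split; first by have := ltn_ord y; rewrite {2}Fp_cast.
  by rewrite dvd_Fp natrD natrM natr_Zp E.
Qed.
Hypothesis (p2 : p <> 2%N).

Lemma two_neq0 : 2 != 0 :> 'F_p.
Proof.
rewrite -dvd_Fp dvdn_prime2 //; exact/eqP.
Qed.

Lemma four_neq0 : (2 * 2 : 'F_p) != 0.
Proof. by rewrite mulf_neq0 // two_neq0. Qed.

Lemma prime_odd : odd p.
Proof. by case: (even_prime pr). Qed.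


Lemma power_root d : (1 < d)%N -> (p %% d = 1)%N -> exists y : 'F_p, ((y ^+ (p %/ d)) ^+ d = 1) /\ (y ^+ (p %/ d) != 1).
Proof.
move=> d1 E; have p1 := prime_gt1 pr.
have E2 : p.-1 = (p %/ d * d)%N by rewrite {1}(divn_eq p d) E addn1.
have k0 : (0 < p %/ d)%N.
  by rewrite lt0n; apply/eqP => K; move: E2 p1; rewrite K mul0n; case: p => [|[]].
have [|y /andP [y0 y1]] := @exists_nontrivial_power 'F_p (p %/ d) k0.
  by rewrite card_Fp // E2 ltn_Pmulr.
by exists y; split=> //; rewrite -exprM -E2 Fp_power_pred.
Qed.

(** A square root of [-4] is twice a square root [w] of [-1], an element of order
    4; the Frobenius fixes it exactly when [p] is 1 modulo 4. *)
Lemma Fp_minus4 : (exists y : 'F_p, y * y + 4%:R = 0) <-> (p %% 4 = 1)%N.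
Proof.
have h4 := four_neq0.
have e4 : 4%:R = 2 * 2 :> 'F_p by rewrite -natrM.
split.
- move=> [y E].
  pose w := y / 2.
  have w2 : w ^+ 2 = -1.
    rewrite expr2 /w mulf_div; apply: (mulIf h4); rewrite mulfVK // mulN1r -e4.
    by apply/eqP; rewrite -addr_eq0 E.
  have w4 : w ^+ 4 = 1 by rewrite (exprM w 2 2) w2 sqrrN expr1n.
  have : (p %% 4 < 4)%N by rewrite ltn_mod.
  have := prime_odd; rewrite -(odd_mod p (erefl : odd 4 = false)).
  case Er : (p %% 4)%N => [|[|[|[|]]]] // _ _.
  have := Fp_power w; rewrite -(GRing.expr_mod p w4) Er exprS w2 mulrN1 => /eqP.
  rewrite eq_sym -subr_eq0 opprK -mulr2n -mulr_natr mulf_eq0 (negbTE two_neq0) orbF => /eqP w0.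
  by move: w2; rewrite w0 expr0n /= => /eqP; rewrite eq_sym oppr_eq0 oner_eq0.
- move=> E.
  have E2 : p = (p %/ 4 * 2 * 2 + 1)%N by rewrite -mulnA {1}(divn_eq p 4) E.
  have [||y [y2 y1]] := @power_root 2 => //; first by rewrite E2 modnMDl.
  have E3 : (p %/ 4 * 2 = p %/ 2)%N by rewrite [in RHS]E2 divnMDl // addn0.
  have Ei : (y ^+ (p %/ 4)) ^+ 2 = -1.
    rewrite -exprM E3.
    move/eqP: y2; rewrite sqrf_eq1 (negbTE y1) /=; exact/eqP.
  exists (2 * y ^+ (p %/ 4)); rewrite e4 mulrACA -[X in _ * X + _]expr2 Ei; by rewrite mulrN1 addNr.
Qed.

(** A square root of [-3] is [2 w + 1] with [w] a primitive cube root of unity. *)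
Lemma Fp_minus3 : p <> 3%N -> (exists y : 'F_p, y * y + 3%:R = 0) <-> (p %% 3 = 1)%N.
Proof.
move=> p3; have h4 := four_neq0; have h2 := two_neq0.
have h3 : 3%:R != 0 :> 'F_p by rewrite -dvd_Fp dvdn_prime2 //; exact/eqP.
have e4 : 4%:R = 2 * 2 :> 'F_p by rewrite -natrM.
have e3 : 3%:R = 4%:R - 1 :> 'F_p by rewrite -[4%:R]/((3 + 1)%N%:R) natrD addrK.
split.
- move=> [y E].
  pose w := (y - 1) / 2.
  have Ew : y = 2 * w + 1 by rewrite /w mulrC mulfVK // subrK.
  have Q : w ^+ 2 + w + 1 = 0.
    by apply: (mulfI h4); rewrite mulr0 -E e3 e4 Ew square_2w1.
  have w3 : w ^+ 3 = 1.
    by apply/eqP; rewrite -subr_eq0 cube_sub1 Q mulr0.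
  have : (p %% 3 < 3)%N by rewrite ltn_mod.
  case Er : (p %% 3)%N => [|[|[|]]] // _.
    by move/eqP: Er; rewrite -/(dvdn 3 p) dvdn_prime2 // => /eqP /esym.
  have := Fp_power w; rewrite -(GRing.expr_mod p w3) Er => Ew2; exfalso.
  have w0 : w != 0 by apply/eqP => w0; move/eqP: Q; rewrite w0 expr0n /= !add0r oner_eq0.
  have w1 : w = 1 by apply: (mulfI w0); rewrite mulr1 -expr2.
  move/eqP: Q; rewrite w1 expr1n (_ : 1 + 1 + 1 = 3%:R) ?(negbTE h3) //.
  by rewrite -[3%:R]/((1 + 1 + 1)%N%:R) !natrD.
- move=> E.
  have [||y [y3 y1]] := @power_root 3 => //.
  pose w := y ^+ (p %/ 3); exists (2 * w + 1).
  have Q : w ^+ 2 + w + 1 = 0.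
    by move/eqP: y3; rewrite -/w -subr_eq0 cube_sub1 mulf_eq0 subr_eq0 (negbTE y1) /= => /eqP.
  by rewrite e3 e4 square_2w1 Q mulr0.
Qed.

End Fp.

Lemma modn_modulo m d : (0 < d)%N -> (m %% d)%N = Nat.modulo m d.
Proof.
move=> d0; apply: (Nat.mod_unique m d (m %/ d)%N); first by apply/ltP; rewrite ltn_mod.
by rewrite [LHS](divn_eq m d) mulnC.
Qed.

Lemma dvdn_modulo d m : (0 < d)%N -> (d %| m)%N <-> Nat.modulo m d = 0%N.
Proof. by move=> d0; rewrite -modn_modulo //; split=> /eqP. Qed.

Lemma expn_pow m n : (m ^ n)%N = Nat.pow m n.
Proof. by elim: n => [|n IH] //=; rewrite expnS IH. Qed.

Lemma square_search p c : prime p ->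
  square_test (Z.opp (Z.of_nat c)) p = true <-> exists x, (x < p)%N /\ (p %| x * x + c)%N.
Proof.
move=> pr; have p0 := prime_gt0 pr; rewrite square_test_nat; first exact/ltP.
by split=> [[x [/ltP Hx /(dvdn_modulo _ _ p0) H]]|[x [/ltP Hx /(dvdn_modulo _ _ p0) H]]]; exists x.
Qed.

Lemma minus4_square p : prime p -> p <> 2%N -> square_test (Z.opp (Z.of_nat 4)) p = true <-> Nat.modulo p 4 = 1%N.
Proof.
move=> pr p2; rewrite (square_search p 4 pr) (Fp_lift p pr 4) (Fp_minus4 p pr p2).
by rewrite modn_modulo.
Qed.

Lemma minus3_square p : prime p -> p <> 2%N -> p <> 3%N ->
  square_test (Z.opp (Z.of_nat 3)) p = true <-> Nat.modulo p 3 = 1%N.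
Proof.
move=> pr p2 p3; rewrite (square_search p 3 pr) (Fp_lift p pr 3) (Fp_minus3 p pr p2 p3).
by rewrite modn_modulo.
Qed.

Lemma prime_modulo p d : prime p -> lt 1 d -> p <> d -> Nat.modulo p d <> 0%N.
Proof.
move=> pr /ltP d1 pd /dvdn_modulo H; have d0 := ltnW d1.
have := H d0; case/primeP: pr => _ /[apply] /orP [] /eqP E; last by apply: pd.
by rewrite E in d1.
Qed.

Lemma prime_decomp_spec n : lt 0 n ->
  List.Forall (fun pe => prime (fst pe)) (prime_decomp n) /\
  n = fold_right (fun pe acc => Nat.mul (Nat.pow (fst pe) (snd pe)) acc) 1%N (prime_decomp n).
Proof.
move=> /ltP n0; split.
- apply/Forall_forall => -[q e] H /=.
  have : (q, e) \in prime_decomp n.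
    by elim: (prime_decomp n) H => [|x l IH] //= [->|/IH]; rewrite inE ?eqxx // => ->; rewrite orbT.
  by move=> /mem_prime_decomp [].
- rewrite {1}(prod_prime_decomp n0).
  by elim: (prime_decomp n) => [|[q e] l IH]; rewrite ?big_nil // big_cons IH expn_pow.
Qed.

End QuadraticCharacter.

Lemma chi4_mult m n : chi4 (m * n) = chi4 m * chi4 n.
Proof.
  have [Bm Bn] := (Nat.mod_upper_bound m 4 (ltac:(lia)), Nat.mod_upper_bound n 4 (ltac:(lia))).
  rewrite /chi4 Nat.Div0.mul_mod.
  have [->|[->|[->|->]]] : (m mod 4 = 0 \/ m mod 4 = 1 \/ m mod 4 = 2 \/ m mod 4 = 3)%nat by lia.
  all: have [->|[->|[->|->]]] : (n mod 4 = 0 \/ n mod 4 = 1 \/ n mod 4 = 2 \/ n mod 4 = 3)%nat by lia.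
  all: cbv [Nat.mul Nat.add Nat.modulo Nat.divmod Nat.sub fst snd]; repeat case: Nat.eq_dec => // _; ring.
Qed.

(** By complete multiplicativity it suffices to compare values at primes. *)
Lemma kronecker_eq k (x : nat -> R) : x 1%nat = 1 -> (forall m n, x (m * n)%nat = x m * x n) ->
  (forall p, prime.prime p = true -> IZR (kronecker_prime k p) = x p) ->
  forall n, (0 < n)%nat -> IZR (kronecker k n) = x n.
Proof.
  move=> x1 xm xp n Hn; have [HF E] := QuadraticCharacter.prime_decomp_spec n Hn.
  rewrite [in RHS]E /kronecker; elim: HF => [|[p e] l /= Hp _ IH]; first by rewrite /= x1.
  rewrite mult_IZR IH xm -pow_IZR (xp _ Hp); congr (_ * _).
  by elim: e => [|e IHe] /=; rewrite ?x1 // xm IHe.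
Qed.

Lemma mod_Z_nat c p : (0 < p)%nat -> ((- Z.of_nat c) mod Z.of_nat p = 0)%Z -> (0 < c)%nat -> (p <= c)%nat.
Proof.
  move=> Hp H Hc; have H2 : (Z.of_nat p | - Z.of_nat c)%Z by apply/Z.mod_divide => //; lia.
  have := Z.divide_pos_le (Z.of_nat p) (Z.of_nat c) (ltac:(lia)) (proj1 (Z.divide_opp_r _ _) H2); lia.
Qed.

Lemma kronecker_prime_minus4 p : prime.prime p = true -> IZR (kronecker_prime (-4) p) = chi4 p.
Proof.
  move=> Hp.
  have P0 : (0 < p)%nat by case: p Hp => //; lia.
  rewrite /kronecker_prime; case: Z.eqb_spec => [H|H].
    have Hle : (p <= 4)%nat := mod_Z_nat 4 p P0 H (ltac:(lia)).
    by move: Hp H; (have [->|[->|[->|->]]] : (p = 1 \/ p = 2 \/ p = 3 \/ p = 4)%nat by lia).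
  have p2 : p <> 2%nat by move=> E; rewrite E in H.
  case: Z.eqb_spec => [E|_]; first lia.
  rewrite -[existsb _ _]/(square_test (- Z.of_nat 4) p).
  have S := QuadraticCharacter.minus4_square p Hp p2.
  have B := Nat.mod_upper_bound p 4 (ltac:(lia)).
  have Hodd := QuadraticCharacter.prime_modulo p 2 Hp (ltac:(lia)) p2.
  have E2 := Nat.div_mod_eq p 2; have E4 := Nat.div_mod_eq p 4; have B2 := Nat.mod_upper_bound p 2 (ltac:(lia)).
  rewrite /chi4; case: square_test S => S.
  - by rewrite (proj1 S).
  - case: Nat.eq_dec => H1; first by have := proj2 S H1.
    by case: Nat.eq_dec => // H3; lia.
Qed.

Lemma kronecker_prime_minus3 p : prime.prime p = true -> IZR (kronecker_prime (-3) p) = chi3 p.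
Proof.
  move=> Hp.
  have P0 : (0 < p)%nat by case: p Hp => //; lia.
  rewrite /kronecker_prime; case: Z.eqb_spec => [H|H].
    have Hle : (p <= 3)%nat := mod_Z_nat 3 p P0 H (ltac:(lia)).
    by move: Hp H; (have [->|[->|->]] : (p = 1 \/ p = 2 \/ p = 3)%nat by lia).
  have p3 : p <> 3%nat by move=> E; rewrite E in H.
  case: Z.eqb_spec => [E|p2]; first by rewrite (_ : p = 2%nat); [lia|].
  have {}p2 : p <> 2%nat by lia.
  rewrite -[existsb _ _]/(square_test (- Z.of_nat 3) p).
  have S := QuadraticCharacter.minus3_square p Hp p2 p3.
  have B := Nat.mod_upper_bound p 3 (ltac:(lia)).
  have H3 := QuadraticCharacter.prime_modulo p 3 Hp (ltac:(lia)) p3.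
  rewrite /chi3; case: square_test S => S.
  - by rewrite (proj1 S).
  - case: Nat.eq_dec => H1; first by have := proj2 S H1.
    by case: Nat.eq_dec => // H4; lia.
Qed.

Lemma Lseries_value k (x : nat -> R) : (forall n, Rabs (x n) <= 1) ->
  (forall n, (0 < n)%nat -> IZR (kronecker k n) = x n) ->
  Lseries k 2 = tsum (fun i : nat => x (S i) / INR (S i) ^ 2).
Proof.
  move=> Hx H; rewrite /Lseries -tsum_Series; first exact: summable_chi.
  apply: Series_ext => i; rewrite H; first lia.
  congr Rmult; rewrite Rpower_Ropp -(Rpower_pow 2); first by apply: lt_0_INR; lia.
  by congr (/ Rpower _ _).
Qed.

Lemma Lseries_minus4 : Lseries (-4) 2 = L4v.
Proof.
  apply: (Lseries_value (-4) chi4 chi4_bound); apply: kronecker_eq => //; first exact: chi4_mult.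
  exact: kronecker_prime_minus4.
Qed.

Lemma Lseries_minus3 : Lseries (-3) 2 = L3v.
Proof.
  apply: (Lseries_value (-3) chi3 chi3_bound); apply: kronecker_eq => //; first exact: chi3_mult.
  exact: kronecker_prime_minus3.
Qed.


(** * Euler's integral at integers and half-integers *)

Definition gint (f : R -> R) (l : R) : Prop := is_RInt_gen f (at_right 0) (Rbar_locally p_infty) l.

Lemma at_right_0_pos : at_right 0 (fun a => 0 < a).
Proof. by exists (mkposreal 1 Rlt_0_1). Qed.

Lemma near_p_infty x : Rbar_locally p_infty (fun b => x < b).
Proof. by exists x. Qed.

Lemma gint_antiderivative (G g : R -> R) la lb :
  (forall u, 0 < u -> is_derive G u (g u)) -> (forall u, 0 < u -> continuous g u) ->
  filterlim G (at_right 0) (locally la) -> filterlim G (Rbar_locally p_infty) (locally lb) ->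
  gint g (lb - la).
Proof.
  move=> HG Hg /filterlim_locally Ha /filterlim_locally Hb.
  apply/filterlimi_locally => eps.
  have He := cond_pos eps.
  have He2 : 0 < eps / 2 by lra.
  apply: (Filter_prod _ _ _ _ _ (filter_and _ _ at_right_0_pos (Ha (mkposreal _ He2)))
    (filter_and _ _ (near_p_infty 0) (Hb (mkposreal _ He2)))).
  move=> a b [Ha0 HA] [Hb0 HB]; exists (G b - G a); split.
  - have Hp u : Rmin a b <= u -> 0 < u by move=> H; have := Rmin_glb_lt a b 0; lra.
    by apply: is_RInt_derive => u [/Hp Hu _]; [exact: HG|exact: Hg].
  - move: HA HB; rewrite /ball /= /AbsRing_ball /abs /minus /plus /opp /= => HA HB.
    move: HA HB; rewrite /Rabs; repeat case: Rcase_abs; lra.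
Qed.

(** The integral is the supremum of the integrals over compact intervals, which
    the antiderivative [G] bounds. *)
Lemma gint_dominated (f G g : R -> R) M :
  (forall u, 0 < u -> continuous f u) -> (forall u, 0 < u -> 0 < f u <= g u) ->
  (forall u, 0 < u -> is_derive G u (g u)) -> (forall u, 0 < u -> continuous g u) ->
  (forall u, 0 < u -> 0 <= G u <= M) -> exists l, 0 < l /\ gint f l.
Proof.
  move=> Hf Hfg HG Hg HM.
  have ex a b : 0 < a -> 0 < b -> ex_RInt f a b.
    move=> Ha Hb; apply: (ex_RInt_continuous (V := R_CompleteNormedModule)) => u [Hu _].
    by apply: Hf; have := Rmin_glb_lt a b 0; lra.
  have bnd a b : 0 < a -> a <= b -> RInt f a b <= M.
    move=> Ha Hab.
    have Hi : is_RInt g a b (G b - G a).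
      apply: is_RInt_derive => u; rewrite Rmin_left // => -[Hu _]; [apply: HG|apply: Hg]; lra.
    apply: (Rle_trans _ (G b - G a)); last by have := HM a Ha; have := HM b; lra.
    rewrite -(is_RInt_unique _ _ _ _ Hi); apply: RInt_le => //; first by apply: ex; lra.
      by exists (G b - G a).
    by move=> u Hu; have := Hfg u; lra.
  have mono a b c d : 0 < a -> a <= b -> b <= c -> c <= d -> RInt f b c <= RInt f a d.
    move=> Ha Hab Hbc Hcd.
    have pos x y : 0 < x -> x <= y -> 0 <= RInt f x y.
      move=> Hx Hxy; apply: RInt_ge_0 => //; first by apply: ex; lra.
      by move=> u Hu; have := Hfg u; lra.
    rewrite -(RInt_Chasles f a b d); try (apply: ex; lra).
    rewrite -(RInt_Chasles f b c d); try (apply: ex; lra).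
    have := pos a b Ha Hab; have := pos c d (ltac:(lra)) Hcd.
    rewrite /plus /=; lra.
  pose E y := exists a b, 0 < a /\ a <= b /\ y = RInt f a b.
  have [l [Hub Hlub]] : {l | is_lub E l}.
    apply: completeness; first by exists M => y [a [b [Ha [Hab ->]]]]; exact: bnd.
    by exists (RInt f 1 2), 1, 2; split; [lra|split; [lra|]].
  exists l; split.
    apply: (Rlt_le_trans _ (RInt f 1 2)).
      apply: RInt_gt_0; first lra.
      - by move=> u Hu; have := Hfg u; lra.
      - by move=> u Hu; apply: Hf; lra.
    by apply: Hub; exists 1, 2; split; [lra|split; [lra|]].
  apply/filterlimi_locally => eps; have He := cond_pos eps.
  have [a0 [b0 [Ha0 [Hab0 Hl]]]] : exists a b, 0 < a /\ a <= b /\ l - eps < RInt f a b.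
    apply: NNPP => H; suff : l <= l - eps by lra.
    apply: Hlub => y [a [b [Ha [Hab ->]]]].
    by apply: Rnot_lt_le => Hlt; apply: H; exists a, b.
  apply: (Filter_prod _ _ _ (fun a => 0 < a < a0) (fun b => b0 < b)).
  - exists (mkposreal _ Ha0) => a Ha Hpos; split=> //.
    move: Ha; rewrite /ball /= /AbsRing_ball /abs /minus /plus /opp /= /Rabs; case: Rcase_abs; lra.
  - by exists b0.
  move=> a b [Ha Haa0] Hb; exists (RInt f a b); split.
    by apply: (RInt_correct (V := R_CompleteNormedModule)); apply: ex => /=; lra.
  have H1 := mono a a0 b0 b Ha (ltac:(lra)) Hab0 (ltac:(lra)).
  have H2 : RInt f a b <= l by apply: Hub; exists a, b; split; [lra|split; [lra|]].
  rewrite /ball /= /AbsRing_ball /abs /minus /plus /opp /= /Rabs; case: Rcase_abs; lra.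
Qed.

Definition euler_integrand (x u : R) : R := Rpower u (x - 1) * exp (- u).

Lemma is_derive_Rpower_exp x u : 0 < u ->
  is_derive (fun u => Rpower u x * exp (- u)) u (x * euler_integrand x u - euler_integrand (x + 1) u).
Proof.
  move=> Hu; rewrite /euler_integrand (_ : x + 1 - 1 = x); first ring.
  have -> : Rpower u x = u * Rpower u (x - 1).
    by rewrite -{2}(Rpower_1 u) // -Rpower_plus; congr Rpower; ring.
  rewrite /Rpower; auto_derive => //.
  rewrite (_ : x * ln u = ln u + (x - 1) * ln u); first ring.
  by rewrite exp_plus exp_ln //; field; lra.
Qed.

Lemma continuous_euler_integrand x u : 0 < u -> continuous (euler_integrand x) u.
Proof.
  move=> Hu; apply: ex_derive_continuous; rewrite /euler_integrand /Rpower; auto_derive; lra.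
Qed.

Lemma Rpower_exp_at_0 x : 0 < x -> filterlim (fun u => Rpower u x * exp (- u)) (at_right 0) (locally 0).
Proof.
  move=> Hx.
  have H : filterlim (fun u => x * ln u - u) (at_right 0) (Rbar_locally m_infty).
    move=> P [M HM].
    have := is_lim_ln_0 (fun y => y < M / x) (ex_intro _ (M / x) (fun y H => H)).
    move=> H; rewrite /filtermap in H *.
    apply: filter_imp (filter_and _ _ H at_right_0_pos) => u [H1 H2]; apply: HM.
    have : x * ln u < x * (M / x) by apply: Rmult_lt_compat_l.
    rewrite (_ : x * (M / x) = M); [by field; lra|lra].
  apply: (filterlim_ext (fun u => exp (x * ln u - u))).
    by move=> u; rewrite /Rminus exp_plus.
  exact: (filterlim_comp _ _ _ _ exp _ _ _ H is_lim_exp_m).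
Qed.

Lemma Rpower_exp_at_infty x : filterlim (fun u => Rpower u x * exp (- u)) (Rbar_locally p_infty) (locally 0).
Proof.
  have H : filterlim (fun u => x * ln u - u) (Rbar_locally p_infty) (Rbar_locally m_infty).
    have H1 : is_lim (fun u => u * (x * (ln u / u) - 1)) p_infty m_infty.
      have H0 : is_lim (fun u => x * (ln u / u) - 1) p_infty (-1).
        apply: is_lim_minus; [apply: is_lim_scal_l; exact: is_lim_div_ln_p|exact: is_lim_const|].
        by rewrite /is_Rbar_minus /is_Rbar_plus /=; do 2 f_equal; ring.
      have -> : m_infty = Rbar_mult p_infty (-1) by rewrite /Rbar_mult /=; case: Rle_dec => // H; exfalso; lra.
      apply: is_lim_mult H0 _; first exact: is_lim_id.
      by rewrite /ex_Rbar_mult; lra.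
    apply: filterlim_ext_loc H1; exists 0 => u Hu; field; lra.
  apply: (filterlim_ext (fun u => exp (x * ln u - u))).
    by move=> u; rewrite /Rminus exp_plus.
  exact: (filterlim_comp _ _ _ _ exp _ _ _ H is_lim_exp_m).
Qed.

(** Integration by parts; the boundary terms vanish. *)
Lemma gint_euler_succ x l : 0 < x -> gint (euler_integrand x) l -> gint (euler_integrand (x + 1)) (x * l).
Proof.
  move=> Hx Hl.
  have H := gint_antiderivative _ _ 0 0 (fun u Hu => is_derive_Rpower_exp x u Hu) _ (Rpower_exp_at_0 x Hx) (Rpower_exp_at_infty x).
  have {}H : gint (fun u => x * euler_integrand x u - euler_integrand (x + 1) u) (0 - 0).
    apply: H => u Hu; apply: continuous_minus; last exact: continuous_euler_integrand.
    by apply: (continuous_scal_r x); exact: continuous_euler_integrand.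
  have S := is_RInt_gen_minus _ _ _ _ (is_RInt_gen_scal _ x _ Hl) H.
  have -> : x * l = minus (scal x l) (0 - 0) by rewrite /minus /plus /opp /scal /= /mult /=; ring.
  refine (is_RInt_gen_ext _ _ _ _ (S _ _ _ _)); apply: filter_forall => ab u _.
  rewrite /minus /plus /opp /scal /= /mult /=; ring.
Qed.

Lemma Gamma_unique x l : gint (euler_integrand x) l -> Gamma x = l.
Proof. exact (is_RInt_gen_unique (V := R_CompleteNormedModule) (euler_integrand x) l). Qed.

Lemma gint_euler_1 : exists l, 0 < l /\ gint (euler_integrand 1) l.
Proof.
  apply: (gint_dominated _ (fun u => 1 - exp (- u)) (fun u => exp (- u)) 1).
  - by move=> u; exact: continuous_euler_integrand.
  - move=> u Hu; rewrite /euler_integrand (_ : 1 - 1 = 0); first ring.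
    rewrite Rpower_O // Rmult_1_l; have := exp_pos (- u); lra.
  - by move=> u _; auto_derive => //; ring.
  - by move=> u _; apply: ex_derive_continuous; auto_derive.
  - move=> u Hu; have := exp_pos (- u); have : exp (- u) < 1 by rewrite -exp_0; apply: exp_increasing; lra.
    lra.
Qed.

(** The majorant is [4] times the derivative of [1 - 1 / (1 + sqrt u)], and
    [(1 + sqrt u)^2 <= 2 (1 + u) <= 2 exp u]. *)
Lemma gint_euler_half : exists l, 0 < l /\ gint (euler_integrand (1 / 2)) l.
Proof.
  pose g u := 2 / (sqrt u * (1 + sqrt u) ^ 2).
  have D u : 0 < u -> is_derive (fun u => 4 * (1 - / (1 + sqrt u))) u (g u).
    move=> Hu; have Hs := sqrt_lt_R0 u Hu; rewrite /g; auto_derive; first by repeat split; lra.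
    field; lra.
  apply: (gint_dominated _ (fun u => 4 * (1 - / (1 + sqrt u))) g 4) => //.
  - by move=> u; exact: continuous_euler_integrand.
  - move=> u Hu; have Hs := sqrt_lt_R0 u Hu; rewrite /euler_integrand (_ : 1 / 2 - 1 = - / 2); first by field.
    rewrite Rpower_Ropp Rpower_sqrt // exp_Ropp; split.
      by apply: Rmult_lt_0_compat; apply: Rinv_0_lt_compat => //; exact: exp_pos.
    rewrite Rmult_comm (_ : g u = 2 * / (1 + sqrt u) ^ 2 * / sqrt u); first by rewrite /g; field; lra.
    apply: Rmult_le_compat_r; first by apply: Rlt_le; apply: Rinv_0_lt_compat.
    have He := exp_ineq1_le u; have E : sqrt u * sqrt u = u by apply: sqrt_sqrt; lra.
    apply: (Rmult_le_reg_r (exp u * (1 + sqrt u) ^ 2)).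
      by apply: Rmult_lt_0_compat; [exact: exp_pos|apply: pow_lt; lra].
    rewrite (_ : / exp u * _ = (1 + sqrt u) ^ 2); first by field; have := exp_pos u; lra.
    rewrite (_ : 2 * _ * _ = 2 * exp u); first by field; lra.
    have := pow2_ge_0 (1 - sqrt u); nra.
  - move=> u Hu; have Hs := sqrt_lt_R0 u Hu; apply: ex_derive_continuous; rewrite /g; auto_derive.
    by repeat split; try lra; apply: Rgt_not_eq; apply: Rmult_lt_0_compat => //; nra.
  - move=> u Hu; have Hs := sqrt_lt_R0 u Hu.
    have : 0 < / (1 + sqrt u) <= 1.
      split; first by apply: Rinv_0_lt_compat; lra.
      by rewrite -Rinv_1; apply: Rinv_le_contravar; lra.
    lra.
Qed.

Lemma pochhammer_succ x l : 0 < x -> 0 < l -> gint (euler_integrand x) l ->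
  forall n, 0 < pochhammer x n /\ pochhammer x (S n) = (x + INR n) * pochhammer x n.
Proof.
  move=> Hx Hl H.
  have HI n : exists k, 0 < k /\ gint (euler_integrand (x + INR n)) k.
    elim: n => [|n [k [Hk IH]]]; first by exists l; rewrite Rplus_0_r.
    have Hn := pos_INR n.
    exists ((x + INR n) * k); split; first by apply: Rmult_lt_0_compat; lra.
    by rewrite S_INR -Rplus_assoc; apply: gint_euler_succ; [lra|].
  move=> n; have [k [Hk Hkn]] := HI n; have Hn := pos_INR n.
  rewrite /pochhammer (Gamma_unique _ _ H) (Gamma_unique _ _ Hkn).
  rewrite S_INR -Rplus_assoc (Gamma_unique _ _ (gint_euler_succ _ _ _ Hkn)); first lra.
  by split; [apply: Rdiv_lt_0_compat|field; lra].
Qed.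

Lemma pochhammer_0 x l : 0 < l -> gint (euler_integrand x) l -> pochhammer x 0 = 1.
Proof. move=> Hl H; rewrite /pochhammer Rplus_0_r (Gamma_unique _ _ H); field; lra. Qed.

Lemma pochhammer_ratio n : pochhammer 1 n / pochhammer (1 / 2) n = pochq n.
Proof.
  have [l1 [P1 H1]] := gint_euler_1; have [l2 [P2 H2]] := gint_euler_half.
  elim: n => [|n IH]; first by rewrite (pochhammer_0 _ _ P1 H1) (pochhammer_0 _ _ P2 H2) /=; field.
  have [A1 ->] := pochhammer_succ 1 l1 Rlt_0_1 P1 H1 n.
  have [A2 ->] := pochhammer_succ (1 / 2) l2 (ltac:(lra)) P2 H2 n.
  cbn [pochq]; rewrite -IH; have := pos_INR n => Hn; field; lra.
Qed.

(** * The evaluation *)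

Lemma series_WW (a b t : R) : Rabs t < 1 ->
  Series (fun j => cq (S j) * (a - b * INR (S j)) * t ^ S j) = a * WW 0 t - b * WW 1 t.
Proof.
  move=> Ht.
  have ex k c : ex_series (fun n => c * (cqk k n * t ^ n)).
    by apply: ex_series_scal_l; apply: ex_series_Rabs; exact: (CV_disk_inside (cqk k) t (cqk_inside k t Ht)).
  have D := Series_minus _ _ (ex 0%nat a) (ex 1%nat b).
  rewrite !Series_scal_l in D; rewrite /WW /PSeries -D [RHS]Series_incr_1; first exact (ex_series_minus _ _ (ex 0%nat a) (ex 1%nat b)).
  rewrite {1 2}/cqk cq_0 !Rmult_0_r !Rmult_0_l !Rmult_0_r Rminus_0_r Rplus_0_l.
  by apply: Series_ext => j; rewrite /cqk; ring.
Qed.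

Theorem mainTheorem6 :
  let r := Rpower 12 (1 / 4) in
  let z := - 8 * (74977 + 40284 * r + 21644 * r ^ 2 + 11629 * r ^ 3) in
  let a := 1 / 18 * (1038 + 558 * r + 300 * r ^ 2 + 161 * r ^ 3) in
  let b := 1 / 3 * (387 + 208 * r + 112 * r ^ 2 + 60 * r ^ 3) in
  48 / PI ^ 2 * epstein 1 0 36 2 =
    140 / 27 * Lseries (-4) 2 + 13 / sqrt 3 * Lseries (-3) 2
    - Series (fun j => let n := S j in
        pochhammer 1 n ^ 3 / pochhammer (1 / 2) n ^ 3
        * ((a - b * INR n) / INR n ^ 3) * powerRZ z (- Z.of_nat n)).
Proof.
  move=> r z a b; have HPI := PI_RGT_0.
  have [Hz _] := TT_3PI; rewrite -/r -/z in Hz.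
  have Hz1 : Rabs (/ z) < 1.
    rewrite Rabs_inv Rabs_left; first lra.
    by rewrite -Rinv_1; apply: Rinv_lt_contravar; lra.
  have -> : Series (fun j => let n := S j in
      pochhammer 1 n ^ 3 / pochhammer (1 / 2) n ^ 3
      * ((a - b * INR n) / INR n ^ 3) * powerRZ z (- Z.of_nat n)) = a * WW 0 (/ z) - b * WW 1 (/ z).
    rewrite -series_WW //; apply: Series_ext => j; cbv zeta.
    have -> : pochhammer 1 (S j) ^ 3 / pochhammer (1 / 2) (S j) ^ 3 = pochq (S j) ^ 3.
      by rewrite -pochhammer_ratio /Rdiv Rpow_mult_distr pow_inv.
    rewrite powerRZ_neg' -pow_powerRZ -pow_inv /cq /Rdiv; ring.
  rewrite (hypergeometric_side : _ = _) Lseries_minus4 Lseries_minus3 epstein_even_part.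
  rewrite -even_plus_odd odd_part_value; field; lra.
Qed.
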